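(* Assume $K$ is simply connected. Let $\xi,\gamma\in\nu(A)$. Let $(\xi_k)_{k\ge1}$ and $(\gamma_k)_{k\ge1}$ be two sequences of elements of $P_+$ such that for every $k\ge1$, $\xi_k\in P_+^k$ and $\gamma_k\in P_+^k$, and such that $\frac1k\xi_k\to\xi$ and $\frac1k\gamma_k\to\gamma$ as $k\to+\infty$. Define the sequence $(\mu_k)_{k\ge1}$ of probability measures on $\nu(A)$ by $$\mu_k=\sum_{\beta\in P_+^k}q_{\gamma_k}(\xi_k,\beta)\,\delta_{\frac{\beta+\rho}{k+h^\vee}},$$ where $q_{\gamma_k}$ is the Markov kernel of the random walk in the level $k$ alcove $P_+^k$ with increment $\gamma_k$. Then $(\mu_k)_{k\ge1}$ converges weakly to a measure $\mu$ on $\nu(A)$ satisfying $$\frac{\mathrm{ch}_\lambda(-\nu^{-1}(\xi))}{\dim(\lambda)}\cdot\frac{\mathrm{ch}_\lambda(-\nu^{-1}(\gamma))}{\dim(\lambda)}=\int_{\nu(A)}\frac{\mathrm{ch}_\lambda(-\nu^{-1}(\beta))}{\dim(\lambda)}\,\mu(d\beta)$$ for every dominant weight $\lambda\in\Lambda^*_+$.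
   Context: Setting. $K$ is a simple, connected, simply connected compact Lie group (realized as a subgroup of a unitary group) with Lie algebra $\mathfrak k$, complexified Lie algebra $\mathfrak g$, and maximal torus $T$ with Lie algebra $\mathfrak t$. Roots are real: $\alpha\in\mathfrak t^*$, $\alpha\ne0$, is a root if there is $X\in\mathfrak g\setminus\{0\}$ with $[H,X]=i\alpha(H)X$ for all $H\in\mathfrak t$. $\Sigma$ is a set of simple roots, $R_+$ the positive roots, $\rho$ their half sum, $\theta$ the highest root, $\alpha^\vee\in\mathfrak t$ the coroot of $\alpha$ ($\alpha(\alpha^\vee)=2$), $h^\vee=1+\rho(\theta^\vee)$. $\mathfrak k$ carries the $K$-invariant inner product $(\cdot|\cdot)$ with $(\theta^\vee|\theta^\vee)=2$, and $\nu:h\mapsto(h|\cdot)$ identifies $\mathfrak k$ with $\mathfrak k^*$ (and $\mathfrak t$ with $\mathfrak t^*$). $P=\{\lambda\in\mathfrak t^*:\lambda(\alpha^\vee)\in\mathbb Z\text{ for all roots }\alpha\}$, $\mathcal C=\{\lambda\in\mathfrak t^*:\lambda(\alpha^\vee)\ge0\ \forall\alpha\in\Sigma\}$, $P_+=P\cap\mathcal C$. For $\lambda\in P_+$, $V_\lambda$ is the irreducible representation of $\mathfrak g$ with highest weight $\lambda$, with weight multiplicities $K_\lambda^\beta$, $\dim(\lambda)=\dim V_\lambda$, and $\mathrm{ch}_\lambda(x)=\sum_{\beta\in P}K_\lambda^\beta e^{2i\pi\beta(x)}$, $x\in\mathfrak t$. With $\exp(x)=e^{2\pi x}$ ($e^{\cdot}$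 the matrix exponential), $\Lambda=\ker(\exp|_{\mathfrak t})$, $\Lambda^*=\{\lambda\in\mathfrak t^*:\lambda(\Lambda)\subset\mathbb Z\}$ and $\Lambda^*_+=\Lambda^*\cap\mathcal C$. $A=\{x\in\mathfrak t:\alpha(x)\ge0\ \forall\alpha\in\Sigma,\ \theta(x)\le1\}$, so $\nu(A)=\{x\in\mathfrak t^*:(x|\alpha)\ge0\ \forall\alpha\in\Sigma,\ x(\theta^\vee)\le1\}$. For an integer $k\ge1$, $P_+^k=\{\lambda\in P_+:\lambda(\theta^\vee)\le k\}$; the level $k$ discretized character is $\chi_\lambda(\sigma)=\mathrm{ch}_\lambda\big(-\nu^{-1}(\frac{\sigma+\rho}{k+h^\vee})\big)$, $\sigma\in P_+^k$; the level $k$ fusion coefficients are the unique non-negative integers $N_{\lambda,\gamma}^\beta$ ($\lambda,\gamma,\beta\in P_+^k$) with $\chi_\lambda(\sigma)\chi_\gamma(\sigma)=\sum_{\beta\in P_+^k}N_{\lambda,\gamma}^\beta\chi_\beta(\sigma)$ for all $\sigma\in P_+^k$. For $\gamma\in P_+^k$ the random walk in the level $k$ alcove with increment $\gamma$ has kernel $q_\gamma(\lambda,\beta)=N_{\lambda,\gamma}^\beta\frac{\chi_\beta(0)}{\chi_\lambda(0)\chi_\gamma(0)}$, $\lambda,\beta\in P_+^k$ (all quantities at level $k$). *)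

(* Defs.v *)
From HB Require Import structures.
From mathcomp Require Import all_boot all_order all_algebra complex spectral.
From mathcomp Require Import all_classical all_reals all_analysis.
Set Implicit Arguments.
Unset Strict Implicit.
Unset Printing Implicit Defensive.
Import Order.TTheory GRing.Theory Num.Theory numFieldNormedType.Exports.
Local Open Scope classical_set_scope.
Local Open Scope ring_scope.

(* R[i] itself carries no topology in the libraries; R[i]^o carries the one
   given by the modulus.  All matrix sets are typed with R[i]^o so that closed,
   connected, continuous, lim refer to the usual topology of M_n(C). *)
Notation cmx R n := 'M[R[i]^o]_n.

Section MatrixLieGroups.
Context {R : realType} {n : nat}.
Implicit Types (G T L I : set (cmx R n)) (X Y : cmx R n).

Definition lbr {m : nat} (X Y : cmx R m) : cmx R m := X *m Y - Y *m X.

Definition mexp X : cmx R n :=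
  limn (series (fun k => ((k`!%:R : R[i])^-1 *: (X ^+ k : cmx R n)))).

(* Compact Lie groups, realized as closed subgroups of U(n). *)
Definition compact_group G : Prop :=
  [/\ forall X, G X -> X \is unitarymx,
      G 1%:M,
      forall X Y, G X -> G Y -> G (X *m Y),
      forall X, G X -> G (invmx X) &
      closed G].

Definition lie G : set (cmx R n) :=
  [set X | forall t : R, G (mexp (t%:C%C *: X))].

Definition real_subspace I : Prop :=
  I 0 /\ forall (a : R) X Y, I X -> I Y -> I (a%:C%C *: X + Y).

Definition lie_ideal L I : Prop :=
  [/\ I `<=` L, real_subspace I & forall X Y, L X -> I Y -> I (lbr X Y)].

Definition simple_lie L : Prop :=
  (exists X Y, [/\ L X, L Y & lbr X Y != 0]) /\
  (forall I, lie_ideal L I -> I = [set 0] \/ I = L).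

Definition null_homotopic G (f : R -> cmx R n) : Prop :=
  exists H : R * R -> cmx R n,
  [/\ {within [set` `[0, 1]] `*` [set` `[0, 1]], continuous H},
      forall s t, 0 <= s <= 1 -> 0 <= t <= 1 -> G (H (s, t)),
      forall s, 0 <= s <= 1 -> H (s, 0) = f s,
      forall s, 0 <= s <= 1 -> H (s, 1) = f 0 &
      forall t, 0 <= t <= 1 -> H (0, t) = f 0 /\ H (1, t) = f 0].

Definition simply_connected G : Prop :=
  connected G /\
  forall f : R -> cmx R n,
    {within [set` `[0, 1]], continuous f} ->
    (forall s, 0 <= s <= 1 -> G (f s)) -> f 0 = f 1 -> null_homotopic G f.

Definition torus_in G T : Prop :=
  [/\ T `<=` G, compact_group T, connected T &
      forall X Y, T X -> T Y -> X *m Y = Y *m X].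

Definition maximal_torus G T : Prop :=
  torus_in G T /\ forall T', torus_in G T' -> T `<=` T' -> T' = T.

(* For L in u(n) one has L :&: iL = 0, so L + iL is the complexification. *)
Definition complexification L : set (cmx R n) :=
  [set Z | exists X Y, [/\ L X, L Y & Z = X + ('i)%C *: Y]].

End MatrixLieGroups.

(* A real basis (tbasis) of the Lie algebra t of
   the maximal torus gives coordinates: t is 'cV[R]_r, its dual t^* is 'rV[R]_r
   (in the dual basis).  The basis is arbitrary. *)
Record lie_data (R : realType) (n r : nat) := LieData {
  grp : set (cmx R n);
  tor : set (cmx R n);
  tbasis : 'I_r -> cmx R n;
  inner : cmx R n -> cmx R n -> R;
  simple_roots : seq 'rV[R]_r;
  theta : 'rV[R]_r }.

Definition nncomb (R : realType) (r : nat) (s : seq 'rV[R]_r) (a : 'rV[R]_r) :=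
  exists c : 'I_(size s) -> nat, a = \sum_i (c i)%:R *: s`_i.

Definition ev (R : realType) (r : nat) (l : 'rV[R]_r) (x : 'cV[R]_r) : R :=
  (l *m x) 0 0.

Section RootData.
Context {R : realType} {n r : nat} (D : lie_data R n r).
Implicit Types (a b l : 'rV[R]_r) (x h : 'cV[R]_r).

Definition glie : set (cmx R n) := complexification (lie (grp D)).

Definition tmx x : cmx R n := \sum_i (x i 0)%:C%C *: tbasis D i.

Definition torus_basis : Prop :=
  injective tmx /\ range tmx = lie (tor D).

Definition root_space a : set (cmx R n) :=
  [set X | glie X /\
     forall h, lbr (tmx h) X = (('i)%C * (ev a h)%:C%C : R[i]) *: X].

Definition is_root a : Prop := a != 0 /\ exists2 X, X != 0 & root_space a X.

Definition simple_system : Prop :=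
  [/\ free (simple_roots D),
      forall a, a \in simple_roots D -> is_root a &
      forall a, is_root a ->
        nncomb (simple_roots D) a \/ nncomb (simple_roots D) (- a)].

Definition pos_roots : set 'rV[R]_r :=
  [set a | is_root a /\ nncomb (simple_roots D) a].

Definition rho : 'rV[R]_r := 2%:R^-1 *: \sum_(a \in pos_roots) a.

Definition highest_root : Prop :=
  is_root (theta D) /\
  forall a, is_root a -> nncomb (simple_roots D) (theta D - a).

(* The unique vector of t in [g_a, g_{-a}] on which a takes the value 2;
   the commutators [X, Y] already fill [g_a, g_{-a}] since g_a is a line. *)
Definition coroot a : 'cV[R]_r :=
  xget 0 [set h | ev a h = 2%:R /\
    exists X Y, [/\ root_space a X, root_space (- a) Y & tmx h = lbr X Y]].

Definition dual_coxeter : R := 1 + ev rho (coroot (theta D)).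

(* The inner product only matters on the Lie algebra of the group. *)
Definition normalized_inner : Prop :=
  let k := lie (grp D) in
  [/\ forall X Y, k X -> k Y -> inner D X Y = inner D Y X,
      forall (c : R) X Y Z, k X -> k Y -> k Z ->
        inner D (c%:C%C *: X + Y) Z = c * inner D X Z + inner D Y Z,
      forall X, k X -> X != 0 -> 0 < inner D X X,
      forall g X Y, grp D g -> k X -> k Y ->
        inner D (g *m X *m invmx g) (g *m Y *m invmx g) = inner D X Y &
      let tv := tmx (coroot (theta D)) in inner D tv tv = 2%:R].

(* nu h = (h | .) on t, in coordinates: its value on the j-th basis vector. *)
Definition nu x : 'rV[R]_r := \row_j inner D (tmx x) (tbasis D j).

Definition nu_inv l : 'cV[R]_r := xget 0 [set x | nu x = l].

Definition weight_lattice : set 'rV[R]_r :=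
  [set l | forall a, is_root a -> ev l (coroot a) \is a Num.int].

Definition chamber : set 'rV[R]_r :=
  [set l | forall a, a \in simple_roots D -> 0 <= ev l (coroot a)].

Definition dominant_weights : set 'rV[R]_r := weight_lattice `&` chamber.

Definition level_weights (k : nat) : set 'rV[R]_r :=
  [set l | dominant_weights l /\ ev l (coroot (theta D)) <= k%:R].

(* The exponential of the torus is normalized as exp x = e^(2 pi x). *)
Definition Lambda : set 'cV[R]_r :=
  [set x | mexp ((2%:R * pi : R)%:C%C *: tmx x) = 1%:M].

Definition Lambda_dual : set 'rV[R]_r :=
  [set l | forall x, Lambda x -> ev l x \is a Num.int].

Definition alcove : set 'cV[R]_r :=
  [set x | (forall a, a \in simple_roots D -> 0 <= ev a x) /\
           ev (theta D) x <= 1].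

Definition nu_alcove : set 'rV[R]_r := nu @` alcove.

(* A finite-dimensional representation of the complex Lie algebra glie.  It is
   carried by a C-linear map on all of M_n(C), of which only the restriction to
   glie is relevant: any linear map on glie extends to M_n(C). *)
Record rep := Rep {
  rdim : nat;
  ract : {linear cmx R n -> cmx R rdim};
  ract_lbr : forall X Y, glie X -> glie Y ->
    ract (lbr X Y) = lbr (ract X) (ract Y) }.

Definition rep_irreducible (V : rep) : Prop :=
  (0 < rdim V)%N /\
  forall W : {vspace 'cV[R[i]]_(rdim V)},
    (forall X v, glie X -> v \in W -> ract V X *m v \in W) ->
    W = 0%VS \/ W = fullv.

Definition rep_highest_weight (V : rep) l : Prop :=
  exists v : 'cV[R[i]]_(rdim V),
  [/\ v != 0,
      forall h, ract V (tmx h) *m v = (('i)%C * (ev l h)%:C%C) *: v &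
      forall a X, pos_roots a -> root_space a X -> ract V X *m v = 0].

(* Dimension of the space of v such that h.v = i b(h) v for all h in t, i.e.
   for every h in the basis of t. *)
Definition weight_mult (V : rep) b : nat :=
  \dim (\bigcap_(j < r) lker (linfun (fun v : 'cV[R[i]]_(rdim V) =>
    ract V (tbasis D j) *m v - (('i)%C * (b 0 j)%:C%C) *: v)%R))%VS.

(* ch x = sum of K^b exp(2 i pi b(x)); the sum has finite support. *)
Definition ch (V : rep) x : R[i] :=
  \sum_(b \in weight_lattice) (weight_mult V b)%:R *
    (cos (2%:R * pi * ev b x) +i* sin (2%:R * pi * ev b x))%C.

End RootData.

Section Fusion.
Context {R : realType} {n r : nat} (D : lie_data R n r).
Variable V : 'rV[R]_r -> rep D.
Variable N : nat -> 'rV[R]_r -> 'rV[R]_r -> 'rV[R]_r -> nat.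
Implicit Types (l g s b : 'rV[R]_r).

Definition is_highest_weight_family : Prop :=
  forall l, dominant_weights D l ->
    rep_irreducible (V l) /\ rep_highest_weight (V l) l.

Definition scaled_weight (k : nat) s : 'rV[R]_r :=
  (k%:R + dual_coxeter D)^-1 *: (s + rho D).

Definition chi (k : nat) l s : R[i] :=
  ch (V l) (- nu_inv D (scaled_weight k s)).

(* N k l g b is the level k fusion coefficient N_{l,g}^b. *)
Definition is_fusion : Prop :=
  forall k, (0 < k)%N -> forall l g s,
    level_weights D k l -> level_weights D k g -> level_weights D k s ->
    chi k l s * chi k g s =
      \sum_(b \in level_weights D k) (N k l g b)%:R * chi k b s.

Definition walk_kernel (k : nat) g l b : R[i] :=
  (N k l g b)%:R * (chi k b 0 / (chi k l 0 * chi k g 0)).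

End Fusion.

(* t^* with its Borel sigma-algebra. *)
Notation tdual R r := (g_sigma_algebraType (@open 'rV[R]_r)).

Section Measures.
Context {R : realType} {r : nat}.
Implicit Types (mu : probability (tdual R r) R) (E : set 'rV[R]_r).

Definition weak_cvg E (mu_ : nat -> probability (tdual R r) R) mu : Prop :=
  forall f : 'rV[R]_r -> R,
    {within E, continuous f} ->
    (exists M : R, forall x, E x -> `|f x| <= M) ->
    (\int[mu_ k]_(x in (E : set (tdual R r))) f x)%R @[k --> \oo] -->
      (\int[mu]_(x in (E : set (tdual R r))) f x)%R.

Definition complex_integral mu E (f : 'rV[R]_r -> R[i]) : R[i] :=
  ((\int[mu]_(x in (E : set (tdual R r))) complex.Re (f x))%R +i*
   (\int[mu]_(x in (E : set (tdual R r))) complex.Im (f x))%R)%C.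

(* mu = sum over b in level_weights of q_g(l, b) times the Dirac mass at
   (b + rho) / (k + dual Coxeter number).  The equation is between complex
   numbers because characters are. *)
Definition is_walk_law (n : nat) (D : lie_data R n r) (V : 'rV[R]_r -> rep D)
    (N : nat -> 'rV[R]_r -> 'rV[R]_r -> 'rV[R]_r -> nat) (k : nat)
    (g l : 'rV[R]_r) mu : Prop :=
  forall B : set (tdual R r), measurable B ->
    (fine (mu B))%:C%C =
      \sum_(b \in level_weights D k)
        walk_kernel V N k g l b * (\1_B (scaled_weight D k b))%:C%C :> R[i].

End Measures.

(* Main.v *)
(* Write x for the point of the alcove attached to a weight.  By the Weyl
   character formula, delta(x) ch_l(x) is a multiple of an alternating sum over
   the Weyl group, and the alternating sum attached to l + rho, taken at the
   point of m + rho, is symmetric in l and m.  Hence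
   chi_l(m) chi_m(0) = chi_m(l) chi_l(0), and the fusion rules give that the
   mean of chi_l under the walk kernel is exactly
   chi_l(xi_k) chi_l(gamma_k) / chi_l(0), as soon as l has level at most k.
   This converges.  On regular points every Weyl-invariant trigonometric
   polynomial with weights in P is a combination of characters, and such
   polynomials separate the points of the alcove, so Stone-Weierstrass and
   Riesz representation turn the convergence of these means into weak
   convergence to a probability measure.  The character formula itself is
   obtained from the Casimir operator, starting from matrix groups: a compact
   torus acts diagonalizably, and root strings come from sl2-triples. *)
Require Import Defs.
From HB Require Import structures.
From mathcomp Require Import all_boot all_order all_algebra complex spectral.
From mathcomp Require Import all_classical all_reals all_analysis.
From mathcomp Require Import ring lra zify.
Set Implicit Arguments.
Unset Strict Implicit.
Unset Printing Implicit Defensive.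
Import Order.TTheory GRing.Theory Num.Theory numFieldNormedType.Exports.
Local Open Scope classical_set_scope.
Local Open Scope ring_scope.

(** * The matrix exponential *)

(** The limits xi and gamma may lie on walls, where delta vanishes. So the character formula is used
    only at the points [(m + rho) / (k + h)], which are interior, and limits are taken in the
    characters themselves, finite sums of exponentials. The formula is proved up to a factor: among
    the exponents of delta times the character, those with the norm of [l + rho] are its Weyl
    conjugates, and independence of exponentials, standing in for differentiation, removes the
    others. The factor is compared with that of delta by letting the point tend to 0, where the
    character tends to the dimension; the ratio is positive, which makes the kernel nonnegative.
    Test functions are spanned by orbit sums because products and conjugates of orbit sums are
    visibly sums of orbit sums. Times delta they are antisymmetric, hence delta times combinations
    of characters. Separation of points is independence of characters again, with the weight as the
    variable: equal orbit sums make two points conjugate under the affine Weyl group, and the alcove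
    meets each orbit at most once. *)

Section ComplexNorm.
Context {R : realType}.
Implicit Types z w : R[i].

(** The l1 norm of a complex number: it takes values in [R], whereas the modulus takes values in
    [R[i]], and it is still submultiplicative. *)
Definition nc z : R := `|complex.Re z| + `|complex.Im z|.

Lemma nc_ge0 z : 0 <= nc z. Proof. exact: addr_ge0. Qed.

Lemma nc0 : nc 0 = 0. Proof. by rewrite /nc /= normr0 addr0. Qed.

Lemma nc_eq0 z : nc z = 0 -> z = 0.
Proof.
case: z => a b; rewrite /nc /= => /eqP.
by rewrite paddr_eq0// !normr_eq0 => /andP[/eqP -> /eqP ->].
Qed.

Lemma ncD z w : nc (z + w) <= nc z + nc w.
Proof.
case: z w => [a b] [c d]; rewrite /nc /=.
by rewrite addrACA lerD// ler_normD.
Qed.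

Lemma ncN z : nc (- z) = nc z.
Proof. by case: z => a b; rewrite /nc /= !normrN. Qed.

Lemma ncM z w : nc (z * w) <= nc z * nc w.
Proof.
case: z w => [a b] [c d]; rewrite /nc /=.
have -> : (`|a| + `|b|) * (`|c| + `|d|) =
  (`|a * c| + `|b * d|) + (`|a * d| + `|b * c|).
  rewrite !normrM; ring.
by rewrite lerD// ?ler_normB ?ler_normD.
Qed.

Lemma ncR (r : R) : nc r%:C%C = `|r|.
Proof. by rewrite /nc /= normr0 addr0. Qed.

Lemma nc_normc z : `|z| <= (nc z)%:C%C.
Proof.
case: z => a b; rewrite /nc /= [X in `|X|](_ : _ = a%:C%C + 'i%C * b%:C%C).
  rewrite (le_trans (ler_normD _ _))// normrM.
  have -> : `|'i%C : R[i]| = 1 by rewrite normc_def /= expr0n add0r expr1n sqrtr1.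
  by rewrite mul1r !normc_def /= !expr0n !addr0 !sqrtr_sqr -rmorphD.
by rewrite [LHS]complexE.
Qed.

Lemma normc_nc z : (nc z)%:C%C <= 2%:R * `|z|.
Proof.
rewrite /nc rmorphD /= mulr_natl mulr2n lerD ?normc_ge_Re//.
have := normc_ge_Re (z * 'i%C); rewrite ReiNIm normrN => /le_trans; apply.
rewrite normrM [X in _ * X](_ : _ = 1) ?mulr1//.
by rewrite normc_def /= expr0n add0r expr1n sqrtr1.
Qed.

Lemma ltcR' (a b : R) : (a%:C%C < b%:C%C :> R[i]) = (a < b).
Proof. by rewrite ltcE /= eqxx. Qed.

Lemma lecR' (a b : R) : (a%:C%C <= b%:C%C :> R[i]) = (a <= b).
Proof. by rewrite lecE /= eqxx. Qed.

Lemma Re_sum I (r : seq I) P (F : I -> R[i]) :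
  complex.Re (\sum_(i <- r | P i) F i) = \sum_(i <- r | P i) complex.Re (F i).
Proof.
apply: (big_ind2 (fun x a => complex.Re x = a)) => // x a y b <- <-.
by case: x; case: y.
Qed.

End ComplexNorm.

(** * The entrywise l1 norm of matrices and the topology it defines *)

Section MatrixNorm.
Context {R : realType}.

Definition mN m n (X : 'M[R[i]^o]_(m, n)) : R := \sum_i \sum_j nc (X i j).

Lemma mN_ge0 m n (X : 'M[R[i]^o]_(m, n)) : 0 <= mN X.
Proof. by apply: sumr_ge0 => i _; apply: sumr_ge0 => j _; exact: nc_ge0. Qed.

Lemma mN0 m n : mN (0 : 'M[R[i]^o]_(m, n)) = 0.
Proof.
by rewrite /mN big1// => i _; rewrite big1// => j _; rewrite mxE nc0.
Qed.

Lemma nc_le_mN m n (X : 'M[R[i]^o]_(m, n)) i j : nc (X i j) <= mN X.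
Proof.
rewrite /mN (bigD1 i)//= (bigD1 j)//= -addrA lerDl.
apply: addr_ge0; apply: sumr_ge0 => k _; first exact: nc_ge0.
by apply: sumr_ge0 => l _; exact: nc_ge0.
Qed.

Lemma mN_eq0 m n (X : 'M[R[i]^o]_(m, n)) : mN X = 0 -> X = 0.
Proof.
move=> X0; apply/matrixP => i j; rewrite mxE; apply: nc_eq0.
by apply/eqP; rewrite eq_le nc_ge0 -X0 nc_le_mN.
Qed.

Lemma mND m n (X Y : 'M[R[i]^o]_(m, n)) : mN (X + Y) <= mN X + mN Y.
Proof.
rewrite /mN -big_split/=; apply: ler_sum => i _.
by rewrite -big_split/=; apply: ler_sum => j _; rewrite mxE ncD.
Qed.

Lemma mNN m n (X : 'M[R[i]^o]_(m, n)) : mN (- X) = mN X.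
Proof. by apply: eq_bigr => i _; apply: eq_bigr => j _; rewrite mxE ncN. Qed.

Lemma mNB m n (X Y : 'M[R[i]^o]_(m, n)) : mN (X - Y) = mN (Y - X).
Proof. by rewrite -mNN opprB. Qed.

Lemma mN_sum m n I (r : seq I) P (F : I -> 'M[R[i]^o]_(m, n)) :
  mN (\sum_(i <- r | P i) F i) <= \sum_(i <- r | P i) mN (F i).
Proof.
elim/big_ind2 : _ => [|x a y b xa yb|//]; first by rewrite mN0.
exact: le_trans (mND _ _) (lerD xa yb).
Qed.

Lemma mNM m n p (X : 'M[R[i]^o]_(m, n)) (Y : 'M[R[i]^o]_(n, p)) :
  mN (X *m Y) <= mN X * mN Y.
Proof.
rewrite /mN mulr_suml; apply: ler_sum => i _.
apply: (@le_trans _ _ (\sum_j \sum_k nc (X i k) * nc (Y k j))).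
  apply: ler_sum => j _; rewrite mxE.
  elim/big_ind2 : _ => [|x a y b xa yb|k _]; first by rewrite nc0.
    exact: le_trans (ncD _ _) (lerD xa yb).
  exact: ncM.
rewrite exchange_big mulr_suml/=; apply: ler_sum => k _.
rewrite -mulr_sumr ler_wpM2l ?nc_ge0//.
rewrite [leRHS](bigD1 k)//= lerDl; apply: sumr_ge0 => l _.
by apply: sumr_ge0 => j _; exact: nc_ge0.
Qed.

Lemma mNZ m n (c : R) (X : 'M[R[i]^o]_(m, n)) :
  mN (c%:C%C *: X) = `|c| * mN X.
Proof.
rewrite /mN mulr_sumr; apply: eq_bigr => i _; rewrite mulr_sumr.
apply: eq_bigr => j _; rewrite mxE; case: (X i j) => a b.
by rewrite /nc /= !mul0r subr0 addr0 !normrM -mulrDr.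
Qed.

Lemma mN_trmxC m n (X : 'M[R[i]^o]_(m, n)) : mN ((X ^t*)%sesqui) = mN X.
Proof.
rewrite /mN exchange_big; apply: eq_bigr => i _; apply: eq_bigr => j _.
by rewrite !mxE; case: (X i j) => a b; rewrite /nc /= normrN.
Qed.

Lemma nbhs_mN m n (X : 'M[R[i]^o]_(m, n)) (A : set 'M[R[i]^o]_(m, n)) :
  nbhs X A <-> exists2 e : R, 0 < e & forall Y, mN (X - Y) < e -> A Y.
Proof.
split=> [/nbhs_ballP[e /= e0 eA]|[e e0 eA]].
  have e0R : e = (complex.Re e)%:C%C by case: e e0 {eA} => a b; rewrite ltcE /= => /andP[/eqP ->].
  exists (complex.Re e); first by rewrite -ltcR' -e0R.
  move=> Y XY; apply: eA; split=> [//|i j]; rewrite /ball /= e0R.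
  apply: le_lt_trans (nc_normc _) _; rewrite ltcR'.
  by apply: le_lt_trans XY; have := nc_le_mN (X - Y) i j; rewrite !mxE.
(* Each of the [m * n] entries contributes at most [2 * d], the 2 being the ratio between [nc] and
   the modulus. The successor makes the total strictly less than [e]. *)
apply/nbhs_ballP; pose d := e / (2 * (m * n).+1)%:R.
exists d%:C%C => /=; first by rewrite ltcR' divr_gt0// ltr0n.
move=> Y XY; apply: eA; apply: (@le_lt_trans _ _ (\sum_(i < m) \sum_(j < n) 2 * d)).
  apply: ler_sum => i _; apply: ler_sum => j _.
  have [_ /(_ i j)/ltW] := XY; rewrite /ball /= => H; rewrite !mxE -lecR' (le_trans (normc_nc _))// rmorphM /= rmorphMn /= rmorph1.
  by rewrite ler_pM2l// ltr0n.
rewrite !sumr_const !card_ord -mulrnA -[X in X < _]mulr_natr.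
rewrite /d natrM; set k := (n * m)%:R; set l := (m * n).+1%:R.
have l0 : 0 < l :> R by rewrite ltr0n.
have kl : k < l :> R by rewrite ltr_nat mulnC.
rewrite (_ : _ * _ = e * (k / l)); last by field; rewrite gt_eqF.
by rewrite gtr_pMr// ltr_pdivrMr// mul1r.
Qed.

Lemma cvg_mN m n T (F : set_system T) (FF : Filter F)
    (f : T -> 'M[R[i]^o]_(m, n)) (X : 'M[R[i]^o]_(m, n)) :
  f @ F --> X <-> (fun t => mN (f t - X)) @ F --> (0 : R).
Proof.
split=> fX.
  apply/cvgrPdist_lt => e e0; apply: (fX (fun Y => `|0 - mN (Y - X)| < e)).
  apply/nbhs_mN; exists e => // Y XY.
  by rewrite sub0r normrN ger0_norm ?mN_ge0// mNB.
move=> A /nbhs_mN[e e0 eA].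
move/cvgrPdist_lt : fX => /(_ e e0); apply: filterS => t /=.
by rewrite sub0r normrN ger0_norm ?mN_ge0// mNB => /eA.
Qed.

Lemma closure_mN m n (A : set 'M[R[i]^o]_(m, n)) X :
  closure A X <-> forall e : R, 0 < e -> exists2 Y, A Y & mN (X - Y) < e.
Proof.
split=> [cAX e e0|H B /nbhs_mN[e e0 eB]].
  have [|Y [AY XY]] := cAX (fun Y => mN (X - Y) < e); last by exists Y.
  by apply/nbhs_mN; exists e.
by have [Y AY /eB] := H e e0; exists Y.
Qed.

Lemma lim_mN m n (f : nat -> 'M[R[i]^o]_(m, n)) (X : 'M[R[i]^o]_(m, n)) :
  f @ \oo --> X -> limn f = X.
Proof. by move=> fX; apply: cvg_lim fX; exact: norm_hausdorff. Qed.

End MatrixNorm.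

Lemma cvg_ext T (U : topologicalType) (F : set_system T) (f g : T -> U) (l : U) :
  f @ F --> l -> f =1 g -> g @ F --> l.
Proof. by move=> fl /funext <-. Qed.

Lemma rcvgc {R : realType} (a : R) : (fun _ : nat => a) @ \oo --> a.
Proof. exact: cvg_cst. Qed.

Lemma rcvg_unique {R : realType} (f : nat -> R) (a b : R) :
  f @ \oo --> a -> f @ \oo --> b -> a = b.
Proof.
by move=> /(cvg_lim (@Rhausdorff R)) <- /(cvg_lim (@Rhausdorff R)) <-.
Qed.

Lemma cvg0_le {R : realType} T (F : set_system T) (FF : Filter F) (f h : T -> R) :
  (forall t, 0 <= f t <= h t) -> h @ F --> 0 -> f @ F --> 0.
Proof.
move=> fh h0; apply: (@squeeze_cvgr _ _ _ _ (fun=> 0) h f _ 0 _ h0).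
  exact: nearW.
exact: cvg_cst.
Qed.

Lemma cvg_bigsum {K : numFieldType} {V : normedModType K} T (F : set_system T)
    (FF : Filter F) I (r : seq I) (f : I -> T -> V) (l : I -> V) :
  (forall i, f i @ F --> l i) ->
  (fun t => \sum_(i <- r) f i t) @ F --> \sum_(i <- r) l i.
Proof.
move=> fl; elim: r => [|i r IH].
  rewrite big_nil (_ : (fun t => _) = cst 0); first exact: cvg_cst.
  by apply/funext => t; rewrite big_nil.
rewrite big_cons (_ : (fun t => _) = f i \+ (fun t => \sum_(i <- r) f i t)).
  exact: cvgD.
by apply/funext => t; rewrite big_cons.
Qed.

Lemma cvg_bigsum0 {K : numFieldType} {V : normedModType K} T (F : set_system T)
    (FF : Filter F) I (r : seq I) (f : I -> T -> V) :
  (forall i, f i @ F --> 0) -> (fun t => \sum_(i <- r) f i t) @ F --> 0.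
Proof.
move=> f0; have := @cvg_bigsum _ _ _ _ FF _ r f (fun=> 0) f0.
by rewrite big1_eq.
Qed.

Lemma exp_series_le {R : realType} (x : R) k :
  0 <= x -> \sum_(0 <= j < k) exp_coeff x j <= expR x.
Proof.
move=> x0; apply: (nondecreasing_cvgn_le _ (is_cvg_series_exp_coeff x) k).
apply/nondecreasing_seqP => m; rewrite /series /= big_nat_recr//= lerDl.
by rewrite /exp_coeff /= divr_ge0 ?exprn_ge0.
Qed.

(** The product of two partial sums differs from the partial sum of the Cauchy product by a triangle
    of terms. Any ring is allowed, so that the same triangle can be compared for matrices and for
    the real numbers that dominate them. *)
Lemma exp_trunc_sum {A : pzRingType} (k : nat) (a b : nat -> A) :
  (\sum_(0 <= j < k) a j) * (\sum_(i < k) b i) -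
  \sum_(m < k) \sum_(i < m.+1) a (m - i)%N * b i =
  \sum_(i < k) (\sum_(k - i <= j < k) a j) * b i.
Proof.
have -> : \sum_(m < k) \sum_(i < m.+1) a (m - i)%N * b i =
    \sum_(i < k) (\sum_(0 <= j < k - i) a j) * b i.
  elim: k => [|k IH]; first by rewrite !big_ord0.
  rewrite big_ord_recr/= IH; under [RHS]eq_bigr => i _.
    rewrite subSn -1?ltnS// big_nat_recr//= mulrDl; over.
  rewrite big_split/=; congr (_ + _).
  by rewrite [RHS]big_ord_recr/= subnn big_nil mul0r addr0.
rewrite mulr_sumr -sumrB; apply: eq_bigr => i _; rewrite -mulrBl; congr (_ * _).
by rewrite (@big_cat_nat _ _ _ (k - i))//= ?leq_subr// addrAC subrr add0r.
Qed.

Lemma exp_telescope {A : pzRingType} (g b : A) j l :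
  (g ^+ j.+1 - b ^+ j.+1) * b ^+ l =
  g ^+ j * (g - b) * b ^+ l + (g ^+ j - b ^+ j) * b ^+ l.+1.
Proof.
rewrite [b ^+ l.+1]exprS mulrA -mulrDl; congr (_ * _).
by rewrite mulrBr mulrBl -!exprSr addrA subrK.
Qed.

Lemma exp_coeffD {R : realType} (x y : R) m :
  exp_coeff (x + y) m = \sum_(i < m.+1) exp_coeff x (m - i)%N * exp_coeff y i.
Proof.
rewrite /exp_coeff /= exprDn mulr_suml; apply: eq_bigr => i _.
have im : (i <= m)%N by rewrite -ltnS.
have := bin_fact im => /(congr1 (fun k => k%:R : R)); rewrite !natrM => <-.
have f0 k : k`!%:R != 0 :> R by rewrite pnatr_eq0 -lt0n fact_gt0.
have b0 : 'C(m, i)%:R != 0 :> R by rewrite pnatr_eq0 -lt0n bin_gt0.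
by rewrite -mulr_natr; field; rewrite !f0 b0.
Qed.

Lemma mN_lim_unique {R : realType} m n (f : nat -> 'M[R[i]^o]_(m, n))
    (X Y : 'M[R[i]^o]_(m, n)) :
  f @ \oo --> X -> f @ \oo --> Y -> X = Y.
Proof. by move=> /lim_mN <- /lim_mN <-. Qed.

Section MatrixExp.
Context {R : realType} {n : nat}.
Implicit Types X Y Z : cmx R n.

(** Comparison test entry by entry: the real and imaginary parts are real series dominated by [b],
    and their limits are reassembled into a matrix. *)
Lemma cvg_series_mN (u : nat -> cmx R n) (b : nat -> R) :
  (forall k, mN (u k) <= b k) -> cvgn (series b) -> cvgn (series u).
Proof.
move=> ub cb.
have b0 k : 0 <= b k by exact: le_trans (mN_ge0 _) (ub k).
have cr (f : nat -> R) : (forall k, `|f k| <= b k) -> cvgn (series f).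
  by move=> fb; apply: normed_cvg; apply: series_le_cvg fb cb.
pose re i j k := complex.Re (u k i j); pose im i j k := complex.Im (u k i j).
have cre i j : cvgn (series (re i j)).
  apply: cr => k; apply: le_trans (ub k).
  by apply: le_trans (nc_le_mN _ i j); rewrite lerDl.
have cim i j : cvgn (series (im i j)).
  apply: cr => k; apply: le_trans (ub k).
  by apply: le_trans (nc_le_mN _ i j); rewrite lerDr.
pose L : cmx R n := \matrix_(i, j) (limn (series (re i j)) +i* limn (series (im i j)))%C.
apply/cvg_ex; exists L; apply/cvg_mN.
have -> : (fun t => mN (series u t - L)) = (fun t => \sum_i \sum_j
    (`|series (re i j) t - limn (series (re i j))| +
     `|series (im i j) t - limn (series (im i j))|)).
  apply/funext => t; apply: eq_bigr => i _; apply: eq_bigr => j _.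
  have E : series u t i j = (series (re i j) t +i* series (im i j) t)%C.
    rewrite /series /=; elim: t => [|t IH]; first by rewrite !big_nil mxE.
    rewrite !big_nat_recr//= mxE IH /re /im; case: (u t i j) => a c.
    by apply/eqP; rewrite eq_complex /= !eqxx.
  by rewrite 2!mxE [X in X - _]E [X in _ - X]mxE.
apply: cvg_bigsum0 => i; apply: cvg_bigsum0 => j.
have H1 : (fun t => series (re i j) t - limn (series (re i j))) @ \oo --> (0 : R).
  by apply/subr_cvg0; exact: cre.
have H2 : (fun t => series (im i j) t - limn (series (im i j))) @ \oo --> (0 : R).
  by apply/subr_cvg0; exact: cim.
have H := cvgD (cvg_norm H1) (cvg_norm H2).
by rewrite !normr0 addr0 in H; exact: H.
Qed.

Definition ifact k : R[i] := (k`!%:R)^-1.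

Definition mterm X k : cmx R n := ifact k *: (X ^+ k : cmx R n).

(** The factor [n.+1] serves the power 0, since the identity has norm [n]. *)
Lemma mN_exp X k : mN (X ^+ k : cmx R n) <= n.+1%:R * mN X ^+ k.
Proof.
have h j : mN (X ^+ j.+1 : cmx R n) <= mN X ^+ j.+1.
  elim: j => [|j IH]; first by rewrite !expr1.
  rewrite exprS [leRHS]exprS; apply: le_trans (mNM _ _) _.
  by rewrite ler_wpM2l ?mN_ge0.
case: k => [|k].
  rewrite !expr0 mulr1 -idmxE /mN.
  rewrite (eq_bigr (fun=> 1)) ?sumr_const ?card_ord ?ler_nat// => i _.
  rewrite (bigD1 i)//= big1 ?addr0 ?mxE ?eqxx; first by rewrite (ncR 1) normr1.
  by move=> j ji; rewrite mxE eq_sym (negbTE ji) nc0.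
apply: le_trans (h k) _; rewrite ler_peMl ?exprn_ge0 ?mN_ge0//.
by rewrite ler1n.
Qed.

Lemma mN_mterm X k : mN (mterm X k) <= n.+1%:R * exp_coeff (mN X) k.
Proof.
rewrite /mterm (_ : ifact k = (k`!%:R^-1 : R)%:C%C); last first.
  by rewrite /ifact fmorphV rmorph_nat.
rewrite mNZ ger0_norm ?invr_ge0 ?ler0n// /exp_coeff /= mulrA mulrC.
by rewrite ler_wpM2r ?invr_ge0 ?ler0n// mN_exp.
Qed.

Lemma cvg_mexp X : series (mterm X) @ \oo --> mexp X.
Proof.
apply: (@cvg_series_mN _ (fun k => n.+1%:R * exp_coeff (mN X) k)).
  exact: mN_mterm.
exact: (@is_cvg_seriesZ _ _ n.+1%:R (is_cvg_series_exp_coeff _)).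
Qed.

Lemma mexp_lim X Y : series (mterm X) @ \oo --> Y -> mexp X = Y.
Proof. exact: lim_mN. Qed.

Lemma mN_lim_le (u : nat -> cmx R n) X (b : R) :
  u @ \oo --> X -> (\forall k \near \oo, mN (u k) <= b) -> mN X <= b.
Proof.
move=> /cvg_mN uX ub; apply/ler_addgt0Pr => e e0.
have H : \forall k \near \oo, mN (u k - X) < e.
  move/cvgrPdist_lt : uX => /(_ e e0); apply: filterS => k /=.
  by rewrite sub0r normrN ger0_norm ?mN_ge0.
have [k [k1 k2]] := filter_ex (filterI H ub).
rewrite -(subrK (u k) X) addrC (le_trans (mND _ _))// lerD//.
by rewrite mNB ltW.
Qed.

(** The first two terms of the series cancel, and [1/(j+2)! <= 1/j!] lets [mN X ^+ 2] be factored
    out of the tail. This is differentiability at 0 in quantitative form. *)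
Lemma mexp_sub1_bound X :
  mN (mexp X - 1%:M - X) <= n.+1%:R * (mN X ^+ 2 * expR (mN X)).
Proof.
apply: (@mN_lim_le (fun k => series (mterm X) k - 1%:M - X)).
  by apply: cvgB (cvg_cst _); apply: cvgB (cvg_cst _); exact: cvg_mexp.
exists 2%N => // k /=; case: k => [//|[//|k]] _.
have -> : series (mterm X) k.+2 - 1%:M - X =
    \sum_(0 <= j < k) mterm X j.+2.
  rewrite /series /= big_nat_recl// big_nat_recl// /mterm /ifact. rewrite fact0 invr1.
  rewrite !scale1r expr0 expr1 -idmxE [1%:M + _]addrC addrK.
  by rewrite [X + _]addrC addrK.
apply: le_trans (mN_sum _ _ _) _.
apply: (@le_trans _ _ (\sum_(0 <= j < k) n.+1%:R * (mN X ^+ 2 * exp_coeff (mN X) j))).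
  apply: ler_sum => j _; apply: le_trans (mN_mterm _ _) _.
  rewrite ler_wpM2l ?ler0n// /exp_coeff /= 2!exprS expr2 !mulrA.
  rewrite ler_wpM2l ?mulr_ge0 ?exprn_ge0 ?mN_ge0// lef_pV2 ?posrE ?ltr0n ?fact_gt0//.
  by rewrite ler_nat !factS mulnA leq_pmull.
rewrite -mulr_sumr ler_wpM2l ?ler0n// -mulr_sumr ler_wpM2l ?exprn_ge0 ?mN_ge0//.
by rewrite exp_series_le ?mN_ge0.
Qed.

Lemma mN_mexp X : mN (mexp X) <= n.+1%:R * expR (mN X).
Proof.
apply: (@mN_lim_le (series (mterm X)) _ _ (@cvg_mexp X)); apply: nearW => k.
apply: le_trans (mN_sum _ _ _) _.
apply: (@le_trans _ _ (\sum_(0 <= j < k) n.+1%:R * exp_coeff (mN X) j)).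
  by apply: ler_sum => j _; exact: mN_mterm.
by rewrite -mulr_sumr ler_wpM2l// exp_series_le ?mN_ge0.
Qed.

Lemma mcvgD (f g : nat -> cmx R n) X Y : f @ \oo --> X -> g @ \oo --> Y ->
  (fun m => f m + g m) @ \oo --> X + Y.
Proof. exact: cvgD. Qed.

Lemma mcvgB (f g : nat -> cmx R n) X Y : f @ \oo --> X -> g @ \oo --> Y ->
  (fun m => f m - g m) @ \oo --> X - Y.
Proof. exact: cvgB. Qed.

Lemma mcvgc X : (fun _ : nat => X) @ \oo --> X.
Proof. exact: cvg_cst. Qed.

Lemma mcvgZ (c : R) (f : nat -> cmx R n) X : f @ \oo --> X ->
  (fun m => c%:C%C *: f m) @ \oo --> (c%:C%C *: X : cmx R n).
Proof.
move=> /cvg_mN fX; apply/cvg_mN.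
have H := cvgM (@cvg_cst _ `|c| _ \oo _) fX; rewrite mulr0 in H.
by apply: (cvg_ext (H _ _)) => m /=; rewrite -mNZ scalerBr.
Qed.

Lemma mulmx_cvg (u v : nat -> cmx R n) X Y :
  u @ \oo --> X -> v @ \oo --> Y -> (fun k => u k *m v k) @ \oo --> X *m Y.
Proof.
move=> /cvg_mN uX /cvg_mN vY; apply/cvg_mN.
have H : (fun k => (mN (u k - X) * mN (v k - Y) + mN (u k - X) * mN Y) +
    mN X * mN (v k - Y)) @ \oo --> (0 * 0 + 0 * mN Y + mN X * 0 : R).
  by do 2?apply: cvgD; apply: cvgM => //; exact: cvg_cst.
rewrite !mulr0 mul0r !addr0 in H.
refine (@cvg0_le _ _ _ _ _ _ _ H) => k.
rewrite mN_ge0/= -mulrDr.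
have -> : u k *m v k - X *m Y = (u k - X) *m v k + X *m (v k - Y).
  by rewrite mulmxBl mulmxBr addrA subrK.
apply: le_trans (mND _ _) _; apply: lerD; last exact: mNM.
apply: le_trans (mNM _ _) _; rewrite ler_wpM2l ?mN_ge0//.
by rewrite -{1}(subrK Y (v k)) mND.
Qed.

(** One statement for three uses: conjugation when [Z] is invertible, commutation when [X = Y], and
    the action on eigenvectors when [Y] is scalar. *)
Lemma mexp_intertwine X Y Z : X *m Z = Z *m Y -> mexp X *m Z = Z *m mexp Y.
Proof.
move=> XZ; have H k : (X ^+ k : cmx R n) *m Z = Z *m (Y ^+ k : cmx R n).
  elim: k => [|k IH]; first by rewrite !expr0 -idmxE mulmx1 mul1mx.
  by rewrite !exprSr -!mulmxE -mulmxA XZ mulmxA IH mulmxA.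
have H1 := mulmx_cvg (@cvg_mexp X) (@mcvgc Z).
have H2 := mulmx_cvg (@mcvgc Z) (@cvg_mexp Y).
rewrite -(lim_mN H1) -(lim_mN H2).
suff -> : (fun k => series (mterm X) k *m Z) = (fun k => Z *m series (mterm Y) k) by [].
apply/funext => k; rewrite /= /series /= mulmx_suml mulmx_sumr.
by apply: eq_bigr => j _; rewrite /mterm -scalemxAl H scalemxAr.
Qed.

Lemma mexp0 : mexp (0 : cmx R n) = 1%:M.
Proof.
apply: (@mexp_lim 0); apply/cvg_mN; apply: cvg_near_cst.
exists 1%N => // -[//|k] _ /=.
rewrite /series /= big_nat_recl// big1 ?addr0.
  by rewrite /mterm /ifact fact0 invr1 scale1r expr0 -idmxE subrr mN0.
by move=> i _; rewrite /mterm expr0n scaler0.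
Qed.

Lemma mtermD X Y m : X *m Y = Y *m X ->
  mterm (X + Y) m = \sum_(i < m.+1) mterm X (m - i)%N *m mterm Y i.
Proof.
move=> XY; rewrite /mterm exprDn_comm// scaler_sumr; apply: eq_bigr => i _.
have im : (i <= m)%N by rewrite -ltnS.
have sc (k : nat) (Z : cmx R n) : Z *+ k = (k%:R : R[i]) *: Z by rewrite scaler_nat.
rewrite sc -scalemxAl -scalemxAr !scalerA -mulmxE; congr (_ *: _); rewrite /ifact.
have := bin_fact im => /(congr1 (fun k => k%:R : R[i])); rewrite !natrM => <-.
have f0 k : k`!%:R != 0 :> R[i] by rewrite pnatr_eq0 -lt0n fact_gt0.
have b0 : 'C(m, i)%:R != 0 :> R[i] by rewrite pnatr_eq0 -lt0n bin_gt0.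
by field; rewrite !f0 b0.
Qed.

(** The error between the product of the partial sums and the partial sum for [X + Y] is a triangle
    of terms. It is dominated by the same triangle for the numbers [mN X] and [mN Y], which tends to
    0 by the addition formula of the real exponential. *)
Lemma mexpD X Y : X *m Y = Y *m X -> mexp (X + Y) = mexp X *m mexp Y.
Proof.
move=> XY; symmetry.
have H1 := mulmx_cvg (@cvg_mexp X) (@cvg_mexp Y).
apply/esym/mexp_lim.
have -> : series (mterm (X + Y)) = (fun k => series (mterm X) k *m series (mterm Y) k -
  (series (mterm X) k *m series (mterm Y) k - series (mterm (X + Y)) k)).
  by apply/funext => k; rewrite subKr.
suff H0 : (fun k => series (mterm X) k *m series (mterm Y) k - series (mterm (X + Y)) k)
    @ \oo --> (0 : cmx R n).
  by have H := cvgB H1 H0; rewrite subr0 in H; exact: H.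
apply/cvg_mN.
have E k : series (mterm X) k *m series (mterm Y) k - series (mterm (X + Y)) k =
    \sum_(i < k) (\sum_(k - i <= j < k) mterm X j) *m mterm Y i.
  rewrite /series /= [X in _ - X](_ : _ = \sum_(m < k) \sum_(i < m.+1)
      mterm X (m - i)%N *m mterm Y i); last first.
    by rewrite big_mkord; apply: eq_bigr => m _; exact: mtermD.
  rewrite [X in _ *m X]big_mkord.
  exact: (@exp_trunc_sum 'M[R[i]^o]_n k (mterm X) (mterm Y)).
set x := mN X; set y := mN Y.
have H2 : (fun k => n.+1%:R ^+ 2 * (series (exp_coeff x) k * series (exp_coeff y) k
     - series (exp_coeff (x + y)) k)) @ \oo --> (n.+1%:R ^+ 2 * (expR x * expR y - expR (x + y)) : R).
  apply: cvgM; first exact: cvg_cst.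
  by apply: cvgB; [apply: cvgM|]; exact: is_cvg_series_exp_coeff.
rewrite expRD subrr mulr0 in H2.
refine (@cvg0_le _ _ _ _ _ _ _ H2) => k; rewrite mN_ge0 subr0 E.
have -> : series (exp_coeff x) k * series (exp_coeff y) k - series (exp_coeff (x + y)) k
    = \sum_(i < k) (\sum_(k - i <= j < k) exp_coeff x j) * exp_coeff y i.
  rewrite -exp_trunc_sum /series /= [in X in _ * X]big_mkord; congr (_ - _).
  by rewrite big_mkord; apply: eq_bigr => m _; exact: exp_coeffD.
apply: le_trans (mN_sum _ _ _) _; rewrite mulr_sumr; apply: ler_sum => i _.
apply: le_trans (mNM _ _) _; rewrite expr2 mulrACA.
apply: ler_pM; rewrite ?mN_ge0 ?mN_mterm// mulr_sumr.
by apply: le_trans (mN_sum _ _ _) _; apply: ler_sum => j _; exact: mN_mterm.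
Qed.

Lemma mexpN X : mexp X *m mexp (- X) = 1%:M.
Proof. by rewrite -mexpD ?subrr ?mexp0// mulmxN mulNmx. Qed.

Lemma mexpZ_natmul X k : mexp (k%:R *: X) = (mexp X ^+ k : cmx R n).
Proof.
elim: k => [|k IH]; first by rewrite scale0r mexp0.
rewrite exprS -IH -mulmxE -mexpD; first by rewrite -natr1 scalerDl scale1r addrC.
by rewrite -scalemxAl -scalemxAr.
Qed.

(** The direction [W m] may vary with [m], so that the lemma also applies to limits of elements of a
    Lie algebra. *)
Lemma mexp_deriv (k : nat -> nat) (W : nat -> cmx R n) Z :
  (forall m, 0 < k m)%N -> (fun m => (k m)%:R^-1 : R) @ \oo --> 0 ->
  W @ \oo --> Z ->
  (fun m => (k m)%:R *: (mexp ((k m)%:R^-1%:C%C *: W m) - 1%:M)) @ \oo --> Z.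
Proof.
move=> k0 kinf WZ; pose b := mN Z + 1.
have Wb : \forall m \near \oo, mN (W m) <= b.
  move/cvg_mN : WZ => /cvgrPdist_lt /(_ 1 ltr01); apply: filterS => m /=.
  rewrite sub0r normrN ger0_norm ?mN_ge0// => /ltW H.
  by rewrite -(subrK Z (W m)) addrC (le_trans (mND _ _))// lerD.
suff H : (fun m => (k m)%:R *: (mexp ((k m)%:R^-1%:C%C *: W m) - 1%:M) - W m) @ \oo --> (0 : cmx R n).
  have H2 := cvgD H WZ; rewrite add0r in H2.
  by apply: (cvg_ext (H2 _)) => m /=; rewrite subrK.
apply/cvg_mN; under eq_fun do rewrite subr0.
have H : (fun m => n.+1%:R * (b ^+ 2 * expR b) * (k m)%:R^-1) @ \oo --> (0 : R).
  rewrite -(mulr0 (n.+1%:R * (b ^+ 2 * expR b))); apply: cvgM => //; exact: cvg_cst.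
apply: (@squeeze_cvgr _ _ _ _ (fun=> 0) (fun m => n.+1%:R * (b ^+ 2 * expR b) * (k m)%:R^-1) _ _ 0 _ H); last exact: cvg_cst.
apply: filterS Wb => m Wb; rewrite mN_ge0/=.
have kR : (k m)%:R != 0 :> R by rewrite pnatr_eq0 -lt0n.
have -> : (k m)%:R *: (mexp ((k m)%:R^-1%:C%C *: W m) - 1%:M) - W m =
    (k m)%:R%:C%C *: (mexp ((k m)%:R^-1%:C%C *: W m) - 1%:M - (k m)%:R^-1%:C%C *: W m).
  by rewrite rmorph_nat [RHS]scalerBr scalerA -(rmorph_nat (real_complex R)) -rmorphM mulfV// scale1r.
rewrite mNZ ger0_norm//; have := mexp_sub1_bound ((k m)%:R^-1%:C%C *: W m).
rewrite mNZ ger0_norm ?invr_ge0// => H1.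
have := ler_wpM2l (ler0n R (k m)) H1; move/le_trans; apply.
rewrite [leLHS](_ : _ = n.+1%:R * (mN (W m) ^+ 2 * expR ((k m)%:R^-1 * mN (W m))) * (k m)%:R^-1); last by field.
rewrite ler_wpM2r ?invr_ge0// ler_wpM2l//.
apply: ler_pM; rewrite ?exprn_ge0 ?mN_ge0 ?expR_ge0//.
  by rewrite lerXn2r ?nnegrE ?mN_ge0// (le_trans (mN_ge0 _) Wb).
rewrite ler_expR; apply: le_trans Wb.
by rewrite ler_piMl ?mN_ge0// invf_le1 ?ltr0n// ler1n.
Qed.

(* A telescoping bound on g_m^k_m - mexp(Z/k_m)^k_m; both power families are bounded. *)
Lemma euler_limit (g : nat -> cmx R n) (k : nat -> nat) (M : R) Z :
  (forall m j, mN (g m ^+ j : cmx R n) <= M) ->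
  (forall m, 0 < k m)%N -> (fun m => (k m)%:R^-1 : R) @ \oo --> 0 ->
  (fun m => (k m)%:R *: (g m - 1%:M)) @ \oo --> Z ->
  (fun m => g m ^+ k m : cmx R n) @ \oo --> mexp Z.
Proof.
move=> gM k0 kinf gZ; pose c := n.+1%:R * expR (mN Z).
pose B m : cmx R n := mexp ((k m)%:R^-1%:C%C *: Z).
have BZ m : B m ^+ k m = mexp Z.
  rewrite /B -mexpZ_natmul scalerA -(rmorph_nat (real_complex R)) -rmorphM mulfV ?scale1r//.
  by rewrite pnatr_eq0 -lt0n.
have Bc m j : (j <= k m)%N -> mN (B m ^+ j : cmx R n) <= c.
  move=> jk; rewrite /B -mexpZ_natmul scalerA -(rmorph_nat (real_complex R)) -rmorphM.
  apply: le_trans (mN_mexp _) _; rewrite ler_wpM2l// ler_expR mNZ.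
  rewrite ger0_norm ?divr_ge0// ler_piMl ?mN_ge0// ler_pdivrMr ?ltr0n//.
  by rewrite mul1r ler_nat.
have M0 : 0 <= M by apply: le_trans (mN_ge0 _) (gM 0%N 0%N).
have c0 : 0 <= c by rewrite mulr_ge0// expR_ge0.
apply/cvg_mN.
have tel m : mN (g m ^+ k m - mexp Z) <= M * c * mN ((k m)%:R *: (g m - B m)).
  rewrite -(BZ m) -(rmorph_nat (real_complex R)) mNZ ger0_norm// mulrCA.
  have E j l : (j + l <= k m)%N ->
      mN ((g m ^+ j - B m ^+ j) *m B m ^+ l : cmx R n) <= j%:R * (M * c * mN (g m - B m)).
    elim: j l => [|j IH] l jl; first by rewrite !expr0 subrr mul0mx mN0 mul0r.
    have -> : (g m ^+ j.+1 - B m ^+ j.+1) *m B m ^+ l =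
        g m ^+ j *m (g m - B m) *m B m ^+ l + (g m ^+ j - B m ^+ j) *m B m ^+ l.+1.
      exact: (@exp_telescope 'M[R[i]^o]_n).
    apply: le_trans (mND _ _) _; rewrite -natr1 mulrDl mul1r addrC lerD//.
      by apply: IH; rewrite addnS.
    apply: le_trans (mNM _ _) _; rewrite -mulrAC; apply: ler_pM; rewrite ?mN_ge0//.
      by apply: le_trans (mNM _ _) _; apply: ler_pM; rewrite ?mN_ge0.
    by apply: Bc; apply: leq_trans jl; rewrite leq_addl.
  by have := E (k m) 0%N; rewrite addn0 expr0 -idmxE mulmx1 mulrCA; apply.
refine (@cvg0_le _ _ _ _ _ (fun m => M * c * mN ((k m)%:R *: (g m - B m))) _ _).
  by move=> m; rewrite mN_ge0 tel.
suff H : (fun m => (k m)%:R *: (g m - B m)) @ \oo --> (0 : cmx R n).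
  move/cvg_mN : H => H; have H2 := cvgM (@cvg_cst _ (M * c) _ \oo _) H.
  by rewrite mulr0 in H2; apply: (cvg_ext (H2 _ _)) => m /=; rewrite subr0.
have BcvgZ : (fun m => (k m)%:R *: (B m - 1%:M)) @ \oo --> Z.
  exact: mexp_deriv kinf (@mcvgc Z).
have H := mcvgB gZ BcvgZ; rewrite (subrr Z) in H.
by apply: (cvg_ext H) => m /=; rewrite -scalerBr opprB addrA subrK.
Qed.

End MatrixExp.

(** * The Lie algebra of a closed subgroup of U(n) *)

Section LieGroup.
Context {R : realType} {n : nat}.
Implicit Types (G T : set (cmx R n)) (X Y Z g : cmx R n).

Lemma natinv_cvg0 : (fun m : nat => m.+1%:R^-1 : R) @ \oo --> 0.
Proof. exact: cvg_harmonic. Qed.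

Lemma mexp_near1 (W : nat -> cmx R n) Z : W @ \oo --> Z ->
  (fun m => mexp (m.+1%:R^-1%:C%C *: W m)) @ \oo --> (1%:M : cmx R n).
Proof.
move=> WZ; have H := mexp_deriv (fun m => ltn0Sn m) natinv_cvg0 WZ.
move/cvg_mN : H => H.
have H3 : (fun m => (mN (m.+1%:R *: (mexp (m.+1%:R^-1%:C%C *: W m) - 1%:M) - Z) + mN Z)
    * m.+1%:R^-1) @ \oo --> (0 : R).
  rewrite -(mulr0 (0 + mN Z)); apply: cvgM natinv_cvg0.
  by apply: cvgD => //; exact: cvg_cst.
apply/cvg_mN; refine (@cvg0_le _ _ _ _ _ _ _ H3) => m; rewrite mN_ge0/=.
set V := mexp _ - _.
have -> : mN V = mN (m.+1%:R *: V) * m.+1%:R^-1.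
  by rewrite -(rmorph_nat (real_complex R)) mNZ ger0_norm// mulrAC mulfV ?mul1r// pnatr_eq0.
rewrite ler_wpM2r ?invr_ge0//; apply: le_trans (mND _ _).
by rewrite subrK.
Qed.

Lemma mexp_prod_deriv X Y :
  (fun m => m.+1%:R *: (mexp (m.+1%:R^-1%:C%C *: X) *m mexp (m.+1%:R^-1%:C%C *: Y) - 1%:M))
    @ \oo --> X + Y.
Proof.
have HX := mexp_deriv (fun m => ltn0Sn m) natinv_cvg0 (@mcvgc _ _ X).
have HY := mexp_deriv (fun m => ltn0Sn m) natinv_cvg0 (@mcvgc _ _ Y).
have H1 := mexp_near1 (@mcvgc _ _ Y).
have H := mcvgD (mulmx_cvg HX H1) HY; rewrite mulmx1 in H.
by apply: (cvg_ext H) => m /=; rewrite -scalemxAl -scalerDr mulmxBl mul1mx addrA subrK.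
Qed.

Lemma closed_seq G (u : nat -> cmx R n) Z :
  closed G -> (forall m, G (u m)) -> u @ \oo --> Z -> G Z.
Proof.
move=> cG uG uZ; apply: (closed_cvg _ cG _ _ uZ) => //.
exact: nearW.
Qed.

Lemma mN_unitary X : X \is unitarymx -> mN X <= \sum_(i < n) \sum_(j < n) 2.
Proof.
move=> /unitarymxP XX; 
have h i j : nc (X i j) <= 2.
  have := congr1 (fun A : cmx R n => complex.Re (A i i)) XX; rewrite !mxE eqxx /=.
  rewrite (_ : complex.Re _ = \sum_k (complex.Re (X i k) ^+ 2 + complex.Im (X i k) ^+ 2)); last first.
    rewrite Re_sum; apply: eq_bigr => k _.
    by rewrite !mxE; case: (X i k) => a b /=; rewrite mulrN opprK !expr2.
  rewrite (bigD1 j)//= => H.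
  have H0 : 0 <= \sum_(i0 < n | i0 != j) (complex.Re (X i i0) ^+ 2 + complex.Im (X i i0) ^+ 2).
    by apply: sumr_ge0 => k _; rewrite addr_ge0 ?sqr_ge0.
  have a0 := sqr_ge0 (complex.Re (X i j)); have b0 := sqr_ge0 (complex.Im (X i j)).
  have h1 (x : R) : x ^+ 2 <= 1 -> `|x| <= 1.
    by move=> h; rewrite ler_norml; apply/andP; split; nra.
  by rewrite /nc -[2]/(1 + 1) lerD//; apply: h1; lra.
by apply: ler_sum => i _; apply: ler_sum.
Qed.

Lemma mexp_trmxC X : mexp ((X ^t*)%sesqui) = ((mexp X) ^t*)%sesqui.
Proof.
apply: mexp_lim; have /cvg_mN H := @cvg_mexp _ _ X.
apply/cvg_mN; apply: (cvg_ext H) => m /=.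
rewrite -mN_trmxC; congr mN.
have tD (A B : cmx R n) : ((A + B) ^t*)%sesqui = (A ^t*)%sesqui + (B ^t*)%sesqui.
  by apply/matrixP => i j; rewrite !mxE rmorphD.
have tX k : ((X ^+ k : cmx R n) ^t*)%sesqui = ((X ^t*)%sesqui ^+ k : cmx R n).
  elim: k => [|k IH]; first by rewrite !expr0 -idmxE trmx1 map_mx1.
  by rewrite exprSr exprS -!mulmxE trmx_mul map_mxM IH.
have tB (A B : cmx R n) : ((A - B) ^t*)%sesqui = (A ^t*)%sesqui - (B ^t*)%sesqui.
  by apply/matrixP => i j; rewrite !mxE rmorphB.
rewrite tB; congr (_ - _).
have t0 : ((0 : cmx R n) ^t*)%sesqui = 0 by apply/matrixP => i j; rewrite !mxE rmorph0.
rewrite /series /= (big_morph (fun A : cmx R n => (A ^t*)%sesqui) tD t0).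
apply: eq_bigr => k _.
rewrite /mterm -tX; apply/matrixP => i j; rewrite !mxE rmorphM; congr (_ * _).
by rewrite /ifact fmorphV rmorph_nat.
Qed.

Section OneGroup.
Variable G : set (cmx R n).
Hypothesis cG : compact_group G.

Let Gu X : G X -> X \is unitarymx. Proof. by case: cG => H _ _ _ _; exact: H. Qed.
Let G1 : G 1%:M. Proof. by case: cG. Qed.
Let GM X Y : G X -> G Y -> G (X *m Y). Proof. by case: cG => _ _ H _ _; exact: H. Qed.
Let GV X : G X -> G (invmx X). Proof. by case: cG => _ _ _ H _; exact: H. Qed.
Let Gc : closed G. Proof. by case: cG. Qed.

Lemma group_exp X k : G X -> G (X ^+ k : cmx R n).
Proof.
move=> GX; elim: k => [|k IH]; first by rewrite expr0 -idmxE.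
by rewrite exprS -mulmxE; exact: GM.
Qed.

(** The powers [g m ^+ k m] stay in the closed group and converge to [mexp Z] by [euler_limit].
    Closure of [lie G] under sums and limits, and from there under brackets, rests on this. *)
Lemma group_euler (g : nat -> cmx R n) (k : nat -> nat) Z :
  (forall m, G (g m)) ->
  (forall m, 0 < k m)%N -> (fun m => (k m)%:R^-1 : R) @ \oo --> 0 ->
  (fun m => (k m)%:R *: (g m - 1%:M)) @ \oo --> Z -> G (mexp Z).
Proof.
move=> Gg k0 kinf gZ.
have gb m j : mN (g m ^+ j : cmx R n) <= \sum_(i < n) \sum_(j < n) 2.
  exact/mN_unitary/Gu/group_exp.
refine (@closed_seq G (fun m => g m ^+ k m : cmx R n) _ Gc _ (euler_limit gb k0 kinf gZ)).
by move=> m; exact: group_exp.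
Qed.

Lemma lieZ (c : R) X : lie G X -> lie G (c%:C%C *: X).
Proof. by move=> LX t; rewrite scalerA -rmorphM; exact: LX. Qed.

Lemma lieD X Y : lie G X -> lie G Y -> lie G (X + Y).
Proof.
move=> LX LY t; rewrite scalerDr.
apply: (group_euler _ (fun m => ltn0Sn m) natinv_cvg0 (@mexp_prod_deriv _ _)) => m.
by apply: GM; rewrite scalerA -rmorphM; [exact: LX|exact: LY].
Qed.

Lemma lie0 : lie G 0.
Proof. by move=> t; rewrite scaler0 mexp0. Qed.

(** Unitarity says that the product of the exponentials of [tX] and of its adjoint is constantly 1,
    so its derivative, [X] plus its adjoint, vanishes. *)
Lemma lie_skew X : lie G X -> (X ^t*)%sesqui = - X.
Proof.
move=> LX; apply/eqP; rewrite -addr_eq0 addrC; apply/eqP.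
have H := @mexp_prod_deriv X (X ^t*)%sesqui.
apply: (mN_lim_unique H); apply: (cvg_ext (@mcvgc _ _ 0)) => m.
have -> : m.+1%:R^-1%:C%C *: (X ^t*)%sesqui = ((m.+1%:R^-1%:C%C *: X) ^t*)%sesqui.
  apply/matrixP => i j; rewrite !mxE rmorphM; congr (_ * _).
  by apply/eqP; rewrite eq_complex /= oppr0 !eqxx.
rewrite mexp_trmxC; have /Gu/unitarymxP -> := LX m.+1%:R^-1.
by rewrite subrr scaler0.
Qed.

Lemma lie_Ad g X : G g -> lie G X -> lie G (g *m X *m invmx g).
Proof.
move=> Gg LX t; have ug : g \in unitmx by apply/unitarymx_unit/Gu.
have -> : mexp (t%:C%C *: (g *m X *m invmx g)) = g *m mexp (t%:C%C *: X) *m invmx g.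
  have H : (t%:C%C *: (g *m X *m invmx g)) *m g = g *m (t%:C%C *: X).
    by rewrite -scalemxAl -scalemxAr mulmxKV.
  by have /= <- := mexp_intertwine H; rewrite mulmxK.
by apply: (GM (GM Gg _)); [exact: LX|exact: GV].
Qed.

Lemma lie_closed (W : nat -> cmx R n) Z :
  (forall m, lie G (W m)) -> W @ \oo --> Z -> lie G Z.
Proof.
move=> LW WZ t.
have tW : (fun m => t%:C%C *: W m) @ \oo --> (t%:C%C *: Z : cmx R n).
  exact: mcvgZ.
apply: (group_euler _ (fun m => ltn0Sn m) natinv_cvg0 (mexp_deriv _ natinv_cvg0 tW)) => // m.
by rewrite scalerA -rmorphM; exact: LW.
Qed.

(** The bracket is the limit of the difference quotients [W m] of the adjoint action of [exp (X/m)]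
    on [Y], all of which lie in [lie G]. *)
Lemma lie_lbr X Y : lie G X -> lie G Y -> lie G (lbr X Y).
Proof.
move=> LX LY.
pose A m := mexp (m.+1%:R^-1%:C%C *: X); pose B m := mexp (m.+1%:R^-1%:C%C *: (- X)).
have AB m : invmx (A m) = B m.
  have H : A m *m B m = 1%:M by rewrite /A /B scalerN mexpN.
  have uA : A m \in unitmx by apply/unitarymx_unit/Gu/LX.
  by rewrite -[RHS](mulKmx uA) H mulmx1.
pose W m := m.+1%:R%:C%C *: (A m *m Y *m invmx (A m) + (-1)%:C%C *: Y).
apply: (@lie_closed W) => [m|].
  by apply/lieZ/lieD; [apply: lie_Ad => //; exact: LX|exact: lieZ].
have HA := mexp_deriv (fun m => ltn0Sn m) natinv_cvg0 (@mcvgc _ _ X).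
have HB := mexp_deriv (fun m => ltn0Sn m) natinv_cvg0 (@mcvgc _ _ (- X)).
have B1 := mexp_near1 (@mcvgc _ _ (- X)).
have H := mcvgD (mulmx_cvg (mulmx_cvg HA (@mcvgc _ _ Y)) B1) (mulmx_cvg (@mcvgc _ _ Y) HB).
rewrite mulmx1 mulmxN in H; apply: (cvg_ext H) => m /=.
rewrite /W AB -/(A m) -/(B m) rmorph_nat rmorphN rmorph1 scaleN1r.
rewrite -!scalemxAl -!scalemxAr -scalerDr mulmxBl mul1mx mulmxBl mulmxBr mulmx1.
by rewrite addrA subrK.
Qed.

End OneGroup.
End LieGroup.

(** * The trace form and maximality of the torus *)

Lemma increasing_ge (f : nat -> nat) :
  {homo f : m n / (m < n)%N} -> forall m, (m <= f m)%N.
Proof.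
by move=> fi; elim=> // m IH; apply: leq_ltn_trans IH _; exact: fi.
Qed.

Lemma cvg_subseq (U : topologicalType) (u : nat -> U) (f : nat -> nat) (l : U) :
  {homo f : m n / (m < n)%N} -> u @ \oo --> l -> (u \o f) @ \oo --> l.
Proof.
move=> fi ul A /ul [N _ NA]; exists N => // m /= Nm.
by apply: NA => /=; apply: leq_trans Nm (increasing_ge fi m).
Qed.

(** Bolzano-Weierstrass is applied to one sequence after another, each time passing to a further
    subsequence. *)
Lemma subseq_family {R : realType} (us : seq (nat -> R)) (M : R) :
  {in us, forall u k, `|u k| <= M} ->
  exists2 f : nat -> nat, {homo f : m n / (m < n)%N} &
    {in us, forall u, cvgn (u \o f)}.
Proof.
elim: us => [|u us IH] ub; first by exists id.
have [|f fi fus] := IH; first by move=> v vus; apply: ub; rewrite inE vus orbT.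
have [|g gi guf] := @bolzano_weierstrass R (u \o f).
  exists M; split; first exact: num_real.
  by move=> N MN x _ /=; apply: le_trans (ltW MN); apply: ub; rewrite inE eqxx.
have gi' : {homo g : m n / (m < n)%N}.
  by move=> a b; rewrite !ltnNge => ab; have := gi b a; rewrite !leEnat => ->.
exists (f \o g) => [a b ab|v]; first by apply/fi/gi'.
rewrite inE => /orP[/eqP ->//|/fus /cvg_ex[l vl]].
by apply/cvg_ex; exists l; exact: (cvg_subseq gi' vl).
Qed.

Lemma mN_subseq {R : realType} {n} (u : nat -> cmx R n) (M : R) :
  (forall k, mN (u k) <= M) ->
  exists2 f : nat -> nat, {homo f : m n / (m < n)%N} &
    exists L : cmx R n, (u \o f) @ \oo --> L.
Proof.
move=> uM.
pose c (p : 'I_n * 'I_n * bool) k :=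
  if p.2 then complex.Re (u k p.1.1 p.1.2) else complex.Im (u k p.1.1 p.1.2).
have [v|f fi fc] := @subseq_family R [seq c p | p : 'I_n * 'I_n * bool] M.
  case/mapP => -[[i j] b] _ -> k; apply: le_trans (uM k).
  by apply: le_trans (nc_le_mN _ i j); rewrite /c /nc; case: b; rewrite /= ?lerDl ?lerDr.
exists f => //.
have fcp p : (c p \o f) @ \oo --> limn (c p \o f).
  by apply: fc; apply/mapP; exists p; rewrite ?mem_enum.
exists (\matrix_(i, j) (limn (c (i, j, true) \o f) +i* limn (c (i, j, false) \o f))%C).
apply/cvg_mN.
suff H : (fun t => \sum_i \sum_j (`|c (i, j, true) (f t) - limn (c (i, j, true) \o f)| +
    `|c (i, j, false) (f t) - limn (c (i, j, false) \o f)|)) @ \oo --> (0 : R).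
  apply: (cvg_ext H) => t; apply: eq_bigr => i _; apply: eq_bigr => j _.
  by rewrite /nc !mxE /c /=; case: (u (f t) i j).
apply: cvg_bigsum0 => i; apply: cvg_bigsum0 => j.
have H p : (fun t => `|c p (f t) - limn (c p \o f)|) @ \oo --> (0 : R).
  have H0 : (fun t => c p (f t) - limn (c p \o f)) @ \oo --> (0 : R).
    by apply/subr_cvg0; exact: fcp.
  by have H1 := cvg_norm H0; rewrite normr0 in H1; exact: H1.
have H2 := cvgD (H (i, j, true)) (H (i, j, false)); rewrite addr0 in H2.
exact: H2.
Qed.

Section TraceForm.
Context {R : realType} {n : nat}.
Implicit Types X Y Z : cmx R n.

Definition retr X : R := complex.Re (\tr X).

Lemma retrE X : retr X = \sum_i complex.Re (X i i).
Proof. exact: Re_sum. Qed.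

Lemma retrD X Y : retr (X + Y) = retr X + retr Y.
Proof. by rewrite /retr mxtraceD; case: (\tr X); case: (\tr Y). Qed.

Lemma retrN X : retr (- X) = - retr X.
Proof. by rewrite /retr raddfN /=; case: (\tr X). Qed.

Lemma retrZ (c : R) X : retr (c%:C%C *: X) = c * retr X.
Proof. by rewrite /retr mxtraceZ; case: (\tr X) => a b /=; rewrite mul0r subr0. Qed.

Lemma retr_le X : `|retr X| <= mN X.
Proof.
rewrite retrE; apply: le_trans (ler_norm_sum _ _ _) _; apply: ler_sum => i _.
rewrite (bigD1 i)//=; apply: ler_wpDr; last by rewrite lerDl.
by apply: sumr_ge0 => j _; exact: nc_ge0.
Qed.

Lemma retr_cvg (u : nat -> cmx R n) X : u @ \oo --> X -> (fun m => retr (u m)) @ \oo --> retr X.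
Proof.
move=> /cvg_mN uX; apply/subr_cvg0/cvgr0Pnorm_lt => e e0.
move/cvgrPdist_lt : uX => /(_ e e0); apply: filterS => m /=.
rewrite sub0r normrN ger0_norm ?mN_ge0//; apply: le_lt_trans.
by rewrite -retrN -retrD retr_le.
Qed.

Lemma retr_skew X : (X ^t*)%sesqui = - X -> retr X = 0.
Proof.
move=> XX; have : retr ((X ^t*)%sesqui) = retr X.
  by rewrite !retrE; apply: eq_bigr => i _; rewrite !mxE; case: (X i i).
by rewrite XX retrN => /eqP; rewrite eq_sym -subr_eq0 opprK -mulr2n mulrn_eq0 /= => /eqP.
Qed.

Definition frob X : R := \sum_i \sum_j (complex.Re (X i j) ^+ 2 + complex.Im (X i j) ^+ 2).

Lemma frob_retr X : retr (X *m (X ^t*)%sesqui) = frob X.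
Proof.
rewrite retrE; apply: eq_bigr => i _; rewrite !mxE Re_sum; apply: eq_bigr => j _.
by rewrite !mxE; case: (X i j) => a b /=; rewrite mulrN opprK !expr2.
Qed.

Lemma frob_eq0 X : frob X = 0 -> X = 0.
Proof.
have h i j : 0 <= complex.Re (X i j) ^+ 2 + complex.Im (X i j) ^+ 2.
  by rewrite addr_ge0 ?sqr_ge0.
move=> /eqP; rewrite psumr_eq0 => [/allP H|i _]; last by apply: sumr_ge0.
apply/matrixP => i j; have := H i (mem_index_enum _).
rewrite /= psumr_eq0// => /allP /(_ j (mem_index_enum _)) /=.
rewrite paddr_eq0 ?sqr_ge0// !sqrf_eq0 mxE; case: (X i j) => a b /=.
by move=> /andP[/eqP -> /eqP ->].
Qed.

Lemma frob_nc X i j : nc (X i j) ^+ 2 <= 2 * frob X.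
Proof.
apply: (@le_trans _ _ (2 * (complex.Re (X i j) ^+ 2 + complex.Im (X i j) ^+ 2))).
  rewrite /nc -(real_normK (num_real (complex.Re (X i j)))).
  rewrite -(real_normK (num_real (complex.Im (X i j)))).
  set x := `|complex.Re _|; set y := `|complex.Im _|.
  by have := sqr_ge0 (x - y); nra.
rewrite ler_wpM2l// /frob (bigD1 i)//= (bigD1 j)//= -addrA lerDl.
by apply: addr_ge0; apply: sumr_ge0 => k _; [|apply: sumr_ge0 => l _]; rewrite addr_ge0 ?sqr_ge0.
Qed.

Lemma frob_le X : frob X <= mN X ^+ 2.
Proof.
rewrite -frob_retr; apply: le_trans (ler_norm _) _; apply: le_trans (retr_le _) _.
by apply: le_trans (mNM _ _) _; rewrite mN_trmxC expr2.
Qed.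

Definition ubound : R := \sum_(i < n) \sum_(j < n) 2.

Lemma ubound_ge0 : 0 <= ubound.
Proof. by apply: sumr_ge0 => i _; apply: sumr_ge0. Qed.

Lemma mN_le_frob X (a : R) : 0 <= a -> frob X <= a ^+ 2 -> mN X <= ubound * a.
Proof.
move=> a0 Xa; rewrite /ubound mulr_suml; apply: ler_sum => i _.
rewrite mulr_suml; apply: ler_sum => j _.
rewrite -(@ler_pXn2r _ 2) ?nnegrE ?nc_ge0 ?mulr_ge0//.
apply: le_trans (frob_nc X i j) _; rewrite exprMn.
by have := sqr_ge0 a; nra.
Qed.

Lemma retr1 : retr (1%:M : cmx R n) = n%:R.
Proof. by rewrite /retr mxtrace1 -(rmorph_nat (real_complex R)). Qed.

Lemma retr_trmxC X : retr ((X ^t*)%sesqui) = retr X.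
Proof. by rewrite !retrE; apply: eq_bigr => i _; rewrite !mxE; case: (X i i). Qed.

(** On unitary matrices maximizing [retr] is the same as minimizing the distance to the identity.
    This is why [retr] is maximized below. *)
Lemma frob_unitary X : X \is unitarymx -> frob (X - 1%:M) = 2 * (n%:R - retr X).
Proof.
move=> /unitarymxP XX; rewrite -frob_retr.
have -> : ((X - 1%:M) ^t*)%sesqui = (X ^t*)%sesqui - 1%:M.
  apply/matrixP => i j; rewrite !mxE rmorphB rmorph_nat eq_sym.
  by [].
rewrite mulmxBl !mulmxBr XX !mulmx1 mul1mx !retrD !retrN retrD retrN retr_trmxC retr1.
by ring.
Qed.

End TraceForm.

Section Compact.
Context {R : realType} {n : nat}.
Variable G : set (cmx R n).
Hypothesis cG : compact_group G.
Implicit Types X Y Z g : cmx R n.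

Lemma group_unitary X : G X -> X \is unitarymx.
Proof. by case: cG => H _ _ _ _; exact: H. Qed.

Lemma group1 : G 1%:M. Proof. by case: cG. Qed.

Lemma groupM X Y : G X -> G Y -> G (X *m Y).
Proof. by case: cG => _ _ H _ _; exact: H. Qed.

Lemma groupV X : G X -> G (invmx X).
Proof. by case: cG => _ _ _ H _; exact: H. Qed.

Lemma group_closed : closed G. Proof. by case: cG. Qed.

Lemma group_bound X : G X -> mN X <= (@ubound R n).
Proof. by move=> /group_unitary /mN_unitary. Qed.

Lemma group_unit X : G X -> X \in unitmx.
Proof. by move=> /group_unitary /unitarymx_unit. Qed.

Lemma group_invE X : G X -> invmx X = (X ^t*)%sesqui.
Proof. by move=> /group_unitary /invmx_unitary. Qed.

Lemma group_cvg_invmx (u : nat -> cmx R n) X :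
  (forall m, G (u m)) -> u @ \oo --> X -> (fun m => invmx (u m)) @ \oo --> invmx X.
Proof.
move=> Gu uX; have GX : G X by exact: closed_seq group_closed Gu uX.
move/cvg_mN : uX => uX; apply/cvg_mN; apply: (cvg_ext uX) => m.
rewrite !group_invE// -mN_trmxC; congr mN.
by apply/matrixP => i j; rewrite !mxE rmorphB.
Qed.

(** A maximizing sequence is bounded, and a subsequence of it converges inside the closed group. *)
Lemma group_argmax g : exists2 z, G z & forall z', G z' -> retr (g *m z') <= retr (g *m z).
Proof.
pose E := [set retr (g *m z) | z in G].
have Eb : has_sup E.
  split; first by exists (retr (g *m 1%:M)), 1%:M => //; exact: group1.
  exists (mN g * (@ubound R n)) => _ [z Gz <-]; apply: le_trans (ler_norm _) _.
  apply: le_trans (retr_le _) _; apply: le_trans (mNM _ _) _.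
  by rewrite ler_wpM2l ?mN_ge0 ?group_bound.
have /choice[u uE] : forall m : nat, exists z, G z /\ sup E - m.+1%:R^-1 < retr (g *m z).
  move=> m; have m0 : (0 : R) < m.+1%:R^-1 by rewrite invr_gt0.
  by have [_ [z Gz <-] H] := sup_adherent m0 Eb; exists z.
have [f fi [z uz]] := mN_subseq (fun k => group_bound (uE k).1).
have Gz : G z by apply: (closed_seq group_closed _ uz) => m /=; exact: (uE _).1.
exists z => // z' Gz'; apply: (@le_trans _ _ (sup E)).
  by apply: (ub_le_sup Eb.2); exists z'.
have H1 := retr_cvg (mulmx_cvg (@mcvgc _ _ g) uz).
have H2 : (fun m => sup E - (f m).+1%:R^-1) @ \oo --> sup E - 0.
  apply: cvgB; first exact: cvg_cst.
  exact: (cvg_subseq fi natinv_cvg0).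
rewrite subr0 in H2.
apply: (ler_cvg_to H2 H1); apply: nearW => m /=; apply: ltW; exact: (uE _).2.
Qed.

End Compact.

(** * From commutation with the Lie algebra of a torus to commutation with the torus *)

Section TorusCentralizer.
Context {R : realType} {n : nat}.
Variable T : set (cmx R n).
Hypotheses (cT : compact_group T) (conT : connected T).
Hypothesis abT : forall X Y, T X -> T Y -> X *m Y = Y *m X.
Variable X : cmx R n.
Hypothesis comX : forall h, lie T h -> X *m h = h *m X.
Implicit Types Y h g : cmx R n.

Let Z : set (cmx R n) := [set g | T g /\ g *m X = X *m g].

Lemma comm_closed (A B : cmx R n) (u : nat -> cmx R n) :
  (forall m, u m *m A = A *m u m) -> u @ \oo --> B -> B *m A = A *m B.
Proof.
move=> uA uB; have H1 := mulmx_cvg uB (@mcvgc _ _ A).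
have H2 := mulmx_cvg (@mcvgc _ _ A) uB.
apply: (mN_lim_unique H1); apply: (cvg_ext H2) => m /=; by rewrite uA.
Qed.

Lemma seq_closed (A : set (cmx R n)) :
  (forall u Y, (forall m : nat, A (u m)) -> u @ \oo --> Y -> A Y) -> closed A.
Proof.
move=> H Y cY.
have /choice[u uE] : forall m : nat, exists y, A y /\ mN (Y - y) < m.+1%:R^-1.
  move=> m; have m0 : (0 : R) < m.+1%:R^-1 by rewrite invr_gt0.
  by have [y Ay yY] := (closure_mN _ _).1 cY _ m0; exists y.
apply: (H u) => [m|]; first exact: (uE m).1.
apply/cvg_mN; refine (@cvg0_le _ _ _ _ _ _ _ (@natinv_cvg0 R)) => m.
by rewrite mN_ge0 mNB ltW// (uE m).2.
Qed.

Lemma stab_compact : compact_group Z.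
Proof.
split.
- by move=> g [/(group_unitary cT)].
- by split; [exact: group1|rewrite mul1mx mulmx1].
- move=> g g' [Tg gX] [Tg' g'X]; split; first exact: groupM.
  by rewrite -mulmxA g'X mulmxA gX mulmxA.
- move=> g [Tg gX]; split; first exact: groupV.
  have ug := group_unit cT Tg.
  by rewrite -[LHS](mulmxK ug) -[invmx g *m X *m g]mulmxA -gX mulKmx.
apply: seq_closed => u Y uZ uY; split.
  by apply: (closed_seq (group_closed cT) _ uY) => m; exact: (uZ m).1.
by apply: comm_closed uY => m; exact: (uZ m).2.
Qed.

Lemma lie_torus_stab h : lie T h -> Z (mexp h).
Proof.
move=> Lh; split; first by have := Lh 1; rewrite rmorph1 scale1r.
by apply: mexp_intertwine; rewrite comX.
Qed.

(* First-order optimality of [z] along the curves [z *m mexp (s h)]. *)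
Lemma argmax_orth g h : (forall z, Z z -> retr (g *m z) <= retr g) -> lie T h ->
  retr (g *m h) = 0.
Proof.
move=> gmax; have le h' : lie T h' -> retr (g *m h') <= 0.
  move=> Lh; have H := mexp_deriv (fun m => ltn0Sn m) natinv_cvg0 (@mcvgc _ _ h').
  have H1 := retr_cvg (mulmx_cvg (@mcvgc _ _ g) H).
  apply: (ler_cvg_to H1 (@cvg_cst _ (0 : R) _ \oo _)); apply: nearW => m /=.
  rewrite -(rmorph_nat (real_complex R)) -scalemxAr retrZ.
  rewrite pmulr_rle0 ?ltr0n// mulmxBr mulmx1 retrD retrN subr_le0.
  by apply: gmax; apply: lie_torus_stab; exact: lieZ.
move=> Lh; apply/eqP; rewrite eq_le le//=.
have := le _ (lieZ (-1) Lh); rewrite rmorphN rmorph1 scaleN1r mulmxN retrN.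
by rewrite oppr_le0.
Qed.

(** Otherwise elements of [T] outside the stabilizer [Z] tend to 1. Each is translated by the
    element of [Z] that brings it closest to 1. The normalized differences [D m] from 1 have a limit
    point [L] in [lie T]; optimality makes every [D m] orthogonal to [lie T], hence to [L]. In the
    limit [L] is orthogonal to itself, which contradicts norm 1. *)
Lemma near1_stab : exists2 e : R, 0 < e & forall g, T g -> mN (g - 1%:M) < e -> Z g.
Proof.
apply: contrapT => nH.
have /choice[g gE] : forall m : nat, exists g, [/\ T g, mN (g - 1%:M) < m.+1%:R^-1 & ~ Z g].
  move=> m; apply: contrapT => H; apply: nH; exists m.+1%:R^-1; first by rewrite invr_gt0.
  by move=> g Tg g1; apply: contrapT => nZ; apply: H; exists g.
have /choice[z zE] : forall m : nat, exists z, Z z /\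
    forall z', Z z' -> retr (g m *m z') <= retr (g m *m z).
  by move=> m; have [z Zz H] := group_argmax stab_compact (g m); exists z.
pose g' m := g m *m z m.
have Tg' m : T (g' m) by apply: groupM => //; [case: (gE m)|case: (zE m) => -[]].
have max m y : Z y -> retr (g' m *m y) <= retr (g' m).
  move=> Zy; rewrite /g' -mulmxA; case: (zE m) => Zz; apply.
  by case: stab_compact => _ _ H _ _; exact: H.
have nZ m : ~ Z (g' m).
  move=> Zg; case: (gE m) => _ _; apply; case: (zE m) => Zz _.
  have := group_unit stab_compact Zz => uz.
  rewrite -[g m](mulmxK uz); case: stab_compact => _ _ H HV _.
  by apply: H => //; exact: HV.
have g'1 : g' @ \oo --> (1%:M : cmx R n).
  apply/cvg_mN; have H : (fun m => @ubound R n * m.+1%:R^-1) @ \oo --> (0 : R).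
    by rewrite -(mulr0 (@ubound R n)); apply: cvgM; [exact: cvg_cst|exact: natinv_cvg0].
  refine (@cvg0_le _ _ _ _ _ _ _ H) => m; rewrite mN_ge0/=.
  case: (gE m) => Tg g1 _; apply: mN_le_frob; first by rewrite invr_ge0.
  apply: (@le_trans _ _ (frob (g m - 1%:M))).
    rewrite !frob_unitary ?(group_unitary cT)// ler_wpM2l// lerB//.
    by case: (zE m) => _ /(_ _ (group1 stab_compact)); rewrite mulmx1.
  apply: le_trans (frob_le _) _; rewrite lerXn2r ?nnegrE ?mN_ge0 ?invr_ge0//.
  exact: ltW.
pose ep m := mN (g' m - 1%:M).
have ep0 m : 0 < ep m.
  rewrite lt_neqAle mN_ge0 andbT eq_sym; apply/eqP => /mN_eq0/eqP.
  rewrite subr_eq0 => /eqP g1; apply: (nZ m); rewrite g1; exact: group1 stab_compact.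
pose D m : cmx R n := (ep m)^-1%:C%C *: (g' m - 1%:M).
have D1 m : mN (D m) = 1 by rewrite mNZ gtr0_norm ?invr_gt0// mulVf ?gt_eqF.
have D1' m : mN (D m) <= 1 by rewrite D1.
have [f fi [L DL]] := mN_subseq D1'.
have epf : (fun m => ep (f m)) @ \oo --> (0 : R).
  by move/cvg_mN : g'1 => H; exact: (cvg_subseq fi H).
have LTpos t : 0 < t -> T (mexp (t%:C%C *: L)).
  (* The number of steps of length [ep] that just exceeds [t]: the [k m]-th power of [g'] then
     approaches the exponential of [t L]. *)
  move=> t0; pose k m := (Num.trunc (t / ep (f m))).+1.
  have kE m : t < (k m)%:R * ep (f m) <= t + ep (f m).
    have := @truncn_itv _ (t / ep (f m)) (divr_ge0 (ltW t0) (ltW (ep0 _))).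
    rewrite ler_pdivlMr// ltr_pdivrMr// => /andP[h1 h2].
    by rewrite h2 -natr1 mulrDl mul1r lerD2r h1.
  have kinv : (fun m => (k m)%:R^-1) @ \oo --> (0 : R).
    have H : (fun m => t^-1 * ep (f m)) @ \oo --> (0 : R).
      by rewrite -(mulr0 t^-1); apply: cvgM => //; exact: cvg_cst.
    refine (@cvg0_le _ _ _ _ _ _ _ H) => m; rewrite invr_ge0 ler0n/=.
    case/andP: (kE m) => /ltW h _.
    by rewrite mulrC ler_pdivlMr// mulrC ler_pdivrMr ?ltr0n// mulrC.
  refine (@group_euler R n T cT (g' \o f) k (t%:C%C *: L) (fun m => Tg' (f m)) (fun m => ltn0Sn _) kinv _).
  apply/cvg_mN; move/cvg_mN : DL => DL.
  have H : (fun m => ep (f m) + t * mN ((D \o f) m - L)) @ \oo --> (0 + t * 0 : R).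
    by apply: cvgD => //; apply: cvgM => //; exact: cvg_cst.
  rewrite mulr0 addr0 in H; refine (@cvg0_le _ _ _ _ _ _ _ H) => m; rewrite mN_ge0/=.
  have -> : (k m)%:R *: (g' (f m) - 1%:M) - t%:C%C *: L =
      ((k m)%:R * ep (f m) - t)%:C%C *: D (f m) + t%:C%C *: (D (f m) - L).
    rewrite [((_ - t)%:C)%C]rmorphB scalerBl [_ *: (D _ - L)]scalerBr addrA subrK; congr (_ - _).
    rewrite /D scalerA -rmorphM -mulrA mulfV ?gt_eqF// mulr1.
    by rewrite rmorph_nat.
  apply: le_trans (mND _ _) _; 
  rewrite [mN (_ *: D _)]mNZ D1 mulr1 [mN (t%:C%C *: _)]mNZ (gtr0_norm t0).
  rewrite lerD2r; case/andP: (kE m) => h1 h2.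
  by rewrite ger0_norm; lra.
have LT : lie T L.
  move=> t; have [t0|t0|->] := ltgtP t 0; last 1 first.
  - by rewrite scale0r mexp0; exact: group1.
  - have := LTpos (- t); rewrite oppr_gt0 => /(_ t0) /(groupV cT).
    have uE : mexp ((- t)%:C%C *: L) \in unitmx.
      by apply/(group_unit cT)/LTpos; rewrite oppr_gt0.
    suff -> : invmx (mexp ((- t)%:C%C *: L)) = mexp (t%:C%C *: L) by [].
    have E : mexp ((- t)%:C%C *: L) *m mexp (t%:C%C *: L) = 1%:M.
      have := mexpN (- (t%:C%C *: L)); rewrite opprK => <-.
      by rewrite rmorphN scaleNr.
    by rewrite -[RHS](mulKmx uE) E mulmx1.
  - exact: LTpos.
have tDh m h : lie T h -> retr (D m *m h) = 0.
  move=> Lh; rewrite /D -scalemxAl retrZ mulmxBl mul1mx retrD retrN.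
  by rewrite (argmax_orth (max m) Lh) (retr_skew (lie_skew cT Lh)) subrr mulr0.
have : retr (L *m L) = 0.
  have H := retr_cvg (mulmx_cvg DL (@mcvgc _ _ L)).
  apply: (rcvg_unique H).
  refine (cvg_ext (@rcvgc R 0) _) => m /=. by rewrite tDh.
have -> : L *m L = - (L *m (L ^t*)%sesqui) by rewrite (lie_skew cT LT) mulmxN opprK.
rewrite retrN frob_retr => /eqP; rewrite oppr_eq0 => /eqP /frob_eq0 L0.
move/cvg_mN : DL; rewrite L0 => H.
have : (1 : R) = 0.
  apply: (rcvg_unique _ H).
  by apply: (cvg_ext (@rcvgc R 1)) => m /=; rewrite subr0 D1.
by move/eqP; rewrite oner_eq0.
Qed.

Lemma open_mN (A : set (cmx R n)) :
  (forall Y, A Y -> exists2 e : R, 0 < e & forall Y', mN (Y - Y') < e -> A Y') -> open A.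
Proof. by move=> H; rewrite openE => Y /H /nbhs_mN. Qed.

(** By [near1_stab] the stabilizer is open in [T]. It is also closed and nonempty, and [T] is
    connected. *)
Lemma torus_stab g : T g -> g *m X = X *m g.
Proof.
suff -> : T = Z by case.
(* Multiplying by the inverse of an element of [T] scales norms by at most [ubound], so points at
   distance [d] from [Z] are moved to within [e] of 1. *)
have [e e0 eZ] := near1_stab; pose d := e / (@ubound R n + 1).
have u0 : 0 < @ubound R n + 1 by rewrite ltr_wpDl ?ubound_ge0.
have d0 : 0 < d by rewrite divr_gt0.
symmetry; apply: conT.
- by exists 1%:M; exact: group1 stab_compact.
- exists [set Y | exists2 z, Z z & mN (z - Y) < d].
    apply: open_mN => Y [z Zz zY]; exists (d - mN (z - Y)); first by rewrite subr_gt0.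
    move=> Y' YY'; exists z => //.
    have -> : z - Y' = (z - Y) + (Y - Y') by rewrite addrA subrK.
    by apply: le_lt_trans (mND _ _) _; rewrite addrC -ltrBrDr.
  apply/seteqP; split=> [z Zz|Y [TY [z Zz zY]]].
    by split; [case: Zz|exists z => //; rewrite subrr mN0].
  have uz := group_unit stab_compact Zz; have Tz : T z by case: Zz.
  have Zy : Z (invmx z *m Y).
    apply: eZ; first by apply: groupM => //; exact: groupV.
    have -> : invmx z *m Y - 1%:M = invmx z *m (Y - z) by rewrite mulmxBr mulVmx.
    apply: le_lt_trans (mNM _ _) _.
    apply: (@le_lt_trans _ _ (@ubound R n * d)).
      by apply: ler_pM; rewrite ?mN_ge0// ?(group_bound cT (groupV cT Tz))// mNB ltW.
    by rewrite /d mulrCA gtr_pMr// ltr_pdivrMr// mul1r ltrDl.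
  have := groupM stab_compact Zz Zy; by rewrite mulKVmx.
exists [set Y | Y *m X = X *m Y].
  by apply: seq_closed => u Y uA; exact: comm_closed.
by apply/seteqP; split=> [z []|z []].
Qed.

End TorusCentralizer.

Section MaximalTorus.
Context {R : realType} {n : nat}.
Variables G T : set (cmx R n).
Hypotheses (cG : compact_group G) (mT : maximal_torus G T).
Implicit Types (X Y h g : cmx R n).

Lemma mexpB_scale X (s t : R) :
  mexp (t%:C%C *: X) = mexp (s%:C%C *: X) *m mexp ((t - s)%:C%C *: X).
Proof.
rewrite -mexpD; last by rewrite -!scalemxAl -!scalemxAr !scalerA mulrC.
by rewrite -scalerDl -rmorphD addrC subrK.
Qed.

Lemma mexp_continuous X : continuous (fun s : R => mexp (s%:C%C *: X)).
Proof.
move=> s; apply/cvg_mN.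
pose c := mN (mexp (s%:C%C *: X)).
have H0 : (fun t : R => `|t - s| * mN X) @ s --> (0 : R).
  rewrite -(mul0r (mN X)); apply: cvgM; last exact: cvg_cst.
  have H : (fun t : R => t - s) @ s --> (0 : R) by apply/subr_cvg0; exact: cvg_id.
  by have H' := cvg_norm H; rewrite normr0 in H'; exact: H'.
have H1 : (fun t : R => c * (`|t - s| * mN X +
    n.+1%:R * ((`|t - s| * mN X) ^+ 2 * expR (`|t - s| * mN X)))) @ s -->
    c * (0 + n.+1%:R * (0 ^+ 2 * expR 0)).
  apply: cvgM; first exact: cvg_cst.
  apply: cvgD => //; apply: cvgM; first exact: cvg_cst.
  apply: cvgM; first by rewrite expr2; under eq_fun do rewrite expr2; exact: cvgM.
  exact: (cvg_comp _ _ H0 (@continuous_expR R 0)).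
rewrite expr2 mul0r mul0r mulr0 addr0 mulr0 in H1.
refine (@cvg0_le _ _ _ _ _ _ _ H1) => t; rewrite mN_ge0/=.
rewrite (mexpB_scale X s t).
have -> : mexp (s%:C%C *: X) *m mexp ((t - s)%:C%C *: X) - mexp (s%:C%C *: X) =
    mexp (s%:C%C *: X) *m (mexp ((t - s)%:C%C *: X) - 1%:M) by rewrite mulmxBr mulmx1.
apply: le_trans (mNM _ _) _; rewrite ler_wpM2l ?mN_ge0//.
rewrite -[_ - 1%:M](subrK ((t - s)%:C%C *: X)).
apply: le_trans (mND _ _) _; rewrite addrC mNZ lerD2l.
by have := mexp_sub1_bound ((t - s)%:C%C *: X); rewrite mNZ.
Qed.

(** The products of the one-parameter group of [X] with [T] form a connected abelian group. Its
    closure is a torus containing [T], so it is [T]. *)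
Lemma maximal_torus_centralizer X :
  lie G X -> (forall h, lie T h -> X *m h = h *m X) -> lie T X.
Proof.
case: mT => -[TG cT conT abT] maxT LX comX.
have tX := torus_stab cT conT comX.
pose E s := mexp (s%:C%C *: X).
have tE g s : T g -> g *m E s = E s *m g.
  move=> /tX gX; symmetry; apply: mexp_intertwine.
  by rewrite -scalemxAl -gX scalemxAr.
have EE s t : E s *m E t = E (s + t).
  rewrite /E -mexpD; last by rewrite -!scalemxAl -!scalemxAr !scalerA mulrC.
  by rewrite -scalerDl -rmorphD.
have EX s : E s = mexp (s%:C%C *: X) by [].
have E0 : E 0 = 1%:M by rewrite /E scale0r mexp0.
have contE : continuous E by exact: mexp_continuous.
have GE s : G (E s) by exact: LX.
clearbody E.
pose S : set (cmx R n) := \bigcup_(s in [set: R]) [set E s *m g | g in T].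
have SG Y : S Y -> G Y.
  by move=> [s _ [g Tg <-]]; apply: (groupM cG); [exact: GE|exact: TG].
have T1 := group1 cT.
have S1 s : S (E s) by exists s => //; exists 1%:M; rewrite ?mulmx1.
have ST g : T g -> S g.
  by move=> Tg; exists 0 => //; exists g => //; rewrite E0 mul1mx.
have EgE s t g g' : T g -> E s *m g *m (E t *m g') = E (s + t) *m (g *m g').
  move=> Tg; rewrite mulmxA -(mulmxA (E s)) (tE g t Tg) (mulmxA (E s)) (EE s t).
  by rewrite mulmxA.
have SM Y Y' : S Y -> S Y' -> S (Y *m Y').
  move=> [s _ [g Tg <-]] [t _ [g' Tg' <-]]; exists (s + t) => //.
  exists (g *m g'); first exact: groupM.
  by rewrite EgE.
have SV Y : S Y -> S (invmx Y).
  move=> SY; case: (SY) => s _ [g Tg gE]; exists (- s) => //.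
  exists (invmx g); first exact: groupV.
  have uY := group_unit cG (SG _ SY); have ug := group_unit cT Tg.
  have E1 : Y *m (E (- s) *m invmx g) = 1%:M.
    by rewrite -gE (EgE s (- s) g (invmx g) Tg) mulmxV// subrr E0 mulmx1.
  by rewrite -[RHS]mulmx1 -E1 mulKmx.
have Scom Y Y' : S Y -> S Y' -> Y *m Y' = Y' *m Y.
  move=> [s _ [g Tg <-]] [t _ [g' Tg' <-]].
  by rewrite (EgE s t g g' Tg) (EgE t s g' g Tg') addrC (abT _ _ Tg Tg').
have conE : connected (range E).
  apply: connected_continuous_connected; first by apply/connected_intervalP.
  by exact: continuous_subspaceT.
(* Every slice [E s *m T] is connected and meets the curve [range E], and all the enlarged slices
   share that curve. *)
have conS : connected S.
  have -> : S = \bigcup_(s in [set: R]) (range E `|` [set E s *m g | g in T]).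
    apply/seteqP; split=> [Y [s _ H]|Y [s _ [[t _ <-]|H]]]; first by exists s => //; right.
      exact: S1.
    by exists s.
  apply: bigcup_connected.
    by exists (E 0) => s _; left; exists 0.
  move=> s _; apply: connectedU => //.
    by exists (E s); split; [exists s|exists 1%:M; rewrite ?mulmx1].
  apply: connected_continuous_connected => //.
  apply: continuous_subspaceT => Y A /nbhs_mN[e e0 eA]; apply/nbhs_mN.
  have c0 : 0 < mN (E s) + 1 by rewrite ltr_wpDl ?mN_ge0.
  exists (e / (mN (E s) + 1)) => [|Y']; first by rewrite divr_gt0.
  rewrite ltr_pdivlMr// mulrC => H; apply: eA; rewrite -mulmxBr.
  apply: le_lt_trans (mNM _ _) _; apply: le_lt_trans H.
  by rewrite ler_wpM2r ?mN_ge0// lerDl.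
have cS Y : closure S Y -> exists2 u : nat -> cmx R n, (forall m, S (u m)) & u @ \oo --> Y.
  move=> cY; have /choice[u uE] : forall m : nat, exists y, S y /\ mN (Y - y) < m.+1%:R^-1.
    move=> m; have m0 : (0 : R) < m.+1%:R^-1 by rewrite invr_gt0.
    by have [y Ay yY] := (closure_mN _ _).1 cY _ m0; exists y.
  exists u; first by move=> m; exact: (uE m).1.
  apply/cvg_mN; refine (@cvg0_le _ _ _ _ _ _ _ (@natinv_cvg0 R)) => m.
  by rewrite mN_ge0 mNB ltW// (uE m).2.
have limS (u : nat -> cmx R n) Y : (forall m, S (u m)) -> u @ \oo --> Y -> closure S Y.
  move=> uS uY; apply: (closed_cvg _ (@closed_closure _ S) _ _ uY) => //.
  by apply: nearW => m; exact: subset_closure.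
have cSG Y : closure S Y -> G Y.
  by move=> /cS[u uS uY]; apply: (closed_seq (group_closed cG) _ uY) => m; exact: SG.
have -> : T = closure S.
  symmetry; apply: maxT; last by move=> g /ST; exact: subset_closure.
  split.
  - exact: cSG.
  - split.
    + by move=> Y /cSG; exact: group_unitary.
    + by apply: subset_closure; exact: ST.
    + move=> Y Y' /cS[u uS uY] /cS[v vS vY].
      by apply: (limS _ _ _ (mulmx_cvg uY vY)) => m; exact: SM.
    + move=> Y /cS[u uS uY].
      have := group_cvg_invmx cG (fun m => SG _ (uS m)) uY.
      by apply: limS => m; exact: SV.
    + exact: closed_closure.
  - exact: connected_closure.
  - move=> Y Y' /cS[u uS uY] /cS[v vS vY].
    have H1 := mulmx_cvg uY vY; have H2 := mulmx_cvg vY uY.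
    by apply: (mN_lim_unique H1); apply: (cvg_ext H2) => m /=; exact: Scom.
by move=> t; rewrite -EX; apply: subset_closure; exact: S1.
Qed.

End MaximalTorus.

(** * Eigenvector decompositions and sl2-strings *)

Section EigenSplit.
Context {K : fieldType} {W : lmodType K} {H : Type}.
Variables (T : H -> W -> W) (U : W -> Prop).
Hypothesis T_lin : forall h (a : K) u v, T h (a *: u + v) = a *: T h u + T h v.
Hypothesis U_lin : forall (a : K) u v, U u -> U v -> U (a *: u + v).
Hypothesis U_stable : forall h u, U u -> U (T h u).

(** Applying [T h - chi i h] kills [v i], multiplies [a] by a nonzero scalar and keeps the other
    terms eigenvectors, so the sum shortens. The predicate [U] is left free: with [U] the zero
    subspace this is independence of eigenvectors, with [U = glie] it puts the components of an
    element back into the Lie algebra. *)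
Lemma eigen_split (I : eqType) (r : seq I) (v : I -> W) (chi : I -> H -> K)
    (a : W) (chi0 : H -> K) :
  U 0 -> (forall h, T h a = chi0 h *: a) ->
  (forall i, i \in r -> forall h, T h (v i) = chi i h *: v i) ->
  (forall i, i \in r -> exists h, chi i h != chi0 h) ->
  U (a + \sum_(i <- r) v i) -> U a.
Proof.
move=> U0 Ta; have T0 h : T h 0 = 0.
  by have := T_lin h 1 0 0; rewrite !scale1r addr0 => /eqP; rewrite addrC -subr_eq subrr eq_sym => /eqP.
have TD h x y : T h (x + y) = T h x + T h y by have := T_lin h 1 x y; rewrite !scale1r.
have TZ h b x : T h (b *: x) = b *: T h x by have := T_lin h b x 0; rewrite T0 !addr0.
have US u b : U u -> U (b *: u) by move=> Uu; rewrite -[_ *: _]addr0; exact: U_lin.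
elim: r v => [|i r IH] v Tv ne; first by rewrite big_nil addr0.
rewrite big_cons => Uw; have [h hi] := ne i (mem_head _ _).
(* The eigenvalue on [v j] of [(T h - chi i h) / (chi0 h - chi i h)], which fixes [a]. *)
pose c j := (chi j h - chi i h) / (chi0 h - chi i h).
have d0 : chi0 h - chi i h != 0 by rewrite subr_eq0 eq_sym.
apply: (IH (fun j => c j *: v j)) => [j jr h'|j jr|].
- by rewrite TZ Tv ?inE ?jr ?orbT// !scalerA mulrC.
- by apply: ne; rewrite inE jr orbT.
have -> : a + \sum_(j <- r) c j *: v j = (chi0 h - chi i h)^-1 *:
    (- chi i h *: (a + (v i + \sum_(j <- r) v j)) + T h (a + (v i + \sum_(j <- r) v j))).
  rewrite !TD Ta Tv ?mem_head//.
  have -> : T h (\sum_(j <- r) v j) = \sum_(j <- r) chi j h *: v j.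
    rewrite (big_morph (T h) (TD h) (T0 h)) big_seq [RHS]big_seq; apply: eq_bigr => j jr.
    by rewrite Tv// inE jr orbT.
  rewrite !scalerDr !scalerA.
  have -> : \sum_(j <- r) c j *: v j = (chi0 h - chi i h)^-1 *:
      (- chi i h *: \sum_(j <- r) v j + \sum_(j <- r) chi j h *: v j).
    rewrite scaler_sumr -big_split/= scaler_sumr; apply: eq_bigr => j _.
    by rewrite -scalerDl scalerA /c mulrC [- _ + _]addrC.
  rewrite scalerDr scalerA.
  rewrite addrACA -scalerDl [X in _ = _ + X]addrACA -scalerDl.
  rewrite [X in _ + (X *: v i + _)](_ : _ = 0) ?scale0r ?add0r; last by rewrite -mulrDr addNr mulr0.
  by rewrite -mulrDr [- _ + _]addrC mulVf// scale1r.
by apply: US; apply: U_lin => //; exact: U_stable.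
Qed.

End EigenSplit.

Section Spanning.
Context {K : fieldType} {W : vectType K}.

Lemma max_free (S : W -> Prop) : exists X : seq W,
  [/\ free X, forall x, x \in X -> S x & forall w, S w -> w \in <<X>>%VS].
Proof.
pose P k := `[< exists X : seq W, [/\ free X, forall x, x \in X -> S x & size X = k] >].
have P0 : exists k, P k by exists 0%N; apply/asboolP; exists [::]; split=> //; exact: nil_free.
have Pb k : P k -> (k <= dim W)%N.
  move=> /asboolP[X [fX _ <-]]; have /eqP <- := fX; rewrite -dimvf.
  by apply: dimvS; exact: subvf.
have [k /asboolP[X [fX XS sX]] kmax] := ex_maxnP P0 Pb.
exists X; split=> // w Sw; apply: contrapT => /negP wX.
have : P k.+1.
  apply/asboolP; exists (w :: X); split; first by rewrite free_cons wX.
    by move=> x; rewrite inE => /orP[/eqP ->|/XS].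
  by rewrite /= sX.
by move=> /kmax; rewrite ltnn.
Qed.

(** Turns a subspace given by a proposition into a [vspace], which is what irreducibility speaks
    about. *)
Lemma pred_vspace (P : W -> Prop) : P 0 ->
  (forall (a : K) u v, P u -> P v -> P (a *: u + v)) ->
  exists U : {vspace W}, forall w, w \in U <-> P w.
Proof.
move=> P0 Pl; have [X [_ XP PX]] := max_free P; exists <<X>>%VS => w; split=> [|/PX//].
move=> wX; rewrite (@coord_span _ _ _ (in_tuple X) w wX); elim/big_ind : _ => // [x y Px Py|i _].
  by rewrite -[x]scale1r; exact: Pl.
rewrite -[_ *: _]addr0; apply: Pl => //; apply: XP; exact: mem_nth.
Qed.

Lemma spanning_basis (S : W -> Prop) :
  (forall U : {vspace W}, (forall w, S w -> w \in U) -> U = fullv) ->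
  exists X : seq W, basis_of fullv X /\ (forall x, x \in X -> S x).
Proof.
move=> H; have [X [fX XS SX]] := max_free S; exists X; split=> //.
by rewrite basisEfree fX /= -(H _ SX) subvv leq_eqVlt /= (eqP fX) eqxx.
Qed.

End Spanning.

(** * Strings of an sl2-triple acting on a finite-dimensional space *)

Section Sl2.
Context {K : numFieldType} {W : vectType K}.
Variables (E F H : W -> W).
Hypothesis E_lin : forall (a : K) u v, E (a *: u + v) = a *: E u + E v.
Hypothesis F_lin : forall (a : K) u v, F (a *: u + v) = a *: F u + F v.
Hypothesis H_lin : forall (a : K) u v, H (a *: u + v) = a *: H u + H v.
Hypothesis HE : forall v, H (E v) = E (H v) + 2 *: E v.
Hypothesis HF : forall v, H (F v) = F (H v) - 2 *: F v.
Hypothesis EF : forall v, E (F v) = F (E v) + H v.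

Lemma linear0' (G : W -> W) : (forall (a : K) u v, G (a *: u + v) = a *: G u + G v) -> G 0 = 0.
Proof.
by move=> Gl; have := Gl 1 0 0; rewrite !scale1r addr0 => /eqP; rewrite addrC -subr_eq subrr eq_sym => /eqP.
Qed.

Lemma linearZ' (G : W -> W) : (forall (a : K) u v, G (a *: u + v) = a *: G u + G v) ->
  forall a u, G (a *: u) = a *: G u.
Proof. by move=> Gl a u; have := Gl a u 0; rewrite (linear0' Gl) !addr0. Qed.

Lemma linearD' (G : W -> W) : (forall (a : K) u v, G (a *: u + v) = a *: G u + G v) ->
  forall u v, G (u + v) = G u + G v.
Proof. by move=> Gl u v; have := Gl 1 u v; rewrite !scale1r. Qed.

Lemma iterZ' (G : W -> W) k : (forall (a : K) u v, G (a *: u + v) = a *: G u + G v) ->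
  forall a u, iter k G (a *: u) = a *: iter k G u.
Proof. by move=> Gl a u; elim: k => //= k ->; rewrite linearZ'. Qed.

Lemma iterD' (G : W -> W) k : (forall (a : K) u v, G (a *: u + v) = a *: G u + G v) ->
  forall u v, iter k G (u + v) = iter k G u + iter k G v.
Proof. by move=> Gl a u; elim: k => //= k ->; rewrite linearD'. Qed.

Lemma weight_E c v k : H v = c *: v -> H (iter k E v) = (c + 2 * k%:R) *: iter k E v.
Proof.
move=> Hv; elim: k => [|k IH] /=; first by rewrite mulr0 addr0.
rewrite HE IH (linearZ' E_lin) -scalerDl -natr1; congr (_ *: _); ring.
Qed.

Lemma weight_F c v k : H v = c *: v -> H (iter k F v) = (c - 2 * k%:R) *: iter k F v.
Proof.
move=> Hv; elim: k => [|k IH] /=; first by rewrite mulr0 subr0.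
rewrite HF IH (linearZ' F_lin) -scalerBl -natr1; congr (_ *: _); ring.
Qed.

(** Nonzero terms of the chain are eigenvectors of [H] for distinct eigenvalues, hence independent,
    and there is no room for [dim W + 1] of them. *)
Lemma chain_vanish (G : W -> W) (s c : K) v : s != 0 ->
  (forall k, H (iter k G v) = (c + s * k%:R) *: iter k G v) -> exists d, iter d G v = 0.
Proof.
move=> s0 Hk; apply: contrapT => nd.
have nz k : iter k G v != 0 by apply/eqP => k0; apply: nd; exists k.
pose N := (dim W).+1; pose X := mktuple (fun i : 'I_N => iter i G v).
have fX : free X.
  apply/freeP => k k0 i; apply/eqP/negPn/negP => ki.
  have : k i *: iter i G v = 0.
    apply: (@eigen_split K W unit (fun _ => H) (fun w => w = 0) _ _ _ 'I_N
       [seq j <- index_enum 'I_N | j != i] (fun j => k j *: iter j G v)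
       (fun j _ => c + s * j%:R) (k i *: iter i G v) (fun _ => c + s * i%:R)) => //.
    - by move=> a u w -> ->; rewrite scaler0 addr0.
    - by move=> _ u ->; rewrite (linear0' H_lin).
    - by move=> _; rewrite (linearZ' H_lin) Hk !scalerA mulrC.
    - by move=> j _ _; rewrite (linearZ' H_lin) Hk !scalerA mulrC.
    - move=> j; rewrite mem_filter => /andP[ji _]; exists tt.
      apply: contra ji => /eqP /addrI /(mulfI s0) /eqP.
      by rewrite eqr_nat.
    rewrite big_filter -[RHS]k0 [RHS](bigD1 i)//=; congr (_ + _).
      by rewrite (nth_mktuple _ _ i).
    by apply: eq_bigr => j _; rewrite (nth_mktuple _ _ j).
  by move/eqP; rewrite scaler_eq0 (negbTE ki) (negbTE (nz i)).
have : (size X <= dim W)%N.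
  have /eqP <- := fX; rewrite -dimvf; apply: dimvS; exact: subvf.
by rewrite size_tuple ltnn.
Qed.

Lemma E_nilp c v : H v = c *: v -> exists d, iter d E v = 0.
Proof. by move=> Hv; apply: (@chain_vanish E 2 c) => [|k]; [rewrite pnatr_eq0|exact: weight_E]. Qed.

Lemma F_nilp c v : H v = c *: v -> exists d, iter d F v = 0.
Proof.
move=> Hv; apply: (@chain_vanish F (- 2) c) => [|k]; first by rewrite oppr_eq0 pnatr_eq0.
by rewrite mulNr; exact: weight_F.
Qed.

Lemma EF_iter c v j : H v = c *: v ->
  E (iter j.+1 F v) = iter j.+1 F (E v) + (j.+1%:R * (c - j%:R)) *: iter j F v.
Proof.
move=> Hv; elim: j => [|j IH]; first by rewrite /= EF Hv subr0 mul1r.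
rewrite [iter j.+2 F v]iterS EF IH (linearD' F_lin) -addrA (linearZ' F_lin); congr (_ + _).
rewrite -iterS (weight_F j.+1 Hv) -scalerDl; congr (_ *: _); rewrite -!natr1; ring.
Qed.

Lemma FE_iter c v d : H v = c *: v ->
  iter d.+1 E (F v) = F (iter d.+1 E v) + (d.+1%:R * (c + d%:R)) *: iter d E v.
Proof.
move=> Hv; elim: d => [|d IH]; first by rewrite /= EF Hv addr0 mul1r.
rewrite [iter d.+2 E (F v)]iterS IH (linearD' E_lin) EF (linearZ' E_lin) -addrA; congr (_ + _).
rewrite -iterS (weight_E d.+1 Hv) -scalerDl; congr (_ *: _); rewrite -!natr1; ring.
Qed.

(** Raise [v] to the last nonzero vector [w], then lower [w] to its last nonzero vector, [l] steps
    down. At that point [EF_iter] reads [(l + 1) (c' - l) = 0], with [c'] the weight of [w]. *)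
Lemma sl2_integral c v : v != 0 -> H v = c *: v -> exists z : int, c = z%:~R.
Proof.
move=> v0 Hv; have [d dv] := E_nilp Hv.
have [k [kv kv0]] : exists k, iter k.+1 E v = 0 /\ iter k E v != 0.
  elim: d dv => [/eqP|d IH dv]; first by rewrite /= (negbTE v0).
  by case: (eqVneq (iter d E v) 0) => [/IH//|nz]; exists d.
have Hw := weight_E k Hv; set w := iter k E v in Hw kv0; set c' := _ + _ in Hw.
have [d' d'w] := F_nilp Hw.
have [l [lw lw0]] : exists l, iter l.+1 F w = 0 /\ iter l F w != 0.
  elim: d' d'w => [/eqP|d' IH d'w]; first by rewrite /= (negbTE kv0).
  by case: (eqVneq (iter d' F w) 0) => [/IH//|nz]; exists d'.
have := EF_iter l Hw; rewrite lw (linear0' E_lin).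
have -> : E w = 0 by rewrite /w -iterS.
have -> : iter l.+1 F 0 = 0 by elim: l.+1 => //= ? ->; rewrite (linear0' F_lin).
rewrite add0r => /esym/eqP; rewrite scaler_eq0 (negbTE lw0) orbF mulf_eq0 pnatr_eq0/=.
rewrite subr_eq0 => /eqP; rewrite /c' => cl.
exists (l%:Z - 2 * k%:Z); rewrite intrB intrM -!pmulrn -cl.
by rewrite addrK.
Qed.

(* Induction on the nilpotency order [d] of [E] on [v], then on [j]. *)
Lemma sl2_inj d j m v : H v = m%:R *: v -> iter d E v = 0 -> iter j F v = 0 ->
  (j <= m)%N -> v = 0.
Proof.
elim: d j m v => [|d IHd] j m v; first by [].
elim: j v => [|j IHj] v Hv dv jv jm; first by [].
pose c : K := j.+1%:R * (m%:R - j%:R).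
have c0 : c != 0.
  by rewrite mulf_neq0 ?pnatr_eq0// -natrB 1?ltnW// pnatr_eq0 -lt0n subn_gt0.
have HEv : H (E v) = (m + 2)%:R *: E v by have := weight_E 1 Hv; rewrite mulr1 natrD.
pose v' := F (E v) + c *: v.
have v'0 : v' = 0.
  apply: IHj; last exact: ltnW.
  - rewrite /v' (linearD' H_lin) HF HEv (linearZ' F_lin) -scalerBl.
    rewrite (linearZ' H_lin) Hv scalerA mulrC -scalerA [RHS]scalerDr; congr (_ *: _ + _).
    by rewrite natrD addrK.
  - rewrite /v' (iterD' _ E_lin) (FE_iter d HEv) (iterZ' _ E_lin) dv scaler0 addr0.
    rewrite -iterSr iterS dv !(linear0' E_lin) (linear0' F_lin) add0r.
    by rewrite -iterSr dv scaler0.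
  have := EF_iter j Hv; rewrite jv (linear0' E_lin) => H0.
  by rewrite /v' (iterD' _ F_lin) (iterZ' _ F_lin) -iterSr.
have Ev0 : E v = 0.
  apply: (IHd j.+2 _ _ HEv); first by rewrite -iterSr.
    rewrite iterSr; have -> : F (E v) = - c *: v.
      by apply/eqP; rewrite -subr_eq0 scaleNr opprK -/v' v'0.
    by rewrite (iterZ' _ F_lin) jv scaler0.
  by rewrite addn2 !ltnS ltnW.
move: v'0; rewrite /v' Ev0 (linear0' F_lin) add0r => /eqP.
by rewrite scaler_eq0 (negbTE c0) => /eqP.
Qed.

Lemma sl2_F_inj m v : H v = m%:R *: v -> iter m F v = 0 -> v = 0.
Proof. by move=> Hv mv; have [d dv] := E_nilp Hv; apply: sl2_inj Hv dv mv _. Qed.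

End Sl2.

(** * Roots and the adjoint action *)

Section Adjoint.
Context {R : realType} {n : nat}.
Implicit Types X Y Z : cmx R n.

Definition adj X : cmx R n := (X ^t*)%sesqui.

Lemma adjD X Y : adj (X + Y) = adj X + adj Y.
Proof. by apply/matrixP => i j; rewrite !mxE rmorphD. Qed.

Lemma adj_scale (a : R[i]) X : adj (a *: X) = (a^*)%C *: adj X.
Proof. by apply/matrixP => i j; rewrite !mxE rmorphM. Qed.

Lemma adjN X : adj (- X) = - adj X.
Proof. by apply/matrixP => i j; rewrite !mxE rmorphN. Qed.

Lemma adjK X : adj (adj X) = X.
Proof. by apply/matrixP => i j; rewrite !mxE conjCK. Qed.

Lemma adjM X Y : adj (X *m Y) = adj Y *m adj X.
Proof. by rewrite /adj trmx_mul map_mxM. Qed.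

Lemma adj_lbr X Y : adj (lbr X Y) = - lbr (adj X) (adj Y).
Proof. by rewrite /lbr adjD adjN !adjM opprB. Qed.

Lemma tr_adj X : \tr (adj X) = ((\tr X)^*)%C.
Proof. by rewrite /mxtrace rmorph_sum; apply: eq_bigr => i _; rewrite !mxE. Qed.

Lemma tr_frob X : \tr (X *m adj X) = (frob X)%:C%C.
Proof.
have E := frob_retr X; rewrite -/(adj X) in E.
have : \tr (X *m adj X) = ((\tr (X *m adj X))^*)%C by rewrite -tr_adj adjM adjK.
rewrite -E /retr; case: (\tr _) => a b /= [] /eqP; rewrite -subr_eq0 opprK -mulr2n mulrn_eq0 /= => /eqP ->.
by [].
Qed.

Lemma lbrDr X Y Z : lbr X (Y + Z) = lbr X Y + lbr X Z.
Proof. by rewrite /lbr mulmxDr mulmxDl opprD addrACA. Qed.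

Lemma lbrZr (a : R[i]) X Y : lbr X (a *: Y) = a *: lbr X Y.
Proof. by rewrite /lbr -scalemxAr -scalemxAl scalerBr. Qed.

Lemma lbrC X Y : lbr X Y = - lbr Y X.
Proof. by rewrite /lbr opprB. Qed.

Lemma lbrDl X Y Z : lbr (X + Y) Z = lbr X Z + lbr Y Z.
Proof. by rewrite /lbr mulmxDr mulmxDl opprD addrACA. Qed.

Lemma lbrZl (a : R[i]) X Y : lbr (a *: X) Y = a *: lbr X Y.
Proof. by rewrite /lbr -scalemxAr -scalemxAl scalerBr. Qed.

Lemma lbrNl X Y : lbr (- X) Y = - lbr X Y.
Proof. by rewrite /lbr mulNmx mulmxN opprB opprK addrC. Qed.

Lemma lbr0 X : lbr X 0 = 0. Proof. by rewrite /lbr mulmx0 mul0mx subrr. Qed.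

Lemma jacobi X Y Z : lbr X (lbr Y Z) = lbr (lbr X Y) Z + lbr Y (lbr X Z).
Proof.
rewrite /lbr !mulmxBr !mulmxBl !mulmxA; apply/matrixP => i j.
by rewrite !mxE; ring.
Qed.

Lemma tr_lbr X Y Z : \tr (lbr X Y *m Z) = \tr (X *m lbr Y Z).
Proof.
rewrite /lbr mulmxBl mulmxBr !mulmxA !raddfB /=; congr (_ - _).
by rewrite mxtrace_mulC mulmxA mxtrace_mulC mulmxA.
Qed.

End Adjoint.

Section LieStructure.
Context {R : realType} {n r : nat} (D : lie_data R n r).
Hypotheses (cG : compact_group (grp D)) (simpleK : simple_lie (lie (grp D))).
Hypotheses (mT : maximal_torus (grp D) (tor D)) (basT : torus_basis D).
Implicit Types (a b l : 'rV[R]_r) (x y h : 'cV[R]_r) (X Y Z : cmx R n).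

Local Notation L := (lie (grp D)).
Local Notation tm := (tmx D).

Lemma lie_tor X : lie (tor D) X -> L X.
Proof. by move=> H t; case: mT => -[TG _ _ _] _; apply/TG/H. Qed.

Lemma tmxD x y : tm (x + y) = tm x + tm y.
Proof.
rewrite /tmx -big_split; apply: eq_bigr => i _ /=.
by rewrite mxE rmorphD scalerDl.
Qed.

Lemma tmxZ (c : R) x : tm (c *: x) = c%:C%C *: tm x.
Proof. by rewrite /tmx scaler_sumr; apply: eq_bigr => i _; rewrite mxE rmorphM scalerA. Qed.

Lemma tmx0 : tm 0 = 0.
Proof. by rewrite -[0](scale0r (0 : 'cV[R]_r)) tmxZ scale0r. Qed.

Lemma tmxN x : tm (- x) = - tm x.
Proof. by rewrite -scaleN1r tmxZ rmorphN rmorph1 scaleN1r. Qed.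

Lemma tmx_lieT x : lie (tor D) (tm x).
Proof. by case: basT => _ <-; exists x. Qed.

Lemma lieT_tmx X : lie (tor D) X -> exists x, X = tm x.
Proof. by case: basT => _ <- [x _ <-]; exists x. Qed.

Lemma tmx_inj x : tm x = 0 -> x = 0.
Proof. by case: basT => inj _ x0; apply: inj; rewrite tmx0. Qed.

Lemma tmx_lie x : L (tm x). Proof. exact: (lie_tor (tmx_lieT x)). Qed.

Lemma tbasisE j : tbasis D j = tm (\col_i (i == j)%:R).
Proof.
rewrite /tmx (bigD1 j)//= big1 => [|i ij]; first by rewrite mxE eqxx addr0 scale1r.
by rewrite mxE (negbTE ij) scale0r.
Qed.

Lemma adj_tmx x : adj (tm x) = - tm x.
Proof. exact: (lie_skew cG (tmx_lie x)). Qed.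

Lemma tmx_comm x y : tm x *m tm y = tm y *m tm x.
Proof.
case: mT => -[_ cT _ abT] _.
have deriv X (Y : cmx R n) : lie (tor D) X -> (forall g, tor D g -> g *m Y = Y *m g) -> X *m Y = Y *m X.
  move=> LX H; apply: comm_closed (mexp_deriv (fun m => ltn0Sn m) natinv_cvg0 (@mcvgc _ _ X)) => m.
  rewrite -scalemxAl -scalemxAr mulmxBl mulmxBr mul1mx mulmx1; congr (_ *: (_ - _)).
  by apply: H; exact: LX.
apply: (deriv _ _ (tmx_lieT x)) => g Tg; symmetry; apply: (deriv _ _ (tmx_lieT y)) => g' Tg'.
exact: abT.
Qed.

Lemma lbr_tmx x y : lbr (tm x) (tm y) = 0.
Proof. by rewrite /lbr tmx_comm subrr. Qed.

Lemma glie_lie X : L X -> glie D X.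
Proof.
by move=> LX; exists X, 0; split; [exact: LX|exact: (lie0 cG)|rewrite scaler0 addr0].
Qed.

Lemma complexC (c : R[i]) : c = (complex.Re c)%:C%C + 'i%C * (complex.Im c)%:C%C.
Proof. exact: complexE. Qed.

Lemma sqr_iC : 'i%C * 'i%C = -1 :> R[i].
Proof. by rewrite -expr2 sqr_i. Qed.

Lemma glie_lin (c : R[i]) X Y : glie D X -> glie D Y -> glie D (c *: X + Y).
Proof.
move=> [A [B [LA LB ->]]] [A' [B' [LA' LB' ->]]].
exists ((complex.Re c)%:C%C *: A + (- complex.Im c)%:C%C *: B + A').
exists ((complex.Re c)%:C%C *: B + (complex.Im c)%:C%C *: A + B'); split.
- exact: (lieD cG (lieD cG (lieZ _ LA) (lieZ _ LB)) LA').
- exact: (lieD cG (lieD cG (lieZ _ LB) (lieZ _ LA)) LB').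
rewrite [in LHS](complexC c) rmorphN; set p := (complex.Re c)%:C%C; set q := (complex.Im c)%:C%C.
apply/matrixP => i j; rewrite !mxE.
rewrite [LHS](_ : _ = (p * A i j + ('i%C * 'i%C) * (q * B i j) + A' i j) +
  'i%C * (p * B i j + q * A i j + B' i j)); last by ring.
by rewrite sqr_iC; ring.
Qed.

Lemma glie0 : glie D 0.
Proof. exact: (glie_lie (lie0 cG)). Qed.

Lemma glieZ (c : R[i]) X : glie D X -> glie D (c *: X).
Proof. by move=> gX; rewrite -[_ *: _]addr0; exact: (glie_lin _ gX glie0). Qed.

Lemma glieN X : glie D X -> glie D (- X).
Proof. by move=> gX; rewrite -scaleN1r; exact: (glieZ _ gX). Qed.

Lemma glieD X Y : glie D X -> glie D Y -> glie D (X + Y).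
Proof. by move=> gX gY; rewrite -[X]scale1r; exact: (glie_lin _ gX gY). Qed.

Lemma glie_lbr X Y : glie D X -> glie D Y -> glie D (lbr X Y).
Proof.
move=> [A [B [LA LB ->]]] [A' [B' [LA' LB' ->]]].
rewrite lbrDl !lbrDr !lbrZl !lbrZr.
have g P Q : L P -> L Q -> glie D (lbr P Q) by move=> LP LQ; exact: (glie_lie (lie_lbr cG LP LQ)).
exact: (glieD (glieD (g _ _ LA LA') (glieZ _ (g _ _ LA LB'))) (glieD (glieZ _ (g _ _ LB LA')) (glieZ _ (glieZ _ (g _ _ LB LB'))))).
Qed.

Lemma glie_adj X : glie D X -> glie D (adj X).
Proof.
move=> [A [B [LA LB ->]]].
have sk P : L P -> adj P = - P by move=> LP; exact: (lie_skew cG LP).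
rewrite adjD adj_scale (sk A LA) (sk B LB).
exact: (glieD (glieN (glie_lie LA)) (glieZ _ (glieN (glie_lie LB)))).
Qed.

Lemma tmx_glie x : glie D (tm x). Proof. exact: (glie_lie (tmx_lie x)). Qed.

Lemma lie_decomp0 X Y : L X -> L Y -> X + 'i%C *: Y = 0 -> X = 0 /\ Y = 0.
Proof.
move=> LX LY E; have E' := congr1 adj E.
rewrite adjD adj_scale (lie_skew cG LX : adj X = _) (lie_skew cG LY : adj Y = _) in E'.
have X0 : X = 0.
  apply/matrixP => i j; have := congr1 (fun A : cmx R n => A i j) E.
  have := congr1 (fun A : cmx R n => A i j) E'; rewrite !mxE.
  rewrite (_ : ('i^*)%C = - 'i%C :> R[i]); last by apply/eqP; rewrite eq_complex /= oppr0 !eqxx.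
  rewrite rmorph0 mulrNN => H1 H2.
  have H3 : 2 * X i j = 0.
    by rewrite mulr_natl mulr2n -[RHS](subrr (0:R[i])) -{1}H2 -H1; ring.
  by move/eqP : H3; rewrite mulf_eq0 pnatr_eq0 /= => /eqP.
split=> //; move/eqP : E; rewrite X0 add0r scaler_eq0 => /orP[|/eqP//].
by rewrite eq_complex /= oner_eq0 andbF.
Qed.

(* The zero root space is the complexified torus: here maximality is used. *)
Lemma root_space0 X : root_space D 0 X -> exists x y, X = tm x + 'i%C *: tm y.
Proof.
move=> [[A [B [LA LB ->]]] H].
have c0 h : lbr (tm h) A = 0 /\ lbr (tm h) B = 0.
  apply: lie_decomp0; [exact: (lie_lbr cG (tmx_lie h))|exact: (lie_lbr cG (tmx_lie h))|].
  by rewrite -lbrZr -lbrDr H /ev mul0mx mxE mulr0 scale0r.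
have cen P : L P -> (forall h, lbr (tm h) P = 0) -> exists x, P = tm x.
  move=> LP cP; apply: lieT_tmx; apply: (maximal_torus_centralizer cG mT LP) => Y.
  move=> /lieT_tmx[h ->]; have /eqP := cP h.
  by rewrite /lbr subr_eq0 => /eqP.
have [x ->] := cen A LA (fun h => (c0 h).1).
by have [y ->] := cen B LB (fun h => (c0 h).2); exists x, y.
Qed.

Lemma root_space_lin a (c : R[i]) X Y :
  root_space D a X -> root_space D a Y -> root_space D a (c *: X + Y).
Proof.
move=> [gX HX] [gY HY]; split=> [|h]; first exact: glie_lin.
by rewrite lbrDr lbrZr HX HY scalerDr !scalerA [c * _]mulrC.
Qed.

Lemma evD a b h : ev (a + b) h = ev a h + ev b h.
Proof. by rewrite /ev mulmxDl mxE. Qed.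

Lemma evN a h : ev (- a) h = - ev a h.
Proof. by rewrite /ev mulNmx mxE. Qed.

Lemma evDr a x y : ev a (x + y) = ev a x + ev a y.
Proof. by rewrite /ev mulmxDr mxE. Qed.

Lemma evZr a (c : R) x : ev a (c *: x) = c * ev a x.
Proof. by rewrite /ev -scalemxAr mxE. Qed.

Lemma evNr a x : ev a (- x) = - ev a x.
Proof. by rewrite -scaleN1r evZr mulN1r. Qed.

Lemma evZ a (c : R) x :
 ev (c *: a) x = c * ev a x.
Proof. by rewrite /ev -scalemxAl mxE. Qed.

Lemma root_space_lbr a b X Y :
  root_space D a X -> root_space D b Y -> root_space D (a + b) (lbr X Y).
Proof.
move=> [gX HX] [gY HY]; split=> [|h]; first exact: glie_lbr.
by rewrite jacobi HX HY lbrZl lbrZr -scalerDl -mulrDr evD rmorphD.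
Qed.

Lemma root_space_adj a X : root_space D a X -> root_space D (- a) (adj X).
Proof.
move=> [gX HX]; split=> [|h]; first exact: glie_adj.
have := congr1 adj (HX h); rewrite adj_lbr adj_tmx lbrNl opprK adj_scale => ->.
congr (_ *: _).
by apply/eqP; rewrite eq_complex /= evN; apply/andP; split; apply/eqP; ring.
Qed.

Lemma tmx_root_space0 x : root_space D 0 (tm x).
Proof.
split=> [|h]; first exact: tmx_glie.
by rewrite lbr_tmx /ev mul0mx mxE mulr0 scale0r.
Qed.

End LieStructure.

(** * Root space decomposition *)

Section RootDecomposition.
Context {R : realType} {n r : nat} (D : lie_data R n r).
Hypotheses (cG : compact_group (grp D)) (simpleK : simple_lie (lie (grp D))).
Hypotheses (mT : maximal_torus (grp D) (tor D)) (basT : torus_basis D).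
Implicit Types (a b l : 'rV[R]_r) (x y h : 'cV[R]_r) (X Y Z : cmx R n).

Local Notation L := (lie (grp D)).
Local Notation tm := (tmx D).

Lemma skew_eigen_imag (A : 'M[R[i]]_n) (v : 'rV[R[i]]_n) (c : R[i]) :
  (A ^t*)%sesqui = - A -> v != 0 -> v *m A = c *: v -> complex.Re c = 0.
Proof.
move=> skA v0 vA; pose s : R := \sum_k (complex.Re (v 0 k) ^+ 2 + complex.Im (v 0 k) ^+ 2).
have sE : (v *m (v ^t*)%sesqui) 0 0 = s%:C%C.
  rewrite mxE /s rmorph_sum; apply: eq_bigr => k _; rewrite !mxE; case: (v 0 k) => p q /=.
  by apply/eqP; rewrite eq_complex /=; apply/andP; split; apply/eqP; ring.
have s0 : s != 0.
  apply: contra v0 => /eqP s0; apply/eqP/matrixP => i k; rewrite ord1 mxE; apply/eqP.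
  have h j : 0 <= complex.Re (v 0 j) ^+ 2 + complex.Im (v 0 j) ^+ 2 by rewrite addr_ge0 ?sqr_ge0.
  move/eqP : s0; rewrite psumr_eq0// => /allP /(_ k (mem_index_enum _)) /=.
  by rewrite paddr_eq0 ?sqr_ge0// !sqrf_eq0; case: (v 0 k) => p q /=; rewrite eq_complex.
pose M := v *m A *m (v ^t*)%sesqui.
have ME : M 0 0 = c * s%:C%C by rewrite /M vA -scalemxAl mxE sE.
have : (M ^t*)%sesqui = - M.
  rewrite /M !trmx_mul !map_mxM skA -mulmxA mulNmx mulmxN.
  have -> : (((v ^t*)%sesqui) ^t*)%sesqui = v by apply/matrixP => i j; rewrite !mxE conjCK.
  by rewrite mulmxA.
move/(congr1 (fun A : 'M[R[i]]_1 => A 0 0)); rewrite mxE [in LHS]mxE [in RHS]mxE ME.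
case: c {vA ME} => p q; rewrite /= => /eqP; rewrite eq_complex /= !mulr0 !subr0 => /andP[/eqP H _].
have : 2 * (p * s) = 0 by rewrite mulr_natl mulr2n {1}H addNr.
by move/eqP; rewrite !mulf_eq0 (negbTE s0) pnatr_eq0 orbF /= => /eqP.
Qed.

(** The basis of t consists of commuting skew-hermitian, hence normal, matrices, which have a common
    diagonalization. Their eigenvalues are purely imaginary, which makes the weights [d p] real. *)
Lemma joint_diag : exists2 P : 'M[R[i]]_n, P \in unitmx &
  exists d : 'I_n -> 'rV[R]_r, forall h p q,
    (P *m tm h) p q = ('i%C * (ev (d p) h)%:C%C) * P p q.
Proof.
pose As := [seq (tbasis D j : 'M[R[i]]_n) | j <- enum 'I_r].
have tb j := tbasisE D j.
have sk j : ((tbasis D j) ^t*)%sesqui = - tbasis D j.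
  by have := adj_tmx cG mT basT (\col_i (i == j)%:R); rewrite -tb.
have [] := (codiagonalizableP As).1.
  split.
    move=> _ _ /mapP[j _ ->] /mapP[k _ ->]; rewrite /comm_mx.
    by have := tmx_comm mT basT (\col_i (i == j)%:R) (\col_i (i == k)%:R); rewrite -!tb.
  move=> _ /mapP[j _ ->].
  have nj : (tbasis D j : 'M[R[i]]_n) \is normalmx.
    by apply/normalmxP; rewrite sk mulmxN mulNmx.
  exists (spectralmx (tbasis D j)); first by apply: unitarymx_unit; exact: spectral_unitarymx.
  have uS : spectralmx (tbasis D j) \in unitmx by apply: unitarymx_unit; exact: spectral_unitarymx.
  apply/(similar_diagP _ uS) => i k ik.
  have /orthomx_spectralP E := nj.
  rewrite {2}E !mulmxA mulmxV// mul1mx -mulmxA mulmxV// mulmx1 !mxE.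
  by rewrite -val_eqE (negbTE ik) mulr0n.
move=> P uP /allP HP; exists P => //.
pose c j p := (P *m tbasis D j *m invmx P) p p.
have Pc j p q : (P *m tbasis D j) p q = c j p * P p q.
  have /(similar_diagP _ uP) H := HP (tbasis D j) (map_f _ (mem_enum _ j)).
  rewrite -[P *m tbasis D j](mulmxKV uP) mxE (bigD1 p)//= big1 ?addr0// => k kp.
  by rewrite H ?mul0r// eq_sym.
have cim j p : complex.Re (c j p) = 0.
  apply: (@skew_eigen_imag (tbasis D j) (row p P) (c j p) (sk j)).
    apply/eqP => p0; have := uP; rewrite -row_free_unit => /row_freeP[Q PQ].
    have := congr1 (row p) PQ; rewrite row_mul p0 mul0mx.
    move/matrixP => /(_ 0 p); rewrite !mxE eqxx => /eqP.
    by rewrite eq_sym oner_eq0.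
  by apply/matrixP => i k; rewrite -row_mul !mxE -Pc mxE.
exists (fun p => \row_j complex.Im (c j p)) => h p q.
rewrite /tmx mulmx_sumr summxE.
have -> : ev (\row_j complex.Im (c j p)) h = \sum_j complex.Im (c j p) * h j 0.
  by rewrite /ev mxE; apply: eq_bigr => j _; rewrite mxE.
rewrite rmorph_sum mulr_sumr mulr_suml; apply: eq_bigr => j _.
rewrite -scalemxAr mxE Pc mulrA; congr (_ * _).
have := cim j p; case: (c j p) => x y /= ->.
by apply/eqP; rewrite eq_complex /=; apply/andP; split; apply/eqP; ring.
Qed.

(** In the common eigenbasis the matrix units are eigenvectors of the adjoint action of t, with
    weights [d p - d q]. *)
Lemma glie_decomp_ws : exists ws : seq 'rV[R]_r, [/\ uniq ws,
  forall a X, X != 0 -> root_space D a X -> a \in ws &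
  forall X, glie D X -> exists F : 'rV[R]_r -> cmx R n,
    (forall a, root_space D a (F a)) /\ X = \sum_(a <- ws) F a].
Proof.
have [P uP [d dE]] := joint_diag.
pose w (p : 'I_n * 'I_n) := d p.1 - d p.2.
exists (undup [seq w p | p <- enum {: 'I_n * 'I_n}]).
have lbrP h X p q : (P *m lbr (tm h) X *m invmx P) p q =
    ('i%C * (ev (w (p, q)) h)%:C%C) * (P *m X *m invmx P) p q.
  have dE' h' : P *m tm h' = diag_mx (\row_p ('i%C * (ev (d p) h')%:C%C)) *m P.
    by apply/matrixP => i j; rewrite dE mul_diag_mx !mxE.
  have dI : tm h *m invmx P = invmx P *m diag_mx (\row_p ('i%C * (ev (d p) h)%:C%C)).
    by rewrite -[LHS](mulKmx uP) [P *m (_ *m _)]mulmxA dE' mulmxK.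
  rewrite /lbr mulmxBr mulmxBl !mulmxA dE' -!mulmxA dI !mulmxA.
  rewrite mxE [in X in _ + X]mxE -!mulmxA mul_diag_mx !mulmxA mul_mx_diag !mxE /w /= evD evN rmorphB.
  ring.
split; first exact: undup_uniq.
- move=> a X X0 [gX HX]; rewrite mem_undup.
  pose X' := P *m X *m invmx P.
  have [p [q pq]] : exists p q, X' p q != 0.
    apply: contrapT => H; move/eqP : X0; apply.
    have X'0 : X' = 0.
      by apply/matrixP => p q; rewrite [RHS]mxE; apply: contrapT => /eqP pq; apply: H; exists p, q.
    by rewrite -[X](mulKmx uP) -[P *m X](mulmxKV uP) -/X' X'0 mul0mx mulmx0.
  suff -> : a = w (p, q) by apply: map_f; rewrite mem_enum.
  apply/matrixP => i j; rewrite ord1 {i}.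
  have := lbrP (\col_i (i == j)%:R) X p q; rewrite HX -scalemxAr -scalemxAl mxE.
  move/(mulIf pq).
  have i0 : 'i%C != 0 :> R[i] by rewrite eq_complex /= oner_eq0 andbF.
  move/(mulfI i0)/(congr1 (@complex.Re R)) => /=.
  have evj l : ev l (\col_i (i == j)%:R) = l 0 j.
    by rewrite /ev mxE (bigD1 j)//= big1 => [|k kj]; rewrite mxE ?eqxx ?mulr1 ?addr0// (negbTE kj) mulr0.
  by rewrite !evj.
move=> X gX; pose v (p : 'I_n * 'I_n) : cmx R n :=
  invmx P *m ((P *m X *m invmx P) p.1 p.2 *: delta_mx p.1 p.2) *m P.
have XE : X = \sum_p v p.
  rewrite -[LHS](mulKmx uP) -[P *m X](mulmxKV uP) {1}[P *m X *m invmx P]matrix_sum_delta.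
  rewrite [LHS]mulmxA mulmx_sumr mulmx_suml -(pair_big predT predT (fun p q => v (p, q)))/=.
  by apply: eq_bigr => p _; rewrite mulmx_sumr mulmx_suml.
have vE h p : lbr (tm h) (v p) = ('i%C * (ev (w p) h)%:C%C) *: v p.
  have H : P *m lbr (tm h) (v p) *m invmx P = ('i%C * (ev (w p) h)%:C%C) *: (P *m v p *m invmx P).
    apply/matrixP => i j; rewrite lbrP.
    have -> : P *m v p *m invmx P = (P *m X *m invmx P) p.1 p.2 *: delta_mx p.1 p.2.
      by rewrite /v !mulmxA mulmxV// mul1mx mulmxK.
    move: ((P *m X *m invmx P) p.1 p.2) => x; case: p => p q /=; rewrite !mxE.
    by case: eqP => [->|]; case: eqP => [->|]; rewrite ?mulr0.
  rewrite -[LHS](mulKmx uP) -[P *m lbr _ _](mulmxKV uP) H -scalemxAl -scalemxAr.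
  by rewrite (mulmxKV uP) (mulKmx uP).
exists (fun a => \sum_(p | w p == a) v p); split.
  move=> a; have Fa h : lbr (tm h) (\sum_(p | w p == a) v p) =
      ('i%C * (ev a h)%:C%C) *: \sum_(p | w p == a) v p.
    rewrite (big_morph (lbr (tm h)) (lbrDr (tm h)) (lbr0 (tm h))) scaler_sumr.
    by apply: eq_bigr => p /eqP <-; exact: vE.
  split=> [|h]; last exact: Fa.
  have i0 : 'i%C != 0 :> R[i] by rewrite eq_complex /= oner_eq0 andbF.
  (* The weight components of [X] are so far only in the full matrix algebra. Since [glie] is stable
     under t, each of them lies in it. *)
  refine (@eigen_split _ _ 'cV[R]_r (fun h => lbr (tm h)) (glie D) _ _ _ _
    [seq p <- index_enum _ | w p != a] v (fun p h => 'i%C * (ev (w p) h)%:C%C) _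
    (fun h => 'i%C * (ev a h)%:C%C) (glie0 cG) Fa _ _ _).
  - by move=> h c Y Z; rewrite lbrDr lbrZr.
  - by move=> c Y Z gY gZ; exact: (glie_lin cG c gY gZ).
  - by move=> h Y gY; exact: (glie_lbr cG (tmx_glie cG mT basT h) gY).
  - by move=> p _ h; exact: vE.
  - move=> p; rewrite mem_filter => /andP[wpa _].
    apply: contrapT => H; move/negP : wpa; apply; apply/eqP/matrixP => i j; rewrite ord1 {i}.
    have evj l : ev l (\col_i (i == j)%:R) = l 0 j.
      by rewrite /ev mxE (bigD1 j)//= big1 => [|k kj]; rewrite mxE ?eqxx ?mulr1 ?addr0// (negbTE kj) mulr0.
    apply: contrapT => wj; apply: H; exists (\col_i (i == j)%:R); rewrite !evj.
    by apply/eqP => /(mulfI i0)/(congr1 (@complex.Re R)).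
  - by have E := XE; rewrite (bigID (fun p => w p == a)) /= in E; rewrite big_filter -E.
rewrite {1}XE (exchange_big_dep xpredT)//=; apply: eq_bigr => p _.
rewrite -big_filter (@perm_big _ _ _ _ [seq x <- _ | _] [:: w p]).
  by rewrite big_seq1.
apply: uniq_perm => //; first by rewrite filter_uniq// undup_uniq.
move=> b; rewrite mem_filter inE [b == _]eq_sym.
apply/andP/eqP => [[/eqP/val_inj ->//]|<-]; split=> //; rewrite mem_undup.
by apply/mapP; exists p; rewrite ?mem_enum.
Qed.

End RootDecomposition.

(** * The trace form on the torus, coroots and sl2-triples of roots *)

Section RootForm.
Context {R : realType} {n r : nat} (D : lie_data R n r).
Hypotheses (cG : compact_group (grp D)) (simpleK : simple_lie (lie (grp D))).
Hypotheses (mT : maximal_torus (grp D) (tor D)) (basT : torus_basis D).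
Implicit Types (a b l : 'rV[R]_r) (x y h : 'cV[R]_r) (X Y Z : cmx R n).

Local Notation L := (lie (grp D)).
Local Notation tm := (tmx D).

Definition gram : 'M[R]_r := \matrix_(j, k) - retr (tbasis D j *m tbasis D k).

Definition gt x y : R := - retr (tm x *m tm y).

Lemma retr_sum (I : Type) (s : seq I) (F : I -> cmx R n) :
  retr (\sum_(i <- s) F i) = \sum_(i <- s) retr (F i).
Proof. by apply: (big_morph retr); [exact: retrD|rewrite /retr mxtrace0]. Qed.

Lemma gt_gram x y : gt x y = ev (x^T *m gram) y.
Proof.
rewrite /gt /ev /tmx mulmx_suml retr_sum mxE.
under [in RHS]eq_bigr => k _ do rewrite mxE mulr_suml.
rewrite exchange_big /= -sumrN; apply: eq_bigr => i _.
rewrite mulmx_sumr retr_sum -sumrN; apply: eq_bigr => k _.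
by rewrite !mxE -scalemxAl -scalemxAr !retrZ; ring.
Qed.

Lemma tr_tmx x y : \tr (tm x *m tm y) = - (gt x y)%:C%C.
Proof.
have E : (\tr (tm x *m tm y))^*%C = \tr (tm x *m tm y).
  have <- := tr_adj (tm x *m tm y); rewrite adjM !(adj_tmx cG mT basT) mulmxN mulNmx opprK.
  by rewrite (tmx_comm mT basT).
rewrite /gt rmorphN opprK /retr; case: (\tr _) E => p q /= [] /eqP.
by rewrite eq_sym -subr_eq0 opprK -mulr2n mulrn_eq0 /= => /eqP ->.
Qed.

Lemma gtC x y : gt x y = gt y x.
Proof. by rewrite /gt (tmx_comm mT basT). Qed.

Lemma gtxx x : gt x x = frob (tm x).
Proof.
rewrite /gt -frob_retr -/(adj _) (adj_tmx cG mT basT) mulmxN retrN; by [].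
Qed.

Lemma frob_ge0 X : 0 <= frob X.
Proof. by apply: sumr_ge0 => i _; apply: sumr_ge0 => j _; rewrite addr_ge0 ?sqr_ge0. Qed.

Lemma frob_gt0 X : X != 0 -> 0 < frob X.
Proof.
by move=> X0; rewrite lt_neqAle frob_ge0 andbT eq_sym; apply: contra X0 => /eqP/frob_eq0 ->.
Qed.

Lemma gt_ge0 x : 0 <= gt x x. Proof. by rewrite gtxx frob_ge0. Qed.

Lemma gt_eq0 x : gt x x = 0 -> x = 0.
Proof. by rewrite gtxx => /frob_eq0 /(tmx_inj basT). Qed.

Lemma gram_unit : gram \in unitmx.
Proof.
rewrite -row_free_unit; apply: inj_row_free => v vG.
have := gt_eq0 (x := v^T); rewrite gt_gram trmxK vG /ev mul0mx mxE => /(_ erefl).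
by move/(congr1 trmx); rewrite trmxK trmx0.
Qed.

(** The vector of t that represents the form [a] for the trace form [gt]. *)
Definition dv a : 'cV[R]_r := (a *m invmx gram)^T.

Lemma gt_dv a y : gt (dv a) y = ev a y.
Proof. by rewrite gt_gram /dv trmxK mulmxKV// gram_unit. Qed.

Lemma gtZr (c : R) x y : gt x (c *: y) = c * gt x y.
Proof. by rewrite !gt_gram evZr. Qed.

Lemma gt_inj x y
 : (forall h, gt h x = gt h y) -> x = y.
Proof.
move=> H; apply/eqP; rewrite -subr_eq0; apply/eqP/gt_eq0.
have := H (x - y); rewrite !gt_gram evDr => ->.
by rewrite -scaleN1r evZr mulN1r subrr.
Qed.

Lemma dvD a b : dv (a + b) = dv a + dv b.
Proof. by rewrite /dv mulmxDl raddfD. Qed.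

Lemma dvZ (c : R) a : dv (c *: a) = c *: dv a.
Proof. by rewrite /dv -scalemxAl linearZ. Qed.

Lemma dvN a : dv (- a) = - dv a.
Proof. by rewrite -scaleN1r dvZ scaleN1r. Qed.

(** The trace form transported to the dual of t. The root system, the Weyl group and the Casimir
    operator are handled with it; the inner product of the data enters later, with [nu]. *)
Definition rq a b : R := ev a (dv b).

Lemma rqC a b : rq a b = rq b a.
Proof. by rewrite /rq -!gt_dv gtC. Qed.

Lemma rqDl a b c : rq (a + b) c = rq a c + rq b c. Proof. exact: evD. Qed.
Lemma rqZl (k : R) a b : rq (k *: a) b = k * rq a b. Proof. exact: evZ. Qed.
Lemma rqNl a b : rq (- a) b = - rq a b. Proof. exact: evN. Qed.
Lemma rqDr a b c : rq c (a + b) = rq c a + rq c b. Proof. by rewrite !(rqC c) rqDl. Qed.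
Lemma rqZr (k : R) a b : rq b (k *: a) = k * rq b a. Proof. by rewrite !(rqC b) rqZl. Qed.
Lemma rqNr a b : rq a (- b) = - rq a b. Proof. by rewrite !(rqC a) rqNl. Qed.

Lemma rq_ge0 a : 0 <= rq a a.
Proof. by rewrite /rq -gt_dv gt_ge0. Qed.

Lemma rq_eq0 a : rq a a = 0 -> a = 0.
Proof.
rewrite /rq -gt_dv => /gt_eq0 /(congr1 trmx); rewrite /dv trmxK trmx0 => E.
by rewrite -[a](mulmxKV gram_unit) E mul0mx.
Qed.

Lemma rq_gt0 a : a != 0 -> 0 < rq a a.
Proof.
by move=> a0; rewrite lt_neqAle rq_ge0 andbT eq_sym; apply: contra a0 => /eqP/rq_eq0 ->.
Qed.

(** The bracket has weight 0, so it lies in the complexified torus. Invariance of the trace gives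
    its pairing with every [tm h], which identifies it. *)
Lemma root_bracket a X Y : root_space D a X -> root_space D (- a) Y ->
  lbr X Y = (- 'i%C * \tr (X *m Y)) *: tm (dv a).
Proof.
move=> aX aY; have := root_space_lbr cG aX aY; rewrite subrr => Z0.
have [x [y E]] := root_space0 cG mT basT Z0.
set t := \tr (X *m Y); pose p := complex.Re t; pose q := complex.Im t.
have H h : - (gt h x)%:C%C + 'i%C * - (gt h y)%:C%C = 'i%C * (ev a h)%:C%C * t.
  have <- : \tr (tm h *m (tm x + 'i%C *: tm y)) = - (gt h x)%:C%C + 'i%C * - (gt h y)%:C%C.
    by rewrite mulmxDr mxtraceD -scalemxAr mxtraceZ !tr_tmx.
  rewrite -E -tr_lbr.
  by case: aX => _ ->; rewrite -scalemxAl mxtraceZ.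
have [xE yE] : x = q *: dv a /\ y = (- p) *: dv a.
  suff H' h : gt h x = q * ev a h /\ gt h y = - p * ev a h.
    by split; apply: gt_inj => h; rewrite gtZr [gt h (dv a)]gtC gt_dv; case: (H' h).
  move: (H h) => /eqP; rewrite eq_complex /p /q; case: t {E H p q} => p q /= /andP[/eqP H1 /eqP H2].
  move: H1 H2; rewrite !(mul0r, mul1r, mulr0, subr0, sub0r, add0r, addr0, oppr0).
  by move=> H1 H2; split; lra.

rewrite E xE yE !tmxZ scalerA -scalerDl; congr (_ *: _).
rewrite /p /q; case: t {E H xE yE p q} => p q /=.
by apply/eqP; rewrite eq_complex /=; apply/andP; split; apply/eqP; ring.
Qed.

Lemma root_neq0 a : is_root D a -> a != 0. Proof. by case. Qed.

(** By [root_bracket] every candidate for the choice is a multiple of [dv a], and the value 2 on [a]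
    fixes the multiple. A candidate exists: pair a root vector with a multiple of its adjoint. *)
Lemma coroot_dv a : is_root D a -> coroot D a = (2 / rq a a) *: dv a.
Proof.
move=> [a0 [X X0 aX]]; have Q0 := rq_gt0 a0; have F0 := frob_gt0 X0.
rewrite /coroot; case: xgetP => [h _ [h2 [Y [Z [aY aZ hE]]]]|].
  rewrite (root_bracket aY aZ) in hE; set t := \tr _ in hE.
  have [hq _] : tm (h - complex.Im t *: dv a) = 0 /\ tm (complex.Re t *: dv a) = 0.
    apply: (lie_decomp0 cG (tmx_lie mT basT _) (tmx_lie mT basT _)).
    rewrite tmxD tmxN hE !tmxZ scalerA -scaleNr -!scalerDl.
    rewrite (_ : _ + _ = 0) ?scale0r//; case: t {hE} => p q /=.
    by apply/eqP; rewrite eq_complex /=; apply/andP; split; apply/eqP; ring.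
  move/(tmx_inj basT)/eqP : hq; rewrite subr_eq0 => /eqP hq.
  move: h2; rewrite hq evZr -/(rq a a) => <-.
  by rewrite mulfK// gt_eqF.
move=> /(_ ((2 / rq a a) *: dv a)) []; split.
  by rewrite evZr -/(rq a a) divfK// gt_eqF.
exists X, (('i%C * (2 / rq a a / frob X)%:C%C) *: adj X); split=> //.
  have := root_space_adj cG mT basT aX => aX'.
  have := root_space_lin cG ('i%C * (2 / rq a a / frob X)%:C%C - 1) aX' aX'.
  by rewrite scalerBl scale1r subrK.
rewrite lbrZr (root_bracket aX (root_space_adj cG mT basT aX)) tr_frob scalerA tmxZ; congr (_ *: _).
set u := ((2 / rq a a / frob X)%:C)%C; set w := ((frob X)%:C)%C.
rewrite [RHS](_ : _ = - ('i%C * 'i%C) * (u * w)); last by rewrite mulrA; ring.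
rewrite /u /w.

by rewrite sqr_iC opprK mul1r -rmorphM divfK// gt_eqF.
Qed.

Lemma root_opp a : is_root D a -> is_root D (- a).
Proof.
move=> [a0 [X X0 aX]]; split; first by rewrite oppr_eq0.
exists (adj X); last exact: (root_space_adj cG mT basT aX).
by apply: contra X0 => /eqP X0; rewrite -[X]adjK X0; apply/eqP/matrixP => i j; rewrite !mxE rmorph0.
Qed.

Lemma corootN a : is_root D a -> coroot D (- a) = - coroot D a.
Proof.
move=> ra; rewrite !coroot_dv//; last exact: root_opp.
by rewrite rqNl rqNr opprK dvN scalerN.
Qed.

Lemma ev_coroot a b : is_root D a -> ev b (coroot D a) = 2 * rq b a / rq a a.
Proof. by move=> ra; rewrite coroot_dv// evZr /rq mulrAC. Qed.

Lemma ev_coroot_self a : is_root D a -> ev a (coroot D a) = 2.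
Proof. by move=> ra; rewrite ev_coroot// mulfK// gt_eqF// rq_gt0// root_neq0. Qed.

(** That [f] is a positive multiple of the adjoint of [e] is recorded for later: it gives [e] and
    [f] a nonzero trace pairing, and it yields elements of the real Lie algebra. *)
Lemma root_sl2 a : is_root D a -> exists e, exists c : R, exists f : cmx R n,
  [/\ e != 0, 0 < c, f = c%:C%C *: adj e, root_space D a e /\ root_space D (- a) f &
      lbr e f = (- 'i%C) *: tm (coroot D a)].
Proof.
move=> ra; have [a0 [X X0 aX]] := ra; have Q0 := rq_gt0 a0; have F0 := frob_gt0 X0.
have c0 : 0 < 2 / (rq a a * frob X) by rewrite divr_gt0// mulr_gt0.
have aX' := root_space_adj cG mT basT aX.
exists X, (2 / (rq a a * frob X)), ((2 / (rq a a * frob X))%:C%C *: adj X); split=> //.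
  split=> //; have := root_space_lin
 cG ((2 / (rq a a * frob X))%:C%C - 1) aX' aX'.
  by rewrite scalerBl scale1r subrK.
rewrite lbrZr (root_bracket aX aX') tr_frob scalerA coroot_dv// tmxZ scalerA.
rewrite mulrCA -rmorphM; congr ((_ * _%:C%C) *: _).
by field; rewrite !gt_eqF.
Qed.

End RootForm.

(** * Weight vectors in a module over the complexified Lie algebra *)

Section Modules.
Context {R : realType} {n r : nat} (D : lie_data R n r).
Hypotheses (cG : compact_group (grp D)) (simpleK : simple_lie (lie (grp D))).
Hypotheses (mT : maximal_torus (grp D) (tor D)) (basT : torus_basis D).
Implicit Types (a b l : 'rV[R]_r) (x y h : 'cV[R]_r) (X Y Z : cmx R n).

Local Notation tm := (tmx D).

Context {W : vectType R[i]}.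
Variable act : cmx R n -> W -> W.

(** The action is a bare function so that the adjoint, the defining and the highest weight
    representations are all instances. *)
Definition is_module : Prop :=
  [/\ forall (c : R[i]) X Y v, act (c *: X + Y) v = c *: act X v + act Y v,
      forall X (c : R[i]) u v, act X (c *: u + v) = c *: act X u + act X v &
      forall X Y v, glie D X -> glie D Y ->
        act (lbr X Y) v = act X (act Y v) - act Y (act X v)].

Hypothesis modW : is_module.

Definition wtv b (v : W) : Prop :=
  forall h, act (tm h) v = ('i%C * (ev b h)%:C%C) *: v.

Lemma act_linr X (c : R[i]) u v : act X (c *: u + v) = c *: act X u + act X v.
Proof. by case: modW. Qed.

Lemma act_0r X : act X 0 = 0. Proof. exact: linear0' (act_linr X). Qed.
Lemma act_Zr X (c : R[i]) v : act X (c *: v) = c *: act X v.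
Proof. exact: linearZ' (act_linr X) c v. Qed.

Lemma act_D X Y v : act (X + Y) v = act X v + act Y v.
Proof. by case: modW => /(_ 1 X Y v); rewrite !scale1r. Qed.

Lemma act_0 v : act 0 v = 0.
Proof. by have := act_D 0 0 v; rewrite addr0 => /eqP; rewrite addrC -subr_eq subrr eq_sym => /eqP. Qed.

Lemma act_Z (c : R[i]) X v : act (c *: X) v = c *: act X v.
Proof. by case: modW => /(_ c X 0 v); rewrite act_0 !addr0. Qed.

Lemma act_lbr X Y v : glie D X -> glie D Y ->
  act X (act Y v) = act Y (act X v) + act (lbr X Y) v.
Proof. by move=> gX gY; case: modW => _ _ ->//; rewrite addrC subrK. Qed.

Lemma wtv_root b a X v : root_space D a X -> wtv b v -> wtv (b + a) (act X v).
Proof.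
move=> [gX HX] bv h; rewrite act_lbr//; last exact: (tmx_glie cG mT basT).
by rewrite bv HX act_Zr act_Z -scalerDl -mulrDr evD rmorphD.
Qed.

Lemma wtv_iter b a X v k : root_space D a X -> wtv b v -> wtv (b + k%:R *: a) (iter k (act X) v).
Proof.
move=> aX bv; elim: k => [|k IH]; first by rewrite scale0r addr0.
by rewrite -natr1 scalerDl scale1r addrA; exact: wtv_root.
Qed.

Variables (a : 'rV[R]_r) (e f : cmx R n).
Hypotheses (ra : is_root D a) (ae : root_space D a e) (af : root_space D (- a) f).
Hypothesis ef : lbr e f = (- 'i%C) *: tm (coroot D a).

Let H0 : W -> W := act (lbr e f).

Let H0E v : H0 v = (- 'i%C) *: act (tm (coroot D a)) v.
Proof. by rewrite /H0 ef act_Z. Qed.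

Let ge : glie D e. Proof. by case: ae. Qed.
Let gf : glie D f. Proof. by case: af. Qed.
Let gef : glie D (lbr e f). Proof. exact: (glie_lbr cG ge gf). Qed.

Lemma negi_i (k : R[i]) : - 'i%C * ('i%C * k) = k.
Proof. by rewrite mulrA mulNr sqr_iC opprK mul1r. Qed.

Let lbr_he : lbr (lbr e f) e = 2 *: e.
Proof.
rewrite ef lbrZl; case: ae => _ ->; rewrite scalerA negi_i ev_coroot_self//.
by rewrite -(rmorph_nat (real_complex R) 2).
Qed.

Let lbr_hf : lbr (lbr e f) f = (- 2) *: f.
Proof.
rewrite ef lbrZl; case: af => _ ->; rewrite scalerA negi_i evN ev_coroot_self//.
by rewrite -(rmorph_nat (real_complex R) 2) -rmorphN.
Qed.

Let HE v : H0 (act e v) = act e (H0 v) + 2 *: act e v.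
Proof. by rewrite /H0 act_lbr// lbr_he act_Z. Qed.

Let HF v : H0 (act f v) = act f (H0 v) - 2 *: act f v.
Proof. by rewrite /H0 act_lbr// lbr_hf act_Z scaleNr. Qed.

Let EF v : act e (act f v) = act f (act e v) + H0 v.
Proof. exact: act_lbr. Qed.

Lemma wtv_H b v : wtv b v -> H0 v = (ev b (coroot D a))%:C%C *: v.
Proof. by move=> bv; rewrite H0E bv scalerA negi_i. Qed.

Lemma wtv_integral b v : v != 0 -> wtv b v -> exists z : int, ev b (coroot D a) = z%:~R.
Proof.
move=> v0 /wtv_H bv.
have [z zE] := sl2_integral (act_linr e) (act_linr f) (act_linr (lbr e f)) HE HF EF v0 bv.
by exists z; move/(congr1 (@complex.Re R)) : zE; rewrite /= -(rmorph_int (real_complex R)).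
Qed.

Lemma wtv_F_inj b v (m : nat) : wtv b v -> ev b (coroot D a) = m%:R ->
  iter m (act f) v = 0 -> v = 0.
Proof.
move=> /wtv_H bv bm; apply: (sl2_F_inj (act_linr e) (act_linr f) (act_linr (lbr e f)) HE HF EF).
by rewrite -/(H0 v) bv bm rmorph_nat.

Qed.

End Modules.

(** * Coroots, reflections and weights of representations *)

Section RootSystem.
Context {R : realType} {n r : nat} (D : lie_data R n r).
Hypotheses (cG : compact_group (grp D)) (simpleK : simple_lie (lie (grp D))).
Hypotheses (mT : maximal_torus (grp D) (tor D)) (basT : torus_basis D).
Implicit Types (a b l : 'rV[R]_r) (x y h : 'cV[R]_r) (X Y Z : cmx R n).

Local Notation L := (lie (grp D)).
Local Notation tm := (tmx D).
Local Notation cor := (coroot D).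

Lemma adjoint_module : is_module (W := cmx R n) D (@lbr R n).
Proof.
split.
- by move=> c X Y v; rewrite lbrDl lbrZl.
- by move=> X c u v; rewrite lbrDr lbrZr.
- by move=> X Y v _ _; rewrite [in RHS]jacobi addrK.
Qed.

Lemma root_space_iter a b X Y k : root_space D a X -> root_space D b Y ->
  root_space D (b + k%:R *: a) (iter k (lbr X) Y).
Proof.
move=> aX bY; elim: k => [|k IH]; first by rewrite scale0r addr0.
rewrite -natr1 scalerDl scale1r addrA [_ + a]addrC iterS.
exact: (root_space_lbr cG aX IH).
Qed.

Lemma root_integral a b : is_root D a -> is_root D b -> exists z : int, ev b (cor a) = z%:~R.
Proof.
move=> ra [_ [X X0 [gX bX]]].
have [e [c [f [_ _ _ [ae af] ef]]]] := root_sl2 cG mT basT ra.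
exact: (wtv_integral cG mT basT adjoint_module ra ae af ef X0 bX).
Qed.

Definition refl a b := b - ev b (cor a) *: a.

Lemma refl_neq0 a b : is_root D a -> b != 0 -> refl a b != 0.
Proof.
move=> ra; apply: contra; rewrite /refl subr_eq0 => /eqP E.
have E2 : ev b (cor a) = ev b (cor a) * 2 by rewrite {1}E evZ (ev_coroot_self cG mT basT ra).
have c0 : ev b (cor a) = 0 by lra.
by rewrite E c0 scale0r.
Qed.

(** Replacing [a] by [-a] does not change the reflection, so the pairing may be taken to be a
    natural number [m]. Then the [m]-th power of the lowering vector is injective on the root space
    of [b] and maps it into that of the reflected root. *)
Lemma root_refl a b : is_root D a -> is_root D b -> is_root D (refl a b).
Proof.
wlog pos : a / 0 <= ev b (cor a) => [H ra rb|].
  have [p|/ltW p] := leP 0 (ev b (cor a)); first exact: H.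
  have ra' := root_opp cG mT basT ra.
  have -> : refl a b = refl (- a) b.
    by rewrite /refl (corootN cG mT basT ra) evNr scaleNr scalerN opprK.
  by apply: H => //; rewrite (corootN cG mT basT ra) evNr oppr_ge0.

move=> ra rb; split; first exact: refl_neq0 ra (root_neq0 rb).
have [z zE] := root_integral ra rb.
have [m mE] : exists m : nat, ev b (cor a) = m%:R.
  by case: z zE => [m|m] E; [exists m|move: pos; rewrite E NegzE mulrNz oppr_ge0 -pmulrn lern0].
case: rb => _ [X X0 bX].
have [e [c [f [_ _ _ [ae af] ef]]]] := root_sl2 cG mT basT ra.
have := root_space_iter m af bX; rewrite scalerN -mE -/(refl a b) => H.
exists (iter m (lbr f) X) => //; apply/eqP => E.
case: bX => gX bX; move/eqP : X0; apply.
exact: (wtv_F_inj cG mT basT adjoint_module ra ae af ef bX mE E).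
Qed.

Lemma lbr_self X : lbr X X = 0. Proof. by rewrite /lbr subrr. Qed.

(** Subtract from [Z] the multiple of [e] that makes the trace with [f] vanish. By [root_bracket]
    the rest is killed by [f]; since its weight is 2, the square of [f] is injective on it. *)
Lemma root_dim1 a X Y : is_root D a -> X != 0 -> root_space D a X -> root_space D a Y ->
  exists k : R[i], Y = k *: X.
Proof.
move=> ra X0 aX aY.
have [e [c [f [e0 c0 fE [ae af] ef]]]] := root_sl2 cG mT basT ra.
have tef : \tr (e *m f) != 0.
  rewrite fE -scalemxAr mxtraceZ tr_frob -rmorphM eq_complex /= eqxx andbT.
  by rewrite mulf_neq0// gt_eqF// frob_gt0.
have dim Z : root_space D a Z -> exists k : R[i], Z = k *: e.
  move=> aZ; pose k := \tr (Z *m f) / \tr (e *m f); exists k.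
  have aZ' : root_space D a (- k *: e + Z) by exact: (root_space_lin cG (- k) ae aZ).
  have Z0 : lbr f (- k *: e + Z) = 0.
    have T0 : \tr ((- k *: e + Z) *m f) = 0.
      by rewrite mulmxDl -scalemxAl mxtraceD mxtraceZ mulNr /k divfK// addNr.
    by rewrite lbrC (root_bracket cG mT basT aZ' af) T0 mulr0 scale0r oppr0.
  have : - k *: e + Z = 0.
    apply: (wtv_F_inj (m := 2) cG mT basT adjoint_module ra ae af ef aZ'.2).
      exact: (ev_coroot_self cG mT basT ra).
    by rewrite /= Z0 lbr0.
  by rewrite scaleNr addrC => /eqP; rewrite subr_eq0 => /eqP.
have [k kE] := dim X aX; have [l lE] := dim Y aY.
have k0 : k != 0 by apply: contra X0 => /eqP k0; rewrite kE k0 scale0r.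
by exists (l / k); rewrite kE scalerA divfK.
Qed.

(** Lowering a vector of root [2a] gives a multiple of [e], then of the coroot, then of [f], then 0.
    But the weight is 4, so four lowerings are injective. *)
Lemma root_double a : is_root D a -> ~ is_root D (2 *: a).
Proof.
move=> ra [_ [X X0 aX]].
have [e [c [f [e0 c0 fE [ae af] ef]]]] := root_sl2 cG mT basT ra.
have fX : root_space D a (lbr f X).
  have := root_space_lbr cG af aX; congr (root_space D _ _).
  by rewrite -[2]/(1 + 1) scalerDl scale1r addrA addNr add0r.
have [k kE] := root_dim1 ra e0 ae fX.
have E : iter 4 (lbr f) X = 0.
  rewrite /= kE !lbrZr [lbr f e]lbrC ef -scaleNr opprK !lbrZr [lbr f (tm _)]lbrC.
  by case: af => _ ->; rewrite -scaleNr lbrZr lbr_self !scaler0.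
move/eqP : X0; apply; apply: (wtv_F_inj (m := 4) cG mT basT adjoint_module ra ae af ef aX.2) => //.
by rewrite evZ (ev_coroot_self cG mT basT ra) -natrM.
Qed.

(** A vector on which all roots vanish is central. The centre is an ideal, and it is not everything
    because some bracket is nonzero. This is where simplicity enters. *)
Lemma roots_separate h : (forall a, is_root D a -> ev a h = 0) -> h = 0.
Proof.
move=> H; apply: (tmx_inj basT).
have [ws [_ _ dec]] := glie_decomp_ws cG mT basT.
have central Y : glie D Y -> lbr (tm h) Y = 0.
  move=> /dec[F [FE ->]]; rewrite (big_morph (lbr (tm h)) (lbrDr (tm h)) (lbr0 (tm h))) big1// => a _.
  have [gF FF] := FE a; have [F0|F0] := eqVneq (F a) 0; first by rewrite F0 lbr0.
  rewrite FF; have [->|a0] := eqVneq a 0; first by rewrite /ev mul0mx mxE mulr0 scale0r.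
  by rewrite (H a); [rewrite mulr0 scale0r|split=> //; exists (F a)].
pose I : set (cmx R n) := [set X | L X /\ forall Y, glie D Y -> lbr X Y = 0].
case: simpleK => -[X [Y [LX LY XY]]] /(_ I) [].
- split; first by move=> Z [].
  + split; first by split; [exact: (lie0 cG)|move=> Z _; rewrite lbrC lbr0 oppr0].
    move=> c A B [LA A0] [LB B0]; split; first exact: (lieD cG (lieZ c LA) LB).
    by move=> Z gZ; rewrite lbrDl lbrZl A0// B0// scaler0 addr0.
  + move=> A B LA [LB B0]; split; first exact: (lie_lbr cG LA LB).
    have gA := glie_lie cG LA; have AB : lbr A B = 0 by rewrite lbrC B0// oppr0.
    by move=> Z _; rewrite AB lbrC lbr0 oppr0.
- move=> I0; have : I (tm h) by split; [exact: (tmx_lie mT basT)|exact: central].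
  by rewrite I0.
- move=> IL; have : I X by rewrite IL.
  by case=> _ /(_ Y (glie_lie cG LY)) E; move: XY; rewrite E eqxx.
Qed.

End RootSystem.

(** * Exponentials of torus elements, and root reflections as conjugations *)

Section TorusExp.
Context {R : realType}.

Definition cis (x : R) : R[i] := (cos x +i* sin x)%C.

Lemma cisD x y : cis (x + y) = cis x * cis y.
Proof. by apply/eqP; rewrite eq_complex /= cosD sinD; apply/andP; split; apply/eqP; ring. Qed.

Lemma cis0 : cis 0 = 1. Proof. by rewrite /cis cos0 sin0. Qed.

Lemma mexp_scalar n (x : R) :
  mexp (('i%C * x%:C%C)%:M : cmx R n) = (cis x)%:M.
Proof.
apply: mexp_lim; apply/cvg_mN.
have termE k : ifact k * ('i%C * x%:C%C) ^+ k = (cos_coeff x k +i* sin_coeff x k)%C.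
  rewrite /ifact /cos_coeff /sin_coeff /= -exprnP exprMn -rmorphXn.

  have -> : ('i%C : R[i]) ^+ k = (((~~ odd k)%:R * (-1) ^+ k./2) +i* ((odd k)%:R * (-1) ^+ k.-1./2))%C.
    have i2 m : ('i%C : R[i]) ^+ m.*2 = ((-1) ^+ m)%:C%C.
      by rewrite -mul2n exprM sqr_i rmorphXn rmorphN rmorph1.
    rewrite -{1}[k]odd_double_half; case: (boolP (odd k)) => ok.
      rewrite add1n exprS i2 (_ : k.-1./2 = k./2); last first.
        by rewrite -{1}[k]odd_double_half ok add1n /= doubleK.
      by apply/eqP; rewrite eq_complex /=; apply/andP; split; apply/eqP; ring.
    rewrite add0n i2.
    by apply/eqP; rewrite eq_complex /=; apply/andP; split; apply/eqP; ring.
  rewrite -(rmorph_nat (real_complex R)) -fmorphV.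
  by apply/eqP; rewrite eq_complex /=; apply/andP; split; apply/eqP; ring.
have scX (c : R[i]) k : (c%:M : cmx R n) ^+ k = (c ^+ k)%:M.
  elim: k => [|k IH]; first by rewrite !expr0.
  by rewrite !exprS IH -mulmxE -scalar_mxM.
have serE m : series (mterm ('i%C * x%:C%C)%:M) m =
    ((series (cos_coeff x) m +i* series (sin_coeff x) m)%C)%:M :> cmx R n.
  rewrite /series /=; elim: m => [|m IH].
    by rewrite !big_geq//; apply/matrixP => i j; rewrite !mxE mul0rn.
  rewrite !big_nat_recr//= IH /mterm scX scale_scalar_mx termE -raddfD /=; congr (_%:M).

have H1 : (fun m => `|series (cos_coeff x) m - cos x|) @ \oo --> (0 : R).
  have H : (fun m => series (cos_coeff x) m - cos x) @ \oo --> (0 : R).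
    by apply/subr_cvg0; rewrite unlock; exact: is_cvg_series_cos_coeff.
  by have H2 := cvg_norm H; rewrite normr0 in H2; exact: H2.
have H2 : (fun m => `|series (sin_coeff x) m - sin x|) @ \oo --> (0 : R).
  have H : (fun m => series (sin_coeff x) m - sin x) @ \oo --> (0 : R).
    by apply/subr_cvg0; rewrite unlock; exact: is_cvg_series_sin_coeff.
  by have H2 := cvg_norm H; rewrite normr0 in H2; exact: H2.
have H3 := cvgM (@rcvgc R n%:R) (cvgD H1 H2); rewrite addr0 mulr0 in H3.
apply: (cvg_ext (H3 _ _)) => m /=; rewrite serE
 -raddfB /= /mN.
rewrite (eq_bigr (fun=> `|series (cos_coeff x) m - cos x| + `|series (sin_coeff x) m - sin x|)).
  by rewrite sumr_const card_ord mulr_natl.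
move=> i _; rewrite (bigD1 i)//= big1 ?addr0 => [|j ji].
  by rewrite mxE eqxx mulr1n.
by rewrite mxE eq_sym (negbTE ji) mulr0n nc0.
Qed.

End TorusExp.

Section ExpEigen.
Context {R : realType} {n r : nat} (D : lie_data R n r).
Hypotheses (cG : compact_group (grp D)) (simpleK : simple_lie (lie (grp D))).
Hypotheses (mT : maximal_torus (grp D) (tor D)) (basT : torus_basis D).
Implicit Types (a b l : 'rV[R]_r) (x y h : 'cV[R]_r) (X Y Z : cmx R n).

Local Notation L := (lie (grp D)).
Local Notation tm := (tmx D).
Local Notation cor := (coroot D).

Lemma mexp_eigen X Z (t : R) : X *m Z = ('i%C * t%:C%C) *: Z -> mexp X *m Z = cis t *: Z.
Proof.
rewrite -mul_mx_scalar => /mexp_intertwine ->.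
by rewrite mexp_scalar mul_mx_scalar.
Qed.

Lemma mexp_eigen_comm X Z (t : R) : X *m Z = Z *m X + ('i%C * t%:C%C) *: Z ->
  mexp X *m Z = cis t *: (Z *m mexp X).
Proof.
rewrite -mul_mx_scalar -mulmxDr => /mexp_intertwine ->.
rewrite mexpD; last by rewrite scalar_mxC.
by rewrite mexp_scalar mulmxA mul_mx_scalar.
Qed.

Lemma defining_module : is_module (W := 'cV[R[i]]_n) D (fun X v => X *m v).
Proof.
split.
- by move=> c X Y v; rewrite mulmxDl scalemxAl.
- by move=> X c u v; rewrite mulmxDr scalemxAr.
- by move=> X Y v _ _; rewrite /lbr mulmxBl !mulmxA.
Qed.

(** The weights of the defining representation are integers on a coroot, so its exponential fixes a
    common eigenbasis. This puts integral forms on [Lambda] into the weight lattice. *)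
Lemma coroot_Lambda a : is_root D a -> Lambda D (cor a).
Proof.
move=> ra; have [P uP [d dE]] := joint_diag cG mT basT.
have [e [c [f [e0 c0 fE [ae af] ef]]]] := root_sl2 cG mT basT ra.
have PiE h : tm h *m invmx P = invmx P *m diag_mx (\row_p ('i%C * (ev (d p) h)%:C%C)).
  have dE' : P *m tm h = diag_mx (\row_p ('i%C * (ev (d p) h)%:C%C)) *m P.
    by apply/matrixP => i j; rewrite dE mul_diag_mx !mxE.
  by rewrite -[LHS](mulKmx uP) [P *m (_ *m _)]mulmxA dE' (mulmxK uP).
have dE2 m p q h : diag_mx (\row_p0 ('i%C * (ev (d p0) h)%:C%C)) *m delta_mx p q =
    ('i%C * (ev (d p) h)%:C%C) *: (delta_mx p q : 'M[R[i]]_(n, m)).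
  apply/matrixP => i j; rewrite mul_diag_mx !mxE.
  by case: eqP => [->|]; rewrite ?andFb ?mulr0.
have eig m p (q : 'I_m) h : tm h *m (invmx P *m delta_mx p q) =
    ('i%C * (ev (d p) h)%:C%C) *: (invmx P *m delta_mx p q).
  by rewrite mulmxA PiE -mulmxA dE2 scalemxAr.
have intd p : exists z : int, ev (d p) (cor a) = z%:~R.
  apply: (wtv_integral (v := invmx P *m delta_mx p (0 : 'I_1)) cG mT basT defining_module ra ae af ef); last by move=> h; exact: eig.
  apply/eqP => p0; have := congr1 (mulmx P) p0; rewrite mulmxA mulmxV// mul1mx mulmx0.
  by move/matrixP => /(_ p 0); rewrite !mxE eqxx => /eqP; rewrite oner_eq0.
have cis_int (z : int) : cis (2 * pi * z%:~R) = 1 :> R[i].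
  have nat_ (m : nat) : cis (2 * pi * m%:R) = 1 :> R[i].
    elim: m => [|m IH]; first by rewrite mulr0 cis0.
    rewrite -[m.+1%:R]natr1 mulrDr mulr1 cisD IH mul1r /cis.

    by rewrite mulr_natl cos2pi sin2pi.
  case: z => m; first exact: nat_.
  by rewrite NegzE mulrNz mulrN /cis cosN sinN -pmulrn; have := nat_ m.+1; rewrite /cis => -[-> ->]; rewrite oppr0.
rewrite /Lambda /=.
pose Z p : cmx R n := invmx P *m delta_mx p p.
have ZE p : mexp ((2 * pi)%:C%C *: tm (cor a)) *m Z p = Z p.
  have [z zE] := intd p.
  rewrite (@mexp_eigen _ (Z p) (2 * pi * z%:~R)) ?cis_int ?scale1r//.
  rewrite -scalemxAl /Z eig zE scalerA; congr (_ *: _); rewrite [in RHS]rmorphM.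
  by rewrite mulrCA.

have SZ : \sum_p Z p = invmx P.
  by rewrite -mulmx_sumr (_ : \sum_p _ = 1%:M) ?mulmx1// -diag_const_mx; apply/matrixP => i j; rewrite summxE !mxE (bigD1 i)//= !mxE eqxx big1 ?addr0 => [|k ki]; rewrite ?mxE 1?eq_sym 1?(negbTE ki)//= eq_sym.
have H : mexp ((2 * pi)%:C%C *: tm (cor a)) *m invmx P = invmx P.
  by rewrite -{1}SZ mulmx_sumr (eq_bigr _ (fun p _ => ZE p)) SZ.
by rewrite -[LHS](mulmxKV uP) H mulVmx.

Qed.

Hypothesis innerK : normalized_inner D.

Definition ip x y : R := inner D (tm x) (tm y).

Let Lt x : L (tm x). Proof. exact: (tmx_lie mT basT x). Qed.

Lemma ipC x y : ip x y = ip y x.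
Proof. by case: innerK => sym _ _ _ _; exact: sym (Lt x) (Lt y). Qed.

Lemma ip_linl (c : R) x y z : ip (c *: x + y) z = c * ip x z + ip y z.
Proof. by case: innerK => _ lin _ _ _; rewrite /ip tmxD tmxZ; exact: lin (Lt x) (Lt y) (Lt z). Qed.

Lemma ipDl x y z : ip (x + y) z = ip x z + ip y z.
Proof. by have := ip_linl 1 x y z; rewrite scale1r mul1r. Qed.

Lemma ip0l z : ip 0 z = 0.
Proof. by have := ip_linl 1 0 0 z; rewrite scale1r mul1r addr0 => /eqP; rewrite addrC -subr_eq subrr eq_sym => /eqP. Qed.

Lemma ipZl (c : R) x z : ip (c *: x) z = c * ip x z.
Proof. by have := ip_linl c x 0 z; rewrite ip0l !addr0. Qed.

Lemma ipDr x y z : ip z (x + y) = ip z x + ip z y. Proof. by rewrite !(ipC z) ipDl. Qed.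
Lemma ipZr (c : R) x z : ip z (c *: x) = c * ip z x. Proof. by rewrite !(ipC z) ipZl. Qed.

Lemma ip_gt0 x : x != 0 -> 0 < ip x x.
Proof.
move=> x0; case: innerK => _ _ pos _ _; apply: pos (Lt x) _.
by apply: contra x0 => /eqP/(tmx_inj basT) ->.
Qed.

Lemma ev_nu x y : ev (nu D x) y = ip x y.
Proof.
rewrite /ev mxE.
have -> : y = \sum_j y j 0 *: (\col_i (i == j)%:R : 'cV[R]_r).
  apply/matrixP => i k; rewrite ord1 summxE (bigD1 i)//= !mxE eqxx mulr1 big1 ?addr0// => j ji.
  by rewrite !mxE eq_sym (negbTE ji) mulr0.
rewrite (big_morph (ip x) (fun u v => ipDr u v x) (_ : ip x 0 = 0)); last by rewrite ipC ip0l.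
apply: eq_bigr => j _; rewrite ipZr /ip -tbasisE mxE mulrC; congr (_ * _).
rewrite summxE (bigD1 j)//= !mxE eqxx mulr1 big1 ?addr0// => k kj.
by rewrite !mxE eq_sym (negbTE kj) mulr0.
Qed.

Definition s_t a x := x - ev a x *: cor a.

(** Bracketing with [X] rotates the plane of [H] and [W] with angular speed 2; the vectors [H + s W]
    with [s] a square root of -1 are its eigenvectors. *)
Lemma rot_comm X H W (s : R[i]) (t : R) :
  lbr X H = (- 2) *: W -> lbr X W = 2 *: H -> s * s = -1 -> 2 * s = 'i%C * t%:C%C ->
  X *m (H + s *: W) = (H + s *: W) *m X + ('i%C * t%:C%C) *: (H + s *: W).
Proof.
move=> XH XW ss st; have : lbr X (H + s *: W) = ('i%C * t%:C%C) *: (H + s *: W).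
  rewrite lbrDr lbrZr XH XW -st; apply/matrixP => i j; rewrite !mxE.
  rewrite [RHS](_ : _ = 2 * (s * s) * W i j + 2 * s * H i j); last by ring.
  by rewrite ss; ring.
by rewrite /lbr => <-; rewrite [RHS]addrC subrK.
Qed.

Lemma anticomm_half (g H Z1 Z2 : cmx R n) :
  g *m Z1 = - (Z1 *m g) -> g *m Z2 = - (Z2 *m g) -> H + H = Z1 + Z2 ->
  g *m H = - (H *m g).
Proof.
move=> g1 g2 E; have E2 : g *m H + g *m H = - (H *m g) - H *m g.
  by rewrite -mulmxDr -opprD -mulmxDl E [LHS]mulmxDr g1 g2 -opprD -mulmxDl.
have H2 : (2 : R[i]) *: (g *m H) = (2 : R[i]) *: - (H *m g).
  by rewrite -[2]/(1 + 1) !scalerDl !scale1r.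
by apply: (scalerI _ H2); rewrite pnatr_eq0.
Qed.

(** The element is the exponential of an [X] in the real Lie algebra spanned by the two root
    vectors. It turns the coroot by a half turn and commutes with the kernel of [a]. *)
Lemma coroot_Ad a : is_root D a -> exists2 g, grp D g &
  forall x, g *m tm x *m invmx g = tm (s_t a x).
Proof.
move=> ra.
have [e [c [f [e0 c0 fE [ae af] ef]]]] := root_sl2 cG mT basT ra.
have [[A [B [LA LB eE]]] he] := ae.
have fE2 : f = c%:C%C *: (- A + 'i%C *: B).
  rewrite fE eE adjD adj_scale (lie_skew cG LA : adj A = _) (lie_skew cG LB : adj B = _).
  congr (_ *: (_ + _)); rewrite scalerN -scaleNr; congr (_ *: _).
  by apply/eqP; rewrite eq_complex /= oppr0 opprK !eqxx.
(* This scaling balances the two root vectors: [q e - q^-1 f] equals [2 q A], an element of the real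
   Lie algebra. *)
pose q := Num.sqrt c; have q0 : 0 < q by rewrite sqrtr_gt0.
have qq : q * q = c by rewrite -expr2 sqr_sqrtr// ltW.
pose X : cmx R n := (2 * q)%:C%C *: A.
pose W : cmx R n := q%:C%C *: e + q^-1%:C%C *: f.
pose H : cmx R n := (- 'i%C) *: tm (cor a).
have qV : q^-1%:C%C * c%:C%C = q%:C%C :> R[i] by rewrite -rmorphM -qq mulrA mulVf ?mul1r// gt_eqF.
have qqV : q%:C%C * q^-1%:C%C = 1 :> R[i] by rewrite -rmorphM mulfV// gt_eqF.
have XE : X = q%:C%C *: e + (- q^-1%:C%C) *: f.
  rewrite fE2 eE [_ *: (c%:C%C *: _)]scalerA mulNr qV /X rmorphM rmorph_nat.
  by apply/matrixP => i j; rewrite !mxE; ring.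
have LX : L X by exact: lieZ.
have h2 : lbr H e = 2 *: e.
  rewrite /H lbrZl he scalerA negi_i (ev_coroot_self cG mT basT ra).
  by rewrite -(rmorph_nat (real_complex R) 2).
have hf2 : lbr H f = (- 2) *: f.
  rewrite /H lbrZl; case: af => _ ->; rewrite scalerA negi_i evN (ev_coroot_self cG mT basT ra).
  by rewrite -(rmorph_nat (real_complex R) 2) -rmorphN.
have XH : lbr X H = (- 2) *: W.
  rewrite lbrC XE lbrDr !lbrZr h2 hf2 /W; apply/matrixP => i j; rewrite !mxE; ring.
have XW : lbr X W = 2 *: H.
  have E1 : lbr e W = q^-1%:C%C *: H by rewrite /W lbrDr !lbrZr lbr_self scaler0 add0r ef.
  have E2 : lbr f W = - (q%:C%C *: H).
    by rewrite /W lbrDr !lbrZr lbr_self scaler0 addr0 [lbr f e]lbrC ef scalerN.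
  rewrite XE lbrDl [lbr (_ *: e) W]lbrZl [lbr (_ *: f) W]lbrZl E1 E2 scalerN scaleNr opprK.
  rewrite !scalerA (mulrC q^-1%:C%C) qqV.
  by apply/matrixP => i j; rewrite !mxE; ring.

have tmH : tm (cor a) = 'i%C *: H by rewrite /H scalerA mulrN sqr_iC opprK scale1r.
clearbody H W X.
have comm (s : R[i]) (t : R) := @rot_comm X H W s t XH XW.
(* With angular speed 2, the time [pi / 2] gives a half turn. *)
pose g := mexp ((pi / 2)%:C%C *: X).
have Gg : grp D g by exact: LX.
have ug := group_unit cG Gg.
have commg (s : R[i]) (t : R) : s * s = -1 -> 2 * s = 'i%C * t%:C%C -> cis (pi / 2 * t) = -1 :> R[i] ->
    g *m (H + s *: W) = - ((H + s *: W) *m g).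
  move=> ss st ct; rewrite /g (@mexp_eigen_comm _ _ (pi / 2 * t)) ?ct ?scaleN1r//.
  rewrite -scalemxAl (comm s t ss st) scalerDr; congr (_ + _); first by rewrite scalemxAr.
  rewrite [LHS]scalerA; congr (_ *: _).

  by apply/eqP; rewrite eq_complex /=; apply/andP; split; apply/eqP; ring.

have pi2 : pi / 2 * 2 = pi :> R by rewrite divfK// pnatr_eq0.
have g1 : g *m (H + 'i%C *: W) = - ((H + 'i%C *: W) *m g).
  apply: (commg _ 2); first exact: sqr_iC.
    by rewrite mulrC -(rmorph_nat (real_complex R) 2).
  by rewrite pi2 /cis cospi sinpi; apply/eqP; rewrite eq_complex /= oppr0 !eqxx.
have g2 : g *m (H + (- 'i%C) *: W) = - ((H + (- 'i%C) *: W) *m g).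
  apply: (commg _ (- 2)); first by rewrite mulrNN sqr_iC.
    by rewrite rmorphN mulrN mulrN mulrC -(rmorph_nat (real_complex R) 2).
  by rewrite mulrN pi2 /cis cosN sinN cospi sinpi; apply/eqP; rewrite eq_complex /= !oppr0 !eqxx.
have gH : g *m H = - (H *m g).
  have E : H + H = (H + 'i%C *: W) + (H + (- 'i%C) *: W).
    by rewrite scaleNr addrACA subrr addr0.
  exact: (anticomm_half g1 g2 E).
have gcor : g *m tm (cor a) *m invmx g = - tm (cor a).
  by rewrite tmH -scalemxAr gH scalerN mulNmx -scalemxAl mulmxK.

have gker x : ev a x = 0 -> g *m tm x *m invmx g = tm x.
  move=> ax; have Xx : X *m tm x = tm x *m X.
    have : lbr (tm x) X = 0.
      rewrite XE lbrDr !lbrZr he; case: af => _ ->.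
      by rewrite evN ax oppr0 mulr0 !scale0r !scaler0 addr0.
    by rewrite /lbr => /eqP; rewrite subr_eq0 => /eqP.
  have -> : g *m tm x = tm x *m g.
    by apply: mexp_intertwine; rewrite -scalemxAl Xx scalemxAr.
  by rewrite mulmxK.
exists g => // x; pose y := x - (ev a x / 2) *: cor a.
have y0 : ev a y = 0.
  by rewrite /y evDr evNr evZr (ev_coroot_self cG mT basT ra) divfK ?subrr// pnatr_eq0.
have -> : x = y + (ev a x / 2) *: cor a by rewrite /y subrK.
rewrite tmxD tmxZ mulmxDr mulmxDl gker// -scalemxAr -scalemxAl gcor.
rewrite /s_t evDr y0 add0r evZr (ev_coroot_self cG mT basT ra) divfK ?pnatr_eq0//.
rewrite scalerN -tmxZ -tmxN -tmxD; congr (tm _); rewrite -addrA; congr (_ + _).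
by apply/matrixP => i j; rewrite !mxE; field.
by apply/matrixP => i j; rewrite !mxE; field.
Qed.

Lemma ip_refl a x y : is_root D a -> ip (s_t a x) (s_t a y) = ip x y.
Proof.
move=> /coroot_Ad[g Gg gE]; rewrite /ip -!gE.
by case: innerK => _ _ _ inv _; exact: inv Gg (Lt x) (Lt y).
Qed.

End ExpEigen.

Lemma nncomb0 {R : realType} {r} (s : seq 'rV[R]_r) : nncomb s 0.
Proof. by exists (fun=> 0%N); rewrite big1// => i _; rewrite scale0r. Qed.

Lemma nncombD {R : realType} {r} (s : seq 'rV[R]_r) a b :
  nncomb s a -> nncomb s b -> nncomb s (a + b).
Proof.
move=> [c ->] [d ->]; exists (fun i => (c i + d i)%N).
by rewrite -big_split/=; apply: eq_bigr => i _; rewrite natrD scalerDl.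
Qed.

(** * Weight bases of irreducible highest weight representations *)

Section HighestWeight.
Context {R : realType} {n r : nat} (D : lie_data R n r).
Hypotheses (cG : compact_group (grp D)) (simpleK : simple_lie (lie (grp D))).
Hypotheses (mT : maximal_torus (grp D) (tor D)) (basT : torus_basis D).
Hypothesis simpS : simple_system D.
Implicit Types (a b l : 'rV[R]_r) (x y h : 'cV[R]_r) (X Y Z : cmx R n).

Local Notation tm := (tmx D).
Local Notation cor := (coroot D).

Variables (V : rep D) (l : 'rV[R]_r).
Hypotheses (irrV : rep_irreducible V) (hwV : rep_highest_weight V l).

Local Notation m := (rdim V).
Local Notation W := 'cV[R[i]]_m.

Definition ract_act X (v : W) : W := ract V X *m v.

Lemma rep_module : is_module (W := W) D ract_act.
Proof.
split.
- by move=> c X Y v; rewrite /ract_act linearP mulmxDl scalemxAl.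
- by move=> X c u v; rewrite /ract_act mulmxDr scalemxAr.
- by move=> X Y v gX gY; rewrite /ract_act ract_lbr// /lbr mulmxBl !mulmxA.
Qed.

Local Notation act := ract_act.
Local Notation wt := (wtv D act).

Let gtm x : glie D (tm x). Proof. exact: (tmx_glie cG mT basT x). Qed.

Lemma act_root0 b X u : root_space D 0 X -> wt b u -> exists c : R[i], act X u = c *: u.
Proof.
move=> /(root_space0 cG mT basT)[x [y ->]] bu.
exists ('i%C * (ev b x)%:C%C + 'i%C * ('i%C * (ev b y)%:C%C)).
by rewrite (act_D rep_module) (act_Z rep_module) !bu scalerDl scalerA.
Qed.

(** Words in negative root vectors applied to [v0]. Their length is recorded for the filtration
    [lowspan], which positive root vectors and the zero root space preserve. *)
Inductive low (v0 : W) : nat -> 'rV[R]_r -> W -> Prop :=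
| low_top : low v0 0 l v0
| low_step k b u a X : low v0 k b u -> pos_roots D a -> root_space D (- a) X ->
    low v0 k.+1 (b - a) (act X u).

Inductive lowspan (v0 : W) (k : nat) : W -> Prop :=
| lowspan_gen j b u : (j <= k)%N -> low v0 j b u -> lowspan v0 k u
| lowspan0 : lowspan v0 k 0
| lowspan_lin (c : R[i]) u v : lowspan v0 k u -> lowspan v0 k v -> lowspan v0 k (c *: u + v).

Lemma lowspanZ v0 k (c : R[i]) u : lowspan v0 k u -> lowspan v0 k (c *: u).
Proof. by move=> H; rewrite -[_ *: _]addr0; apply: lowspan_lin H (lowspan0 _ _). Qed.

Lemma lowspanD v0 k u v : lowspan v0 k u -> lowspan v0 k v -> lowspan v0 k (u + v).
Proof. by move=> H H'; rewrite -[u]scale1r; exact: lowspan_lin. Qed.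

Lemma lowspan_mono v0 k k' u : (k <= k')%N -> lowspan v0 k u -> lowspan v0 k' u.
Proof.
move=> kk; elim=> [j b w jk jw| |c w w' _ IH _ IH'].
- exact: lowspan_gen (leq_trans jk kk) jw.
- exact: lowspan0.
- exact: lowspan_lin.
Qed.

Lemma lowspan_lower v0 k a X u : pos_roots D a -> root_space D (- a) X ->
  lowspan v0 k u -> lowspan v0 k.+1 (act X u).
Proof.
move=> pa aX; elim=> [j b w jk jw| |c w w' _ IH _ IH'].
- by apply: (lowspan_gen _ (low_step jw pa aX)).
- by rewrite (act_0r rep_module); exact: lowspan0.
- by rewrite (act_linr rep_module); exact: lowspan_lin.
Qed.

Lemma low_wt v0 k b u : wt l v0 -> low v0 k b u ->
  wt b u /\ nncomb (simple_roots D) (l - b).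
Proof.
move=> lv0; elim=> [|j c w a X _ [cw nc] pa aX].
  by split=> //; rewrite subrr; exact: nncomb0.
split; first exact: (wtv_root cG mT basT rep_module aX cw).
by rewrite opprB addrCA addrC; apply: nncombD => //; case: pa.
Qed.

(** Induction on the word, by [X F w = F X w + [X, F] w]. The bracket is zero, of weight zero,
    raising or lowering, and in each case the length does not grow. *)
Lemma low_raise v0 j b u : wt l v0 ->
  (forall a X, pos_roots D a -> root_space D a X -> act X v0 = 0) ->
  low v0 j b u -> forall X,
    root_space D 0 X \/ (exists2 a, pos_roots D a & root_space D a X) ->
    lowspan v0 j (act X u).
Proof.
move=> lv0 hv0; elim=> [|k c w a F lw IH pa aF] X hX.
  case: hX => [/act_root0 /(_ lv0)[c ->]|[a pa aX]].
    by apply: lowspanZ; exact: lowspan_gen (leqnn _) (low_top _).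
  by rewrite (hv0 a X pa aX); exact: lowspan0.
have lFw := low_step lw pa aF.
case: hX => [X0|[b' pb bX]].
  have [d ->] := act_root0 X0 (low_wt lv0 lFw).1.
  by apply: lowspanZ; exact: lowspan_gen (leqnn _) lFw.
have gX : glie D X by case: bX.
have gF : glie D F by case: aF.
rewrite (act_lbr rep_module _ gX gF); apply: lowspanD.
  by apply: lowspan_lower pa aF _; apply: IH; right; exists b'.
have XF := root_space_lbr cG bX aF.
have [E0|E0] := eqVneq (lbr X F) 0; first by rewrite E0 (act_0 rep_module); exact: lowspan0.
have [w0|w0] := eqVneq (b' - a) 0.
  by apply: (lowspan_mono (leqnSn _)); apply: IH; left; rewrite -w0.
have rba : is_root D (b' - a) by split=> //; exists (lbr X F).
case: simpS => _ _ /(_ _ rba)[nn|nn].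
  by apply: (lowspan_mono (leqnSn _)); apply: IH; right; exists (b' - a).
have pab : pos_roots D (- (b' - a)) by split=> //; exact: (root_opp cG mT basT rba).
by apply: lowspan_gen (leqnn _) (low_step lw pab _); rewrite opprK.
Qed.

(** The span of the lowered vectors is invariant under the whole Lie algebra and contains [v0], so
    irreducibility makes it everything; a basis is then extracted from the words themselves, which
    are weight vectors. *)
Lemma weight_basis : exists X : seq W, basis_of fullv X /\
  forall u, u \in X -> exists2 b, wt b u & nncomb (simple_roots D) (l - b).
Proof.
have [v0 [v00 lv0 hv0]] := hwV.
have lv : wt l v0 by move=> h; exact: lv0.
have [|X [bX XS]] := @spanning_basis _ W (fun u => exists k b, low v0 k b u).
  move=> U SU.
  have [|c u v [k ku] [k' kv]|U' U'E] := @pred_vspace _ W (fun u => exists k, lowspan v0 k u).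
  - by exists 0%N; exact: lowspan0.
  - exists (maxn k k'); apply: lowspan_lin.
      exact: lowspan_mono (leq_maxl _ _) ku.
    exact: lowspan_mono (leq_maxr _ _) kv.
  have U'U : (U' <= U)%VS.
    apply/subvP => w /U'E[k]; elim=> [j b u _ ju| |c u v _ IH _ IH'].
    - by apply: SU; exists j, b.
    - exact: mem0v.
    - by rewrite memvD// memvZ.
  have inv X u : glie D X -> u \in U' -> ract V X *m u \in U'.
    move=> gX /U'E[k ku]; have [ws [_ _ dec]] := glie_decomp_ws cG mT basT.
    have [F [FF ->]] := dec X gX; rewrite linear_sum mulmx_suml.
    apply: memv_suml => a _; apply/U'E; rewrite -/(act (F a) u).
    have [Fa0|Fa0] := eqVneq (F a) 0.
      by exists 0%N; rewrite Fa0 (act_0 rep_module); exact: lowspan0.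
    have raise : root_space D 0 (F a) \/ (exists2 b, pos_roots D b & root_space D b (F a)) ->
        exists k, lowspan v0 k (act (F a) u).
      move=> H; exists k; elim: ku => [j b w jk jw| |c w w' _ IH _ IH'].
      - by apply: (lowspan_mono jk); exact: (low_raise lv hv0 jw).
      - by rewrite (act_0r rep_module); exact: lowspan0.
      - by rewrite (act_linr rep_module); exact: lowspan_lin.
    have [a0|a0] := eqVneq a 0; first by apply: raise; left; rewrite -a0.
    have ra : is_root D a by split=> //; exists (F a).
    case: simpS => _ _ /(_ _ ra)[nn|nn]; first by apply: raise; right; exists a.
    have pa : pos_roots D (- a) by split=> //; exact: (root_opp cG mT basT ra).
    exists k.+1; apply: lowspan_lower pa _ ku; by rewrite opprK.
  have v0U' : v0 \in U' by apply/U'E; exists 0%N; exact: lowspan_gen (leqnn _) (low_top _).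
  case: irrV => _ /(_ U' inv)[U0|Ufull].
    by move: v0U'; rewrite U0 memv0 (negbTE v00).
  by apply/eqP; rewrite eqEsubv subvf -Ufull U'U.
exists X; split=> // u /XS[k [b kb]]; have [bu nb] := low_wt lv kb.
by exists b.
Qed.

Lemma weight_diag : exists2 P : 'M[R[i]]_m, P \in unitmx &
  exists mu : 'I_m -> 'rV[R]_r,
    (forall p, wt (mu p) (col p P)) /\
    (forall p, nncomb (simple_roots D) (l - mu p)).
Proof.
have [X [bX XS]] := weight_basis.
move: bX => /andP[/eqP spX fX].
have sX : size X = m by move/eqP: fX => <-; rewrite spX dimvf dim_matrix; exact: muln1.
pose Xt : m.-tuple W := Tuple (introT eqP sX).
have {}fX : free Xt by exact: fX.
have [p|mu muE] := @choice _ _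
    (fun (p : 'I_m) b => wt b Xt`_p /\ nncomb (simple_roots D) (l - b)).
  have [|b b1 b2] := XS Xt`_p; last by exists b.
  by apply: mem_nth; rewrite size_tuple.
pose P : 'M[R[i]]_m := \matrix_(i, j) Xt`_j i 0.
have colP p : col p P = Xt`_p by apply/matrixP => i j; rewrite !mxE ord1.
exists P; last by exists mu; split=> p; [rewrite colP; exact: (muE p).1|exact: (muE p).2].
rewrite -unitmx_tr -row_free_unit; apply: inj_row_free => v vP.
move/freeP : fX => /(_ (fun i => v 0 i)) fX; apply/matrixP => i j; rewrite ord1 mxE {i}.
apply: fX; apply/matrixP => i k; rewrite ord1 summxE.
move/matrixP : vP => /(_ 0 i); rewrite !mxE => vP; rewrite -[RHS]vP.
by apply: eq_bigr => p _; rewrite !mxE.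
Qed.

Lemma rep_wt_integral b u a : u != 0 -> wt b u -> is_root D a ->
  exists z : int, ev b (cor a) = z%:~R.
Proof.
move=> u0 bu ra; have [e [c [f [_ _ _ [ae af] ef]]]] := root_sl2 cG mT basT ra.
exact: (wtv_integral cG mT basT rep_module ra ae af ef u0 bu).
Qed.

Definition wspace b : {vspace W} :=
  (\bigcap_(j < r) lker (linfun (fun v : W =>
    ract V (tbasis D j) *m v - (('i)%C * (b 0 j)%:C%C) *: v)%R))%VS.

Lemma wspaceP b u : u \in wspace b <-> wt b u.
Proof.
have lin j : linear (fun v : W => ract V (tbasis D j) *m v - (('i)%C * (b 0 j)%:C%C) *: v).
  move=> c x y; rewrite mulmxDr -scalemxAr scalerDr scalerBr !scalerA [c * _]mulrC.
  by rewrite opprD addrACA.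
pose F j := GRing.isLinear.Build _ _ _ _ _ (lin j).
pose G j : {linear W -> W} := HB.pack (fun v : W => ract V (tbasis D j) *m v - (('i)%C * (b 0 j)%:C%C) *: v) (F j).
have evb j : ev b (\col_i (i == j)%:R) = b 0 j.
  by rewrite /ev mxE (bigD1 j)//= big1 => [|k kj]; rewrite mxE ?eqxx ?mulr1 ?addr0// (negbTE kj) mulr0.
have kerE j : (u \in lker (linfun (fun v : W =>
    ract V (tbasis D j) *m v - (('i)%C * (b 0 j)%:C%C) *: v)%R)) =
    (ract V (tbasis D j) *m u == (('i)%C * (b 0 j)%:C%C) *: u).
  by rewrite memv_ker (lfunE (G j)) /= subr_eq0.
split=> [ub h|bu].
  rewrite /ract_act {1}/tmx linear_sum /= mulmx_suml.
  have -> : ev b h = \sum_j b 0 j * h j 0 by rewrite /ev mxE.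
  rewrite rmorph_sum mulr_sumr scaler_suml; apply: eq_bigr => j _.
  have : u \in lker (linfun (fun v : W =>
    ract V (tbasis D j) *m v - (('i)%C * (b 0 j)%:C%C) *: v)%R).
    have sub : (wspace b <= lker (linfun (fun v : W =>
        ract V (tbasis D j) *m v - (('i)%C * (b 0 j)%:C%C) *: v)%R))%VS.
      exact: (@bigcapv_inf _ _ _ j predT _ _ isT (subvv _)).
    exact: (subvP sub).
  rewrite kerE => /eqP E; rewrite linearZ -scalemxAl E scalerA; congr (_ *: _).
  by rewrite rmorphM mulrC mulrA.
rewrite /wspace memvE; apply/subv_bigcapP => j _; rewrite -memvE kerE.
by have := bu (\col_i (i == j)%:R); rewrite /ract_act -tbasisE evb => ->.
Qed.

End HighestWeight.

Lemma ev_inj {R : realType} {r} (a b : 'rV[R]_r) : (forall h, ev a h = ev b h) -> a = b.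
Proof.
move=> H; apply/rowP => j; have := H (delta_mx j 0).
by rewrite /ev -!colE !mxE.
Qed.

Lemma scalar_act {R : realType} (m : nat) (u v : R[i]) (x : 'cV[R[i]]_m) :
  u = v -> u *: x = v *: x.
Proof. by move->. Qed.

Definition cisev {R : realType} {r} (b : 'rV[R]_r) (x : 'cV[R]_r) : R[i] :=
  cis (2%:R * pi * ev b x).

(** * Reflection symmetry of the weights, and the character as a finite sum *)

Section Weights.
Context {R : realType} {n r : nat} (D : lie_data R n r).
Hypotheses (cG : compact_group (grp D)) (simpleK : simple_lie (lie (grp D))).
Hypotheses (mT : maximal_torus (grp D) (tor D)) (basT : torus_basis D).
Hypothesis simpS : simple_system D.
Implicit Types (a b : 'rV[R]_r) (x y h : 'cV[R]_r) (X Y Z : cmx R n).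

Local Notation tm := (tmx D).
Local Notation cor := (coroot D).

Definition rootseq : seq 'rV[R]_r :=
  xget [::] [set s | uniq s /\ forall a, is_root D a <-> a \in s].

Lemma rootseq_spec : uniq rootseq /\ forall a, is_root D a <-> a \in rootseq.
Proof.
have [ws [uws H _]] := glie_decomp_ws cG mT basT.
pose s := [seq a <- ws | `[< is_root D a >]].
apply: (@xgetPex _ [::] [set s | uniq s /\ forall a, is_root D a <-> a \in s]).
exists s; split; first exact: filter_uniq.
move=> a; rewrite mem_filter; split=> [ra|/andP[/asboolP //]].
by apply/andP; split; [exact/asboolP|case: ra => _ [X X0 aX]; exact: H aX].
Qed.

Lemma rootseqP a : reflect (is_root D a) (a \in rootseq).
Proof. by apply: (iffP idP) => /rootseq_spec.2. Qed.

Lemma rootseq_uniq : uniq rootseq.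
Proof. exact: rootseq_spec.1. Qed.

Variable V : rep D.
Local Notation m := (rdim V).
Local Notation W := 'cV[R[i]]_m.
Local Notation A := (ract V).
Local Notation wt := (wtv D (ract_act (V := V))).

Variables (P : 'M[R[i]]_m) (mu : 'I_m -> 'rV[R]_r).
Hypotheses (uP : P \in unitmx) (muP : forall p, wt (mu p) (col p P)).

Lemma wt_coef b u p : wt b u -> (invmx P *m u) p 0 != 0 -> mu p = b.
Proof.
move=> bu up; apply: ev_inj => h; set c := invmx P *m u in up *.
have AP : A (tm h) *m P = P *m diag_mx (\row_p ('i%C * (ev (mu p) h)%:C%C)).
  apply/matrixP => i j; rewrite mul_mx_diag mxE.
  have := muP j h => /matrixP/(_ i 0); rewrite /ract_act !mxE => E.
  rewrite mulrC -E; apply: eq_bigr => k _; by rewrite !mxE.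
have Ec : diag_mx (\row_p ('i%C * (ev (mu p) h)%:C%C)) *m c = ('i%C * (ev b h)%:C%C) *: c.
  rewrite /c scalemxAr -(bu h) /ract_act.
  move: (A (tm h)) (diag_mx _) AP => Ah d AP.
  have -> : Ah = P *m d *m invmx P by rewrite -AP mulmxK.
  by rewrite -!mulmxA mulKmx.
clearbody c; move/matrixP : Ec => /(_ p 0); rewrite mul_diag_mx !mxE => /(mulIf up).
move=> /(congr1 (fun z => complex.Im z)) /=; rewrite !mul0r !mul1r !add0r; exact.
Qed.

Lemma wt_expand u : u = \sum_p (invmx P *m u) p 0 *: col p P.
Proof.
rewrite -[LHS](mulKVmx uP); apply/matrixP => i j; rewrite ord1 summxE mxE.
by apply: eq_bigr => p _; rewrite [in RHS]mxE [in RHS](mxE _ (fun i j => P i p)) mulrC.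
Qed.

Lemma col_free (s : seq 'I_m) : uniq s -> free [seq col p P : W | p <- s].
Proof.
move=> us; pose X : m.-tuple W := mktuple (fun p => col p P : W).
have fX : free X.
  apply/freeP => k H i; pose c : W := \col_p k p.
  have : P *m c = 0.
    rewrite -[RHS]H; apply/matrixP => a b; rewrite ord1 summxE mxE.
    by apply: eq_bigr => p _; rewrite nth_mktuple !mxE mulrC.
  move=> /(congr1 (mulmx (invmx P))); rewrite mulKmx// mulmx0 => /matrixP/(_ i 0).
  by rewrite !mxE.
have XE : tval X = [seq col p P : W | p <- enum 'I_m] by [].
have inj : {in enum 'I_m &, injective (fun p => col p P : W)}.
  move=> i j _ _ E; have := free_uniq fX; move/tuple_uniqP => /(_ i j).
  by rewrite !tnth_mktuple => /(_ E).
have pe : perm_eq s [seq p <- enum 'I_m | p \in s].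
  apply: uniq_perm => //; first exact: filter_uniq (enum_uniq _).
  by move=> p; rewrite mem_filter mem_enum andbT.
rewrite (perm_free (perm_map _ pe)).
have -> : [seq col p P : W | p <- [seq p <- enum 'I_m | p \in s]] =
          [seq v <- tval X | v \in [seq col p P : W | p <- s]].
  rewrite XE [RHS]filter_map; apply: (congr1 (map _)); apply: eq_in_filter => p pe' /=.
  apply/idP/mapP => [ps|[q qs /inj ->]//]; first by exists p.
  by rewrite mem_enum.
exact: filter_free.
Qed.

Definition wdim b : nat := \dim (wspace V b).

Lemma wspace_dim b : wdim b = count_mem b [seq mu p | p <- enum 'I_m].
Proof.
rewrite /wdim; pose s := [seq p <- enum 'I_m | mu p == b].
have -> : wspace V b = <<[seq col p P : W | p <- s]>>%VS.
  apply/eqP; rewrite eqEsubv; apply/andP; split.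
    apply/subvP => u /wspaceP bu; rewrite (wt_expand u); apply: memv_suml => p _.
    have [->|up] := eqVneq ((invmx P *m u) p 0) 0; first by rewrite scale0r mem0v.
    apply: memvZ; apply: memv_span; apply/mapP; exists p => //.
    by rewrite mem_filter (wt_coef bu up) eqxx mem_enum.
  apply/span_subvP => u /mapP[p]; rewrite mem_filter => /andP[/eqP <- _] ->.
  by apply/wspaceP; exact: muP.
have fs : free [seq col p P : W | p <- s].
  by apply: col_free; exact: filter_uniq (enum_uniq _).
by rewrite (eqP fs) size_map size_filter [RHS]count_map.
Qed.

Lemma mu_integral p a : is_root D a -> exists z : int, ev (mu p) (cor a) = z%:~R.
Proof.
apply: (rep_wt_integral cG mT basT _ (muP p)).
apply/eqP => cP; have := col_free (s := [:: p]) isT.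
by rewrite /= seq1_free cP eqxx.
Qed.

Lemma mu_weight p : weight_lattice D (mu p).
Proof. by move=> a /(mu_integral p)[z ->]; exact: intr_int. Qed.

(** If the pairing with the coroot is [k >= 0], the [k]-th power of the lowering vector embeds one
    weight space into the other; a negative pairing is treated with [-a]. Since reflections are
    involutions, the inequality gives equality. *)
Lemma wdim_refl_le a b : is_root D a -> (wdim b <= wdim (refl D a b))%N.
Proof.
move=> ra.
have [W0|] := eqVneq (wspace V b) 0%VS; first by rewrite {1}/wdim W0 dimv0.
rewrite -subv0 => /subvPn[u /wspaceP bu]; rewrite memv0 => u0.
have [z zE] := rep_wt_integral cG mT basT u0 bu ra.
suff main a' (k : nat) : is_root D a' -> ev b (cor a') = k%:R ->
    (wdim b <= wdim (refl D a' b))%N.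
  case: z zE => k zE; first exact: main ra zE.
  have ra' := root_opp cG mT basT ra.
  have -> : refl D a b = refl D (- a) b.
    by rewrite /refl (corootN cG mT basT ra) evNr scalerN scaleNr opprK.
  apply: (main _ k.+1) => //; rewrite (corootN cG mT basT ra) evNr zE NegzE.
  by rewrite rmorphN opprK.
move=> {ra zE z u bu u0 a} ra kE.
have [e [c [f [e0 c0 fE [ae af] ef]]]] := root_sl2 cG mT basT ra.
pose G := iter k (fun g => (linfun (mulmx (A f) : W -> W) \o g)%VF) \1%VF.
have GE v : G v = iter k (ract_act (V := V) f) v.
  rewrite /G; elim: k {kE G} => [|k IH] /=; first by rewrite id_lfunE.
  by rewrite comp_lfunE IH lfunE.
have lk : (wspace V b :&: lker G = 0)%VS.
  apply/eqP; rewrite -subv0; apply/subvP => v; rewrite memv_cap memv_ker GE memv0.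
  move=> /andP[/wspaceP bv /eqP H]; apply/eqP.
  exact: (wtv_F_inj cG mT basT (@rep_module R n r D V) ra ae af ef bv kE H).
have H : (\dim (G @: wspace V b) <= wdim (refl D a' b))%N; last first.
  exact: (eq_ind _ (fun d => (d <= _)%N) H _ (limg_dim_eq lk)).
apply: dimvS; apply/subvP => _ /memv_imgP[v /wspaceP bv ->]; apply/wspaceP.
rewrite GE /refl kE.
have := wtv_iter cG mT basT (@rep_module R n r D V) k af bv.
by rewrite scalerN.
Qed.

Lemma reflK a b : is_root D a -> refl D a (refl D a b) = b.
Proof.
move=> ra; rewrite /refl evD evN evZ (ev_coroot_self cG mT basT ra).
by apply/matrixP => i j; rewrite !mxE; ring.
Qed.

Lemma mu_refl a : is_root D a ->
  perm_eq [seq mu p | p <- enum 'I_m] [seq refl D a (mu p) | p <- enum 'I_m].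
Proof.
move=> ra; apply/allP => b _; apply/eqP.
have -> : count_mem b [seq refl D a (mu p) | p <- enum 'I_m] =
          count_mem (refl D a b) [seq mu p | p <- enum 'I_m].
  rewrite !count_map; apply: eq_count => p /=.
  by apply/eqP/eqP => [<-|->]; rewrite reflK.
rewrite -(wspace_dim b) -(wspace_dim (refl D a b)); apply/eqP.
rewrite eqn_leq; apply/andP; split; first exact: wdim_refl_le.
have H := wdim_refl_le (refl D a b) ra; rewrite (reflK b ra) in H; exact: H.
Qed.

Lemma sum_mu_refl (T : nmodType) (F : 'rV[R]_r -> T) a : is_root D a ->
  \sum_p F (mu p) = \sum_p F (refl D a (mu p)).
Proof.
move=> ra; have := perm_big _ (mu_refl ra) (op := +%R) (x := 0) (F := F) (P := predT).
have E f : \sum_(b <- [seq f p | p <- enum 'I_m]) F b = \sum_p F (f p).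
  by rewrite big_map big_enum.
by rewrite (E mu) (E (fun p => refl D a (mu p))).
Qed.

Lemma ch_mu x : ch V x = \sum_p cisev (mu p) x.
Proof.
rewrite /ch; set F := fun b => _.
transitivity (\sum_(b \in [set` undup [seq mu p | p <- enum 'I_m]]) F b).
  apply/esym/fsbig_widen.
    by move=> b /=; rewrite mem_undup => /mapP[p _ ->]; exact: mu_weight.
  move=> b [_ /=]; rewrite mem_undup => /negP bn; rewrite /F.
  have -> : weight_mult V b = wdim b by [].
  by rewrite wspace_dim (count_memPn bn) mul0r.
rewrite -fsbig_seq ?undup_uniq//.
transitivity (\sum_(b <- undup [seq mu p | p <- enum 'I_m])
    cisev b x *+ count_mem b [seq mu p | p <- enum 'I_m]).
  apply: eq_bigr => b _; rewrite /F.
  have -> : weight_mult V b = wdim b by [].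
  by rewrite wspace_dim mulr_natl.
have -> : \sum_p cisev (mu p) x = \sum_(b <- [seq mu p | p <- enum 'I_m]) cisev b x.
  by rewrite big_map big_enum.
by rewrite -[RHS]big_undup_iterop_count; exact: eq_bigr.
Qed.

End Weights.

(** * The Casimir operator *)

Section Casimir.
Context {R : realType} {n r : nat} (D : lie_data R n r).
Hypotheses (cG : compact_group (grp D)) (simpleK : simple_lie (lie (grp D))).
Hypotheses (mT : maximal_torus (grp D) (tor D)) (basT : torus_basis D).
Hypothesis simpS : simple_system D.
Implicit Types (a b : 'rV[R]_r) (x y h : 'cV[R]_r) (X Y Z : cmx R n).

Local Notation tm := (tmx D).
Local Notation cor := (coroot D).
Local Notation rs := (rootseq D).
Local Notation rq := (rq D).

Definition is_pos a : bool := `[< nncomb (simple_roots D) a >].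

Lemma normalized_root_vectors : exists E : 'rV[R]_r -> cmx R n, forall a, is_root D a ->
  root_space D a (E a) /\ \tr (E a *m adj (E a)) = 1.
Proof.
have [|E HE] := @choice _ _ (fun a (X : cmx R n) => is_root D a ->
    root_space D a X /\ \tr (X *m adj X) = 1); last by exists E.
move=> a; have [ra|nra] := pselect (is_root D a); last by exists 0.
have [_ [X X0 aX]] := ra; have X1 := frob_gt0 X0.
exists ((Num.sqrt (frob X))^-1%:C%C *: X) => _; split.
  rewrite -[_ *: X]addr0; apply: (root_space_lin cG) => //.
  by split=> [|h]; [exact: glie0|rewrite /lbr mulmx0 mul0mx subrr scaler0].
rewrite adj_scale -scalemxAl -scalemxAr !mxtraceZ tr_frob conjc_real -!rmorphM /=.
by congr (_%:C%C); rewrite mulrA -expr2 exprVn sqr_sqrtr ?ltW// mulVf ?gt_eqF.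
Qed.

Lemma root_space_tr0 a b X Y : root_space D a X -> root_space D b Y -> a + b != 0 ->
  \tr (X *m Y) = 0.
Proof.
move=> [_ aX] [_ bY] ab0.
have [h hab] : exists h, ev (a + b) h != 0.
  apply: contrapT => H; move/eqP: ab0; apply; apply: ev_inj => h.
  rewrite [RHS]/ev mul0mx mxE; apply/eqP/negPn/negP => ?; by apply: H; exists h.
have E1 : \tr (lbr (tm h) X *m Y) = ('i%C * (ev a h)%:C%C) * \tr (X *m Y).
  by rewrite aX -scalemxAl mxtraceZ.
have E2 : \tr (lbr (tm h) X *m Y) = - (('i%C * (ev b h)%:C%C) * \tr (X *m Y)).
  by rewrite lbrC mulNmx raddfN /= tr_lbr bY -scalemxAr mxtraceZ.
have : 'i%C * (ev (a + b) h)%:C%C * \tr (X *m Y) = 0.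
  by rewrite evD rmorphD /= mulrDr mulrDl -E1 E2 addNr.
move=> /eqP; rewrite mulf_eq0 => /orP[|/eqP//]; rewrite mulf_eq0 => /orP[] /eqP.
  by move=> /(congr1 (fun z => complex.Im z)) /= /eqP; rewrite oner_eq0.
by move=> /(congr1 (fun z => complex.Re z)) /= /eqP; rewrite (negbTE hab).
Qed.

Lemma rq_coord b c : rq b c = \sum_j c 0 j * rq b (delta_mx 0 j).
Proof.
have -> : rq b c = \sum_j c 0 j * dv D b j 0 by rewrite (rqC cG mT basT) /rq /ev mxE.
apply: eq_bigr => j _; congr (_ * _).
by rewrite (rqC cG mT basT) /rq /ev -rowE [RHS]mxE.
Qed.

Variables (E : 'rV[R]_r -> cmx R n).
Hypothesis HE : forall a, is_root D a -> root_space D a (E a) /\ \tr (E a *m adj (E a)) = 1.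

(** [cas_x] and [cas_y] are dual bases of the complexified Lie algebra for the trace form, indexed
    by the basis of t and by the roots. *)
Definition cas_idx := ('I_r + 'I_(size rs))%type.
Definition cas_x (i : cas_idx) : cmx R n :=
  match i with inl j => tbasis D j | inr k => E (rs`_k) end.
Definition cas_y (i : cas_idx) : cmx R n :=
  match i with inl j => - tm (dv D (delta_mx 0 j)) | inr k => adj (E (rs`_k)) end.

Let rsk (k : 'I_(size rs)) : is_root D (rs`_k).
Proof. by apply/(rootseqP cG mT basT); exact: mem_nth. Qed.

Lemma cas_glie i : glie D (cas_x i) /\ glie D (cas_y i).
Proof.
case: i => [j|k] /=; split.
- by rewrite tbasisE; exact: (tmx_glie cG mT basT).
- exact: (glieN cG (tmx_glie cG mT basT _)).
- by have [[g _] _] := HE (rsk k).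
- by have [[g _] _] := HE (rsk k); exact: (glie_adj cG g).
Qed.

Lemma tr_tm_root x a X : is_root D a -> root_space D a X -> \tr (tm x *m X) = 0.
Proof.
move=> [a0 _] aX; apply: (root_space_tr0 (tmx_root_space0 cG mT basT x) aX).
by rewrite add0r.
Qed.

Lemma sum_rs (T : nmodType) (F : 'rV[R]_r -> T) :
  \sum_(k < size rs) F (rs`_k) = \sum_(a <- rs) F a.
Proof. by rewrite (big_nth 0) big_mkord. Qed.

(** Both expansions are linear in [Z], so it is enough to check torus elements and root vectors,
    where weights make most traces vanish. *)
Lemma cas_expand Z : glie D Z ->
  Z = \sum_i \tr (Z *m cas_y i) *: cas_x i /\ Z = \sum_i \tr (Z *m cas_x i) *: cas_y i.
Proof.
pose Q Z := Z = \sum_i \tr (Z *m cas_y i) *: cas_x i /\ Z = \sum_i \tr (Z *m cas_x i) *: cas_y i.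
have Ql (c : R[i]) X Y : Q X -> Q Y -> Q (c *: X + Y).
  move=> [X1 X2] [Y1 Y2]; split.
    rewrite {1}X1 {1}Y1 scaler_sumr -big_split; apply: eq_bigr => i _ /=.
    by rewrite mulmxDl -scalemxAl mxtraceD mxtraceZ scalerDl scalerA.
  rewrite {1}X2 {1}Y2 scaler_sumr -big_split; apply: eq_bigr => i _ /=.
  by rewrite mulmxDl -scalemxAl mxtraceD mxtraceZ scalerDl scalerA.
have Q0 : Q 0.
  by split; rewrite big1// => i _; rewrite mul0mx mxtrace0 scale0r.
have Qt x : Q (tm x).
  split; rewrite big_sumType /= [X in _ + X]big1 ?addr0.
  - rewrite {1}/tmx; apply: eq_bigr => j _; congr (_ *: _).
    rewrite mulmxN raddfN /= (tr_tmx cG mT basT) opprK (gtC mT basT) (gt_dv cG mT basT).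
    by rewrite /ev -rowE [row _ _ _ _]mxE.
  - move=> k _; rewrite (@tr_tm_root x (- rs`_k)) ?scale0r//.
      exact: (root_opp cG mT basT).
    exact: (root_space_adj cG mT basT (HE (rsk k)).1).
  - have xE : x = \sum_j gt D x (delta_mx j 0) *: dv D (delta_mx 0 j).
      apply: (gt_inj cG mT basT) => h; rewrite (gtC mT basT) !gt_gram.
      have -> : ev (h^T *m gram D) (\sum_j gt D x (delta_mx j 0) *: dv D (delta_mx 0 j)) =
          \sum_j gt D x (delta_mx j 0) * ev (h^T *m gram D) (dv D (delta_mx 0 j)).
        rewrite /ev mulmx_sumr summxE; apply: eq_bigr => j _.
        by rewrite -scalemxAr mxE.
      have -> : ev (x^T *m gram D) h = \sum_j (x^T *m gram D) 0 j * h j 0 by rewrite /ev mxE.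
      apply: eq_bigr => j _; rewrite -gt_gram (gtC mT basT h) (gt_dv cG mT basT).
      by rewrite gt_gram /ev -rowE -colE [col _ _ _ _]mxE [row _ _ _ _]mxE.
    have tmE (F : 'I_r -> 'cV[R]_r) : tm (\sum_j F j) = \sum_j tm (F j).
      by apply: (big_morph tm (fun x y => tmxD D x y)); exact: tmx0.
    rewrite {1}xE tmE; apply: eq_bigr => j _; rewrite tmxZ.
    have -> : tbasis D j = tm (delta_mx j 0).
      by rewrite tbasisE; congr tm; apply/colP => i; rewrite !mxE andbT.
    by rewrite (tr_tmx cG mT basT) scaleNr scalerN opprK.
  - move=> k _; rewrite (@tr_tm_root x (rs`_k)) ?scale0r//.
    exact: (HE (rsk k)).1.
have Qr a k : is_root D a -> Q (k *: E a).
  move=> ra; have [aE trE] := HE ra.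
  have kt b X : root_space D b X -> a + b != 0 -> \tr (k *: E a *m X) = 0.
    by move=> bX ab; rewrite -scalemxAl mxtraceZ (root_space_tr0 aE bX ab) mulr0.
  have a0 : a != 0 by case: ra.
  have h0 x : \tr (k *: E a *m tm x) = 0.
    by apply: kt (tmx_root_space0 cG mT basT x) _; rewrite addr0.
  split; rewrite big_sumType /= [X in X + _]big1 ?add0r.
  - rewrite (sum_rs (fun b => \tr (k *: E a *m adj (E b)) *: E b)).
    rewrite (bigD1_seq a) /=; last 2 first.
    + exact/(rootseqP cG mT basT).
    + exact: (rootseq_uniq cG mT basT).
    rewrite big1_seq ?addr0 => [|b /andP[ba /(rootseqP cG mT basT) rb]].
      by rewrite -scalemxAl mxtraceZ trE mulr1.
    rewrite (kt (- b)) ?scale0r//; first exact: (root_space_adj cG mT basT (HE rb).1).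
    by rewrite subr_eq0 eq_sym.
  - by move=> j _; rewrite mulmxN raddfN /= h0 oppr0 scale0r.
  - rewrite (sum_rs (fun b => \tr (k *: E a *m E b) *: adj (E b))).
    have rna := root_opp cG mT basT ra; have [naE ntr] := HE rna.
    rewrite (bigD1_seq (- a)) /=; last 2 first.
    + exact/(rootseqP cG mT basT).
    + exact: (rootseq_uniq cG mT basT).
    rewrite big1_seq ?addr0 => [|b /andP[ba /(rootseqP cG mT basT) rb]]; last first.
      rewrite (kt b) ?scale0r//; first exact: (HE rb).1.
      by rewrite addrC addr_eq0.
    have := root_space_adj cG mT basT naE; rewrite opprK => aaE.
    have aE0 : adj (E (- a)) != 0.
      by apply/eqP => e0; move: ntr; rewrite e0 mulmx0 mxtrace0 => /esym/eqP; rewrite oner_eq0.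
    have [k' ->] := root_dim1 cG mT basT ra aE0 aaE aE.
    by rewrite scalerA -scalemxAl mxtraceZ mxtrace_mulC ntr mulr1.
  - by move=> j _; rewrite tbasisE h0 scale0r.
move=> gZ; have [ws [_ _ dec]] := glie_decomp_ws cG mT basT.
have [F [FF ->]] := dec Z gZ; rewrite -/(Q _).
elim: ws {dec} => [|a ws IH]; first by rewrite big_nil; exact: Q0.
rewrite big_cons -[F a]scale1r; apply: (Ql 1 (F a) _ _ IH).
have [->|Fa0] := eqVneq (F a) 0; first exact: Q0.
have [a0|a0] := eqVneq a 0.
  have Fa := eq_ind a (fun b => root_space D b (F a)) (FF a) 0 a0.
  have [x [y ->]] := root_space0 cG mT basT Fa.
  exact: (eq_ind _ Q (Ql 'i%C (tm y) (tm x) (Qt y) (Qt x)) _ (addrC _ _)).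
have ra : is_root D a by split=> //; exists (F a).
have [aE trE] := HE ra.
have E0 : E a != 0.
  by apply/eqP => e0; move: trE; rewrite e0 mul0mx mxtrace0 => /esym/eqP; rewrite oner_eq0.
by have [k ->] := root_dim1 cG mT basT ra E0 aE (FF a); exact: Qr.
Qed.

Variables (V : rep D) (l : 'rV[R]_r).
Hypotheses (irrV : rep_irreducible V) (hwV : rep_highest_weight V l).
Local Notation m := (rdim V).
Local Notation W := 'cV[R[i]]_m.
Local Notation A := (ract V).
Local Notation wt := (wtv D (ract_act (V := V))).
Local Notation z := (cisev).

Definition casimir : 'M[R[i]]_m := \sum_i A (cas_x i) *m A (cas_y i).

Lemma ract_ad X Y Z : glie D X -> glie D Y -> glie D Z ->
  A X *m (A Y *m A Z) - A Y *m A Z *m A X = A (lbr X Y) *m A Z + A Y *m A (lbr X Z).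
Proof.
move=> gX gY gZ; rewrite (ract_lbr V gX gY) (ract_lbr V gX gZ).
move: (A X) (A Y) (A Z) => a b c.
by rewrite /lbr mulmxBl mulmxBr !mulmxA addrA subrK.
Qed.

(** By invariance of the trace, the coefficients of [[X, x_i]] in the basis [x] and those of
    [[X, y_k]] in the basis [y] are opposite, so the two halves of the commutator cancel. *)
Lemma casimir_comm X : glie D X -> A X *m casimir = casimir *m A X.
Proof.
move=> gX; apply/eqP; rewrite -subr_eq0; apply/eqP.
pose x := cas_x; pose y := cas_y.
have gx i : glie D (x i) by have [] := cas_glie i.
have gy i : glie D (y i) by have [] := cas_glie i.
rewrite /casimir -/x -/y mulmx_sumr mulmx_suml -sumrB.
under eq_bigr do rewrite (ract_ad gX (gx _) (gy _)).
rewrite big_split /=.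
have -> : \sum_i A (lbr X (x i)) *m A (y i) =
    \sum_i \sum_k \tr (lbr X (x i) *m y k) *: (A (x k) *m A (y i)).
  apply: eq_bigr => i _; rewrite {1}(cas_expand (glie_lbr cG gX (gx i))).1.
  rewrite linear_sum mulmx_suml; apply: eq_bigr => k _.
  by rewrite linearZ -scalemxAl.
have -> : \sum_i A (x i) *m A (lbr X (y i)) =
    \sum_i \sum_k \tr (lbr X (y k) *m x i) *: (A (x k) *m A (y i)).
  rewrite exchange_big; apply: eq_bigr => k _ /=.
  rewrite {1}(cas_expand (glie_lbr cG gX (gy k))).2.
  rewrite linear_sum mulmx_sumr; apply: eq_bigr => i _.
  by rewrite linearZ -scalemxAr.
rewrite -big_split big1// => i _ /=; rewrite -big_split big1// => k _ /=.
rewrite -scalerDl !tr_lbr (lbrC (y k)) mulmxN raddfN /= subrr.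
by rewrite scale0r.
Qed.

Let casT b u : wt b u ->
  \sum_j A (tbasis D j) *m (A (- tm (dv D (delta_mx 0 j))) *m u) = (rq b b)%:C%C *: u.
Proof.
move=> bu; rewrite (rq_coord b b) rmorph_sum scaler_suml; apply: eq_bigr => j _.
have H h : A (tm h) *m u = ('i%C * (ev b h)%:C%C) *: u := bu h.
rewrite linearN mulNmx H mulmxN -scalemxAr tbasisE H scalerA -scaleNr; apply: scalar_act.
have -> : ev b (\col_i (i == j)%:R) = b 0 j.
  by rewrite /ev mxE (bigD1 j)//= big1 => [|k kj]; rewrite mxE ?eqxx ?mulr1 ?addr0// (negbTE kj) mulr0.
by rewrite mulrACA sqr_iC mulN1r opprK -rmorphM mulrC.
Qed.

Lemma rep_root_bracket a b u : is_root D a -> wt b u ->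
  A (lbr (E a) (adj (E a))) *m u = (rq b a)%:C%C *: u.
Proof.
move=> ra bu; have [aE trE] := HE ra.
rewrite (root_bracket cG mT basT aE (root_space_adj cG mT basT aE)) trE mulr1 linearZ -scalemxAl.
have -> : A (tm (dv D a)) *m u = ('i%C * (ev b (dv D a))%:C%C) *: u := bu _.
by rewrite scalerA negi_i.
Qed.

(** This is the scalar product of [l] with [l + 2 rho]. *)
Definition cas_scalar : R[i] := (rq l l + \sum_(a <- rs | is_pos a) rq l a)%:C%C.

(** Schur's argument: the eigenspace of the highest weight vector is invariant, hence everything. On
    that vector a positive root contributes through the bracket of its two root vectors, a negative
    one contributes nothing. *)
Lemma casimir_scalar : casimir = cas_scalar%:M.
Proof.
have [v0 [v00 lv0 hv0]] := hwV.
have lv : wt l v0 by move=> h; exact: lv0.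
have c0 : casimir *m v0 = cas_scalar *: v0.
  rewrite /casimir big_sumType /= mulmxDl /cas_scalar rmorphD scalerDl; congr (_ + _).
    by rewrite mulmx_suml -(casT lv); apply: eq_bigr => j _; rewrite mulmxA.
  rewrite (sum_rs (fun a => A (E a) *m A (adj (E a)))) mulmx_suml.
  rewrite rmorph_sum scaler_suml [RHS]big_mkcond; apply: eq_big_seq => a.
  move=> /(rootseqP cG mT basT) ra; have [aE trE] := HE ra.
  rewrite -mulmxA /is_pos; case: asboolP => [pa|npa].
    rewrite -(rep_root_bracket ra lv) ract_lbr; last 2 first.
    + by case: aE.
    + by case: aE => g _; exact: (glie_adj cG g).
    rewrite /lbr mulmxBl -!mulmxA (hv0 a (E a)) ?mulmx0 ?subr0//.
  have pa : nncomb (simple_roots D) (- a) by case: simpS => _ _ /(_ _ ra)[].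
  rewrite (hv0 (- a) (adj (E a))) ?mulmx0//.
    by split=> //; exact: (root_opp cG mT basT).
  exact: (root_space_adj cG mT basT aE).
have [|c u v uc vc|U UE] := @pred_vspace _ W (fun u => casimir *m u = cas_scalar *: u).
- by rewrite mulmx0 scaler0.
- by rewrite mulmxDr -scalemxAr uc vc scalerDr !scalerA [c * _]mulrC.
case: irrV => _ /(_ U) [|U0|Uf].
- move=> X v gX /UE vU; apply/UE.
  by rewrite mulmxA -(casimir_comm gX) -mulmxA vU scalemxAr.
- by move/UE : c0; rewrite U0 memv0 (negbTE v00).
apply/matrixP => i j; have : (delta_mx j 0 : W) \in U by rewrite Uf memvf.
move/UE; rewrite -mul_scalar_mx -!colE => /matrixP/(_ i 0).
by rewrite [col _ _ _ _]mxE [in RHS]mxE.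
Qed.

Variables (P : 'M[R[i]]_m) (mu : 'I_m -> 'rV[R]_r).
Hypotheses (uP : P \in unitmx) (muP : forall p, wt (mu p) (col p P)).

(** The operator by which the torus element of parameter [x] should act, built from the weight
    basis. *)
Definition torus_mx x : 'M[R[i]]_m := P *m diag_mx (\row_p z (mu p) x) *m invmx P.

Lemma torus_mx_wt b u x : wt b u -> torus_mx x *m u = z b x *: u.
Proof.
move=> bu; rewrite -[u in RHS](mulKVmx uP) /torus_mx -!mulmxA scalemxAr; congr (_ *m _).
have H := wt_coef uP muP bu; move: (invmx P *m u) H => c H.
apply/matrixP => p j; rewrite (ord1 j) mul_diag_mx !mxE.
by have [->|cp] := eqVneq (c p 0) 0; [rewrite !mulr0|rewrite (H p cp)].
Qed.

Lemma mx_col_inj (B C : 'M[R[i]]_m) : (forall p, B *m col p P = C *m col p P) -> B = C.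
Proof.
move=> H; rewrite -(mulmxK uP B) -(mulmxK uP C); congr (_ *m _).
apply/matrixP => i p; have /matrixP/(_ i 0) := H p.
have E0 (M : 'M[R[i]]_m) : (M *m col p P) i 0 = (M *m P) i p.
  by rewrite mxE [RHS]mxE; apply: eq_bigr => k _; rewrite [col _ _ _ _]mxE.
by rewrite !E0.
Qed.

Lemma tr_eigen (B : 'M[R[i]]_m) (d : 'I_m -> R[i]) :
  (forall p, B *m col p P = d p *: col p P) -> \tr B = \sum_p d p.
Proof.
move=> H; rewrite -[B](mulmxK uP) mxtrace_mulC.
suff -> : B *m P = P *m diag_mx (\row_p d p).
  by rewrite mulKmx// mxtrace_diag; apply: eq_bigr => p _; rewrite mxE.
apply/matrixP => i p; have /matrixP/(_ i 0) := H p.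
rewrite mul_mx_diag !mxE mulrC => <-; by apply: eq_bigr => k _; rewrite mxE.
Qed.

Definition cas_term a x : R[i] := \tr (A (E a) *m A (adj (E a)) *m torus_mx x).

(** Carrying the torus operator around the trace multiplies it by [e^a], while exchanging the two
    root vectors costs their bracket, which acts on weights by scalars. The two relations determine
    the root term. *)
Lemma cas_term_eq a x : is_root D a ->
  (z a x - 1) * cas_term a x = z a x * \sum_p (rq (mu p) a)%:C%C * z (mu p) x.
Proof.
move=> ra; have [aE trE] := HE ra; have aaE := root_space_adj cG mT basT aE.
have MA : z a x *: (torus_mx x *m A (adj (E a))) = A (adj (E a)) *m torus_mx x.
  apply: mx_col_inj => p; rewrite -scalemxAl -(mulmxA (torus_mx x)).
  rewrite -(mulmxA (A (adj (E a)))) (torus_mx_wt x (muP p)).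
  have H := wtv_root cG mT basT (@rep_module R n r D V) aaE (muP p).
  have -> : torus_mx x *m (A (adj (E a)) *m col p P) = z (mu p - a) x *: (A (adj (E a)) *m col p P).
    exact: torus_mx_wt H.
  rewrite scalerA -scalemxAr; apply: scalar_act.
  by rewrite /z -cisD -mulrDr -evD addrC subrK.
have trS : \sum_p (rq (mu p) a)%:C%C * z (mu p) x = \tr (A (lbr (E a) (adj (E a))) *m torus_mx x).
  apply/esym/tr_eigen => p.
  rewrite -(mulmxA (A (lbr (E a) (adj (E a))))) (torus_mx_wt x (muP p)) -scalemxAr.
  by rewrite (rep_root_bracket ra (muP p)) scalerA mulrC.
have T1 : cas_term a x = z a x * \tr (A (adj (E a)) *m A (E a) *m torus_mx x).
  rewrite /cas_term -(mulmxA (A (E a))) -MA -scalemxAr mxtraceZ; congr (_ * _).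
  rewrite mxtrace_mulC -(mulmxA (torus_mx x)) mxtrace_mulC.
  by [].
have gE : glie D (E a) by case: aE.
have trB : \sum_p (rq (mu p) a)%:C%C * z (mu p) x =
    cas_term a x - \tr (A (adj (E a)) *m A (E a) *m torus_mx x).
  rewrite trS; transitivity (\tr ((A (E a) *m A (adj (E a)) - A (adj (E a)) *m A (E a)) *m torus_mx x)).
    exact: (congr1 (fun B => \tr (B *m torus_mx x)) (ract_lbr V gE (glie_adj cG gE))).
  by rewrite mulmxBl raddfB.
move: {trS} T1 trB.
move: (cas_term a x) (\tr (A (adj (E a)) *m A (E a) *m torus_mx x)) (\sum_p _) => T t S T1 ->.
by rewrite mulrBr -T1 mulrBl mul1r.
Qed.

(** The trace of the Casimir operator times a torus element, computed once as a scalar multiple of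
    the character and once term by term. *)
Lemma casimir_trace x : cas_scalar * \sum_p z (mu p) x =
  \sum_p (rq (mu p) (mu p))%:C%C * z (mu p) x + \sum_(a <- rs) cas_term a x.
Proof.
have -> : cas_scalar * \sum_p z (mu p) x = \tr (casimir *m torus_mx x).
  rewrite casimir_scalar mul_scalar_mx mxtraceZ; congr (_ * _).
  by apply/esym/tr_eigen => p; rewrite (torus_mx_wt x (muP p)).
rewrite /casimir big_sumType /= mulmxDl raddfD /=; congr (_ + _).
  apply: tr_eigen => p; rewrite -(mulmxA _ (torus_mx x)) (torus_mx_wt x (muP p)) -scalemxAr mulrC -scalerA.
  congr (_ *: _); rewrite -(casT (muP p)) mulmx_suml.
  by apply: eq_bigr => j _; rewrite mulmxA.
rewrite (sum_rs (fun a => A (E a) *m A (adj (E a)))) mulmx_suml raddf_sum.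
by [].
Qed.

End Casimir.

(** * Simple reflections and the Weyl group *)

Section Roots.
Context {R : realType} {n r : nat} (D : lie_data R n r).
Hypotheses (cG : compact_group (grp D)) (simpleK : simple_lie (lie (grp D))).
Hypotheses (mT : maximal_torus (grp D) (tor D)) (basT : torus_basis D).
Hypothesis simpS : simple_system D.
Implicit Types (a b : 'rV[R]_r) (x y h : 'cV[R]_r) (w : 'M[R]_r).

Local Notation cor := (coroot D).
Local Notation rs := (rootseq D).
Local Notation rq := (rq D).
Local Notation s := (size (simple_roots D)).

(** One matrix serves both reflections: on the dual of t it acts by multiplication on the right, on
    t by multiplication on the left. *)
Definition Smx a : 'M[R]_r := 1%:M - cor a *m a.

Lemma ev_scalar b x : b *m x = (ev b x)%:M.
Proof. by rewrite [LHS]mx11_scalar. Qed.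

Lemma refl_mx a b : refl D a b = b *m Smx a.
Proof. by rewrite /refl /Smx mulmxBr mulmx1 mulmxA ev_scalar mul_scalar_mx. Qed.

Lemma st_mx a x : s_t D a x = Smx a *m x.
Proof. by rewrite /s_t /Smx mulmxBl mul1mx -mulmxA ev_scalar mul_mx_scalar. Qed.

Lemma ev_mul b w x : ev (b *m w) x = ev b (w *m x).
Proof. by rewrite /ev mulmxA. Qed.

Lemma Smx_sq a : is_root D a -> Smx a *m Smx a = 1%:M.
Proof.
move=> ra; rewrite {2}/Smx mulmxBr mulmx1 /Smx mulmxA mulmxBl mul1mx -(mulmxA _ a).
rewrite ev_scalar (ev_coroot_self cG mT basT ra) mul_mx_scalar scaler_nat mulr2n.
by rewrite opprD addrA subrr sub0r mulNmx opprK subrK.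
Qed.

(** Factoring one block matrix in two ways gives [det (1 - u a) = 1 - a u], and the coroot takes the
    value 2. *)
Lemma det_Smx a : is_root D a -> \det (Smx a) = -1.
Proof.
move=> ra; pose u := cor a.
have E1 : block_mx (1%:M : 'M[R]_r) u a (1%:M : 'M[R]_1) =
    block_mx 1%:M 0 a 1%:M *m block_mx 1%:M u 0 (1%:M - a *m u).
  rewrite mulmx_block ?(mul1mx, mul0mx, mulmx0, mulmx1) ?addr0.
  by rewrite addrCA subrr addr0.
have E2 : block_mx (1%:M : 'M[R]_r) u a (1%:M : 'M[R]_1) =
    block_mx (1%:M - u *m a) u 0 1%:M *m block_mx 1%:M 0 a 1%:M.
  by rewrite mulmx_block ?(mul1mx, mul0mx, mulmx0, mulmx1) ?add0r subrK.
have : \det (block_mx (1%:M : 'M[R]_r) u a (1%:M : 'M[R]_1)) = \det (Smx a).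
  by rewrite E2 det_mulmx det_ublock det_lblock !det1 !mulr1.
move=> <-; rewrite E1 det_mulmx det_ublock det_lblock !det1 !mul1r det_mx11 !mxE.
by have := ev_coroot_self cG mT basT ra; rewrite /ev mxE => ->; rewrite eqxx /=; ring.
Qed.

Lemma rq_coroot a b : is_root D a -> rq b a = ev b (cor a) * rq a a / 2.
Proof.
move=> ra; rewrite (ev_coroot cG mT basT _ ra).
have a0 : rq a a != 0 by rewrite gt_eqF// (rq_gt0 cG mT basT)//; case: ra.
by field.
Qed.

Lemma rq_refl a b c : is_root D a -> rq (refl D a b) (refl D a c) = rq b c.
Proof.
move=> ra; have C := rqC cG mT basT.
have e d : rq d a = ev d (cor a) * rq a a / 2 by exact: rq_coroot.
rewrite /refl !(rqDl, rqNl, rqZl, rqDr cG mT basT, rqNr cG mT basT, rqZr cG mT basT).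
by rewrite (C a c) (e b) (e c); field.
Qed.

Lemma cor_refl a b : is_root D a -> is_root D b -> cor (refl D a b) = s_t D a (cor b).
Proof.
move=> ra rb; have C := rqC cG mT basT.
have n0 c : is_root D c -> rq c c != 0.
  by move=> rc; rewrite gt_eqF// (rq_gt0 cG mT basT)//; case: rc.
rewrite (coroot_dv cG mT basT (root_refl cG mT basT ra rb)) (rq_refl b b ra).
rewrite /refl dvD dvN dvZ /s_t (ev_coroot cG mT basT _ ra) (ev_coroot cG mT basT _ rb).
rewrite (coroot_dv cG mT basT ra) (coroot_dv cG mT basT rb) (C a b).
have := n0 a ra; have := n0 b rb; move=> h1 h2.
by apply/matrixP => i j; rewrite !mxE; field; rewrite h1 h2.
Qed.

Lemma Smx_refl a b : is_root D a -> is_root D b ->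
  Smx (refl D a b) = Smx a *m Smx b *m Smx a.
Proof.
move=> ra rb; rewrite {1}/Smx (cor_refl ra rb) st_mx refl_mx.
rewrite [Smx b]/Smx; move: (Smx a) (Smx_sq ra) => S S1.
by rewrite mulmxBr mulmx1 mulmxBl S1 !mulmxA.
Qed.

Definition al (i : 'I_s) : 'rV[R]_r := (simple_roots D)`_i.

Definition Bmx : 'M[R]_(s, r) := \matrix_(i < s) al i.

Lemma al_root i : is_root D (al i).
Proof. by case: simpS => _ + _; apply; exact: mem_nth. Qed.

Lemma nncomb_simple i : nncomb (simple_roots D) (al i).
Proof.
exists (fun j => (j == i)%N : nat); rewrite (bigD1 i)//= eqxx scale1r big1 ?addr0// => j ji.
by rewrite (negbTE ji) scale0r.
Qed.

Lemma Bmx_free : row_free Bmx.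
Proof.
apply: inj_row_free => v vB; have [fS _ _] := simpS.
have := @freeP _ _ _ (in_tuple (simple_roots D)); move=> /elimT/(_ fS) H.
apply/rowP => i; rewrite [RHS]mxE; apply: (H (fun i => v 0 i)).
rewrite -[RHS]vB; apply/rowP => j; rewrite summxE [RHS]mxE.
by apply: eq_bigr => k _; rewrite !mxE.
Qed.

Lemma Bmx_full : row_full Bmx.
Proof.
rewrite -[row_full _]/(\rank Bmx == r) -mxrank_tr -[_ == r]/(row_free Bmx^T).
apply: inj_row_free => v vB; apply: trmx_inj; rewrite trmx0.
apply: (roots_separate cG simpleK mT basT) => a ra.
have al0 i : ev (al i) v^T = 0.
  move: vB => /(congr1 trmx); rewrite trmx_mul trmxK trmx0 => vB.
  have -> : ev (al i) v^T = (Bmx *m v^T) i 0.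
    by rewrite /ev [LHS]mxE [RHS]mxE; apply: eq_bigr => j _; rewrite [Bmx _ _]mxE.
  by rewrite vB mxE.
have nn b : nncomb (simple_roots D) b -> ev b v^T = 0.
  move=> [c ->]; rewrite /ev mulmx_suml summxE big1// => i _.
  by rewrite -scalemxAl mxE -/(ev _ _) -/(al i) al0 mulr0.
case: simpS => _ _ /(_ _ ra)[/nn //|/nn].
by rewrite evN => /eqP; rewrite oppr_eq0 => /eqP.
Qed.

(** The fundamental coweights, the basis of t dual to the simple roots. *)
Definition fc (i : 'I_s) : 'cV[R]_r := col i (pinvmx Bmx).

Lemma al_fc i j : ev (al j) (fc i) = (j == i)%:R.
Proof.
have := mulmxVp Bmx_free => /matrixP/(_ j i); rewrite !mxE => <-.
by rewrite /ev mxE; apply: eq_bigr => k _; rewrite !mxE.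
Qed.

Lemma coord_expand b : b = \sum_i ev b (fc i) *: al i.
Proof.
rewrite -[LHS]mulmx1 -(mulVpmx Bmx_full) mulmxA; apply/rowP => j.
rewrite mxE summxE; apply: eq_bigr => i _; rewrite [RHS]mxE [Bmx _ _]mxE; congr (_ * _).
by rewrite /fc /ev [LHS]mxE [RHS]mxE; apply: eq_bigr => k _; rewrite [col _ _ _ _]mxE.
Qed.

Lemma nncomb_fc b i : nncomb (simple_roots D) b -> exists k : nat, ev b (fc i) = k%:R.
Proof.
move=> [c ->]; exists (c i); rewrite /ev mulmx_suml summxE (bigD1 i)//= big1 ?addr0.
  by rewrite -scalemxAl mxE -/(ev _ _) -/(al i) al_fc eqxx mulr1.
by move=> j ji; rewrite -scalemxAl mxE -/(ev _ _) -/(al j) al_fc (negbTE ji) mulr0.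
Qed.

Lemma ev0 x : ev (0 : 'rV[R]_r) x = 0.
Proof. by rewrite /ev mul0mx mxE. Qed.

Lemma ev_sum (I : Type) (t : seq I) (F : I -> 'rV[R]_r) x :
  ev (\sum_(i <- t) F i) x = \sum_(i <- t) ev (F i) x.
Proof. by apply: (big_morph (fun b => ev b x)); [move=> b c; exact: evD|exact: ev0]. Qed.

Lemma pos_or_neg b : is_root D b -> pos_roots D b \/ pos_roots D (- b).
Proof.
move=> rb; case: simpS => _ _ /(_ _ rb)[p|p]; [left|right]; split=> //.
exact: (root_opp cG mT basT).
Qed.

Lemma al_pos i : pos_roots D (al i).
Proof. by split; [exact: al_root|exact: nncomb_simple]. Qed.

(** The reflection changes only the coefficient of [al i]. If the image were negative, all other
    coefficients of [b] would be both nonnegative and nonpositive, so [b] would be a multiple of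
    [al i]. *)
Lemma simple_refl_pos i b : pos_roots D b -> b != al i -> pos_roots D (refl D (al i) b).
Proof.
move=> pb bi; have [rb nb] := pb; have ra := al_root i.
have [//|[_ nr]] := pos_or_neg (root_refl cG mT basT ra rb).
have bE : b = ev b (fc i) *: al i.
  rewrite {1}(coord_expand b) (bigD1 i)//= big1 ?addr0// => j ji.
  have [k kE] := nncomb_fc j nb; have [k' k'E] := nncomb_fc j nr.
  move: k'E; rewrite /refl evN evD evN evZ al_fc eq_sym (negbTE ji) mulr0 subr0 kE.
  move=> /eqP; rewrite eq_sym -addr_eq0 -natrD pnatr_eq0 addn_eq0 => /andP[_ /eqP ->].
  by rewrite scale0r.
have [k kE] := nncomb_fc i nb; rewrite kE in bE.
have b0 : b != 0 by case: rb.
have a0 : rq (al i) (al i) != 0.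
  by rewrite gt_eqF// (rq_gt0 cG mT basT)//; case: ra.
have k0 : k%:R != 0 :> R by apply/eqP => k0; move: b0; rewrite bE k0 scale0r eqxx.
have [z zE] := root_integral cG mT basT rb ra.
(* For [b = k al i] the coroot of [b] takes the value [2 / k] on [al i], an integer. So [k] divides
   2, and [k = 2] is excluded by [root_double]. *)
have : z%:~R * k%:R = 2 :> R.
  rewrite -zE (ev_coroot cG mT basT _ rb) bE !(rqZl, rqZr cG mT basT).
  by field; rewrite k0 a0.
move=> /eqP; rewrite -[k%:R]/((k : int)%:~R) -intrM -[2]/(2%:~R) eqr_int => /eqP zk.
have k2 : (k <= 2)%N.
  apply: dvdn_leq => //; apply/dvdnP; exists `|z|%N.
  by rewrite -[2%N]/(absz 2) -zk abszM.
case: k k2 kE bE k0 zk => [|[|[|//]]] _ kE bE k0 zk.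
- by rewrite eqxx in k0.
- by move: bi; rewrite bE scale1r eqxx.
- by case: (root_double cG mT basT ra); rewrite -bE.
Qed.

Lemma rq_expand b c : rq b c = \sum_i ev b (fc i) * rq (al i) c.
Proof.
rewrite {1}(coord_expand b) /rq ev_sum; apply: eq_bigr => i _; exact: evZ.
Qed.

Definition ht b : R := ev b (\sum_i fc i).

Lemma htE b : ht b = \sum_i ev b (fc i).
Proof. by rewrite /ht /ev mulmx_sumr summxE. Qed.

Lemma ht_al i : ht (al i) = 1.
Proof.
rewrite htE (bigD1 i)//= al_fc eqxx big1 ?addr0// => j ji.
by rewrite al_fc eq_sym (negbTE ji).
Qed.

Lemma ht_nat b : nncomb (simple_roots D) b -> exists k : nat, ht b = k%:R.
Proof.
move=> nb; rewrite htE.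
elim/big_ind: _ => [|_ _ [k ->] [k' ->]|i _]; first by exists 0%N.
  by exists (k + k')%N; rewrite natrD.
exact: nncomb_fc.
Qed.

(** Induction on the height. As [b] has positive norm, it pairs positively with some simple coroot;
    if [b] is not simple, that reflection keeps it positive and lowers its height. *)
Lemma pos_root_ind (Q : 'rV[R]_r -> Prop) : (forall i, Q (al i)) ->
  (forall i b, pos_roots D b -> Q b -> Q (refl D (al i) b)) ->
  forall b, pos_roots D b -> Q b.
Proof.
move=> Q1 Q2 b pb; have [k kE] := ht_nat pb.2.
have [N] := ubnP k; elim: N b k pb kE => // N IH b k pb kE kN.
have [[i ->]|nsimp] := pselect (exists i, b = al i); first exact: Q1.
have [i ip] : exists i, 0 < ev b (cor (al i)).
  apply: contrapT => H; have [b0 _] := pb.1.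
  have := rq_gt0 cG mT basT b0; rewrite ltNge => /negP; apply.
  rewrite rq_expand; apply: sumr_le0 => i _.
  have [k' ->] := nncomb_fc i pb.2; rewrite mulr_ge0_le0//.
  rewrite (rqC cG mT basT) (rq_coroot _ (al_root i)) -mulrA mulr_le0_ge0//; last first.
    by rewrite divr_ge0// (rq_ge0 cG mT basT).
  by rewrite leNgt; apply/negP => ?; apply: H; exists i.
have bi : b != al i by apply/eqP => e; apply: nsimp; exists i.
have pr := simple_refl_pos pb bi; have [k' k'E] := ht_nat pr.2.
rewrite -(reflK cG mT basT b (al_root i)); apply: Q2 => //.
apply: (IH _ k' pr k'E); rewrite ltnS in kN; apply: leq_trans kN.
rewrite -(ltr_nat R) -k'E -kE.
by rewrite /ht /refl evD evN evZ -/(ht (al i)) ht_al mulr1 gtrBl.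
Qed.

End Roots.

Lemma seq_argmax {R : realType} (T : eqType) (f : T -> R) (t : seq T) w0 : w0 \in t ->
  exists2 w, w \in t & forall v, v \in t -> f v <= f w.
Proof.
elim: t w0 => // a t IH w0 _; case: t IH => [_|b t IH].
  by exists a; rewrite ?mem_head// => v; rewrite inE => /eqP ->.
have [w wt wm] := IH b (mem_head _ _).
have [aw|wa] := leP (f a) (f w).
  exists w; first by rewrite inE wt orbT.
  by move=> v; rewrite inE => /orP[/eqP ->//|]; exact: wm.
exists a; first exact: mem_head.
move=> v; rewrite inE => /orP[/eqP ->//|vt].
exact: le_trans (wm _ vt) (ltW wa).
Qed.

(** * The Weyl group, its fundamental chamber and the vector rho *)

Section WeylGroup.
Context {R : realType} {n r : nat} (D : lie_data R n r).
Hypotheses (cG : compact_group (grp D)) (simpleK : simple_lie (lie (grp D))).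
Hypotheses (mT : maximal_torus (grp D) (tor D)) (basT : torus_basis D).
Hypothesis simpS : simple_system D.
Implicit Types (a b : 'rV[R]_r) (x y h : 'cV[R]_r) (w v : 'M[R]_r).

Local Notation cor := (coroot D).
Local Notation rs := (rootseq D).
Local Notation rq := (rq D).
Local Notation s := (size (simple_roots D)).
Local Notation al := (@al R n r D).
Local Notation S := (Smx D).

(** The index counts the letters of a word, reduced or not; inductions on it take the place of the
    length function. *)
Inductive weyl : nat -> 'M[R]_r -> Prop :=
| weyl0 : weyl 0 1%:M
| weylS k i w : weyl k w -> weyl k.+1 (S (al i) *m w).

Definition inW w := exists k, weyl k w.

Let ra i : is_root D (al i). Proof. exact: al_root. Qed.
Let SS i : S (al i) *m S (al i) = 1%:M. Proof. exact: (Smx_sq cG mT basT (ra i)). Qed.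

Lemma weyl_mul j k w v : weyl j w -> weyl k v -> weyl (j + k) (w *m v).
Proof.
move=> jw kv; elim: jw => [|j' i w' _ IH]; first by rewrite mul1mx.
by rewrite -mulmxA addSn; exact: weylS.
Qed.

Lemma weyl1 i : weyl 1 (S (al i)).
Proof. by rewrite -[S _]mulmx1; exact: weylS weyl0. Qed.

Lemma inW1 : inW 1%:M. Proof. by exists 0%N; exact: weyl0. Qed.

Lemma inWM w v : inW w -> inW v -> inW (w *m v).
Proof. by move=> [j jw] [k kv]; exists (j + k)%N; exact: weyl_mul. Qed.

Lemma inW_al i : inW (S (al i)). Proof. by exists 1%N; exact: weyl1. Qed.

Lemma weyl_inv k w : weyl k w -> exists v, [/\ weyl k v, w *m v = 1%:M & v *m w = 1%:M].
Proof.
elim=> [|j i u _ [v [jv uv vu]]]; first by exists 1%:M; rewrite mulmx1; split=> //; exact: weyl0.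
exists (v *m S (al i)); split.
- by rewrite -addn1; exact: weyl_mul jv (weyl1 i).
- by rewrite -mulmxA (mulmxA u) uv mul1mx SS.
- by rewrite -mulmxA (mulmxA (S _)) SS mul1mx.
Qed.

Lemma inW_inv w : inW w -> exists v, [/\ inW v, w *m v = 1%:M & v *m w = 1%:M].
Proof. by move=> [k /weyl_inv[v [kv e1 e2]]]; exists v; split=> //; exists k. Qed.

Lemma weyl_last k w : weyl k.+1 w -> exists2 v, weyl k v & exists i, w = v *m S (al i).
Proof.
elim: k w => [|k IH] w H; inversion_clear H as [|k' i u kw].
  inversion_clear kw; exists 1%:M; first exact: weyl0.
  by exists i; rewrite mul1mx mulmx1.
have [v kv [j ->]] := IH _ kw; exists (S (al i) *m v); first exact: weylS.
by exists j; rewrite mulmxA.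
Qed.

Lemma inW_ind (Q : 'M[R]_r -> Prop) : Q 1%:M -> (forall i w, inW w -> Q w -> Q (S (al i) *m w)) ->
  forall w, inW w -> Q w.
Proof. by move=> Q1 QS w [k]; elim=> // j i v jv; apply: QS; exists j. Qed.

Lemma inW_root w b : inW w -> is_root D b -> is_root D (b *m w).
Proof.
move=> Hw; move: w Hw b; apply: inW_ind => [b|i w _ IH b rb]; first by rewrite mulmx1.
by rewrite mulmxA -refl_mx; apply: IH; exact: (root_refl cG mT basT (ra i) rb).
Qed.

Lemma inW_rq w b c : inW w -> rq (b *m w) (c *m w) = rq b c.
Proof.
move=> Hw; move: w Hw b c; apply: inW_ind => [b c|i w _ IH b c]; first by rewrite !mulmx1.
by rewrite !mulmxA IH -!refl_mx (rq_refl cG mT basT _ _ (ra i)).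
Qed.

Lemma inW_weight w b : inW w -> weight_lattice D b -> weight_lattice D (b *m w).
Proof.
move=> Hw; move: w Hw b; apply: inW_ind => [b|i w _ IH b wb]; first by rewrite mulmx1.
rewrite mulmxA; apply: IH => c rc; rewrite ev_mul -st_mx.
rewrite -(cor_refl cG mT basT (ra i) rc); apply: wb.
exact: (root_refl cG mT basT (ra i) rc).
Qed.

Lemma inW_det w : inW w -> \det w = 1 \/ \det w = -1.
Proof.
move: w; apply: inW_ind; first by left; rewrite det1.
by move=> i w _ [] dw; rewrite det_mulmx (det_Smx cG mT basT (ra i)) dw; [right|left]; ring.
Qed.

Lemma weyl_Smx w b : inW w -> is_root D b -> w *m S (b *m w) = S b *m w.
Proof.
move=> Hw; move: w Hw b; apply: inW_ind => [b rb|i w _ IH b rb].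
  by rewrite mul1mx !mulmx1.
rewrite mulmxA -(refl_mx D (al i)) -mulmxA (IH _ (root_refl cG mT basT (ra i) rb)).
by rewrite (Smx_refl cG mT basT (ra i) rb) !mulmxA SS mul1mx.
Qed.

Lemma inW_Smx b : is_root D b -> inW (S b).
Proof.
have H : forall b, pos_roots D b -> inW (S b).
  apply: (pos_root_ind cG simpleK mT basT simpS) => [i|i c pc IH]; first exact: inW_al.
  rewrite (Smx_refl cG mT basT (ra i) pc.1).
  exact: inWM (inWM (inW_al _) IH) (inW_al _).
move=> rb; have [/H//|/H] := pos_or_neg cG mT basT simpS rb.
by rewrite /Smx (corootN cG mT basT rb) mulNmx mulmxN opprK.
Qed.

(** The deletion property. Applying the letters of [w] to [al j] one by one, the root turns negative
    at some letter; just before, it must be the simple root of that letter, so multiplying by the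
    reflection of [al j] erases the letter. *)
Lemma weyl_deletion k w j : weyl k w -> pos_roots D (- (al j *m w)) ->
  exists2 k', (k' < k)%N & weyl k' (S (al j) *m w).
Proof.
elim: k w => [|k IH] w kw pw.
  inversion kw; subst; rewrite mulmx1 in pw.
  exfalso; have := ht_nat simpS pw.2 => -[k].
  rewrite /ht evN -/(ht D (al j)) (ht_al simpS) => E.
  by have := oppr_lt0 (1 : R); rewrite ltr01 E ltNge ler0n.
have [v kv [i wE]] := weyl_last kw; subst w.
have rv : is_root D (al j *m v) by apply: inW_root (ra j); exists k.
have [pv|nv] := pos_or_neg cG mT basT simpS rv; last first.
  have [k' kk wk'] := IH v kv nv; exists k'.+1 => //.
  by rewrite mulmxA -addn1; exact: weyl_mul wk' (weyl1 i).
exists k; first exact: ltnSn.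
suff E : al j *m v = al i.
  have := @weyl_Smx v (al j) (ex_intro _ k kv) (ra j); rewrite E => E1.
  by rewrite E1 mulmxA SS mul1mx.
apply/eqP/negPn/negP => ne.
have p := simple_refl_pos cG simpleK mT basT simpS pv ne.
move: p pw; rewrite refl_mx -mulmxA => -[[b0 _] [c cE]] [_ [d dE]].
move: b0; apply/negP; rewrite negbK; apply/eqP.
have nn b : nncomb (simple_roots D) b -> nncomb (simple_roots D) (- b) -> b = 0.
  move=> nb nb'; rewrite (coord_expand cG simpleK mT basT simpS b) big1// => p _.
  have [k1 E1] := nncomb_fc simpS p nb.
  have [k2] := nncomb_fc simpS p nb'.
  rewrite evN E1 => /eqP; rewrite eq_sym -addr_eq0 -natrD pnatr_eq0 addn_eq0 => /andP[_ /eqP ->].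
  by rewrite scale0r.
by apply: nn; [exists c|exists d].
Qed.

Lemma nncomb_ev_ge0 b x : nncomb (simple_roots D) b -> (forall i, 0 <= ev (al i) x) -> 0 <= ev b x.
Proof.
move=> [c ->] H; rewrite /ev mulmx_suml summxE; apply: sumr_ge0 => i _.
by rewrite -scalemxAl mxE mulr_ge0// ?ler0n//; exact: (H i).
Qed.

Lemma weyl_dominant_unique k w x : weyl k w -> (forall i, 0 <= ev (al i) x) ->
  (forall i, 0 <= ev (al i) (w *m x)) -> w *m x = x.
Proof.
have [N] := ubnP k; elim: N k w => // N IH k w kN kw dx dwx.
inversion kw as [|k0 j v kv kE wE]; first by rewrite mul1mx.
rewrite wE.
have rw : is_root D (al j *m w) by apply: inW_root (ra j); exists k.
have kN' : (k0 < N)%N by rewrite -kE ltnS in kN.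
have [pw|nw] := pos_or_neg cG mT basT simpS rw.
  have nv : pos_roots D (- (al j *m v)).
    suff -> : - (al j *m v) = al j *m w by [].
    rewrite -wE mulmxA -refl_mx /refl (ev_coroot_self cG mT basT (ra j)).
    by rewrite scaler_nat mulr2n opprD addrA subrr sub0r mulNmx.
  have [k' kk wk'] := weyl_deletion kv nv.
  rewrite wE in wk'; exact (IH k' w (ltn_trans kk kN') wk' dx dwx).
have y0 : ev (al j) (w *m x) = 0.
  apply/eqP; rewrite eq_le dwx andbT -ev_mul -oppr_ge0 -evN.
  exact: nncomb_ev_ge0 nw.2 dx.
have E : w *m x = v *m x.
  have : S (al j) *m (w *m x) = w *m x by rewrite -st_mx /s_t y0 scale0r subr0.
  by rewrite -{1}wE !mulmxA SS mul1mx => <-.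
by rewrite E; apply: (IH k0 v kN' kv dx) => i; rewrite -E.
Qed.

(** A Weyl group element is determined by the images of the simple roots, which are roots; hence it
    is found among finitely many candidate matrices. *)
Definition Ws : seq 'M[R]_r := undup [seq M <-
  [seq pinvmx (Bmx D) *m \matrix_(i < s) rs`_(f i) | f : {ffun 'I_s -> 'I_(size rs)}] | `[< inW M >]].

Lemma mem_Ws w : w \in Ws <-> inW w.
Proof.
rewrite mem_undup mem_filter; split=> [/andP[/asboolP //]|Hw].
apply/andP; split; first exact/asboolP.
have rw i : al i *m w \in rs by apply/(rootseqP cG mT basT); exact: inW_root Hw (ra i).
have lt i : (index (al i *m w) rs < size rs)%N by rewrite index_mem.
apply/mapP; exists [ffun i => Ordinal (lt i)]; first by rewrite mem_enum.
rewrite -[LHS]mul1mx -(mulVpmx (Bmx_full cG simpleK mT basT simpS)) -mulmxA; congr (_ *m _).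
apply/row_matrixP => i; rewrite rowK ffunE /= nth_index//.
by rewrite row_mul rowK.
Qed.

Lemma Ws_uniq : uniq Ws. Proof. exact: undup_uniq. Qed.

Lemma Ws_perm v : inW v -> perm_eq [seq v *m w | w <- Ws] Ws.
Proof.
move=> Hv; have [u [Hu vu uv]] := inW_inv Hv; apply: uniq_perm.
- rewrite map_inj_uniq ?Ws_uniq// => w1 w2 /(congr1 (mulmx u)).
  by rewrite !mulmxA uv !mul1mx.
- exact: Ws_uniq.
move=> w; apply/mapP/idP => [[w' /mem_Ws Hw' ->]|/mem_Ws Hw]; first exact/mem_Ws/inWM.
exists (u *m w); first exact/mem_Ws/inWM.
by rewrite mulmxA vu mul1mx.
Qed.

Lemma Ws_permr v : inW v -> perm_eq [seq w *m v | w <- Ws] Ws.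
Proof.
move=> Hv; have [u [Hu vu uv]] := inW_inv Hv; apply: uniq_perm.
- rewrite map_inj_uniq ?Ws_uniq// => w1 w2 /(congr1 (mulmx^~ u)).
  by rewrite -!mulmxA vu !mulmx1.
- exact: Ws_uniq.
move=> w; apply/mapP/idP => [[w' /mem_Ws Hw' ->]|/mem_Ws Hw]; first exact/mem_Ws/inWM.
exists (w *m u); first exact/mem_Ws/inWM.
by rewrite -mulmxA uv mulmx1.
Qed.

Lemma sum_Ws (T : nmodType) (F : 'M[R]_r -> T) v : inW v ->
  \sum_(w <- Ws) F (v *m w) = \sum_(w <- Ws) F w.
Proof. by move=> Hv; rewrite -[RHS](perm_big _ (Ws_perm Hv)) big_map. Qed.

Lemma sum_Wsr (T : nmodType) (F : 'M[R]_r -> T) v : inW v ->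
  \sum_(w <- Ws) F (w *m v) = \sum_(w <- Ws) F w.
Proof. by move=> Hv; rewrite -[RHS](perm_big _ (Ws_permr Hv)) big_map. Qed.

Definition posseq : seq 'rV[R]_r := [seq a <- rs | is_pos D a].

Lemma posseqP a : reflect (pos_roots D a) (a \in posseq).
Proof.
rewrite mem_filter; apply: (iffP andP) => [[/asboolP na /(rootseqP cG mT basT) rb]|[rb na]].
  by [].
by split; [exact/asboolP|exact/(rootseqP cG mT basT)].
Qed.

Lemma posseq_uniq : uniq posseq.
Proof. exact: filter_uniq (rootseq_uniq cG mT basT). Qed.

Lemma rhoE : rho D = 2^-1 *: \sum_(a <- posseq) a.
Proof.
rewrite /rho; congr (_ *: _); rewrite (fsbig_seq _ _ posseq_uniq); apply: eq_fsbigl.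
by apply/predeqP => a; split=> /posseqP.
Qed.

Lemma posseq_al i : perm_eq posseq (al i :: rem (al i) posseq).
Proof. by apply: perm_to_rem; apply/posseqP; exact: (al_pos simpS _). Qed.

Lemma posseq_rem i :
  perm_eq [seq refl D (al i) a | a <- rem (al i) posseq] (rem (al i) posseq).
Proof.
have memr a : a \in rem (al i) posseq = (a != al i) && (a \in posseq).
  by rewrite mem_rem_uniq ?posseq_uniq// inE.
have cl a : a \in rem (al i) posseq -> refl D (al i) a \in rem (al i) posseq.
  rewrite !memr => /andP[ai /posseqP pa]; apply/andP; split; last first.
    by apply/posseqP; exact: (simple_refl_pos cG simpleK mT basT simpS).
  apply/eqP => E; have := reflK cG mT basT a (ra i); rewrite E => aE.
  have [_] := simple_refl_pos cG simpleK mT basT simpS pa ai; rewrite E => _.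
  have : nncomb (simple_roots D) (- al i).
    move: pa; rewrite -aE => -[_]; rewrite /refl (ev_coroot_self cG mT basT (ra i)).
    by rewrite scaler_nat mulr2n opprD addrA subrr sub0r.
  move=> /(ht_nat simpS)[k].
  rewrite /ht evN -/(ht D (al i)) (ht_al simpS) => E'.
  by have := oppr_lt0 (1 : R); rewrite ltr01 E' ltNge ler0n.
have ur : uniq (rem (al i) posseq) by exact: rem_uniq posseq_uniq.
apply: uniq_perm => //.
  rewrite map_inj_in_uniq// => a b _ _ /(congr1 (refl D (al i))).
  by rewrite !(reflK cG mT basT _ (ra i)).
move=> a; apply/mapP/idP => [[b bp ->]|ap]; first exact: cl.
by exists (refl D (al i) a); [exact: cl|rewrite (reflK cG mT basT _ (ra i))].
Qed.

Lemma refl_rho i : refl D (al i) (rho D) = rho D - al i.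
Proof.
rewrite rhoE (perm_big _ (posseq_al i)) big_cons refl_mx -scalemxAl mulmxDl mulmx_suml.
under [X in _ + X]eq_bigr do rewrite -refl_mx.
rewrite -refl_mx -(big_map (refl D (al i)) predT id) (perm_big _ (posseq_rem i)) /=.
rewrite /refl (ev_coroot_self cG mT basT (ra i)).
by apply/matrixP => p q; rewrite !mxE; field.
Qed.

Lemma rho_al i : ev (rho D) (cor (al i)) = 1.
Proof.
have := refl_rho i; rewrite /refl => /addrI/oppr_inj E.
have [a0 _] := ra i; apply/eqP; rewrite -subr_eq0; apply/eqP.
have : (ev (rho D) (cor (al i)) - 1) *: al i = 0 by rewrite scalerBl E scale1r subrr.
by move=> /eqP; rewrite scaler_eq0 (negbTE a0) orbF => /eqP.
Qed.

Lemma root_weight b : is_root D b -> weight_lattice D b.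
Proof. by move=> rb a ha; have [z ->] := root_integral cG mT basT ha rb; exact: intr_int. Qed.

Lemma weight_lin b c : weight_lattice D b -> weight_lattice D c -> weight_lattice D (b + c).
Proof. by move=> wb wc a ha; rewrite evD; apply: rpredD; [exact: wb|exact: wc]. Qed.

Lemma weight_opp b : weight_lattice D b -> weight_lattice D (- b).
Proof. by move=> wb a ha; rewrite evN rpredN; exact: wb. Qed.

Lemma weight0 : weight_lattice D 0.
Proof. by move=> a _; rewrite ev0. Qed.

Lemma weight_simple b : (forall i, ev b (cor (al i)) \is a Num.int) -> weight_lattice D b.
Proof.
move=> H; have Hp : forall a, pos_roots D a -> ev b (cor a) \is a Num.int.
  apply: (pos_root_ind cG simpleK mT basT simpS) => // i a pa IH.
  rewrite (cor_refl cG mT basT (ra i) pa.1) /s_t evDr evNr evZr rpredB// rpredM//.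
  by have [z ->] := root_integral cG mT basT pa.1 (ra i); exact: intr_int.
move=> a ha; have [/Hp//|/Hp] := pos_or_neg cG mT basT simpS ha.
by rewrite (corootN cG mT basT ha) evNr rpredN.
Qed.

Lemma rho_weight : weight_lattice D (rho D).
Proof. by apply: weight_simple => i; rewrite rho_al. Qed.

Lemma rq_al b i : rq b (al i) = ev b (cor (al i)) * (rq (al i) (al i) / 2).
Proof. by rewrite (rq_coroot cG mT basT _ (ra i)) mulrA. Qed.

Lemma rq_al_gt0 i : 0 < rq (al i) (al i) / 2.
Proof. by rewrite divr_gt0// (rq_gt0 cG mT basT)//; case: (ra i). Qed.

(** Maximize the product with [rho] over the orbit: a negative pairing with a simple coroot could be
    improved by the corresponding reflection. *)
Lemma dominant_rep b : exists2 w, inW w & forall i, 0 <= ev (b *m w) (cor (al i)).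
Proof.
have [w /mem_Ws Hw wmax] := seq_argmax (fun w => rq (b *m w) (rho D)) ((mem_Ws _).2 inW1).
exists w => // i; rewrite leNgt; apply/negP => neg.
have /mem_Ws/wmax : inW (w *m S (al i)) by exact: inWM Hw (inW_al i).
rewrite mulmxA -refl_mx /refl rqDl rqNl rqZl (rqC cG mT basT (al i)) rq_al rho_al mul1r.
rewrite gerBl; apply/negP; rewrite -ltNge nmulr_rlt0//; exact: rq_al_gt0.
Qed.

Lemma pos_sum_ge0 b : (forall i, 0 <= ev b (cor (al i))) ->
  forall a, pos_roots D a -> 0 <= rq a b.
Proof.
move=> db a pa; rewrite (rq_expand cG simpleK mT basT simpS); apply: sumr_ge0 => i _.
have [k ->] := nncomb_fc simpS i pa.2.
by rewrite mulr_ge0 ?ler0n// (rqC cG mT basT) rq_al mulr_ge0// ltW// rq_al_gt0.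
Qed.

End WeylGroup.

(** * Alternating exponential sums and the Weyl denominator *)

Section CharIndep.
Context {K : numFieldType} {G : zmodType} {I : finType}.
Variables (Pr : G -> Prop) (chi : I -> G -> K).
Hypothesis PrD : forall g h, Pr g -> Pr h -> Pr (g + h).
Hypothesis chiD : forall i g h, Pr g -> Pr h -> chi i (g + h) = chi i g * chi i h.

Definition char_eq (i j : I) : bool := `[< forall g, Pr g -> chi i g = chi j g >].

(** Dedekind's argument: shift the variable, subtract, and lose one index. Several indices may carry
    the same character, so only the sum over each class of equal characters vanishes. *)
Lemma char_indep_class (s : seq I) (c : I -> K) i0 :
  (forall g, Pr g -> \sum_(i <- s) c i * chi i g = 0) ->
  forall g, Pr g -> \sum_(i <- s | char_eq i i0) c i * chi i g = 0.
Proof.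
have [k] := ubnP (size s); elim: k s c => // k IH s c sk H g Pg.
have [allE|/allPn[j js jn]] := boolP (all (fun i => char_eq i i0) s).
  rewrite -[RHS](H g Pg) big_seq_cond [RHS]big_seq_cond; apply: eq_bigl => i.
  by have [si|//] := boolP (i \in s); rewrite (allP allE i si).
have [h Ph hj] : exists2 h, Pr h & chi j h != chi i0 h.
  apply: contrapT => H'; move/negP: jn; apply; apply/asboolP => h Ph.
  by apply/eqP/negPn/negP => ne; apply: H'; exists h.
pose c' i := c i * (chi i h - chi j h).
have cj g' : c' j * chi j g' = 0 by rewrite /c' subrr mulr0 mul0r.
have E g' (q : pred I) : \sum_(i <- rem j s | q i) c' i * chi i g' =
    \sum_(i <- s | q i) c' i * chi i g'.
  by rewrite [RHS](perm_big _ (perm_to_rem js)) /= big_cons; case: ifP => // _; rewrite cj add0r.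
have Hc : forall g', Pr g' -> \sum_(i <- rem j s) c' i * chi i g' = 0.
  move=> g' Pg'; rewrite E.
  have -> : \sum_(i <- s) c' i * chi i g' =
      \sum_(i <- s) c i * chi i (g' + h) - chi j h * \sum_(i <- s) c i * chi i g'.
    rewrite mulr_sumr -sumrB; apply: eq_bigr => i _; rewrite chiD// /c'; ring.
  by rewrite (H _ (PrD Pg' Ph)) (H _ Pg') mulr0 subr0.
have sz : (size (rem j s) < k)%N by rewrite size_rem//; case: (s) js sk => //= *; lia.
have := IH (rem j s) c' sz Hc g Pg; rewrite E.
have -> : \sum_(i <- s | char_eq i i0) c' i * chi i g =
    (chi i0 h - chi j h) * \sum_(i <- s | char_eq i i0) c i * chi i g.
  rewrite mulr_sumr; apply: eq_bigr => i /asboolP e; rewrite /c' (e h Ph); ring.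
move=> /eqP; rewrite mulf_eq0 => /orP[|/eqP//]; rewrite subr_eq0 eq_sym.
by rewrite (negbTE hj).
Qed.

(** A vanishing sum may be weighted by any function of the character. With [phi] a function of the
    exponent, this acts like a differential operator on identities between exponential sums. *)
Lemma char_indep (c phi : I -> K) :
  (forall g, Pr g -> \sum_i c i * chi i g = 0) ->
  (forall i j, (forall g, Pr g -> chi i g = chi j g) -> phi i = phi j) ->
  forall g, Pr g -> \sum_i c i * phi i * chi i g = 0.
Proof.
move=> H Hphi g Pg; pose N i : K := \sum_(j | char_eq j i) 1.
have NE i : N i = #|[pred j | char_eq j i]|%:R by rewrite /N sumr_const.
have N0 i : N i != 0.
  have ii : char_eq i i by apply/asboolP.
  by rewrite NE pnatr_eq0 -lt0n; apply/card_gt0P; exists i; exact: ii.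
have sym i j : char_eq i j = char_eq j i.
  by apply/asboolP/asboolP => e g' Pg'; rewrite e.
have Nc i j : char_eq i j -> N i = N j.
  move=> /asboolP e; apply: eq_bigl => k; apply/asboolP/asboolP => e' g' Pg'.
    by rewrite e' ?e.
  by rewrite e' -?e.
(* Summing over all [i] meets each class as many times as it has members; dividing by the class size
   [N i] compensates. *)
have : \sum_i (phi i / N i) * \sum_(j | char_eq j i) c j * chi j g = 0.
  by rewrite big1// => i _; rewrite (char_indep_class _ H Pg) mulr0.
move=> H1; rewrite -[RHS]H1; under [RHS]eq_bigr do rewrite mulr_sumr.
rewrite [RHS](exchange_big_dep xpredT) //=; apply: eq_bigr => j _.
rewrite (eq_bigr (fun i => phi j / N j * (c j * chi j g))).
  rewrite sumr_const -[RHS]mulr_natl.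
  have -> : #|[pred i | char_eq j i]|%:R = N j :> K.
    by rewrite NE; congr (_%:R); apply: eq_card => i; rewrite !inE sym.
  by rewrite mulrA [N j * _]mulrC divfK//; ring.
move=> i /= ji; rewrite (Nc _ _ ji); congr (_ / _ * _).
by apply/esym/Hphi; exact/asboolP.
Qed.

End CharIndep.

Section Trig.
Context {R : realType} {r : nat}.
Implicit Types (b c : 'rV[R]_r) (x y : 'cV[R]_r).

Lemma cisevD b c x : cisev (b + c) x = cisev b x * cisev c x.
Proof. by rewrite /cisev evD mulrDr cisD. Qed.

Lemma cisevDr b x y : cisev b (x + y) = cisev b x * cisev b y.
Proof. by rewrite /cisev evDr mulrDr cisD. Qed.

Lemma cisev0 x : cisev (0 : 'rV[R]_r) x = 1.
Proof. by rewrite /cisev ev0 mulr0 cis0. Qed.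

Lemma cisevN b x : cisev b x * cisev (- b) x = 1.
Proof. by rewrite -cisevD subrr cisev0. Qed.

Lemma cisev_neq0 b x : cisev b x != 0.
Proof.
by apply/eqP => H; have := cisevN b x; rewrite H mul0r => /esym/eqP; rewrite oner_eq0.
Qed.

Lemma cisev_sum (I : Type) (t : seq I) (F : I -> 'rV[R]_r) x :
  cisev (\sum_(i <- t) F i) x = \prod_(i <- t) cisev (F i) x.
Proof.
by apply: (big_morph (fun b => cisev b x)); [move=> *; exact: cisevD|exact: cisev0].
Qed.

Lemma cisev_inj b c : (forall x, cisev b x = cisev c x) -> b = c.
Proof.
move=> H; apply/eqP; rewrite -subr_eq0; apply/eqP; apply: ev_inj => h.
rewrite ev0; apply/eqP/negPn/negP => h0.
have := H ((2^-1 / ev (b - c) h) *: h).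
have -> : b = (b - c) + c by rewrite subrK.
rewrite cisevD -[RHS]mul1r => /(mulIf (cisev_neq0 _ _)); rewrite /cisev {1}subrK evZr.
rewrite mulfVK// mulrAC divff ?pnatr_eq0// mul1r /cis cospi => /eqP; rewrite eq_complex /=.
by move=> /andP[/eqP h1 _]; move: h1; lra.
Qed.

End Trig.

(** * Antisymmetric exponential sums and the Weyl denominator *)

Section WCF.
Context {R : realType} {n r : nat} (D : lie_data R n r).
Hypotheses (cG : compact_group (grp D)) (simpleK : simple_lie (lie (grp D))).
Hypotheses (mT : maximal_torus (grp D) (tor D)) (basT : torus_basis D).
Hypothesis simpS : simple_system D.
Implicit Types (a b : 'rV[R]_r) (x y h : 'cV[R]_r) (w v : 'M[R]_r).

Local Notation cor := (coroot D).
Local Notation rs := (rootseq D).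
Local Notation ps := (posseq D).
Local Notation rq := (rq D).
Local Notation s := (size (simple_roots D)).
Local Notation al := (@al R n r D).
Local Notation S := (Smx D).
Local Notation inW := (inW D).
Local Notation Ws := (Ws D).
Local Notation rho := (rho D).

Definition dominant b : Prop := forall i, 0 <= ev b (cor (al i)).

Let ra i : is_root D (al i). Proof. exact: al_root. Qed.

Definition J b x : R[i] := \sum_(w <- Ws) (\det w)%:C%C * cisev b (w *m x).

Lemma cisev_mul b w x : cisev b (w *m x) = cisev (b *m w) x.
Proof. by rewrite /cisev ev_mul. Qed.

Lemma inW_det2 w : inW w -> \det w * \det w = 1.
Proof. by move=> /(inW_det cG mT basT simpS)[] ->; ring. Qed.

Lemma J_mul v b x : inW v -> J (b *m v) x = (\det v)%:C%C * J b x.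
Proof.
move=> Hv; rewrite /J -(sum_Ws cG simpleK mT basT simpS (fun w => (\det w)%:C%C * cisev b (w *m x)) Hv).
rewrite mulr_sumr; apply: eq_bigr => w _.
rewrite det_mulmx mulrA -rmorphM mulrA (inW_det2 Hv) mul1r; congr (_ * _).
by rewrite -mulmxA cisev_mul -!cisev_mul.
Qed.

Lemma J_singular b x i : ev b (cor (al i)) = 0 -> J b x = 0.
Proof.
move=> b0; have := J_mul b x (inW_al i).
rewrite -refl_mx /refl b0 scale0r subr0 (det_Smx cG mT basT (ra i)) rmorphN1 mulN1r => E.
have : J b x *+ 2 = 0 by rewrite mulr2n {1}E addNr.
by move=> /eqP; rewrite mulrn_eq0 => /orP[//|/eqP].
Qed.

Definition anti (f : 'cV[R]_r -> R[i]) : Prop := forall i x, f (S (al i) *m x) = - f x.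

Lemma anti_W f w x : anti f -> inW w -> f (w *m x) = (\det w)%:C%C * f x.
Proof.
move=> af Hw; move: w Hw x; apply: inW_ind => [x|i w _ IH x].
  by rewrite mul1mx det1 mul1r.
by rewrite -mulmxA af IH det_mulmx (det_Smx cG mT basT (ra i)) rmorphM rmorphN1 mulN1r mulNr.
Qed.

Lemma Ws_size_neq0 : (size Ws)%:R != 0 :> R[i].
Proof.
rewrite pnatr_eq0 size_eq0; apply/eqP => W0.
by have := (mem_Ws cG simpleK mT basT simpS 1%:M).2 (inW1 D); rewrite W0.
Qed.

Lemma anti_avg (I : finType) (c : I -> R[i]) (bb : I -> 'rV[R]_r) f x :
  (forall x, f x = \sum_i c i * cisev (bb i) x) -> anti f ->
  (size Ws)%:R * f x = \sum_i c i * J (bb i) x.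
Proof.
move=> fE af; transitivity (\sum_(w <- Ws) (\det w)%:C%C * f (w *m x)).
  transitivity (\sum_(w <- Ws) f x).
    by rewrite big_const_seq count_predT iter_addr_0 mulr_natl.
  apply: eq_big_seq => w /(mem_Ws cG simpleK mT basT simpS) Hw.
  by rewrite (anti_W _ af Hw) mulrA -rmorphM (inW_det2 Hw) mul1r.
under eq_bigr do rewrite fE mulr_sumr.
rewrite exchange_big; apply: eq_bigr => i _ /=; rewrite /J mulr_sumr.
by apply: eq_bigr => w _; rewrite mulrCA.
Qed.

(** Averaging an antisymmetric function over the Weyl group replaces each exponential by its
    alternating sum, so only the exponents that occur have to be understood. *)
Lemma anti_J (I : finType) (c : I -> R[i]) (bb : I -> 'rV[R]_r) f nu :
  (forall x, f x = \sum_i c i * cisev (bb i) x) -> anti f ->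
  (forall i, c i != 0 -> exists k : R[i], forall x, J (bb i) x = k * J nu x) ->
  exists k : R[i], forall x, f x = k * J nu x.
Proof.
move=> fE af H.
have [i|k kE] := @choice _ _ (fun i (k : R[i]) => c i != 0 -> forall x, J (bb i) x = k * J nu x).
  by have [c0|/H[k kE]] := eqVneq (c i) 0; [exists 0|exists k].
exists ((size Ws)%:R^-1 * \sum_i c i * k i) => x.
apply: (mulfI Ws_size_neq0); rewrite (anti_avg x fE af) !mulrA mulfV ?Ws_size_neq0// mul1r.
rewrite mulr_suml; apply: eq_bigr => i _.
by have [->|c0] := eqVneq (c i) 0; [rewrite !mul0r|rewrite (kE i c0) mulrA].
Qed.

Lemma J_rep b : exists2 w, inW w & dominant (b *m w) /\
  exists k : R[i], forall x, J b x = k * J (b *m w) x.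
Proof.
have [w Hw dw] := dominant_rep cG simpleK mT basT simpS b; exists w => //; split=> //.
exists (\det w)%:C%C => x; rewrite (J_mul _ _ Hw) mulrA -rmorphM (inW_det2 Hw) mul1r.
by [].
Qed.

Definition fac a x : R[i] := cisev (2^-1 *: a) x - cisev (- (2^-1 *: a)) x.
Definition delta x : R[i] := \prod_(a <- ps) fac a x.

Lemma fac_S a i x : fac a (S (al i) *m x) = fac (refl D (al i) a) x.
Proof. by rewrite /fac !cisev_mul refl_mx mulNmx scalemxAl. Qed.

Lemma fac_opp a x : fac (- a) x = - fac a x.
Proof. by rewrite /fac scalerN opprK opprB. Qed.

Lemma delta_anti : anti delta.
Proof.
move=> i x; rewrite /delta (perm_big _ (posseq_al cG mT basT simpS i)) [in RHS](perm_big _ (posseq_al cG mT basT simpS i)).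
rewrite !big_cons /= fac_S.
have -> : refl D (al i) (al i) = - al i.
  by rewrite /refl (ev_coroot_self cG mT basT (ra i)) scaler_nat mulr2n opprD addrA subrr sub0r.
rewrite fac_opp mulNr; congr (- (_ * _)).
under eq_bigr do rewrite fac_S.
rewrite -(big_map (refl D (al i)) predT (fun a => fac a x)).
by rewrite (perm_big _ (posseq_rem cG simpleK mT basT simpS i)).
Qed.

Local Notation N := (size ps).
(** A choice of sign for each positive root: these index the terms of the expanded product [delta],
    with exponent [be e] and coefficient [sg e]. *)
Definition eps := {ffun 'I_N -> bool}.
Definition sgb (e : bool) : R := if e then -1 else 1.
Definition be (e : eps) : 'rV[R]_r := \sum_k (sgb (e k) / 2) *: ps`_k.
Definition sg (e : eps) : R[i] := \prod_k (sgb (e k))%:C%C.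

Let psk (k : 'I_N) : pos_roots D (ps`_k).
Proof. by apply/(posseqP cG mT basT); exact: mem_nth. Qed.

Lemma fac_bool a x : fac a x = \sum_(e : bool) (sgb e)%:C%C * cisev ((sgb e / 2) *: a) x.
Proof. by rewrite big_bool /sgb /fac /= !mul1r !mulN1r scaleNr rmorphN1 mulN1r addrC. Qed.

Lemma sum_eps (F : 'I_N -> bool -> R[i]) :
  \prod_k \sum_(e : bool) F k e = \sum_(e : eps) \prod_k F k (e k).
Proof. exact: bigA_distr_bigA. Qed.

Lemma delta_sum x : delta x = \sum_e sg e * cisev (be e) x.
Proof.
rewrite /delta (big_nth 0) big_mkord; under eq_bigr do rewrite fac_bool.
rewrite sum_eps; apply: eq_bigr => e _; rewrite big_split; congr (_ * _).
by rewrite /be cisev_sum.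
Qed.

(** Inserting the sign of the [k]-th factor turns the difference in that factor into a sum, as
    differentiating it would. *)
Lemma delta_sum_k k x : \sum_e sg e * (sgb (e k))%:C%C * cisev (be e) x =
  (cisev (2^-1 *: ps`_k) x + cisev (- (2^-1 *: ps`_k)) x) * \prod_(j | j != k) fac (ps`_j) x.
Proof.
pose F (j : 'I_N) (e : bool) := (sgb e)%:C%C * cisev ((sgb e / 2) *: ps`_j) x *
  (if j == k then (sgb e)%:C%C else 1).
transitivity (\sum_(e : eps) \prod_j F j (e j)).
  apply: eq_bigr => e _; rewrite /F !big_split /= -/(sg e) -cisev_sum -/(be e).
  rewrite -(big_mkcond (fun j : 'I_N => j == k) (fun j : 'I_N => (sgb (e j))%:C%C)) big_pred1_eq.
  by rewrite mulrAC.
rewrite -sum_eps (bigD1 k)//=; congr (_ * _).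
  rewrite big_bool /F eqxx /sgb /= !mulN1r !mul1r scaleNr !rmorphN1 mulN1r mulrN1 opprK.
  by rewrite mulr1 addrC.
apply: eq_bigr => j jk; rewrite fac_bool; apply: eq_bigr => e _.
by rewrite /F (negbTE jk) mulr1.
Qed.

Lemma sum_rootseq (T : nmodType) (g : 'rV[R]_r -> T) :
  \sum_(a <- rs) g a = \sum_(a <- ps) (g a + g (- a)).
Proof.
have pe : perm_eq rs (ps ++ [seq - a | a <- ps]).
  apply: uniq_perm; first exact: rootseq_uniq.
    rewrite cat_uniq (posseq_uniq cG mT basT) (map_inj_uniq oppr_inj) (posseq_uniq cG mT basT) andbT /=.
    apply/hasPn => _ /mapP[a /(posseqP cG mT basT) [_ na] ->].
    apply/negP => /(posseqP cG mT basT) [[a0 _] nna].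
    move: a0; apply/negP; rewrite negbK oppr_eq0; apply/eqP.
    rewrite (coord_expand cG simpleK mT basT simpS a) big1// => p _.
    have [k1 E1] := nncomb_fc simpS p na; have [k2] := nncomb_fc simpS p nna.
    rewrite evN E1 => /eqP; rewrite eq_sym -addr_eq0 -natrD pnatr_eq0 addn_eq0 => /andP[_ /eqP ->].
    by rewrite scale0r.
  move=> a; rewrite mem_cat; apply/idP/orP.
    move=> /(rootseqP cG mT basT) raa; have [p|p] := pos_or_neg cG mT basT simpS raa.
      by left; exact/(posseqP cG mT basT).
    by right; apply/mapP; exists (- a); rewrite ?opprK//; exact/(posseqP cG mT basT).
  move=> [/(posseqP cG mT basT)[h _]|/mapP[b /(posseqP cG mT basT)[h _] ->]].
    exact/(rootseqP cG mT basT).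
  by apply/(rootseqP cG mT basT); exact: (root_opp cG mT basT).
by rewrite (perm_big _ pe) /= big_cat /= big_map -big_split.
Qed.

Lemma rq_sum (I : Type) (t : seq I) (F : I -> 'rV[R]_r) d :
  rq (\sum_(i <- t) F i) d = \sum_(i <- t) rq (F i) d.
Proof.
apply: (big_morph (fun b => rq b d)); first by move=> b c; exact: rqDl.
by rewrite /rq ev0.
Qed.

Lemma rho_rq d : 2 * rq rho d = \sum_(a <- ps) rq a d.
Proof. by rewrite (rhoE cG mT basT) rqZl rq_sum mulrA mulfV ?mul1r// pnatr_eq0. Qed.

(** The left side is at most half the sum of the absolute values of the products of [d] with the
    images of the positive roots. Since [w] permutes the roots up to sign, that sum is the one for
    [rho]. *)
Lemma eps_bound e w d : inW w -> dominant d -> rq (be e *m w) d <= rq rho d.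
Proof.
move=> Hw dd.
have h1 : \sum_(a <- rs) `|rq (a *m w) d| = \sum_(a <- rs) `|rq a d|.
  have [v [Hv wv vw]] := inW_inv cG mT basT simpS Hw.
  rewrite -(big_map (fun a => a *m w) predT (fun a => `|rq a d|)); apply: perm_big.
  have inj : injective (fun a : 'rV[R]_r => a *m w).
    by move=> a c /(congr1 (mulmx^~ v)); rewrite -!mulmxA wv !mulmx1.
  have ur := rootseq_uniq cG mT basT.
  apply: uniq_perm => //; first by rewrite (map_inj_uniq inj).
  move=> a; apply/mapP/idP => [[c /(rootseqP cG mT basT) rc ->]|/(rootseqP cG mT basT) raa].
    by apply/(rootseqP cG mT basT); exact: (inW_root cG mT basT simpS Hw rc).
  exists (a *m v); last by rewrite -mulmxA vw mulmx1.
  by apply/(rootseqP cG mT basT); exact: (inW_root cG mT basT simpS Hv raa).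
have h2 : \sum_(a <- ps) `|rq (a *m w) d| = \sum_(a <- ps) rq a d.
  move: h1; rewrite !sum_rootseq.
  under eq_bigr do rewrite mulNmx rqNl normrN -mulr2n.
  under [in RHS]eq_bigr do rewrite rqNl normrN -mulr2n.
  rewrite !sumrMnl => /(@pmulrnI _ 2 isT) ->.
  rewrite big_seq [RHS]big_seq; apply: eq_bigr => a /(posseqP cG mT basT) pa.
  by rewrite ger0_norm// (pos_sum_ge0 cG simpleK mT basT simpS dd pa).
have -> : rq rho d = \sum_(a <- ps) rq a d / 2.
  by rewrite -mulr_suml -rho_rq; field.
rewrite -mulr_suml -h2 mulr_suml (big_nth 0) big_mkord /be mulmx_suml rq_sum.
apply: ler_sum => k _; rewrite -scalemxAl rqZl.
have := ler_norm (rq (ps`_k *m w) d); have := ler_norm (- rq (ps`_k *m w) d).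
by rewrite normrN /sgb; case: (e k); lra.
Qed.

Lemma be_weight e : weight_lattice D (be e).
Proof.
have -> : be e = rho - \sum_k (if e k then ps`_k else 0).
  rewrite (rhoE cG mT basT) (big_nth 0) big_mkord scaler_sumr -sumrB; apply: eq_bigr => k _.
  by rewrite /sgb; case: (e k); apply/matrixP => i j; rewrite !mxE; field.
apply: weight_lin; first exact: (rho_weight cG simpleK mT basT simpS).
apply: weight_opp; elim/big_ind: _ => [|b c|k _]; [exact: weight0|exact: weight_lin|].
by case: (e k); [exact: (root_weight cG mT basT (psk k).1)|exact: weight0].
Qed.

Lemma dominant_rq_ge0 d : dominant d -> 0 <= rq rho d.
Proof.
move=> dd; have := rho_rq d; have : 0 <= \sum_(a <- ps) rq a d; last lra.
rewrite big_seq; apply: sumr_ge0 => a /(posseqP cG mT basT) pa.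
exact: (pos_sum_ge0 cG simpleK mT basT simpS dd pa).
Qed.

Lemma rq_sub d c : rq (d - c) (d - c) = rq d d - 2 * rq d c + rq c c.
Proof.
rewrite rqDl rqNl !(rqDr cG mT basT) !(rqNr cG mT basT) (rqC cG mT basT c d).
by ring.
Qed.

(** Let [d] be the dominant conjugate of [be e]. If [d] lies on a wall its alternating sum vanishes.
    Otherwise [d - rho] is dominant by integrality, and [(d, d) <= (rho, d)] from [eps_bound] then
    forces [d = rho]. *)
Lemma J_be e : exists2 k : R[i], forall x, J (be e) x = k * J rho x &
  (rq (be e) (be e) != rq rho rho -> k = 0).
Proof.
have [w Hw [dd [k kE]]] := J_rep (be e).
have [[i i0]|reg] := pselect (exists i, ev (be e *m w) (cor (al i)) = 0).
  exists 0 => // x; by rewrite kE (J_singular x i0) mul0r mulr0.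
suff E : be e *m w = rho.
  exists k; first by move=> x; rewrite kE E.
  by rewrite -E (inW_rq cG mT basT simpS _ _ Hw) eqxx.
have wd : weight_lattice D (be e *m w) by exact: (inW_weight cG mT basT simpS Hw (be_weight e)).
have b1 := eps_bound e Hw dd; move: dd wd b1 reg; move: (be e *m w) => d dd wd b1 reg.
have dm : dominant (d - rho).
  move=> i; rewrite evD evN (rho_al cG simpleK mT basT simpS) subr_ge0.
  have /intrP[z zE] := wd _ (ra i); rewrite zE -[1]/(1%:~R) ler_int.
  have := dd i; rewrite zE ler0z; rewrite le_eqVlt => /orP[/eqP z0|//].
  by exfalso; apply: reg; exists i; rewrite zE -z0.
apply/eqP; rewrite -subr_eq0; apply/eqP; apply: (rq_eq0 cG mT basT).
have := dominant_rq_ge0 dm; have := rq_ge0 cG mT basT (d - rho).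
rewrite rq_sub (rqDr cG mT basT) (rqNr cG mT basT) (rqC cG mT basT rho d).
rewrite (rqC cG mT basT d rho) in b1 *; lra.
Qed.

Lemma delta_J : exists k : R[i], forall x, delta x = k * J rho x.
Proof.
apply: (anti_J delta_sum delta_anti) => e _; have [k kE _] := J_be e.
by exists k.
Qed.

End WCF.

(** * The Weyl character formula *)

Section WeylCharacter.
Context {R : realType} {n r : nat} (D : lie_data R n r).
Hypotheses (cG : compact_group (grp D)) (simpleK : simple_lie (lie (grp D))).
Hypotheses (mT : maximal_torus (grp D) (tor D)) (basT : torus_basis D).
Hypothesis simpS : simple_system D.
Implicit Types (a b : 'rV[R]_r) (x y h : 'cV[R]_r) (w v : 'M[R]_r).

Local Notation cor := (coroot D).
Local Notation rs := (rootseq D).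
Local Notation ps := (posseq D).
Local Notation rq := (rq D).
Local Notation al := (@al R n r D).
Local Notation Ws := (Ws D).
Local Notation rho := (rho D).
Local Notation delta := (delta D).
Local Notation fac := fac.
Local Notation J := (J D).
Local Notation be := (@be R n r D).
Local Notation sg := (@sg R n r D).
Local Notation eps := (eps D).

Lemma cisev_indep (I : finType) (c phi : I -> R[i]) (bb : I -> 'rV[R]_r) :
  (forall x, \sum_i c i * cisev (bb i) x = 0) ->
  (forall i j, bb i = bb j -> phi i = phi j) ->
  forall x, \sum_i c i * phi i * cisev (bb i) x = 0.
Proof.
move=> H Hphi x.
apply: (@char_indep _ _ _ (fun=> True) (fun i x => cisev (bb i) x)) => //.
- by move=> i g h _ _; exact: cisevDr.
- by move=> i j E; apply: Hphi; apply: cisev_inj => g; exact: E.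
Qed.

(** [delta] is an eigenfunction of the Laplacian because it is a multiple of [J rho], whose
    exponents all have the norm of [rho]. *)
Lemma delta_laplace x :
  \sum_e sg e * (rq (be e) (be e))%:C%C * cisev (be e) x = (rq rho rho)%:C%C * delta x.
Proof.
have [k kE] := delta_J cG simpleK mT basT simpS.
(* The expanded product minus the multiple of the alternating sum is a vanishing exponential sum
   over the disjoint union of the two index sets, and it is this sum that is weighted. *)
pose I := (eps + 'I_(size Ws))%type.
pose c (i : I) : R[i] := match i with inl e => sg e | inr j => - k * (\det (Ws`_j))%:C%C end.
pose bb (i : I) : 'rV[R]_r := match i with inl e => be e | inr j => rho *m Ws`_j end.
have H0 y : \sum_i c i * cisev (bb i) y = 0.
  rewrite big_sumType /= -(delta_sum D) kE /J (big_nth 0) big_mkord mulr_sumr -big_split big1// => j _ /=.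
  by rewrite cisev_mul !mulNr mulrA subrr.
have := @cisev_indep I c (fun i => (rq (bb i) (bb i) - rq rho rho)%:C%C) bb H0 _ x.
rewrite big_sumType /= [X in _ + X]big1 ?addr0; last first.
  move=> j _; rewrite (inW_rq cG mT basT simpS); last first.
    by apply/(mem_Ws cG simpleK mT basT simpS); exact: mem_nth.
  by rewrite subrr rmorph0 mulr0 mul0r.
move=> H; apply/eqP; rewrite -subr_eq0; apply/eqP; rewrite -[RHS]H; last by move=> i j ->.
rewrite (delta_sum D) mulr_sumr -sumrB; apply: eq_bigr => e _.
by rewrite rmorphB /=; ring.
Qed.

Variables (V : rep D) (l : 'rV[R]_r).
Hypotheses (irrV : rep_irreducible V) (hwV : rep_highest_weight V l).
Hypothesis dl : dominant D l.
Local Notation m := (rdim V).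

Lemma ch_S a x : is_root D a -> ch V (Smx D a *m x) = ch V x.
Proof.
move=> ra; have [P uP [mu [muP nn]]] := weight_diag cG mT basT simpS irrV hwV.
rewrite !(ch_mu cG mT basT uP muP).
rewrite [RHS](sum_mu_refl cG mT basT uP muP (fun b => cisev b x) ra).
by apply: eq_bigr => p _; rewrite cisev_mul refl_mx.
Qed.

Section Terms.
Variables (P : 'M[R[i]]_m) (mu : 'I_m -> 'rV[R]_r) (E : 'rV[R]_r -> cmx R n).
Hypotheses (uP : P \in unitmx) (muP : forall p, wtv D (ract_act (V := V)) (mu p) (col p P)).
Hypothesis HE : forall a, is_root D a -> root_space D a (E a) /\ \tr (E a *m adj (E a)) = 1.

Local Notation T := (cas_term E P mu).
Local Notation SS a x := (\sum_p (rq (mu p) a)%:C%C * cisev (mu p) x).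

(** The relations for [a] and [-a] are combined after the factors [e^a - 1] and [e^-a - 1] are
    written through [e^{a/2} - e^{-a/2}]. *)
Lemma fac_cas a x : is_root D a -> fac a x * (T a x + T (- a) x) =
  (cisev (2^-1 *: a) x + cisev (- (2^-1 *: a)) x) * SS a x.
Proof.
move=> ra; have rna := root_opp cG mT basT ra.
have h1 := cas_term_eq cG mT basT HE uP muP x ra.
have h2 := cas_term_eq cG mT basT HE uP muP x rna.
have Sn : SS (- a) x = - SS a x.
  by rewrite -sumrN; apply: eq_bigr => p _; rewrite (rqNr cG mT basT) rmorphN mulNr.
rewrite Sn in h2; rewrite /fac.
have hh : 2^-1 + 2^-1 = 1 :> R by field.
have ea : cisev a x = cisev (2^-1 *: a) x * cisev (2^-1 *: a) x.
  by rewrite -cisevD -scalerDl hh scale1r.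
have ena : cisev (- a) x = cisev (- (2^-1 *: a)) x * cisev (- (2^-1 *: a)) x.
  by rewrite -cisevD -opprD -scalerDl hh scale1r.
have uu := cisevN (2^-1 *: a) x.
rewrite ea in h1; rewrite ena in h2.
move: (T a x) (T (- a) x) (SS a x) (cisev (2^-1 *: a) x) (cisev (- (2^-1 *: a)) x) h1 h2 uu.
move=> t t' S u u' h1 h2 uu.
have e1 : (u - u') * t = u * S.
  have -> : (u - u') * t = u' * ((u * u - 1) * t) + u * (1 - u * u') * t by ring.
  rewrite h1 uu subrr mulr0 mul0r addr0.
  by rewrite -[RHS]mul1r -uu; ring.
have e2 : (u - u') * t' = u' * S.
  have -> : (u - u') * t' = - (u * ((u' * u' - 1) * t')) - u' * (1 - u * u') * t' by ring.
  rewrite h2 uu subrr mulr0 mul0r subr0.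
  by rewrite -[RHS]mul1r -uu; ring.
by rewrite mulrDr e1 e2 mulrDl.
Qed.

(** The left side is twice the product of the gradients of [delta] and of the character. The product
    rule differentiates one factor of [delta] at a time, and [fac_cas] matches each with a root term
    of the Casimir trace. *)
Lemma delta_gradient x :
  2 * \sum_(e : eps) \sum_p sg e * (rq (be e) (mu p))%:C%C * (cisev (be e) x * cisev (mu p) x) =
  delta x * \sum_(a <- rs) T a x.
Proof.
pose Pi (k : 'I_(size ps)) := \prod_(j < size ps | j != k) fac (ps`_j) x.
have dE (k : 'I_(size ps)) : delta x = fac (ps`_k) x * Pi k.
  by rewrite /delta (big_nth 0) big_mkord (bigD1 k).
have psk (k : 'I_(size ps)) : is_root D (ps`_k).
  by have /(posseqP cG mT basT)[] : ps`_k \in ps by exact: mem_nth.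
have -> : \sum_(a <- rs) T a x = \sum_(k < size ps) (T (ps`_k) x + T (- ps`_k) x).
  by rewrite (sum_rootseq cG simpleK mT basT simpS) (big_nth 0) big_mkord.
rewrite [RHS]mulr_sumr.
transitivity (\sum_(k < size ps) (cisev (2^-1 *: ps`_k) x + cisev (- (2^-1 *: ps`_k)) x) * Pi k * SS (ps`_k) x).
  transitivity (2 * \sum_p \sum_(e : eps)
      sg e * (rq (be e) (mu p))%:C%C * (cisev (be e) x * cisev (mu p) x)).
    by congr (2 * _); exact: exchange_big.
  rewrite mulr_sumr; under [RHS]eq_bigr do rewrite mulr_sumr.
  rewrite [RHS]exchange_big /=; apply: eq_bigr => p _.
  have -> : \sum_(e : eps) sg e * (rq (be e) (mu p))%:C%C * (cisev (be e) x * cisev (mu p) x) =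
     \sum_(k < size ps) \sum_(e : eps) (rq (ps`_k) (mu p) / 2)%:C%C * cisev (mu p) x *
        (sg e * (sgb (e k))%:C%C * cisev (be e) x).
    rewrite exchange_big; apply: eq_bigr => e _ /=.
    rewrite {1}/be rq_sum rmorph_sum mulr_sumr mulr_suml; apply: eq_bigr => k _.
    by rewrite rqZl !rmorphM /=; ring.
  rewrite mulr_sumr; apply: eq_bigr => k _.
  rewrite -mulr_sumr delta_sum_k -/(Pi k) (rqC cG mT basT (mu p)).
  have -> : (rq ps`_k (mu p))%:C%C = 2 * (rq ps`_k (mu p) / 2)%:C%C.
    by rewrite -[2 in RHS](rmorph_nat (@real_complex R)) -rmorphM; congr (_%:C%C); field.
  by ring.
apply: eq_bigr => k _; rewrite (dE k).
by rewrite [RHS]mulrAC (fac_cas x (psk k)) mulrAC.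
Qed.

End Terms.

(** The product is an eigenfunction of the Laplacian, so only exponents with the norm of [l + rho]
    survive. The dominant conjugate [d] of such an exponent satisfies [(d, d) <= (l + rho, d)], and
    equality of norms forces [d = l + rho]. *)
Theorem weyl_character : exists k : R[i], forall x, delta x * ch V x = k * J (l + rho) x.
Proof.
have [P uP [mu [muP nn]]] := weight_diag cG mT basT simpS irrV hwV.
have [E HE] := normalized_root_vectors cG.
pose I := (eps * 'I_m)%type; pose bb (i : I) := be i.1 + mu i.2.
pose K := rq (l + rho) (l + rho).
have F1 x : delta x * ch V x = \sum_(i : I) sg i.1 * cisev (bb i) x.
  rewrite (delta_sum D) (ch_mu cG mT basT uP muP) big_distrlr pair_big /=.
  by apply: eq_bigr => i _; rewrite /bb cisevD mulrA.
(* The Leibniz rule for the Laplacian of a product, read off the expansion of the norm of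
   [be e + mu p]; the Casimir trace supplies the mixed term. *)
have F2 x : \sum_(i : I) sg i.1 * (rq (bb i) (bb i))%:C%C * cisev (bb i) x =
    K%:C%C * (delta x * ch V x).
  have cas := casimir_trace cG mT basT simpS HE irrV hwV uP muP x.
  rewrite -(ch_mu cG mT basT uP muP) in cas.
  have -> : K%:C%C * (delta x * ch V x) =
      (rq rho rho)%:C%C * delta x * ch V x + delta x * (cas_scalar D l * ch V x).
    have -> : K = rq rho rho + (rq l l + \sum_(a <- rs | is_pos D a) rq l a).
      have -> : \sum_(a <- rs | is_pos D a) rq l a = 2 * rq rho l.
        by rewrite (rho_rq cG mT basT) -big_filter; apply: eq_bigr => a _; rewrite (rqC cG mT basT).
      by rewrite /K !rqDl !(rqDr cG mT basT) (rqC cG mT basT l rho); ring.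
    by rewrite rmorphD /= /cas_scalar; ring.
  rewrite cas mulrDr -(delta_gradient uP muP HE) -(delta_laplace x).
  have G e p : sg e * (rq (bb (e, p)) (bb (e, p)))%:C%C * cisev (bb (e, p)) x =
      sg e * (rq (be e) (be e))%:C%C * cisev (be e) x * cisev (mu p) x +
      (2 * (sg e * (rq (be e) (mu p))%:C%C * (cisev (be e) x * cisev (mu p) x)) +
       sg e * cisev (be e) x * ((rq (mu p) (mu p))%:C%C * cisev (mu p) x)).
    rewrite /bb /= cisevD rqDl !(rqDr cG mT basT) (rqC cG mT basT (mu p) (be e)) !rmorphD /=.
    by ring.
  transitivity (\sum_(e : eps) \sum_p
      (sg e * (rq (be e) (be e))%:C%C * cisev (be e) x * cisev (mu p) x +
      (2 * (sg e * (rq (be e) (mu p))%:C%C * (cisev (be e) x * cisev (mu p) x)) +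
       sg e * cisev (be e) x * ((rq (mu p) (mu p))%:C%C * cisev (mu p) x)))).
    by rewrite pair_big; apply: eq_bigr => -[e p] _; exact: G.
  under eq_bigr do rewrite !big_split /=.
  rewrite !big_split /=; congr (_ + _).
    by rewrite (ch_mu cG mT basT uP muP) big_distrlr.
  rewrite addrC (delta_sum D) big_distrlr; congr (_ + _).
  by rewrite mulr_sumr; apply: eq_bigr => e _; rewrite mulr_sumr.
have F3 x : delta x * ch V x =
    \sum_(i : I) (if rq (bb i) (bb i) == K then sg i.1 else 0) * cisev (bb i) x.
  have H0 y : \sum_(i : I) (sg i.1 * (rq (bb i) (bb i) - K)%:C%C) * cisev (bb i) y = 0.
    transitivity (\sum_(i : I) sg i.1 * (rq (bb i) (bb i))%:C%C * cisev (bb i) y -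
        K%:C%C * \sum_(i : I) sg i.1 * cisev (bb i) y).
      by rewrite mulr_sumr -sumrB; apply: eq_bigr => i _; rewrite rmorphB /=; ring.
    by rewrite F2 F1 subrr.
  (* Weighting by the inverse of [norm - K] shows that the terms of norm different from [K] add up
     to 0; the terms of norm [K] already had coefficient 0 in [H0]. *)
  have := @cisev_indep I _ (fun i => ((rq (bb i) (bb i) - K)^-1)%:C%C) bb H0 _ x.
  move=> H; rewrite F1 -[RHS]addr0 -[X in _ + X]H; last by move=> i j ->.
  rewrite -big_split; apply: eq_bigr => i _ /=.
  have [->|ne] := eqVneq (rq (bb i) (bb i)) K; first by rewrite subrr rmorph0 mulr0 !mul0r addr0.
  by rewrite mul0r add0r -(mulrA (sg i.1)) -rmorphM mulfV ?subr_eq0// rmorph1 mulr1.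
apply: (anti_J cG simpleK mT basT simpS F3).
  move=> i x; rewrite (delta_anti cG simpleK mT basT simpS) ch_S ?mulNr//.
  exact: al_root.
move=> i; have [eK _|] := eqVneq (rq (bb i) (bb i)) K; last by rewrite eqxx.
have [w Hw [dd [k kE]]] := J_rep cG simpleK mT basT simpS (bb i).
exists k => x; rewrite kE; congr (_ * J _ _).
have b1 := eps_bound cG simpleK mT basT simpS i.1 Hw dd.
(* The Weyl group permutes the weights, so the conjugate is again a weight and lies below [l]. *)
have [q qE] : exists q, mu q = mu i.2 *m w.
  move: {kE b1 dd} w Hw (i.2); apply: inW_ind => [p|j w Hw IH p]; first by exists p; rewrite mulmx1.
  have : refl D (al j) (mu p) \in [seq mu p | p <- enum 'I_m].
    rewrite (perm_mem (mu_refl cG mT basT uP muP (al_root simpS j))).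
    by apply/mapP; exists p; rewrite ?mem_enum.
  by move=> /mapP[p' _ e]; have [q qE] := IH p'; exists q; rewrite qE -e refl_mx mulmxA.
have b2 : rq (mu i.2 *m w) (bb i *m w) <= rq l (bb i *m w).
  rewrite -qE -subr_ge0 -rqNl -rqDl (rq_expand cG simpleK mT basT simpS).
  apply: sumr_ge0 => j _; have [t ->] := nncomb_fc simpS j (nn q).
  rewrite mulr_ge0 ?ler0n//; exact: (pos_sum_ge0 cG simpleK mT basT simpS dd (al_pos simpS j)).
have b3 : rq (bb i *m w) (bb i *m w) = K by rewrite (inW_rq cG mT basT simpS _ _ Hw).
have b4 : rq (bb i *m w) (bb i *m w) <= rq (l + rho) (bb i *m w).
  have E1 : bb i *m w = be i.1 *m w + mu i.2 *m w by rewrite /bb mulmxDl.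
  move: (bb i *m w) b1 b2 E1 => d b1 b2 E1.
  by rewrite {1}E1 !rqDl [leLHS]addrC; exact: lerD.
apply/eqP; rewrite -subr_eq0; apply/eqP; apply: (rq_eq0 cG mT basT).
have := rq_ge0 cG mT basT (bb i *m w - (l + rho)).
rewrite (rq_sub cG mT basT) (rqC cG mT basT (bb i *m w) (l + rho)) -/K; lra.
Qed.

End WeylCharacter.

(** * Stone-Weierstrass on a compact set *)

Section StoneWeierstrass.
Context {R : realType} {T : topologicalType} (E : set T).
Implicit Types f g : T -> R.

Definition wc f : Prop := forall x, E x -> f @ within E (nbhs x) --> f x.

Lemma wcP f : {within E, continuous f} -> wc f.
Proof. by move=> /subspace_continuousP. Qed.

Lemma wc_near f x e : wc f -> E x -> 0 < e -> \forall y \near x, E y -> `|f x - f y| < e.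
Proof. by move=> wf Ex e0; move/cvgrPdist_lt : (wf x Ex) => /(_ _ e0). Qed.

Lemma wc_cst (c : R) : wc (fun=> c).
Proof. by move=> x _; exact: cvg_cst. Qed.

Lemma wcD f g : wc f -> wc g -> wc (fun x => f x + g x).
Proof. by move=> wf wg x Ex; apply: cvgD; [exact: wf|exact: wg]. Qed.

Lemma wcM f g : wc f -> wc g -> wc (fun x => f x * g x).
Proof. by move=> wf wg x Ex; apply: cvgM; [exact: wf|exact: wg]. Qed.

Lemma wcN f : wc f -> wc (fun x => - f x).
Proof. by move=> wf x Ex; apply: cvgN; exact: wf. Qed.

Lemma wcB f g : wc f -> wc g -> wc (fun x => f x - g x).
Proof. by move=> wf wg; exact: wcD wf (wcN wg). Qed.

Lemma wc_abs f : wc f -> wc (fun x => `|f x|).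
Proof. by move=> wf x Ex; apply: cvg_norm; exact: wf. Qed.

Definition fmax f g : T -> R := fun x => (f x + g x + `|f x - g x|) / 2.
Definition fmin f g : T -> R := fun x => (f x + g x - `|f x - g x|) / 2.

Lemma fmaxE f g x : fmax f g x = Num.max (f x) (g x).
Proof. by rewrite /fmax; case: leP => h; [rewrite ler0_norm|rewrite gtr0_norm]; lra. Qed.

Lemma fminE f g x : fmin f g x = Num.min (f x) (g x).
Proof. by rewrite /fmin; case: leP => h; [rewrite ler0_norm|rewrite gtr0_norm]; lra. Qed.

Lemma wc_max f g : wc f -> wc g -> wc (fmax f g).
Proof.
move=> wf wg; rewrite /fmax; apply: wcM; last exact: wc_cst.
by apply: wcD; [exact: wcD|apply: wc_abs; exact: wcB].
Qed.

Lemma wc_min f g : wc f -> wc g -> wc (fmin f g).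
Proof.
move=> wf wg; rewrite /fmin; apply: wcM; last exact: wc_cst.
by apply: wcB; [exact: wcD|apply: wc_abs; exact: wcB].
Qed.

Hypothesis cE : compact E.

(* Otherwise the complements of the sets satisfying [Q] generate a proper
   filter on E, which has no cluster point. *)
Lemma compact_ind (Q : set T -> Prop) : Q set0 ->
  (forall A B, Q A -> Q B -> Q (A `|` B)) -> (forall A B, A `<=` B -> Q B -> Q A) ->
  (forall x, E x -> exists2 U, nbhs x U & Q (U `&` E)) -> Q E.
Proof.
move=> Q0 QU QS Qloc; apply: contrapT => nQ.
pose F : set_system T := [set S | Q (E `\` S)].
have FF : Filter F.
  split.
  - by rewrite /F /= setDT.
  - move=> A B FA FB; apply: QS (QU _ _ FA FB) => x [Ex /not_andP[]]; by [left|right].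
  - move=> A B AB FA; apply: QS FA => x [Ex nB]; split=> // /AB; exact: nB.
have PF : ProperFilter F.
  by split=> // F0; apply: nQ; apply: QS F0 => x Ex; split.
have FE : F E by rewrite /F /= setDv.
have [x [Ex clx]] := cE PF FE; have [U xU QUE] := Qloc x Ex.
have : F (~` U) by apply: QS QUE => y [Ey /contrapT Uy]; split.
by move=> /clx/(_ xU)[y [nU Uy]]; exact: nU.
Qed.

Lemma wc_bounded f : wc f -> exists2 M, 0 < M & forall x, E x -> `|f x| <= M.
Proof.
move=> wf; pose Q S := exists2 M, 0 < M & forall x, S x -> E x -> `|f x| <= M.
suff [M M0 H] : Q E by exists M => // x Ex; exact: H.
apply: compact_ind.
- by exists 1.
- move=> A B [M M0 H] [M' M'0 H']; exists (M + M'); first exact: addr_gt0.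
  by move=> x [/H h|/H' h] /h h'; apply: le_trans h' _; rewrite ?lerDl ?lerDr ltW.
- by move=> A B AB [M M0 H]; exists M => // x /AB; exact: H.
move=> x Ex; exists [set y | E y -> `|f x - f y| < 1].
  exact: (wc_near wf Ex ltr01).
exists (`|f x| + 1); first by rewrite ltr_wpDl.
move=> y [h' Ey] _; have h := h' Ey; have {h'} := ler_normD (f x) (f y - f x).
rewrite addrC subrK distrC => h'; apply: le_trans h' _; by rewrite lerD2l ltW// distrC.
Qed.

Variable A : (T -> R) -> Prop.
Hypothesis A_cst : forall c, A (fun=> c).
Hypothesis A_D : forall f g, A f -> A g -> A (fun x => f x + g x).
Hypothesis A_M : forall f g, A f -> A g -> A (fun x => f x * g x).
Hypothesis A_wc : forall f, A f -> wc f.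
Hypothesis A_sep : forall x y, E x -> E y -> x <> y -> exists2 f, A f & f x <> f y.

Definition approx f : Prop := forall e, 0 < e ->
  exists2 g, A g & forall x, E x -> `|f x - g x| < e.

(** The classical polynomial iteration that increases to [|t|], the square root of [t ^+ 2]. *)
Fixpoint sqrt_iter (k : nat) (t : R) : R :=
  if k is k'.+1 then sqrt_iter k' t + (t ^+ 2 - sqrt_iter k' t ^+ 2) / 2 else 0.

(** Each step multiplies the error by [1 - (|t| + p)/2], which is at most 1 minus half the error.
    The resulting rate [2/(k+1)] is uniform in [t], also near 0. *)
Lemma sqrt_iter_bound k t : `|t| <= 1 ->
  [/\ 0 <= sqrt_iter k t, sqrt_iter k t <= `|t| & (`|t| - sqrt_iter k t) * k.+1%:R <= 2].
Proof.
move=> t1; have t0 := normr_ge0 t; elim: k => [|k [p0 pt pN]] /=.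
  by split=> //; rewrite subr0 mulr1; apply: le_trans t1 _; rewrite ler1n.
have t2 : t ^+ 2 = `|t| ^+ 2 by rewrite real_normK ?num_real.
rewrite t2; set p := sqrt_iter k t in p0 pt pN *; set a := `|t| in t0 t1 pt pN *.
have N1 : 1 <= k.+1%:R :> R by rewrite ler1n.
rewrite -[k.+2]addn1 natrD; set N := k.+1%:R in pN N1 *.
clearbody a p N; split; [nra|nra|].
have -> : a - (p + (a ^+ 2 - p ^+ 2) / 2) = (a - p) * (1 - (a + p) / 2) by field.
have h1 : (a - p) * (1 - (a + p) / 2) <= (a - p) * (1 - (a - p) / 2).
  by apply: ler_wpM2l; lra.
have h2 : 2 - (a - p) * (1 - (a - p) / 2) * (N + 1) =
  (2 - (a - p) * N) * (1 - (a - p) / 2) + (a - p) ^+ 2 / 2 by field.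
have h3 : 0 <= (2 - (a - p) * N) * (1 - (a - p) / 2) by apply: mulr_ge0; lra.
have h4 : 0 <= (a - p) ^+ 2 / 2 by rewrite divr_ge0 ?sqr_ge0.
apply: (@le_trans _ _ ((a - p) * (1 - (a - p) / 2) * (N + 1))).
  by apply: ler_wpM2r => //; lra.
by rewrite -subr_ge0 h2 addr_ge0.
Qed.

Lemma A_sqrt_iter k g : A g -> A (fun x => sqrt_iter k (g x)).
Proof.
move=> Ag; elim: k => [|k IH] /=; first exact: A_cst.
apply: (A_D IH); apply: A_M (A_cst _).
have H : A (fun x => g x * g x + (-1) * (sqrt_iter k (g x) * sqrt_iter k (g x))).
  by apply: A_D (A_M Ag Ag) _; exact: A_M (A_cst _) (A_M IH IH).
by under eq_fun do rewrite !expr2 -mulN1r.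
Qed.

Lemma approx_A_abs g : A g -> approx (fun x => `|g x|).
Proof.
move=> Ag e e0; have [M M0 gM] := wc_bounded (A_wc Ag).
pose h x := g x * M^-1; have Ah : A h by exact: A_M Ag (A_cst _).
have h1 x : E x -> `|h x| <= 1.
  by move=> /gM gx; rewrite normrM normfV (gtr0_norm M0) ler_pdivrMr// mul1r.
pose k := (Num.bound (2 * M / e)).+1.
exists (fun x => sqrt_iter k (h x) * M); first exact: A_M (A_sqrt_iter k Ah) (A_cst _).
move=> x Ex; have [b0 b1 b2] := sqrt_iter_bound k (h1 x Ex).
have -> : `|g x| = `|h x| * M.
  by rewrite /h normrM normfV (gtr0_norm M0) mulrVK// unitfE gt_eqF.
rewrite -mulrBl normrM (gtr0_norm M0) ger0_norm ?subr_ge0//.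
have kb : 2 * M / e < k.+1%:R.
  apply: lt_trans (archi_boundP _) _; first by rewrite divr_ge0 ?ltW// mulr_gt0.
  by rewrite ltr_nat /k ltnS leqnSn.
have k0 : 0 < k.+1%:R :> R by rewrite ltr0n.
move: kb; rewrite ltr_pdivrMr// => kb; rewrite -(ltr_pM2r k0).
move: b2; set d := _ - _; rewrite [e * _]mulrC; set N := k.+1%:R in kb k0 *.
move=> b2; apply: le_lt_trans kb; have := ler_wpM2r (ltW M0) b2.
by rewrite mulrAC.
Qed.

Lemma approx_A f : A f -> approx f.
Proof. by move=> Af e e0; exists f => // x _; rewrite subrr normr0. Qed.

Lemma approx_D f g : approx f -> approx g -> approx (fun x => f x + g x).
Proof.
move=> af ag e e0; have e2 : 0 < e / 2 by rewrite divr_gt0.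
have [f' Af' ff'] := af _ e2; have [g' Ag' gg'] := ag _ e2.
exists (fun x => f' x + g' x); first exact: A_D.
move=> x Ex; rewrite opprD addrACA; apply: le_lt_trans (ler_normD _ _) _.
by have := ff' x Ex; have := gg' x Ex; lra.
Qed.

Lemma approx_Z f (c : R) : approx f -> approx (fun x => f x * c).
Proof.
move=> af e e0; have c0 : 0 < `|c| + 1 by rewrite ltr_wpDl.
have [f' Af' ff'] := af _ (divr_gt0 e0 c0).
exists (fun x => f' x * c); first exact: A_M Af' (A_cst _).
move=> x Ex; rewrite -mulrBl normrM; have := ff' x Ex; rewrite ltr_pdivlMr// => h.
apply: le_lt_trans h; rewrite ler_wpM2l//; lra.
Qed.

Lemma approx_abs f : approx f -> approx (fun x => `|f x|).
Proof.
move=> af e e0; have e2 : 0 < e / 2 by rewrite divr_gt0.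
have [f' Af' ff'] := af _ e2; have [g Ag gg] := approx_A_abs Af' e2.
exists g => // x Ex; have := ff' x Ex; have := gg x Ex.
have := ler_dist_dist (f x) (f' x); have := ler_distD (`|f' x|) (`|f x|) (g x); lra.
Qed.

Lemma approx_max f g : approx f -> approx g -> approx (fmax f g).
Proof.
move=> af ag; apply: approx_Z; apply: approx_D (approx_D af ag) _; apply: approx_abs.
have := approx_D af (approx_Z (-1) ag).
by under eq_fun do rewrite mulrN1.
Qed.

Lemma approx_min f g : approx f -> approx g -> approx (fmin f g).
Proof.
move=> af ag; apply: approx_Z; apply: approx_D (approx_D af ag) _.
have H : approx (fun x => f x - g x).
  by have := approx_D af (approx_Z (-1) ag); under eq_fun do rewrite mulrN1.
by have := approx_Z (-1) (approx_abs H); under eq_fun do rewrite mulrN1.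
Qed.

Lemma A_interpolate (a b : R) x y : E x -> E y -> (x = y -> a = b) ->
  exists2 h, A h & h x = a /\ h y = b.
Proof.
move=> Ex Ey ab; have [xy|xy] := pselect (x = y).
  by exists (fun=> a); [exact: A_cst|rewrite -(ab xy)].
have [f Af fxy] := A_sep Ex Ey xy.
have d0 : f x - f y != 0 by rewrite subr_eq0; apply/eqP.
exists (fun z => f z * ((a - b) / (f x - f y)) + (b - f y * ((a - b) / (f x - f y)))).
  by apply: A_D; [exact: A_M Af (A_cst _)|exact: A_cst].
by split; field.
Qed.

(** The lattice argument. For fixed [x], finite minima of interpolating functions stay below [f + e]
    everywhere and above [f - e] at [x]; finite maxima of these then approximate [f]. The finite
    subcovers are hidden in [compact_ind]. *)
Theorem stone_weierstrass f : wc f -> approx f.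
Proof.
move=> wf.
have step1 x e : E x -> 0 < e -> exists g, [/\ approx g, wc g, f x - e < g x &
    forall y, E y -> g y < f y + e].
  move=> Ex e0; pose Q S := exists g, [/\ approx g, wc g, f x - e < g x &
    forall y, S y -> E y -> g y < f y + e].
  suff [g [g1 g2 g3 g4]] : Q E by exists g; split=> // y Ey; exact: g4.
  apply: compact_ind.
  - exists (fun=> f x); split=> //; [exact/approx_A/A_cst|exact: wc_cst|lra].
  - move=> S S' [g [g1 g2 g3 g4]] [g' [g'1 g'2 g'3 g'4]]; exists (fmin g g'); split.
    + exact: approx_min.
    + exact: wc_min.
    + by rewrite fminE lt_min g3.
    + by move=> y [Sy|Sy] Ey; rewrite fminE gt_min ?(g4 y Sy Ey)// (g'4 y Sy Ey) orbT.
  - by move=> S S' SS [g [g1 g2 g3 g4]]; exists g; split=> // y /SS; exact: g4.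
  move=> y Ey; have [|h Ah [hx hy]] := @A_interpolate (f x) (f y) x y Ex Ey.
    by move->.
  have e2 : 0 < e / 2 by rewrite divr_gt0.
  exists [set z | (E z -> `|h y - h z| < e / 2) /\ (E z -> `|f y - f z| < e / 2)].
    by apply: filterI; [exact: (wc_near (A_wc Ah) Ey e2)|exact: (wc_near wf Ey e2)].
  exists h; split; [exact: approx_A|exact: A_wc|rewrite hx; lra|].
  move=> z [[h1 h2] Ez] _; move: (h1 Ez) (h2 Ez).
  by rewrite hy !ltr_distlC => /andP[? ?] /andP[? ?]; lra.
move=> e e0; have e2 : 0 < e / 2 by rewrite divr_gt0.
pose Q S := exists g, [/\ approx g, wc g, forall y, E y -> g y < f y + e / 2 &
    forall z, S z -> E z -> f z - e / 2 < g z].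
have [g [g1 _ g3 g4]] : Q E.
  apply: compact_ind.
  - have [[x Ex]|nE] := pselect (exists x, E x).
      by have [g [g1 g2 g3 g4]] := step1 x _ Ex e2; exists g.
    exists (fun=> 0); split=> //; [exact/approx_A/A_cst|exact: wc_cst|].
    by move=> y Ey; case: nE; exists y.
  - move=> S S' [g [g1 g2 g3 g4]] [g' [g'1 g'2 g'3 g'4]]; exists (fmax g g'); split.
    + exact: approx_max.
    + exact: wc_max.
    + by move=> y Ey; rewrite fmaxE gt_max g3// g'3.
    + by move=> y [Sy|Sy] Ey; rewrite fmaxE lt_max ?(g4 y Sy Ey)// (g'4 y Sy Ey) orbT.
  - by move=> S S' SS [g [g1 g2 g3 g4]]; exists g; split=> // y /SS; exact: g4.
  move=> x Ex; have e4 : 0 < e / 2 / 3 by rewrite !divr_gt0.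
  have [g [g1 g2 g3 g4]] := step1 x _ Ex e4.
  exists [set z | (E z -> `|g x - g z| < e / 2 / 3) /\ (E z -> `|f x - f z| < e / 2 / 3)].
    by apply: filterI; [exact: (wc_near g2 Ex e4)|exact: (wc_near wf Ex e4)].
  exists g; split=> // [y Ey|z [[h1 h2] Ez] _]; first by have := g4 y Ey; lra.
  by move: (h1 Ez) (h2 Ez); rewrite !ltr_distlC => /andP[? ?] /andP[? ?]; lra.
have [h Ah gh] := g1 _ e2; exists h => // x Ex.
have := g3 x Ex; have := g4 x Ex Ex; have := gh x Ex.
by rewrite !ltr_norml => /andP[? ?] ? ?; apply/andP; split; lra.
Qed.

End StoneWeierstrass.

(** * The outer measure of a positive functional *)

Section RieszOuter.
Context {R : realType} {T : pointedType} (C : (T -> R) -> Prop) (E : set T) (L : (T -> R) -> R).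
Hypothesis C_cst : forall c, C (fun=> c).
Hypothesis C_D : forall f g, C f -> C g -> C (fun x => f x + g x).
Hypothesis C_M : forall f g, C f -> C g -> C (fun x => f x * g x).
Hypothesis C_min : forall f g, C f -> C g -> C (fun x => Num.min (f x) (g x)).
Hypothesis L_D : forall f g, C f -> C g -> L (fun x => f x + g x) = L f + L g.
Hypothesis L_Z : forall f (c : R), C f -> L (fun x => c * f x) = c * L f.
Hypothesis L_ge0 : forall f, C f -> (forall x, E x -> 0 <= f x) -> 0 <= L f.
Hypothesis L_1 : L (fun=> 1) = 1.
(* Dini's theorem for increasing sequences with limit at least 1. *)
Hypothesis dini : forall g : nat -> T -> R, (forall k, C (g k)) ->
  (forall k x, E x -> g k x <= g k.+1 x) ->
  (forall x, E x -> forall c, c < 1 -> exists k, c < g k x) ->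
  forall e, 0 < e -> exists k, forall x, E x -> 1 - e < g k x.

Lemma L_le f g : C f -> C g -> (forall x, E x -> f x <= g x) -> L f <= L g.
Proof.
move=> Cf Cg fg; have Cf' : C (fun x => -1 * f x) by exact: C_M (C_cst _) Cf.
have : 0 <= L (fun x => g x + -1 * f x).
  by apply: L_ge0 => [|x Ex]; [exact: C_D|rewrite mulN1r subr_ge0; exact: fg].
by rewrite L_D// L_Z// mulN1r subr_ge0.
Qed.

(** Daniell's construction: a set is covered by an increasing sequence of functions whose limit is
    at least 1 on it, and the cost is a bound for the functional along the sequence. *)
Definition cov (S : set T) (a : R) : Prop := exists g : nat -> T -> R,
  [/\ forall k, C (g k), forall k x, E x -> 0 <= g k x, forall k x, E x -> g k x <= g k.+1 x,
      forall k, L (g k) <= a & forall x, S x -> E x -> forall c, c < 1 -> exists k, c < g k x].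

Definition omr (S : set T) : R := inf [set a | cov S a].

Lemma cov1 S : cov S 1.
Proof.
exists (fun _ _ => 1); split=> // [k|x _ _ c c1]; first by rewrite L_1.
by exists 0%N.
Qed.

Lemma cov_ge0 S a : cov S a -> 0 <= a.
Proof. by move=> [g [Cg g0 _ La _]]; apply: le_trans (La 0%N); apply: L_ge0 => //; exact: g0. Qed.

Lemma omr_inf S : has_inf [set a | cov S a].
Proof. by split; [exists 1; exact: cov1|exists 0 => a /cov_ge0]. Qed.

Lemma omr_le S a : cov S a -> omr S <= a.
Proof. by move=> Sa; apply: ge_inf => //; case: (omr_inf S). Qed.

Lemma omr_ge0 S : 0 <= omr S.
Proof. by apply: lb_le_inf => [|a /cov_ge0//]; case: (omr_inf S). Qed.

Lemma omr_lt S e : 0 < e -> exists2 a, cov S a & a < omr S + e.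
Proof. by move=> e0; have [a Sa ae] := inf_adherent e0 (omr_inf S); exists a. Qed.

Lemma omr_mono S S' : S `<=` S' -> omr S <= omr S'.
Proof.
move=> SS; apply: lb_le_inf => [|a [g [g1 g2 g3 g4 g5]]]; first by case: (omr_inf S').
by apply: omr_le; exists g; split=> // x /SS; exact: g5.
Qed.

(** A sequence covering [E] exceeds [1 - e] uniformly from some index on by Dini's theorem, so its
    cost is at least [1 - e]. *)
Lemma omr_E : omr E = 1.
Proof.
apply/eqP; rewrite eq_le (omr_le (cov1 E)) /=; apply: lb_le_inf; first by case: (omr_inf E).
move=> a [g [g1 g2 g3 g4 g5]]; apply/ler_addgt0Pl => e e0.
have [k kE] := dini g1 g3 (fun x Ex => g5 x Ex Ex) e0.
have : L (fun=> 1 - e) <= L (g k) by apply: L_le => // x /kE/ltW.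
have -> : L (fun=> 1 - e) = 1 - e.
  have -> : (fun _ : T => 1 - e) = (fun x => (1 - e) * (fun=> 1) x) by apply/funext => x; rewrite mulr1.
  by rewrite L_Z// L_1 mulr1.
by have := g4 k; lra.
Qed.

Definition om (S : set T) : \bar R := (omr S)%:E.

Lemma om0 : om set0 = 0%E.
Proof.
congr EFin; apply/eqP; rewrite eq_le omr_ge0 andbT; apply: omr_le.
exists (fun _ _ => 0); split=> // k.
have -> : (fun _ : T => 0) = (fun x => 0 * (fun=> 1) x) :> (T -> R).
  by apply/funext => x; rewrite mul0r.
by rewrite L_Z// mul0r.
Qed.

Lemma L_sum (F : nat -> T -> R) k : (forall i, C (F i)) ->
  C (fun x => \sum_(i < k) F i x) /\ L (fun x => \sum_(i < k) F i x) = \sum_(i < k) L (F i).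
Proof.
move=> CF; elim: k => [|k [IH1 IH2]].
  rewrite big_ord0; under eq_fun do rewrite big_ord0; split; first exact: C_cst.
  have -> : (fun _ : T => 0) = (fun x => 0 * (fun=> 1) x) :> (T -> R).
    by apply/funext => x; rewrite mul0r.
  by rewrite L_Z// mul0r.
rewrite big_ord_recr /=; under eq_fun do rewrite big_ord_recr /=.
by split; [exact: C_D|rewrite L_D// IH2].
Qed.

Lemma om_subadd : sigma_subadditive om.
Proof.
move=> F; have om_ge0 i : (0 <= om (F i))%E by rewrite lee_fin omr_ge0.
have [->|fin] := eqVneq (\sum_(i <oo) om (F i))%E +oo%E; first by rewrite leey.
have sfin : (\sum_(i <oo) om (F i))%E \is a fin_num.
  by rewrite ge0_fin_numE ?lt_neqAle ?fin ?leey// nneseries_ge0.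
rewrite -(fineK sfin) lee_fin; set s := fine _.
have part k : \sum_(i < k) omr (F i) <= s.
  rewrite -lee_fin fineK// -sumEFin -(big_mkord xpredT (fun i => om (F i))).
  exact: nneseries_lim_ge.
apply/ler_addgt0Pr => e e0.
have [|a aE] := @choice _ _ (fun (i : nat) a => cov (F i) a /\ a < omr (F i) + e * 2^-1 ^+ i.+1).
  move=> i; have [|a h1 h2] := @omr_lt (F i) (e * 2^-1 ^+ i.+1); last by exists a.
  by rewrite mulr_gt0 ?exprn_gt0 ?invr_gt0.
have [|g gE] := @choice _ _ (fun (i : nat) (g : nat -> T -> R) =>
  [/\ forall k, C (g k), forall k x, E x -> 0 <= g k x, forall k x, E x -> g k x <= g k.+1 x,
      forall k, L (g k) <= a i & forall x, F i x -> E x -> forall c, c < 1 -> exists k, c < g k x]).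
  by move=> i; have [[g hg] _] := aE i; exists g.
have g1 i k : C (g i k) by have [h _ _ _ _] := gE i.
have g2 i k x : E x -> 0 <= g i k x by have [_ h _ _ _] := gE i; exact: h.
have g3 i k x : E x -> g i k x <= g i k.+1 x by have [_ _ h _ _] := gE i; exact: h.
have g4 i k : L (g i k) <= a i by have [_ _ _ h _] := gE i.
(* The diagonal sum increases with [k], both in the number of terms and in each term, and covers
   every [F i]. The slacks [e / 2^(i+1)] add up to at most [e]. *)
apply: omr_le; exists (fun k x => \sum_(i < k) g i k x); split.
- by move=> k; exact: (@L_sum (fun i => g i k) k (fun i => g1 i k)).1.
- by move=> k x Ex; apply: sumr_ge0 => i _; exact: g2.
- move=> k x Ex; rewrite big_ord_recr /= -[X in X <= _]addr0; apply: lerD (g2 _ _ _ Ex).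
  by apply: ler_sum => i _; exact: g3.
- move=> k; rewrite (@L_sum (fun i => g i k) k (fun i => g1 i k)).2.
  apply: (@le_trans _ _ (\sum_(i < k) (omr (F i) + e * 2^-1 ^+ i.+1))).
    by apply: ler_sum => i _; apply: le_trans (g4 i k) (ltW (aE i).2).
  rewrite big_split /=; apply: lerD; first exact: part.
  rewrite -mulr_sumr; apply: ler_piMr; first exact: ltW.
  have -> : \sum_(i < k) 2^-1 ^+ i.+1 = 1 - 2^-1 ^+ k :> R.
    elim: k => [|k IH]; first by rewrite big_ord0 expr0 subrr.
    by rewrite big_ord_recr /= IH exprS; field.
  by rewrite gerBl exprn_ge0// invr_ge0.
- move=> x [i _ Fix] Ex c c1; have [_ _ _ _ h] := gE i; have [k ck] := h x Fix Ex c c1.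
  exists (maxn k i.+1); apply: (lt_le_trans ck).
  have mono j j' : (j <= j')%N -> g i j x <= g i j' x.
    move=> /subnK <-; elim: (j' - j)%N => // d IH; rewrite addSn.
    by apply: le_trans IH _; exact: g3.
  apply: (le_trans (mono _ _ (leq_maxl k i.+1))).
  have im : (i < maxn k i.+1)%N by rewrite leq_max ltnSn orbT.
  rewrite (bigD1 (Ordinal im)) //= lerDl; apply: sumr_ge0 => j _; exact: g2.
Qed.

HB.instance Definition _ := isOuterMeasure.Build R T om om0
  (fun S => omr_ge0 S) (fun S S' SS => omr_mono SS) om_subadd.

(* With [u k = min 1 (k phi)] increasing to the indicator of [phi > 0],
   [g k * u k] and [g k * (1 - u j)] cover the two pieces. *)
Lemma om_cara phi U : C phi -> (forall x, E x -> 0 <= phi x) ->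
  (forall x, E x -> U x <-> 0 < phi x) -> om.-caratheodory U.
Proof.
move=> Cphi phi0 UE; apply: le_caratheodory_measurable => X.
rewrite -EFinD lee_fin; apply: lb_le_inf; first by case: (omr_inf X).
move=> a [g [g1 g2 g3 g4 g5]]; apply/ler_addgt0Pr => e e0.
pose u (k : nat) x := Num.min 1 (k%:R * phi x).
have Cu k : C (u k) by apply: C_min => //; exact: C_M.
have u01 k x : E x -> 0 <= u k x <= 1.
  by move=> Ex; rewrite /u le_min ler01 mulr_ge0 ?phi0// ge_min lexx.
have umono k x : E x -> u k x <= u k.+1 x.
  move=> Ex; rewrite /u le_min !ge_min lexx /=; apply/orP; right.
  by rewrite ler_wpM2r ?phi0// ler_nat.
have umonoW j k x : E x -> (j <= k)%N -> u j x <= u k x.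
  move=> Ex /subnK <-; elim: (k - j)%N => // d IH; rewrite addSn.
  by apply: le_trans IH _; exact: umono.
have gmonoW j k x : E x -> (j <= k)%N -> g j x <= g k x.
  move=> Ex /subnK <-; elim: (k - j)%N => // d IH; rewrite addSn.
  by apply: le_trans IH _; exact: g3.
pose gu j k x := g k x * u j x.
have Cgu j k : C (gu j k) by exact: C_M.
have gule j k : L (gu j k) <= a.
  apply: le_trans (g4 k); apply: L_le => // x Ex; have /andP[h1 h2] := u01 j x Ex.
  by rewrite ler_piMr ?g2.
pose A := [set L (gu k k) | k in [set: nat]].
have supA : has_sup A by split; [exists (L (gu 0%N 0%N)); exists 0%N|exists a => _ [k _ <-]; exact: gule].
pose al := sup A.
have [_ [j _ <-] jal] := sup_adherent e0 supA.
have alub k : L (gu k k) <= al by apply: ub_le_sup; [case: supA|exists k].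
have c1 : cov (X `&` U) al.
  exists (fun k => gu k k); split=> //.
  - by move=> k x Ex; rewrite mulr_ge0 ?g2//; case/andP: (u01 k x Ex).
  - move=> k x Ex; apply: ler_pM; [exact: g2|by case/andP: (u01 k x Ex)|exact: g3|exact: umono].
  move=> x [Xx Ux] Ex c c1; have [k ck] := g5 x Xx Ex c c1.
  have p0 := (UE x Ex).1 Ux; pose N := (Num.bound (phi x)^-1); exists (maxn k N).
  apply: (lt_le_trans ck); rewrite /gu.
  have -> : u (maxn k N) x = 1.
    apply/eqP; rewrite /u; apply/eqP; apply: min_idPl.
    rewrite -ler_pdivrMr// div1r; apply: (le_trans (ltW (archi_boundP _))).
      by rewrite invr_ge0 ltW.
    by rewrite ler_nat leq_maxr.
  by rewrite mulr1; apply: gmonoW => //; exact: leq_maxl.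
have Cgu' k : C (fun x => g k x + -1 * gu j k x) by apply: C_D => //; exact: C_M.
have c2 : cov (X `&` ~` U) (a - al + e).
  exists (fun k x => g k x + -1 * gu j k x); split=> //.
  - move=> k x Ex; rewrite mulN1r subr_ge0 ler_piMr ?g2//.
    by case/andP: (u01 j x Ex).
  - move=> k x Ex; rewrite !mulN1r /gu; have /andP[h1 h2] := u01 j x Ex.
    have := g3 k x Ex; nra.
  - move=> k; have step : forall k, (j <= k)%N -> L (fun x => g k x + -1 * gu j k x) <= a - al + e.
      move=> i ji; rewrite L_D//; last exact: C_M.
      rewrite L_Z// mulN1r.
      have : L (gu j j) <= L (gu j i).
        apply: L_le => // x Ex; rewrite ler_wpM2r//; last exact: gmonoW.
        by case/andP: (u01 j x Ex).
      by have := g4 i; move: jal; rewrite -/al; lra.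
    apply: (le_trans _ (step (maxn k j) (leq_maxr _ _))); apply: L_le => // x Ex.
    rewrite !mulN1r /gu; have /andP[h1 h2] := u01 j x Ex.
    have := gmonoW k (maxn k j) x Ex (leq_maxl _ _); nra.
  move=> x [Xx nUx] Ex c clt; have [k ck] := g5 x Xx Ex c clt; exists k.
  have -> : gu j k x = 0; last by rewrite mulr0 addr0.
  have p0 : phi x = 0.
    apply/eqP; rewrite eq_le phi0// andbT leNgt; apply/negP => p.
    by apply: nUx; exact/(UE x Ex).2.
  by rewrite /gu /u p0 mulr0 (min_idPr _) ?mulr0// ler01.
have := omr_le c1; have := omr_le c2; lra.
Qed.

Lemma om_le phi (U : set T) : C phi -> (forall x, E x -> 0 <= phi x) ->
  (forall x, U x -> E x -> 1 <= phi x) -> omr U <= L phi.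
Proof.
move=> Cphi phi0 H; apply: omr_le; exists (fun=> phi); split=> // x Ux Ex c c1.
by exists 0%N; exact: lt_le_trans c1 (H x Ux Ex).
Qed.

Lemma riesz_measure (G : set (set T)) : (forall U, G U -> om.-caratheodory U) ->
  exists P : probability (g_sigma_algebraType G) R, forall A, P A = om A.
Proof.
move=> HG.
have cara (A : set (g_sigma_algebraType G)) : measurable A -> om.-caratheodory A.
  move: A; apply: smallest_sub => //; split.
  - exact: caratheodory_measurable_set0.
  - by move=> A hA; rewrite setTD; exact: caratheodory_measurable_setC.
  - by move=> F hF; exact: caratheodory_measurable_bigcup.
pose m (A : set (g_sigma_algebraType G)) : \bar R := om A.
have msig : semi_sigma_additive m.
  move=> F mF tF mbF.
  apply: (@caratheodory_measure_sigma_additive R T om) => //; last exact: cara.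
  by move=> i; exact: cara.
have m_ge0 A : (0 <= m A)%E by rewrite lee_fin omr_ge0.
pose iM := isMeasure.Build _ _ _ m om0 m_ge0 msig.
pose mM : {measure set (g_sigma_algebraType G) -> \bar R} := HB.pack m iM.
have m1 : mM setT = 1%E.
  congr EFin; apply/eqP; rewrite eq_le (omr_le (cov1 _)) /= -omr_E.
  exact: omr_mono.
pose iP := Measure_isProbability.Build _ _ _ mM m1.
pose P : probability (g_sigma_algebraType G) R := HB.pack m iM iP.
by exists P.
Qed.

End RieszOuter.

(** * Orbit sums separate the points of the alcove *)

Section IntegerPeriods.
Context {R : realType}.

Lemma sin_add_natpi (x : R) k : sin (x + k%:R * pi) = 0 <-> sin x = 0.
Proof.
elim: k => [|k IH]; first by rewrite mul0r addr0.
rewrite -natr1 mulrDl mul1r addrA sinDpi -IH.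
by split=> [/eqP|->]; [rewrite oppr_eq0 => /eqP|rewrite oppr0].
Qed.

Lemma cis_eq1 (t : R) : cis (2%:R * pi * t) = 1 -> t \is a Num.int.
Proof.
move=> H; have c1 : cos (2 * pi * t) = 1 by have := congr1 (@complex.Re R) H.
have s0 : sin (pi * t) = 0.
  have : cos ((pi * t) *+ 2) = 1 by rewrite -c1 -mulr_natl mulrA.
  rewrite cos_mulr2n => /eqP; rewrite subr_eq -mulr2n => /eqP/(@pmulrnI _ 2 isT) c2.
  have := cos2Dsin2 (pi * t); rewrite c2 => /eqP.
  by rewrite -subr_eq0 addrAC subrr add0r sqrf_eq0 => /eqP.
pose z := Num.floor t; have /andP[z1 z2] : z%:~R <= t < (z + 1)%:~R by exact: floor_itv.
pose s := t - z%:~R; have s01 : 0 <= s < 1.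
  by rewrite /s subr_ge0 z1 ltrBlDr addrC; move: z2; rewrite intrD.
have ss : sin (pi * s) = 0.
  rewrite /s; case: z {s01 z1 z2 s} => k.
    by apply/(sin_add_natpi _ k); rewrite -pmulrn [k%:R * pi]mulrC -mulrDr subrK.
  have -> : t - (Negz k)%:~R = t + k.+1%:R by rewrite NegzE rmorphN opprK.
  by rewrite mulrDr [pi * _%:R]mulrC; apply/sin_add_natpi.
have [s0'|sp] := eqVneq s 0.
  by have -> : t = z%:~R by apply/eqP; rewrite -subr_eq0; apply/eqP.
have : 0 < sin (pi * s).
  apply: sin_gt0_pi; case/andP: s01 => h1 h2; apply/andP; split.
    by apply: mulr_gt0; [exact: pi_gt0|rewrite lt_def sp].
  by rewrite gtr_pMr ?pi_gt0.
by rewrite ss ltxx.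
Qed.

End IntegerPeriods.

Section Alcove.
Context {R : realType} {n r : nat} (D : lie_data R n r).
Hypotheses (cG : compact_group (grp D)) (simpleK : simple_lie (lie (grp D))).
Hypotheses (mT : maximal_torus (grp D) (tor D)) (basT : torus_basis D).
Hypotheses (simpS : simple_system D) (hth : highest_root D).
Implicit Types (a b : 'rV[R]_r) (x y q : 'cV[R]_r) (w v : 'M[R]_r).

Local Notation cor := (coroot D).
Local Notation rs := (rootseq D).
Local Notation rq := (rq D).
Local Notation s := (size (simple_roots D)).
Local Notation al := (@al R n r D).
Local Notation inW := (inW D).
Local Notation Ws := (Ws D).

Let ra i : is_root D (al i). Proof. exact: al_root. Qed.

Lemma alcove_al x i : alcove D x -> 0 <= ev (al i) x.
Proof. by move=> [h _]; apply: h; exact: mem_nth. Qed.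

Lemma pos_alcove a x : pos_roots D a -> alcove D x -> 0 <= ev a x <= 1.
Proof.
move=> pa Ax; have A0 i := alcove_al i Ax.
rewrite (nncomb_ev_ge0 pa.2 A0) /=; apply: le_trans Ax.2.
have := nncomb_ev_ge0 (hth.2 a pa.1) A0.
by rewrite evD evN subr_ge0.
Qed.

Lemma root_alcove a x : is_root D a -> alcove D x -> `|ev a x| <= 1.
Proof.
move=> rt Ax; have [pa|pa] := pos_or_neg cG mT basT simpS rt.
  by have /andP[h1 h2] := pos_alcove pa Ax; rewrite ger0_norm.
by have /andP[] := pos_alcove pa Ax; rewrite evN -normrN => h1 h2; rewrite ger0_norm.
Qed.

Lemma gtDr x y z : gt D x (y + z) = gt D x y + gt D x z.
Proof. by rewrite !gt_gram evDr. Qed.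

Lemma gtNr x y : gt D x (- y) = - gt D x y.
Proof. by rewrite !gt_gram evNr. Qed.

Lemma gt_cor a y : is_root D a -> gt D (cor a) y = 2 / rq a a * ev a y.
Proof.
move=> rt; rewrite (coroot_dv cG mT basT rt) (gtC mT basT) gtZr (gtC mT basT).
by rewrite (gt_dv cG mT basT).
Qed.

Lemma dv_gram x : dv D (x^T *m gram D) = x.
Proof. by rewrite /dv mulmxK ?trmxK// (gram_unit cG mT basT). Qed.

(** The trace form turns a multiple of the fundamental coweight [fc i] into the fundamental
    weight. *)
Lemma fundamental_weight i : exists2 om, weight_lattice D om &
  forall j, ev om (cor (al j)) = (j == i)%:R.
Proof.
pose c := rq (al i) (al i) / 2.
have E j : ev ((c *: fc i)^T *m gram D) (cor (al j)) = (j == i)%:R.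
  rewrite (ev_coroot cG mT basT _ (ra j)) (rqC cG mT basT).
  have -> : rq (al j) ((c *: fc i)^T *m gram D) = c * (j == i)%:R.
    by rewrite /rq dv_gram evZr (al_fc simpS).
  have [->|ji] := eqVneq j i; last by rewrite !mulr0 mul0r.
  have n0 : rq (al i) (al i) != 0 by rewrite gt_eqF// (rq_gt0 cG mT basT)//; case: (ra i).
  by rewrite /c /= mulr1; field.
exists ((c *: fc i)^T *m gram D) => //.
by apply: (weight_simple cG simpleK mT basT simpS) => j; rewrite E; exact: intr_nat.
Qed.

Lemma ev_sumr b (I : Type) (t : seq I) (F : I -> 'cV[R]_r) :
  ev b (\sum_(i <- t) F i) = \sum_(i <- t) ev b (F i).
Proof. by rewrite /ev mulmx_sumr summxE. Qed.

Lemma coroot_expand q : exists c : 'I_s -> R, q = \sum_j c j *: cor (al j).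
Proof.
pose a := q^T *m gram D; exists (fun j => ev a (fc j) * (rq (al j) (al j) / 2)).
have dvs (F : 'I_s -> 'rV[R]_r) : dv D (\sum_j F j) = \sum_j dv D (F j).
  apply: (big_morph (dv D)); first by move=> u v; exact: dvD.
  by rewrite -[X in dv D X](scale0r 0) dvZ scale0r.
rewrite -[LHS]dv_gram -/a [in LHS](coord_expand cG simpleK mT basT simpS a) dvs.
apply: eq_bigr => j _; rewrite dvZ (coroot_dv cG mT basT (ra j)) scalerA; congr (_ *: _).
have n0 : rq (al j) (al j) != 0 by rewrite gt_eqF// (rq_gt0 cG mT basT)//; case: (ra j).
by field.
Qed.

(** This is the coroot lattice: the fundamental weights read off the coefficients along the simple
    coroots. *)
Definition colattice q : Prop := forall b, weight_lattice D b -> ev b q \is a Num.int.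

(* A nonzero vector of the coroot lattice is moved by a simple reflection to
   one with smaller coefficients, so it cannot be minuscule. *)
Lemma no_minuscule N (m : 'I_s -> int) : (\sum_j `|m j| < N)%N ->
  (forall a, is_root D a -> `|ev a (\sum_j (m j)%:~R *: cor (al j))| <= 1) ->
  \sum_j (m j)%:~R *: cor (al j) = 0.
Proof.
elim: N m => // N IH m mN; set q := \sum_j _ => q1.
apply: contrapT => q0.
have gq : 0 < gt D q q.
  rewrite lt_def (gtxx cG mT basT) frob_ge0 andbT; apply/eqP => g0; apply: q0.
  by apply: (gt_eq0 cG mT basT); rewrite (gtxx cG mT basT).
have [i ip] : exists i, 0 < (m i)%:~R * ev (al i) q.
  apply: contrapT => H; move: gq; rewrite ltNge => /negP; apply.
  rewrite {2}/q; have -> : gt D q (\sum_j (m j)%:~R *: cor (al j)) = \sum_j (m j)%:~R * gt D q (cor (al j)).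
    by rewrite gt_gram ev_sumr; apply: eq_bigr => j _; rewrite evZr -gt_gram.
  apply: sumr_le0 => j _; rewrite (gtC mT basT) (gt_cor _ (ra j)) mulrCA.
  rewrite mulr_ge0_le0 ?divr_ge0 ?(rq_ge0 cG mT basT)//.
  by rewrite leNgt; apply/negP => ?; apply: H; exists j.
have /intrP[k kE] : ev (al i) q \is a Num.int.
  rewrite /q ev_sumr; apply: rpred_sum => j _; rewrite evZr rpredM ?intr_int//.
  exact: (root_weight cG mT basT (ra i) (ra j)).
have k1 : (`|k| <= 1)%R by have := q1 _ (ra i); rewrite kE -intr_norm -[1]/(1%:~R) ler_int.
rewrite kE -intrM ltr0z in ip.
pose m' j := if j == i then m j - k else m j.
have q'E : \sum_j (m' j)%:~R *: cor (al j) = q - k%:~R *: cor (al i).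
  rewrite /q (bigD1 i) //= [in RHS](bigD1 i) //= /m' eqxx intrB scalerBl addrAC; congr (_ + _ - _).
  by apply: eq_bigr => j ji; rewrite (negbTE ji).
have q'S : q - k%:~R *: cor (al i) = s_t D (al i) q by rewrite /s_t kE.
have : \sum_j (m' j)%:~R *: cor (al j) = 0.
  apply: IH => [|a rt]; last first.
    rewrite q'E q'S st_mx -ev_mul -refl_mx; apply: q1; exact: (root_refl cG mT basT (ra i) rt).
  rewrite ltnS in mN; apply: leq_trans mN.
  rewrite (bigD1 i) //= [X in (_ < X)%N](bigD1 i) //= /m' eqxx.
  rewrite (eq_bigr (fun j => `|m j|%N)) => [|j ji]; last by rewrite (negbTE ji).
  rewrite ltn_add2r.
  have [k0|[k0|k0]] : k = 0 \/ k = 1 \/ k = -1 by move: k1; clear; lia.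
  - by move: ip; rewrite k0 mulr0 ltxx.
  - by move: ip; rewrite k0 mulr1; clear; lia.
  - by move: ip; rewrite k0 mulrN1; clear; lia.
rewrite q'E q'S => S0; apply: q0.
have := Smx_sq cG mT basT (ra i) => S2.
rewrite -[q]mul1mx -S2 -mulmxA.
have E : Smx D (al i) *m q = 0 by rewrite -S0 st_mx.
by rewrite E mulmx0.
Qed.

Lemma colattice_minuscule q : colattice q -> (forall a, is_root D a -> `|ev a q| <= 1) -> q = 0.
Proof.
move=> Qq q1; have [c cE] := coroot_expand q.
have [j|m mE] := @choice _ _ (fun j (z : int) => c j = z%:~R).
  have [om wom omE] := fundamental_weight j; have := Qq om wom.
  rewrite cE ev_sumr (bigD1 j)//= evZr omE eqxx mulr1 big1 ?addr0 => [/intrP//|i ij].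
  by rewrite evZr omE (negbTE ij) mulr0.
have qE : q = \sum_j (m j)%:~R *: cor (al j).
  by rewrite cE; apply: eq_bigr => j _; rewrite mE.
by rewrite qE; apply: no_minuscule (ltnSn _) _; rewrite -qE.
Qed.

(** Descent on the norm of the translation [q]. If all roots are at most 1 in absolute value on [q],
    then [q = 0] and the chamber argument applies. Otherwise some root is at least 2 on [q], and the
    bounds on the alcove force it to be 2 on [q] and 1 at the image point. *)
Lemma affine_unique (e : R) N w q x : 0 < e -> (forall a, is_root D a -> e <= 4 / rq a a) ->
  inW w -> colattice q -> gt D q q < N%:R * e -> alcove D x -> alcove D (w *m x + q) ->
  w *m x + q = x.
Proof.
move=> e0 eP; elim: N w q => [|N IH] w q Hw Qq qN Ax Ay.
  by move: qN; rewrite mul0r (gtxx cG mT basT) ltNge frob_ge0.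
have [q1|] := pselect (forall a, is_root D a -> `|ev a q| <= 1).
  have q0 := colattice_minuscule Qq q1; rewrite q0 addr0 in Ay *.
  have [k kw] := Hw; apply: (weyl_dominant_unique cG simpleK mT basT simpS kw) => i; exact: alcove_al.
move=> /existsNP[a' /not_implyP[ra' /negP]]; rewrite -ltNge => a'1.
have [a rt a1] : exists2 a, is_root D a & 1 < ev a q.
  have [h|h] := leP 0 (ev a' q); first by exists a'; rewrite // -(ger0_norm h).
  by exists (- a'); [exact: (root_opp cG mT basT)|rewrite evN -(ltr0_norm h)].
have a2 : 2 <= ev a q.
  have /intrP[k kE] := Qq a (root_weight cG mT basT rt); move: a1; rewrite kE.
  by rewrite -[1]/(1%:~R) -[2]/(2%:~R) ltr_int ler_int; lia.
have b1 := root_alcove rt Ay; have b2 := root_alcove (inW_root cG mT basT simpS Hw rt) Ax.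
rewrite evDr in b1; rewrite ev_mul in b2.
move: b1 b2; rewrite !ler_norml => /andP[_ b1] /andP[b2 _].
have aq : ev a q = 2 by lra.
have ay : ev a (w *m x + q) = 1 by rewrite evDr; lra.
(* The image lies on the hyperplane [a = 1], so it is fixed by the affine reflection there.
   Composing with it replaces [q] by [q - cor a], whose squared norm is smaller by [4 / rq a a]. *)
have E : w *m x + q = Smx D a *m w *m x + (q - cor a).
  have : s_t D a (w *m x + q) + cor a = w *m x + q by rewrite /s_t ay scale1r subrK.
  rewrite st_mx mulmxDr mulmxA -(st_mx D a q) /s_t aq => {1}<-.
  by rewrite scaler_nat mulr2n opprD -!addrA addNr addr0.
rewrite E; apply: IH => //.
- by apply: inWM Hw; exact: (inW_Smx cG simpleK mT basT simpS).
- move=> b wb; rewrite evDr evNr rpredB//; [exact: Qq|exact: wb].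
- rewrite gtDr gtNr (gtC mT basT _ q) (gtC mT basT _ (cor a)) !gtDr !gtNr (gtC mT basT q (cor a)).
  rewrite !(gt_cor _ rt) aq (ev_coroot_self cG mT basT rt).
  have := eP a rt; move: qN; rewrite -natr1 mulrDl mul1r.
  have -> : 4 / rq a a = 2 / rq a a * 2 by rewrite mulrAC -natrM.
  lra.
- by rewrite -E.
Qed.

Definition orbit_sum b x : R[i] := \sum_(w <- Ws) cisev b (w *m x).

(** For fixed points the exponentials are characters of the weight lattice. Independence of these
    characters yields some [w] with [w *m x] equal to [y] modulo the coroot lattice, and
    [affine_unique] concludes. *)
Theorem alcove_separation x y : alcove D x -> alcove D y ->
  (forall b, weight_lattice D b -> orbit_sum b x = orbit_sum b y) -> x = y.
Proof.
move=> Ax Ay H.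
have [w Hw wy] : exists2 w, inW w & forall b, weight_lattice D b -> cisev b (w *m x) = cisev b y.
  apply: contrapT => nH; pose I := ('I_(size Ws) + 'I_(size Ws))%type.
  pose c (i : I) : R[i] := if i is inl _ then 1 else -1.
  pose chi (i : I) b : R[i] := match i with
    inl k => cisev b (Ws`_k *m x) | inr k => cisev b (Ws`_k *m y) end.
  (* This weight selects the indices with the character of [y]. If none came from [x], the weighted
     sum at the weight 0 would count, up to sign, only indices from [y], and the identity gives at
     least one. *)
  pose phi (i : I) : R[i] := if `[< forall b, weight_lattice D b -> chi i b = cisev b y >] then 1 else 0.
  have chiD i b b' : weight_lattice D b -> weight_lattice D b' -> chi i (b + b') = chi i b * chi i b'.
    by move=> _ _; case: i => k; exact: cisevD.
  have H0 b : weight_lattice D b -> \sum_i c i * chi i b = 0.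
    move=> wb; rewrite big_sumType /= /c; under eq_bigr do rewrite mul1r.
    under [X in _ + X]eq_bigr do rewrite mulN1r.
    have sumE u : orbit_sum b u = \sum_(k < size Ws) cisev b (Ws`_k *m u).
      by rewrite /orbit_sum (big_nth 0) big_mkord.
    by rewrite sumrN -!sumE (H b wb) subrr.
  have Hphi i j : (forall g, weight_lattice D g -> chi i g = chi j g) -> phi i = phi j.
    move=> e; rewrite /phi; congr (if _ then _ else _).
    by apply/asboolP/asboolP => h b wb; rewrite -h ?e// e.
  have := @char_indep _ _ I (weight_lattice D) chi (@weight_lin _ _ _ D) chiD c phi H0 Hphi 0 (@weight0 _ _ _ D).
  have chi0 i : chi i 0 = 1 by case: i => k; exact: cisev0.
  under eq_bigr do rewrite chi0 mulr1.
  rewrite big_sumType /= [X in X + _]big1 ?add0r => [|k _]; last first.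
    rewrite /phi; case: asboolP => [h|_]; last by rewrite mulr0.
    by exfalso; apply: nH; exists (Ws`_k) => //; apply/(mem_Ws cG simpleK mT basT simpS); exact: mem_nth.
  rewrite /c; under eq_bigr do rewrite mulN1r.
  rewrite sumrN => /eqP; rewrite oppr_eq0; apply/negP.
  have i1 : 1%:M \in Ws by apply/(mem_Ws cG simpleK mT basT simpS); exact: inW1.
  have lt1 : (index 1%:M Ws < size Ws)%N by rewrite index_mem.
  rewrite (bigD1 (Ordinal lt1)) //=.
  have -> : phi (inr (Ordinal lt1)) = 1.
    by rewrite /phi; case: asboolP => // nh; exfalso; apply: nh => b _; rewrite /chi /= nth_index// mul1mx.
  rewrite gt_eqF// ltr_wpDr ?ltr01//; apply: sumr_ge0 => j _.
  by rewrite /phi; case: ifP.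
have Qq : colattice (y - w *m x).
  move=> b wb; apply: cis_eq1; rewrite -/(cisev b (y - w *m x)).
  have := cisevDr b (y - w *m x) (w *m x); rewrite subrK (wy b wb) -[LHS]mul1r.
  by move=> /(mulIf (cisev_neq0 _ _)) <-.
(* A bound for all [rq a a], so that [4 / M] is a lower bound for the decrease at every step of the
   descent. *)
pose M : R := 1 + \sum_(a <- rs) rq a a.
have rqs0 : 0 <= \sum_(a <- rs) rq a a by apply: sumr_ge0 => a _; exact: (rq_ge0 cG mT basT).
have M0 : 0 < M by rewrite ltr_wpDr.
have eP a : is_root D a -> 4 / M <= 4 / rq a a.
  move=> rt; rewrite ler_pM2l// lef_pV2 ?posrE ?(rq_gt0 cG mT basT)//; last by case: rt.
  have ain : a \in rs by exact/(rootseqP cG mT basT).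
  rewrite /M (big_rem a)//= addrCA lerDl addr_ge0//; apply: sumr_ge0 => *; exact: (rq_ge0 cG mT basT).
have e0 : 0 < 4 / M by rewrite divr_gt0.
have yE : y = w *m x + (y - w *m x) by rewrite addrCA subrr addr0.
pose g := gt D (y - w *m x) (y - w *m x).
have g0 : 0 <= g by rewrite /g (gtxx cG mT basT) frob_ge0.
rewrite yE; apply/esym; apply: (@affine_unique _ (Num.bound (g / (4 / M))) _ _ _ e0 eP Hw Qq) => //.
  by rewrite -ltr_pdivrMr// archi_boundP// divr_ge0// ltW.
by rewrite -yE.
Qed.

End Alcove.

(** * Weak limits of probability measures *)

Section WeakLimit.
Context {R : realType} {r : nat} (E : set 'rV[R]_r).
Hypothesis cE : compact E.
Implicit Types f g : 'rV[R]_r -> R.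
Local Notation wc := (@wc R 'rV[R]_r E).
Local Notation Tm := (tdual R r).

Lemma open_tdual (U : set 'rV[R]_r) : open U -> measurable (U : set Tm).
Proof. by move=> oU; exact: sub_sigma_algebra. Qed.

Lemma compact_tdual : measurable (E : set Tm).
Proof.
rewrite -[E]setCK; apply: measurableC; apply: open_tdual; rewrite openC.
by apply: compact_closed cE; exact: norm_hausdorff.
Qed.

Lemma wc_measurable f : wc f -> measurable_fun (E : set Tm) f.
Proof.
move=> wf; apply: (measurability _ (measurable_realfun.RGenOInfty.measurableE R)) => _ [_ [a ->] <-].
pose V := interior [set y | E y -> a < f y].
have -> : E `&` f @^-1` `]a, +oo[%classic = E `&` V.
  apply/seteqP; split=> x [Ex]; rewrite /= in_itv /= andbT => fx; split=> //.
    have e0 : 0 < f x - a by rewrite subr_gt0.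
    apply: filterS (wc_near wf Ex e0) => y h Ey.
    by have := h Ey; rewrite ltr_distlC => /andP[]; lra.
  by have := interior_subset fx; apply.
apply: measurableI; first exact: compact_tdual.
by apply: open_tdual; exact: open_interior.
Qed.

Lemma wc_integrable (mu : probability Tm R) f : wc f -> mu.-integrable (E : set Tm) (EFin \o f).
Proof.
move=> wf; apply: measurable_bounded_integrable.
- exact: compact_tdual.
- apply: le_lt_trans (probability_le1 mu compact_tdual) _; exact: ltry.
- exact: wc_measurable.
have [M M0 fM] := wc_bounded cE wf; exists M; split; first exact: num_real.
by move=> N MN x Ex; apply: le_trans (fM x Ex) (ltW MN).
Qed.

Definition functional (L : ('rV[R]_r -> R) -> R) : Prop :=
  [/\ forall f g, wc f -> wc g -> L (fun x => f x + g x) = L f + L g,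
      forall f (c : R), wc f -> L (fun x => c * f x) = c * L f,
      forall f, wc f -> (forall x, E x -> 0 <= f x) -> 0 <= L f &
      L (fun=> 1) = 1].

Definition integ (mu : probability Tm R) f : R := (\int[mu]_(x in (E : set Tm)) f x)%R.

Lemma integ_functional (mu : probability Tm R) : mu (E : set Tm) = 1%E -> functional (integ mu).
Proof.
move=> mE; split.
- move=> f g wf wg; rewrite /integ RintegralD//; try exact: compact_tdual; exact: wc_integrable.
- move=> f c wf; rewrite /integ RintegralZl//; try exact: compact_tdual; exact: wc_integrable.
- by move=> f wf f0; rewrite /integ; apply: Rintegral_ge0.
- by rewrite /integ (Rintegral_cst _ compact_tdual) mul1r; exact: (congr1 fine mE).
Qed.

Lemma func_B L f g : functional L -> wc f -> wc g -> L (fun x => f x - g x) = L f - L g.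
Proof.
move=> [LD LZ _ _] wf wg; have wg' : wc (fun x => -1 * g x) by apply: wcM wg; exact: wc_cst.
have -> : (fun x => f x - g x) = (fun x => f x + -1 * g x) by apply/funext => x; rewrite mulN1r.
by rewrite LD// LZ// mulN1r.
Qed.

Lemma func_le L f g : functional L -> wc f -> wc g -> (forall x, E x -> f x <= g x) -> L f <= L g.
Proof.
move=> fL wf wg fg; rewrite -subr_ge0 -(func_B fL wg wf); case: fL => _ _ L0 _.
by apply: L0 => [|x Ex]; [exact: wcB|rewrite subr_ge0 fg].
Qed.

Lemma func_cst L c : functional L -> L (fun=> c) = c.
Proof.
move=> [_ LZ _ L1]; have -> : (fun _ : 'rV[R]_r => c) = (fun x => c * (fun=> 1) x).
  by apply/funext => x; rewrite mulr1.
by rewrite LZ ?L1 ?mulr1//; exact: wc_cst.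
Qed.

Lemma func_sum L (F : nat -> 'rV[R]_r -> R) k : functional L -> (forall i, wc (F i)) ->
  wc (fun x => \sum_(i < k) F i x) /\ L (fun x => \sum_(i < k) F i x) = \sum_(i < k) L (F i).
Proof.
move=> fL CF; elim: k => [|k [IH1 IH2]].
  rewrite big_ord0; under eq_fun do rewrite big_ord0; split; first exact: wc_cst.
  exact: func_cst.
rewrite big_ord_recr /=; under eq_fun do rewrite big_ord_recr /=.
by split; [exact: wcD|case: fL => LD _ _ _; rewrite LD// IH2].
Qed.

Lemma func_dist L f g e : functional L -> wc f -> wc g ->
  (forall x, E x -> `|f x - g x| < e) -> `|L f - L g| <= e.
Proof.
move=> fL wf wg fg; have wB := wcB wf wg.
have fg' x : E x -> - e <= f x - g x <= e by move=> /fg; rewrite ltr_norml => /andP[/ltW -> /ltW ->].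
have l1 : L (fun=> - e) <= L (fun x => f x - g x).
  by apply: (func_le fL (@wc_cst _ _ E (- e)) wB) => x /fg'/andP[].
have l2 : L (fun x => f x - g x) <= L (fun=> e).
  by apply: (func_le fL wB (@wc_cst _ _ E e)) => x /fg'/andP[].
by rewrite ler_norml -(func_B fL wf wg) -{1}(func_cst (- e) fL) l1 -(func_cst e fL) l2.
Qed.

Section Represent.
Variables (mu : probability Tm R) (L : ('rV[R]_r -> R) -> R).
Hypotheses (mE : mu (E : set Tm) = 1%E) (fL : functional L).
(** A one-sided bound on level sets is all that links [mu] to [L]. It is available both for the
    Riesz measure and for finite sums of point masses. *)
Hypothesis muL : forall phi, wc phi -> (forall x, E x -> 0 <= phi x) ->
  fine (mu ((E `&` [set x | 1 <= phi x]) : set Tm)) <= L phi.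

Let level_measurable phi c : wc phi -> measurable ((E `&` [set x | c <= phi x]) : set Tm).
Proof.
move=> wphi; have := wc_measurable wphi compact_tdual (measurable_itv `[c, +oo[).
by congr (measurable _); apply/seteqP; split=> x /=; rewrite in_itv /= andbT.
Qed.

(* Layer-cake decomposition with [N] layers. *)
Lemma integ_le f : wc f -> (forall x, E x -> 0 <= f x <= 1) -> integ mu f <= L f.
Proof.
move=> wf f01; have fI := integ_functional mE.
apply/ler_addgt0Pr => e e0; pose N := (Num.bound e^-1).+1; pose d : R := N%:R^-1.
have N0 : 0 < N%:R :> R by rewrite ltr0n.
have d0 : 0 < d by rewrite invr_gt0.
have de : d < e.
  rewrite /d invf_plt ?posrE//; apply: lt_trans (archi_boundP _) _; first by rewrite invr_ge0 ltW.
  by rewrite ltr_nat.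
pose F (j : nat) : 'rV[R]_r -> R := fmin (fmax (fun x => f x - j%:R * d) (fun=> 0)) (fun=> d).
have wF j : wc (F j).
  apply: wc_min; last exact: wc_cst.
  apply: wc_max; last exact: wc_cst.
  by apply: wcB; [exact: wf|exact: wc_cst].
have FE j x : F j x = Num.min (Num.max (f x - j%:R * d) 0) d by rewrite /F fminE fmaxE.
have F0 j x : 0 <= F j x by rewrite FE le_min le_max lexx orbT /= ltW.
have sumF k x : E x -> \sum_(i < k) F i x = Num.min (f x) (k%:R * d).
  move=> Ex; have /andP[f0 f1] := f01 x Ex; elim: k => [|k IH].
    by rewrite big_ord0 mul0r (min_idPr f0).
  rewrite big_ord_recr /= IH FE -natr1 mulrDl mul1r.
  have kd : 0 <= k%:R * d by rewrite mulr_ge0// ltW.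
  have [h|h] := boolP (f x <= k%:R * d).
    have -> : Num.max (f x - k%:R * d) 0 = 0 by apply: max_r; lra.
    have -> : Num.min 0 d = 0 by apply: min_l; lra.
    by rewrite addr0 (min_l h) min_l//; lra.
  rewrite -ltNge in h; have -> : Num.min (f x) (k%:R * d) = k%:R * d by apply: min_r; lra.
  have -> : Num.max (f x - k%:R * d) 0 = f x - k%:R * d by apply: max_l; lra.
  have [h2|h2] := boolP (f x <= k%:R * d + d).
    by rewrite (min_l h2) min_l ?addrA; lra.
  by rewrite -ltNge in h2; rewrite (min_r (ltW h2)) min_r//; lra.
have sumN x : E x -> f x = \sum_(i < N) F i x.
  move=> Ex; rewrite sumF// /d mulfV ?gt_eqF//; have /andP[_ f1] := f01 x Ex.
  by rewrite (min_idPl f1).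
have [wS LS] := func_sum N fL wF; have [_ IS] := func_sum N fI wF.
have eqL M : functional M -> M f = M (fun x => \sum_(i < N) F i x).
  move=> fM; apply/eqP; rewrite eq_le !func_le// => x Ex; by rewrite -sumN.
rewrite (eqL _ fL) (eqL _ fI) LS IS.
have step j : integ mu (F j.+1) <= L (F j).
  pose S := E `&` [set x | 1 <= d^-1 * F j x].
  have wd : wc (fun x => d^-1 * F j x) by apply: wcM (wF j); exact: wc_cst.
  have mS : measurable (S : set Tm) by exact: level_measurable.
  have h1 : fine (mu (S : set Tm)) <= L (fun x => d^-1 * F j x).
    by apply: muL => // x _; rewrite mulr_ge0 ?F0// invr_ge0 ltW.
  have mI : measurable_fun (E : set Tm) (\1_(S : set Tm) : Tm -> R) by exact: measurable_realfun.measurable_indic.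
  have iI : mu.-integrable (E : set Tm) (EFin \o (\1_(S : set Tm) : Tm -> R)).
    apply: measurable_bounded_integrable => //.
    - exact: compact_tdual.
    - by apply: le_lt_trans (probability_le1 mu compact_tdual) _; exact: ltry.
    exists 1; split; first exact: num_real.
    move=> M M1 x _; apply: le_trans (ltW M1); rewrite /= /indic.
    by case: (_ \in _); rewrite ?normr1 ?normr0.
  have h2 : (\int[mu]_(x in (E : set Tm)) (\1_(S : set Tm) : Tm -> R) x)%R = fine (mu (S : set Tm)).
    rewrite /Rintegral integral_indic//; last exact: compact_tdual.
    by congr (fine (mu _)); apply/setIidl => x [].
  apply: (@le_trans _ _ (d * fine (mu (S : set Tm)))); last first.
    case: fL => _ LZ _ _; move: h1; rewrite LZ// => h1.
    have := ler_wpM2l (ltW d0) h1; rewrite mulrA mulfV ?mul1r// gt_eqF//.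
  rewrite -h2 -RintegralZl//; last exact: compact_tdual.
  rewrite /integ; apply: le_Rintegral.
  - exact: compact_tdual.
  - exact: wc_integrable.
  - have := @integrableZl _ _ _ mu (E : set Tm) compact_tdual d _ iI.
    by apply: eq_integrable => //; exact: compact_tdual.
  move=> x Ex; rewrite indicE; have [xS|xS] := boolP (x \in (S : set Tm)).
    by rewrite mulr1 FE ge_min lexx orbT.
  rewrite mulr0.
  have nS : F j x < d.
    rewrite ltNge; apply/negP => dF; move/negP : xS; apply; rewrite inE; split=> //=.
    by rewrite ler_pdivlMl// mulr1.
  move: nS; rewrite !FE gt_min ltxx orbF gt_max => /andP[nS _].
  rewrite -natr1 mulrDl mul1r.
  have -> : Num.max (f x - (j%:R * d + d)) 0 = 0 by apply: max_r; lra.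
  by rewrite min_l// ltW.
have LF0 j : 0 <= L (F j) by case: fL => _ _ L0 _; apply: L0.
rewrite {1}/N big_ord_recl [leRHS]addrC; apply: lerD.
  apply: le_trans (ltW de); rewrite -[leRHS](func_cst d fI); apply: func_le => //; first exact: wc_cst.
  by move=> x _; rewrite FE ge_min lexx orbT.
apply: (@le_trans _ _ (\sum_(i < N.-1) L (F i))).
  by apply: ler_sum => i _; exact: step.
by rewrite /N /= [leRHS]big_ord_recr lerDl; exact: LF0.
Qed.

(** After rescaling into [[0, 1]], the inequality for [h] and for [1 - h] gives equality. *)
Lemma integ_eq f : wc f -> integ mu f = L f.
Proof.
move=> wf; have fI := integ_functional mE; have [M M0 fM] := wc_bounded cE wf.
have M20 : 0 < 2 * M by rewrite mulr_gt0.
pose h x := (2 * M)^-1 * (f x + M).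
have wh : wc h by apply: wcM; [exact: wc_cst|apply: wcD; [exact: wf|exact: wc_cst]].
have h01 x : E x -> 0 <= h x <= 1.
  move=> /fM; rewrite ler_norml => /andP[? ?]; apply/andP; split.
    by apply: mulr_ge0; [rewrite invr_ge0 ltW|lra].
  by rewrite ler_pdivrMl// mulr1; lra.
have e1 : integ mu h <= L h by exact: integ_le.
have w1 : wc (fun x => 1 - h x) by apply: wcB => //; exact: wc_cst.
have e2 : integ mu (fun x => 1 - h x) <= L (fun x => 1 - h x).
  by apply: integ_le => // x /h01/andP[? ?]; apply/andP; split; lra.
have wc1 : wc (fun=> 1) by exact: wc_cst.
rewrite (func_B fI wc1 wh) (func_B fL wc1 wh) !func_cst// lerD2l lerN2 in e2.
have eh : integ mu h = L h by apply/eqP; rewrite eq_le e1 e2.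
have exp Q : functional Q -> Q f = 2 * M * Q h - M.
  move=> fQ; have [QD QZ _ _] := fQ; have wcM' : wc (fun=> M) by exact: wc_cst.
  rewrite /h QZ ?QD ?(func_cst _ fQ) ?mulrA ?mulfV ?gt_eqF// ?mul1r ?addrK//.
  exact: wcD.
by rewrite (exp _ fI) (exp _ fL) eh.
Qed.

End Represent.

Lemma dini (g : nat -> 'rV[R]_r -> R) : (forall k, wc (g k)) ->
  (forall k x, E x -> g k x <= g k.+1 x) ->
  (forall x, E x -> forall c, c < 1 -> exists k, c < g k x) ->
  forall e, 0 < e -> exists k, forall x, E x -> 1 - e < g k x.
Proof.
move=> wg gm gs e e0.
have mono j k x : E x -> (j <= k)%N -> g j x <= g k x.
  move=> Ex /subnK <-; elim: (k - j)%N => // d IH; rewrite addSn.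
  by apply: le_trans IH _; exact: gm.
pose Q S := exists k, forall x, S x -> E x -> 1 - e < g k x.
suff [k H] : Q E by exists k => x Ex; exact: H.
apply: (compact_ind cE).
- by exists 0%N.
- move=> A B [k kA] [k' kB]; exists (maxn k k') => x [/kA h|/kB h] Ex; apply: lt_le_trans (h Ex) _.
    by apply: mono => //; exact: leq_maxl.
  by apply: mono => //; exact: leq_maxr.
- by move=> A B AB [k kB]; exists k => x /AB; exact: kB.
move=> x Ex; have e2 : 0 < e / 2 by rewrite divr_gt0.
have [|k gk] := gs x Ex (1 - e / 2); first lra.
exists [set y | E y -> `|g k x - g k y| < e / 2]; first exact: (wc_near (wg k) Ex e2).
exists k => y [h Ey] _; have := h Ey; rewrite ltr_distlC => /andP[? ?]; lra.
Qed.

Definition dist_to (A : set 'rV[R]_r) (x : 'rV[R]_r) : R := inf [set `|x - a| | a in A].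

(** The distance to its complement exhibits an open set as the locus where a continuous nonnegative
    function is positive, the form asked for by [om_cara]. *)
Lemma dist_to_prop (A : set 'rV[R]_r) (a0 : 'rV[R]_r) : A a0 -> closed A ->
  and4 (forall x : 'rV[R]_r, 0 <= dist_to A x)
       (forall x : 'rV[R]_r, (A x -> False) -> 0 < dist_to A x)
       (forall x : 'rV[R]_r, A x -> dist_to A x = 0)
       (continuous (dist_to A)).
Proof.
move=> Aa0 clA.
have hinf x : has_inf [set `|x - a| | a in A].
  by split; [exists `|x - a0|; exists a0|exists 0 => _ [a _ <-]].
have le x a : A a -> dist_to A x <= `|x - a|.
  by move=> Aa; apply: ge_inf; [case: (hinf x)|exists a].
have ge x c : (forall a, A a -> c <= `|x - a|) -> c <= dist_to A x.
  by move=> H; apply: lb_le_inf => [|_ [a Aa <-]]; [case: (hinf x)|exact: H].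
have d0 x : 0 <= dist_to A x by apply: ge.
have lip x y : dist_to A x - dist_to A y <= `|x - y|.
  rewrite lerBlDl -lerBlDr; apply: ge => a Aa; rewrite lerBlDr.
  apply: le_trans (le x a Aa) _.
  by rewrite [leRHS]addrC; exact: (ler_distD y x a).
split=> //.
- move=> x nAx; have : nbhs x (~` A) by apply: open_nbhs_nbhs; split=> //; rewrite openC.
  move=> /nbhs_normP[e /= e0 H]; apply: lt_le_trans e0 _; apply: ge => a Aa.
  by rewrite leNgt; apply/negP => xa; apply: (H a).
- by move=> x Ax; apply/eqP; rewrite eq_le d0 andbT; have := le x x Ax; rewrite subrr normr0.
move=> x; suff H : dist_to A y @[y --> x] --> dist_to A x by exact: H.
have FF : Filter (nbhs x) := nbhs_filter x.
apply/(@cvgrPdist_lt _ _ _ (nbhs x) FF) => e e0.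
have Hn : \forall y \near x, `|x - y| < e.
  exact: (@cvgr_dist_lt _ _ _ (nbhs x) FF id x cvg_id e e0).
apply: filterS Hn => y /= xy.
apply: (@le_lt_trans _ _ `|x - y|).
  by rewrite ler_norml lip andbT lerNl opprB (distrC x) lip.
exact: xy.
Qed.

Theorem riesz L : functional L -> exists2 mu : probability Tm R, mu (E : set Tm) = 1%E &
  forall f, wc f -> integ mu f = L f.
Proof.
move=> fL; have [LD LZ L0 L1] := fL.
have cmin f g : wc f -> wc g -> wc (fun x => Num.min (f x) (g x)).
  by move=> wf wg; have := wc_min wf wg; congr (wc _); apply/funext => x; rewrite fminE.
pose G : set (set 'rV[R]_r) := @open 'rV[R]_r.
have Gc U : G U -> (om wc E L).-caratheodory U.
  (* The whole space is treated apart, with the constant 1: the distance to an empty complement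
     would be meaningless. *)
  move=> oU; have [UT|[a nUa]] : (forall x, U x) \/ exists a, (~` U) a.
    by have [H|/existsNP[a H]] := pselect (forall x, U x); [left|right; exists a].
    apply: (@om_cara _ _ wc E L (@wc_cst _ _ E) (@wcD _ _ E) (@wcM _ _ E) cmin LD LZ L0 L1 (fun=> 1)) => //.
    exact: wc_cst.
  have [d0 dp dz dc] := @dist_to_prop (~` U) a nUa (open_closedC oU).
  apply: (@om_cara _ _ wc E L (@wc_cst _ _ E) (@wcD _ _ E) (@wcM _ _ E) cmin LD LZ L0 L1 (dist_to (~` U))) => //.
    by apply: wcP; apply: continuous_subspaceT.
  move=> x _; split=> [Ux|]; first by apply: dp => /(_ Ux).
  by move=> p; apply: contrapT => nU; move: p; rewrite dz ?ltxx.
have [mu muE] := @riesz_measure _ _ wc E L (@wc_cst _ _ E) (@wcD _ _ E) (@wcM _ _ E) LD LZ L0 L1 dini G Gc.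
have mE : mu (E : set Tm) = 1%E.
  by rewrite muE /om (omr_E (@wc_cst _ _ E) (@wcD _ _ E) (@wcM _ _ E) LD LZ L0 L1 dini).
exists mu => // f wf; apply: integ_eq => // phi wphi phi0; rewrite muE /om /=.
by apply: (om_le (@wc_cst _ _ E) L0 L1 wphi phi0) => x [].
Qed.

Variable A : ('rV[R]_r -> R) -> Prop.
Hypothesis A_cst : forall c, A (fun=> c).
Hypothesis A_D : forall f g, A f -> A g -> A (fun x => f x + g x).
Hypothesis A_M : forall f g, A f -> A g -> A (fun x => f x * g x).
Hypothesis A_wc : forall f, A f -> wc f.
Hypothesis A_sep : forall x y, E x -> E y -> x <> y -> exists2 f, A f & f x <> f y.

(** Uniform approximation by [A] makes the integrals of every continuous function Cauchy. The limits
    exist along the whole sequence, define a functional, and [riesz] represents it. *)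
Theorem weak_limit (mu_ : nat -> probability Tm R) :
  (forall k, mu_ k (E : set Tm) = 1%E) ->
  (forall f, A f -> exists l : R, integ (mu_ k) f @[k --> \oo] --> l) ->
  exists mu : probability Tm R, mu (E : set Tm) = 1%E /\ weak_cvg E mu_ mu.
Proof.
move=> mE HA; have fI k := integ_functional (mE k).
have cv f : wc f -> integ (mu_ k) f @[k --> \oo] --> lim (integ (mu_ k) f @[k --> \oo]).
  move=> wf; apply/cauchy_cvgP; apply: cauchy_exP => e e0.
  have e2 : 0 < e / 2 by rewrite divr_gt0.
  have [g Ag fg] := stone_weierstrass cE A_cst A_D A_M A_wc A_sep wf e2.
  have [l gl] := HA g Ag; exists l.
  have /cvgrPdist_lt/(_ _ e2) H := gl.
  suff : \forall k \near \oo, ball l e (integ (mu_ k) f) by [].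
  near=> k.
  have h1 : `|l - integ (mu_ k) g| < e / 2 by near: k.
  have h2 := func_dist (fI k) wf (A_wc Ag) fg.
  rewrite /ball /= -(subrK (integ (mu_ k) g) l) -addrA.
  apply: le_lt_trans (ler_normD _ _) _; rewrite distrC in h2; lra.
pose L f := lim (integ (mu_ k) f @[k --> \oo]).
have fL : functional L.
  split.
  - move=> f g wf wg; apply: cvg_lim => //.
    have -> : (fun k => integ (mu_ k) (fun x => f x + g x)) = (fun k => integ (mu_ k) f + integ (mu_ k) g).
      by apply/funext => k; case: (fI k) => H _ _ _; rewrite H.
    by apply: cvgD; exact: cv.
  - move=> f c wf; apply: cvg_lim => //.
    have -> : (fun k => integ (mu_ k) (fun x => c * f x)) = (fun k => c * integ (mu_ k) f).
      by apply/funext => k; case: (fI k) => _ H _ _; rewrite H.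
    by apply: cvgMr; exact: cv.
  - move=> f wf f0; apply: limr_ge; first by apply/cvg_ex; exists (L f); exact: cv.
    by near=> k; case: (fI k) => _ _ H _; exact: H.
  - apply: cvg_lim => //; have -> : (fun k => integ (mu_ k) (fun=> 1)) = (fun=> 1).
      by apply/funext => k; case: (fI k).
    exact: cvg_cst.
have [mu muE muL] := riesz fL; exists mu; split=> // f cf _.
have wf := wcP cf; have := cv f wf; rewrite -/(L f) -(muL f wf).
exact.
Unshelve. all: by end_near. Qed.

End WeakLimit.

Lemma discrete_probability {R : realType} {r : nat} (n : nat) (q : nat -> R)
    (pt : nat -> 'rV[R]_r) : (forall i, 0 <= q i) -> \sum_(i < n) q i = 1 ->
  exists P : probability (tdual R r) R,
    forall B, P B = (\sum_(i < n) q i * \1_B (pt i))%:E.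
Proof.
move=> q0 q1; pose m_ (i : nat) := mscale (NngNum (q0 i)) (dirac (pt i : tdual R r)).
pose m : {measure set (tdual R r) -> \bar R} := msum (fun i => m_ i) n.
have mE B : m B = (\sum_(i < n) q i * \1_B (pt i))%:E.
  rewrite /m /msum /= -sumEFin; apply: eq_bigr => i _.
  by rewrite EFinM.
(* The same measure with its values in explicit form, so that the required equation holds by
   conversion. *)
pose m0 (B : set (tdual R r)) : \bar R := (\sum_(i < n) q i * \1_B (pt i))%:E.
have m0E : m0 = m by apply/funext => B; rewrite mE.
have p0 : m0 set0 = 0%E by rewrite m0E measure0.
have pge B : (0 <= m0 B)%E by rewrite m0E; exact: measure_ge0.
have psig : semi_sigma_additive m0 by rewrite m0E; exact: measure_semi_sigma_additive.
pose iM := isMeasure.Build _ _ _ m0 p0 pge psig.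
pose mM : {measure set (tdual R r) -> \bar R} := HB.pack m0 iM.
have m1 : mM setT = 1%E.
  by rewrite /mM /= /m0 -q1; congr EFin; apply: eq_bigr => i _; rewrite indicT mulr1.
pose iP := Measure_isProbability.Build _ _ _ mM m1.
pose P : probability (tdual R r) R := HB.pack m0 iM iP.
by exists P.
Qed.

(** * Characters on scaled regular weights *)

Section ComplexLimits.
Context {R : realType}.
Implicit Types (u v : nat -> R[i]) (a b : R[i]).

Definition ccvg u a : Prop :=
  (fun k => complex.Re (u k)) @ \oo --> complex.Re a /\
  (fun k => complex.Im (u k)) @ \oo --> complex.Im a.

Lemma ccvg_cst a : ccvg (fun=> a) a.
Proof. by split; exact: cvg_cst. Qed.

Lemma ccvgD u v a b : ccvg u a -> ccvg v b -> ccvg (fun k => u k + v k) (a + b).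
Proof.
move=> [u1 u2] [v1 v2]; split.
  have -> : complex.Re (a + b) = complex.Re a + complex.Re b by case: a b {u1 u2 v1 v2} => ? ? [].
  have -> : (fun k => complex.Re (u k + v k)) = (fun k => complex.Re (u k) + complex.Re (v k)).
    by apply/funext => k; case: (u k) (v k) => ? ? [].
  exact: cvgD.
have -> : complex.Im (a + b) = complex.Im a + complex.Im b by case: a b {u1 u2 v1 v2} => ? ? [].
have -> : (fun k => complex.Im (u k + v k)) = (fun k => complex.Im (u k) + complex.Im (v k)).
  by apply/funext => k; case: (u k) (v k) => ? ? [].
exact: cvgD.
Qed.

Lemma ccvgM u v a b : ccvg u a -> ccvg v b -> ccvg (fun k => u k * v k) (a * b).
Proof.
move=> [u1 u2] [v1 v2]; split.
  have -> : complex.Re (a * b) = complex.Re a * complex.Re b - complex.Im a * complex.Im b.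
    by case: a b {u1 u2 v1 v2} => ? ? [].
  have -> : (fun k => complex.Re (u k * v k)) =
      (fun k => complex.Re (u k) * complex.Re (v k) - complex.Im (u k) * complex.Im (v k)).
    by apply/funext => k; case: (u k) (v k) => ? ? [].
  by apply: cvgB; apply: cvgM.
have -> : complex.Im (a * b) = complex.Re a * complex.Im b + complex.Im a * complex.Re b.
  by case: a b {u1 u2 v1 v2} => ? ? [].
have -> : (fun k => complex.Im (u k * v k)) =
    (fun k => complex.Re (u k) * complex.Im (v k) + complex.Im (u k) * complex.Re (v k)).
  by apply/funext => k; case: (u k) (v k) => ? ? [].
by apply: cvgD; apply: cvgM.
Qed.

Lemma ccvg_sum (I : Type) (t : seq I) (u : I -> nat -> R[i]) (a : I -> R[i]) :
  (forall i, ccvg (u i) (a i)) -> ccvg (fun k => \sum_(i <- t) u i k) (\sum_(i <- t) a i).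
Proof.
move=> H; elim: t => [|i t IH].
  by rewrite big_nil; under eq_fun do rewrite big_nil; exact: ccvg_cst.
by rewrite big_cons; under eq_fun do rewrite big_cons; exact: ccvgD.
Qed.

Lemma ccvg_unique u a b : ccvg u a -> ccvg u b -> a = b.
Proof.
move=> [u1 u2] [v1 v2]; apply/eqP; rewrite eq_complex; apply/andP.
by split; apply/eqP; [exact: (cvg_unique _ u1 v1)|exact: (cvg_unique _ u2 v2)].
Qed.

Lemma ccvg_cisev {r} (b : 'rV[R]_r) (x : nat -> 'cV[R]_r) (x0 : 'cV[R]_r) :
  ev b (x k) @[k --> \oo] --> ev b x0 -> ccvg (fun k => cisev b (x k)) (cisev b x0).
Proof.
move=> H; have H2 : 2%:R * pi * ev b (x k) @[k --> \oo] --> 2%:R * pi * ev b x0.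
  by apply: cvgM H; exact: cvg_cst.
split; rewrite /cisev /cis /=.
  by apply: (continuous_cvg _ (@continuous_cos R _)).
by apply: (continuous_cvg _ (@continuous_sin R _)).
Qed.

End ComplexLimits.

(** * The normalized inner product and the constants of the character formula *)

Section Inner.
Context {R : realType} {n r : nat} (D : lie_data R n r).
Hypotheses (cG : compact_group (grp D)) (simpleK : simple_lie (lie (grp D))).
Hypotheses (mT : maximal_torus (grp D) (tor D)) (basT : torus_basis D).
Hypotheses (simpS : simple_system D) (hth : highest_root D) (innerK : normalized_inner D).
Implicit Types (a b l : 'rV[R]_r) (x y z : 'cV[R]_r) (w v : 'M[R]_r).

Local Notation cor := (coroot D).
Local Notation ps := (posseq D).
Local Notation s := (size (simple_roots D)).
Local Notation al := (@al R n r D).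
Local Notation inW := (inW D).
Local Notation Ws := (Ws D).
Local Notation rho := (rho D).
Local Notation J := (J D).
Local Notation delta := (delta D).
Local Notation ip := (ip D).
Local Notation yv := (nu_inv D).

Let ra i : is_root D (al i). Proof. exact: al_root. Qed.

Definition Gi : 'M[R]_r := \matrix_(i, j) ip (delta_mx i 0) (delta_mx j 0).

Lemma nuE x : nu D x = x^T *m Gi.
Proof.
apply/rowP => j; rewrite !mxE.
have -> : tbasis D j = tmx D (delta_mx j 0).
  by rewrite tbasisE; congr tmx; apply/colP => i; rewrite !mxE andbT.
rewrite -/(ip x (delta_mx j 0)).
have xE : x = \sum_i x i 0 *: delta_mx i 0.
  apply/colP => i; rewrite summxE (bigD1 i)//= big1 => [|k ki]; rewrite !mxE ?eqxx ?mulr1 ?addr0//.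
  by rewrite eq_sym (negbTE ki) mulr0.
rewrite {1}xE; rewrite (big_morph (fun x => ip x (delta_mx j 0)) (fun x y => ipDl mT basT innerK x y _) (ip0l mT basT innerK _)).
by apply: eq_bigr => i _; rewrite (ipZl mT basT innerK) !mxE.
Qed.

Lemma Gi_unit : Gi \in unitmx.
Proof.
rewrite -row_free_unit; apply: inj_row_free => v vG.
have nv : nu D v^T = 0 by rewrite nuE trmxK.
apply: trmx_inj; rewrite trmx0; apply/eqP/negPn/negP => v0.
by have := ip_gt0 mT basT innerK v0; rewrite -(ev_nu mT basT innerK) nv ev0 ltxx.
Qed.

Lemma nu_invK b : nu D (yv b) = b.
Proof.
apply: (@xgetPex _ 0 [set x | nu D x = b]); exists (b *m invmx Gi)^T => /=.
by rewrite nuE trmxK mulmxKV// Gi_unit.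
Qed.

Lemma yvE b : yv b = (b *m invmx Gi)^T.
Proof.
have := nu_invK b; rewrite nuE => E; apply: trmx_inj; rewrite trmxK -[in RHS]E.
by rewrite mulmxK// Gi_unit.
Qed.

Lemma yv_nu x : yv (nu D x) = x.
Proof. by rewrite yvE nuE mulmxK ?trmxK// Gi_unit. Qed.

Lemma yvZ (c : R) b : yv (c *: b) = c *: yv b.
Proof. by rewrite !yvE -scalemxAl linearZ. Qed.

Lemma ev_ip a z : ev a z = ip (yv a) z.
Proof. by rewrite -{1}(nu_invK a) (ev_nu mT basT innerK). Qed.

(** Exhibits the left side as a linear form in [b], for continuity and for limits. *)
Lemma ev_yv_form a w b : ev a (w *m yv b) = ev b (invmx Gi *m (a *m w)^T).
Proof.
have T (M : 'M[R]_1) : M 0 0 = M^T 0 0 by rewrite mxE.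
by rewrite yvE /ev [LHS]T !trmx_mul !trmxK !mulmxA.
Qed.

Lemma ip_W w x y : inW w -> ip (w *m x) (w *m y) = ip x y.
Proof.
move=> Hw; move: w Hw x y; apply: inW_ind => [x y|i w _ IH x y]; first by rewrite !mul1mx.
by rewrite -!mulmxA -!st_mx (ip_refl cG mT basT innerK _ _ (ra i)).
Qed.

Lemma inW_invmx w : inW w -> [/\ inW (invmx w), w \in unitmx & \det (invmx w) = \det w].
Proof.
move=> Hw; have [v [Hv wv vw]] := inW_inv cG mT basT simpS Hw.
have uw : w \in unitmx by case: (mulmx1_unit wv).
have vE : invmx w = v by rewrite -[LHS]mulmx1 -wv mulKmx.
split=> //; first by rewrite vE.
by rewrite det_inv; case: (inW_det cG mT basT simpS Hw) => ->; rewrite ?invr1 ?invrN1.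
Qed.

Lemma sum_W_inv (T : nmodType) (F : 'M[R]_r -> T) :
  \sum_(w <- Ws) F (invmx w) = \sum_(w <- Ws) F w.
Proof.
rewrite -(big_map invmx predT F); apply: perm_big; apply: uniq_perm.
- by rewrite map_inj_uniq ?Ws_uniq//; exact: (can_inj (@invmxK _ _)).
- exact: Ws_uniq.
move=> w; apply/mapP/idP => [[v /(mem_Ws cG simpleK mT basT simpS) Hv ->]|/(mem_Ws cG simpleK mT basT simpS) Hw].
  by apply/(mem_Ws cG simpleK mT basT simpS); case: (inW_invmx Hv).
exists (invmx w); last by rewrite invmxK.
by apply/(mem_Ws cG simpleK mT basT simpS); case: (inW_invmx Hw).
Qed.

(** Moving [w] across the invariant inner product replaces it by its inverse, which has the same
    determinant and also runs over the group. *)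
Lemma J_sym a b (c : R) : J a (- (c *: yv b)) = J b (- (c *: yv a)).
Proof.
rewrite /J -[RHS]sum_W_inv; apply: eq_big_seq => w /(mem_Ws cG simpleK mT basT simpS) Hw.
have [_ uw ->] := inW_invmx Hw; congr (_ * cis (_ * _)).
rewrite !mulmxN -!scalemxAr !evNr !evZr; congr (- (_ * _)).
rewrite !ev_ip -[RHS](ip_W _ _ Hw) mulKVmx//.
by rewrite (ipC mT basT innerK).
Qed.

(** Invariance under the reflection in [a] forces the coroot to be proportional to the vector
    representing [a]. *)
Lemma cor_ip a z : is_root D a -> ip (cor a) z = ev a z * (ip (cor a) (cor a) / 2).
Proof.
move=> rt; have := ip_refl cG mT basT innerK (cor a) z rt.
have -> : s_t D a (cor a) = (-1) *: cor a.
  by rewrite /s_t (ev_coroot_self cG mT basT rt) scaleN1r scaler_nat mulr2n opprD addrA subrr sub0r.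
have -> : s_t D a z = (- ev a z) *: cor a + z by rewrite /s_t scaleNr addrC.
rewrite (ipZl mT basT innerK) (ipC mT basT innerK (cor a) (_ + _)) (ipDl mT basT innerK) (ipZl mT basT innerK).
rewrite (ipC mT basT innerK z); lra.
Qed.

Lemma cor_ip_gt0 a : is_root D a -> 0 < ip (cor a) (cor a) / 2.
Proof.
move=> rt; rewrite divr_gt0// (ip_gt0 mT basT innerK)//; apply/eqP => c0.
have := ev_coroot_self cG mT basT rt; rewrite c0 /ev mulmx0 mxE => /eqP.
by rewrite eq_sym pnatr_eq0.
Qed.

Lemma ev_cor_yv a b : is_root D a -> ev b (cor a) = ev a (yv b) * (ip (cor a) (cor a) / 2).
Proof. by move=> rt; rewrite -(cor_ip _ rt) (ipC mT basT innerK) -ev_ip. Qed.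

(** The normalization of the inner product makes the factor in [ev_cor_yv] equal to 1 for [theta];
    this matches the level with the last wall of the alcove. *)
Lemma ev_theta_yv b : ev b (cor (theta D)) = ev (theta D) (yv b).
Proof.
rewrite (ev_cor_yv _ hth.1); case: innerK => _ _ _ _ /= h.
by rewrite /ip h divff ?pnatr_eq0// mulr1.
Qed.

Lemma pos_strict y a : (forall i, 0 < ev (al i) y) -> pos_roots D a -> 0 < ev a y.
Proof.
move=> y0 pa; have E : ev a y = \sum_i ev a (fc i) * ev (al i) y.
  rewrite {1}(coord_expand cG simpleK mT basT simpS a) ev_sum.
  by apply: eq_bigr => i _; exact: evZ.
have t0 i : 0 <= ev a (fc i) * ev (al i) y.
  by have [k ->] := nncomb_fc simpS i pa.2; rewrite mulr_ge0 ?ler0n// ltW.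
rewrite lt_def {2}E sumr_ge0 ?andbT//; apply/eqP => E0; rewrite E in E0.
case: pa => -[/eqP a0 _] _; apply: a0.
rewrite (coord_expand cG simpleK mT basT simpS a) big1// => i _.
have : ev a (fc i) * ev (al i) y = 0 := psumr_eq0P (fun i _ => t0 i) E0 isT.
by move=> /eqP; rewrite mulf_eq0 (gt_eqF (y0 i)) orbF => /eqP ->; rewrite scale0r.
Qed.

Definition regular b : Prop := forall i, 0 < ev b (cor (al i)).

Lemma regular_al b i : regular b -> 0 < ev (al i) (yv b).
Proof.
move=> /(_ i); rewrite (ev_cor_yv _ (ra i)) => h.
by move: h; rewrite pmulr_lgt0// cor_ip_gt0.
Qed.

Lemma regular_pos b a : regular b -> pos_roots D a -> 0 < ev a (yv b).
Proof. by move=> rb; apply: pos_strict => i; exact: regular_al. Qed.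

Lemma regular_rho l : dominant D l -> regular (l + rho).
Proof. by move=> dl i; rewrite evD (rho_al cG simpleK mT basT simpS) ltr_wpDl. Qed.

(** The real part of the work done by the denominator: [delta (- y)] is this product times the
    constant [dconst], and it is positive in the open alcove. *)
Definition sd y : R := \prod_(a <- ps) sin (pi * ev a y).

Definition dconst : R[i] := (- (2 * 'i%C)) ^+ size ps.

Lemma dconst_neq0 : dconst != 0.
Proof.
rewrite expf_neq0// oppr_eq0 mulf_neq0 ?pnatr_eq0//.
by rewrite eq_complex /= oner_eq0 andbF.
Qed.

Lemma fac_neg a y : fac a (- y) = - (2 * 'i%C) * (sin (pi * ev a y))%:C%C.
Proof.
rewrite /fac /cisev evN evZ evNr.
have -> : 2%:R * pi * (2^-1 * - ev a y) = - (pi * ev a y) by field.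
have -> : 2%:R * pi * - (2^-1 * - ev a y) = pi * ev a y by field.
move: (pi * ev a y) => t; rewrite /cis cosN sinN.
by apply/eqP; rewrite eq_complex /=; apply/andP; split; apply/eqP; ring.
Qed.

Lemma delta_neg y : delta (- y) = dconst * (sd y)%:C%C.
Proof.
rewrite /delta /dconst /sd; elim: ps => [|a t IH].
  by rewrite !big_nil expr0 mul1r.
by rewrite !big_cons IH fac_neg exprS rmorphM /=; ring.
Qed.

Lemma sd_gt0 y : (forall a, pos_roots D a -> 0 < ev a y < 1) -> 0 < sd y.
Proof.
move=> H; rewrite /sd big_seq; apply: prodr_gt0 => a /(posseqP cG mT basT)/H/andP[h1 h2].
by apply: sin_gt0_pi; rewrite mulr_gt0 ?pi_gt0//= gtr_pMr ?pi_gt0.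
Qed.

Lemma ch0 (V : rep D) l : rep_irreducible V -> rep_highest_weight V l -> ch V 0 = (rdim V)%:R.
Proof.
move=> irrV hwV; have [P uP [mu [muP nn]]] := weight_diag cG mT basT simpS irrV hwV.
rewrite (ch_mu cG mT basT uP muP) (eq_bigr (fun=> 1)) ?sumr_const ?card_ord// => p _.
by rewrite /cisev /ev mulmx0 mxE mulr0 cis0.
Qed.

Lemma ccvg_ch (V : rep D) l (x : nat -> 'cV[R]_r) x0 : rep_irreducible V -> rep_highest_weight V l ->
  (forall b, ev b (x k) @[k --> \oo] --> ev b x0) -> ccvg (fun k => ch V (x k)) (ch V x0).
Proof.
move=> irrV hwV H; have [P uP [mu [muP nn]]] := weight_diag cG mT basT simpS irrV hwV.
rewrite (ch_mu cG mT basT uP muP); under eq_fun do rewrite (ch_mu cG mT basT uP muP).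
by apply: ccvg_sum => p; apply: ccvg_cisev; exact: H.
Qed.

(** At small multiples of the vector of [rho], [J_sym] turns the numerator into a denominator, so
    the character is the unknown ratio [q] times a positive quotient of sines. As the point tends to
    0 the character tends to the dimension, which makes [q] real and positive. *)
Lemma normalization : exists2 k0 : R[i], k0 != 0 & (forall x, delta x = k0 * J rho x) /\
  forall (V : rep D) l, rep_irreducible V -> rep_highest_weight V l -> dominant D l ->
    exists2 q : R, 0 < q & forall x, delta x * ch V x = q%:C%C * k0 * J (l + rho) x.
Proof.
have [k0 k0E] := delta_J cG simpleK mT basT simpS.
have rr : regular rho by move=> i; rewrite (rho_al cG simpleK mT basT simpS).
have small b : regular b -> exists2 M : R, 0 < M & forall c, 0 < c -> c <= M^-1 -> 0 < sd (c *: yv b).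
  move=> rb; have p0 a : a \in ps -> 0 < ev a (yv b).
    by move=> /(posseqP cG mT basT); exact: regular_pos.
  pose M : R := 1 + \sum_(a <- ps) ev a (yv b).
  have S0 : 0 <= \sum_(a <- ps) ev a (yv b) by rewrite big_seq sumr_ge0// => a /p0/ltW.
  have M0 : 0 < M by rewrite ltr_wpDr.
  exists M => // c c0 cM; apply: sd_gt0 => a pa; rewrite evZr.
  have ain : a \in ps by exact/(posseqP cG mT basT).
  rewrite mulr_gt0 ?p0//=; apply: (@le_lt_trans _ _ (M^-1 * ev a (yv b))).
    by rewrite ler_wpM2r// ltW// p0.
  rewrite ltr_pdivrMl// mulr1 /M (big_rem a)//= addrCA ltrDl ltr_wpDr//.
  by rewrite big_seq sumr_ge0// => a' /mem_rem/p0/ltW.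
have k00 : k0 != 0.
  have [M M0 /(_ M^-1)] := small rho rr; rewrite invr_gt0 => /(_ M0 (lexx _)) h.
  apply/eqP => e; have := k0E (- (M^-1 *: yv rho)); rewrite e mul0r delta_neg => /eqP.
  rewrite mulf_eq0 (negbTE dconst_neq0) /= => /eqP/(congr1 (@complex.Re R)) /= /eqP.
  by rewrite (gt_eqF h).
exists k0 => //; split=> // V l irrV hwV dl.
have [k kE] := weyl_character cG simpleK mT basT simpS irrV hwV.
pose q := k / k0; have kq : k = q * k0 by rewrite /q mulfVK.
have [M1 M10 s1] := small rho rr; have [M2 M20 s2] := small _ (regular_rho dl).
(* Small enough for the sine products of both [rho] and [l + rho] to be positive, and tending to
   0. *)
pose c (j : nat) : R := (M1 + M2)^-1 * j.+1%:R^-1.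
have M0 : 0 < M1 + M2 by exact: addr_gt0.
have c0 j : 0 < c j by rewrite mulr_gt0 ?invr_gt0.
have cle j M : 0 < M -> M <= M1 + M2 -> c j <= M^-1.
  move=> M'0 MM; apply: (@le_trans _ _ (M1 + M2)^-1); last by rewrite lef_pV2 ?posrE.
  by rewrite ler_piMr ?invr_ge0 ?(ltW M0)// invf_le1 ?ltr0n// ler1n.
have s1j j : 0 < sd (c j *: yv rho) by apply: s1 => //; apply: cle => //; rewrite lerDl ltW.
have s2j j : 0 < sd (c j *: yv (l + rho)) by apply: s2 => //; apply: cle => //; rewrite lerDr ltW.
pose t j := sd (c j *: yv (l + rho)) / sd (c j *: yv rho).
have t0 j : 0 < t j by rewrite divr_gt0.
pose u j := ch V (- (c j *: yv rho)).
have uE j : u j = q * (t j)%:C%C.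
  have := kE (- (c j *: yv rho)); rewrite J_sym kq -mulrA -k0E !delta_neg -/(u j) => H.
  have n0 : (sd (c j *: yv rho))%:C%C != 0 :> R[i] by rewrite eq_complex /= gt_eqF.
  have E : dconst * ((sd (c j *: yv rho))%:C%C * u j) =
           dconst * (q * (sd (c j *: yv (l + rho)))%:C%C) by rewrite mulrA H mulrCA.
  apply: (mulfI n0); rewrite (mulfI dconst_neq0 E) [RHS]mulrCA -rmorphM; congr (_ * _%:C%C).
  by rewrite /t mulrC divfK// gt_eqF.
have ucv : ccvg u (rdim V)%:R.
  rewrite -(ch0 irrV hwV); apply: (ccvg_ch irrV hwV) => b.
  have -> : ev b 0 = - (ev b (yv rho) * ((M1 + M2)^-1 * 0)).
    by rewrite /ev mulmx0 mxE !mulr0 oppr0.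
  under eq_fun do rewrite evNr evZr mulrC.
  apply: cvgN; apply: cvgM; first exact: cvg_cst.
  by apply: cvgM; [exact: cvg_cst|exact: cvg_harmonic].
have [uR uI] := ucv.
have RM : complex.Re ((rdim V)%:R : R[i]) = (rdim V)%:R.
  by rewrite -(rmorph_nat (@real_complex R)).
have IM : complex.Im ((rdim V)%:R : R[i]) = 0.
  by rewrite -(rmorph_nat (@real_complex R)).
rewrite RM in uR; rewrite IM in uI.
have m0 : 0 < (rdim V)%:R :> R by case: irrV => h _; rewrite ltr0n.
have Rj j : complex.Re (u j) = complex.Re q * t j by rewrite uE; case: (q) => ? ? /=; ring.
have Ij j : complex.Im (u j) = complex.Im q * t j by rewrite uE; case: (q) => ? ? /=; ring.
(* Each [u j] is [q] times a real number, so [Im q * Re (u j) = Re q * Im (u j)]. In the limit the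
   right side vanishes and the left is [Im q] times the dimension. *)
have Iq : complex.Im q = 0.
  have h1 : complex.Im q * complex.Re (u j) @[j --> \oo] --> complex.Im q * (rdim V)%:R.
    by apply: cvgM => //; exact: cvg_cst.
  have h2 : complex.Re q * complex.Im (u j) @[j --> \oo] --> complex.Re q * 0.
    by apply: cvgM => //; exact: cvg_cst.
  have E : (fun j => complex.Im q * complex.Re (u j)) = (fun j => complex.Re q * complex.Im (u j)).
    by apply/funext => j; rewrite Rj Ij; ring.
  rewrite E in h1.
  have e0 : complex.Im q * (rdim V)%:R = complex.Re q * 0.
    by apply: (cvg_unique _ h1 h2); exact: norm_hausdorff.
  by apply: (mulIf (lt0r_neq0 m0)); rewrite e0 mulr0 mul0r.
have Rq : 0 < complex.Re q.
  have /cvgrPdist_lt/(_ _ m0) [N _ HN] := uR; have := HN N (leqnn N).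
  rewrite /= ltr_distlC subrr Rj => /andP[h _]; by rewrite (pmulr_lgt0 _ (t0 N)) in h.
exists (complex.Re q) => // x; rewrite kE kq; congr (_ * _ * _).
by apply/eqP; rewrite eq_complex /= eqxx Iq /=.
Qed.

End Inner.

(** * The walk in the level k alcove *)

Lemma ev_continuous {R : realType} {r : nat} (z : 'cV[R]_r) : continuous (fun c : 'rV[R]_r => ev c z).
Proof.
have -> : (fun c : 'rV[R]_r => ev c z) = (fun c => \sum_j c 0 j * z j 0).
  by apply/funext => c; rewrite /ev mxE.
have H (t : seq 'I_r) : continuous (fun c : 'rV[R]_r => (\sum_(j <- t) c 0 j * z j 0) : R).
  elim: t => [|j t IH] c.
    have -> : (fun c : 'rV[R]_r => (\sum_(j <- [::]) c 0 j * z j 0) : R) = (fun=> 0 : R).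
      by apply/funext => c'; rewrite big_nil.
    exact: cst_continuous.
  have -> : (fun c : 'rV[R]_r => (\sum_(j <- j :: t) c 0 j * z j 0) : R) =
      (fun c : 'rV[R]_r => c 0 j * z j 0 : R) \+ (fun c => (\sum_(j <- t) c 0 j * z j 0) : R).
    by apply/funext => c'; rewrite big_cons.
  apply: continuousD; last exact: IH.
  have h : {for c, continuous (fun c : 'rV[R]_r => c 0 j : R)} := @coord_continuous R 1 r 0 j c.
  have h2 : {for c, continuous (fun=> z j 0 : R)} := @cst_continuous _ _ (z j 0) c.
  exact: (continuousM h h2).
exact: H.
Qed.

Lemma complex_split {R : realType} (z : R[i]) :
  z = (complex.Re z)%:C%C + 'i%C * (complex.Im z)%:C%C.
Proof. by case: z => a b; apply/eqP; rewrite eq_complex /=; apply/andP; split; apply/eqP; ring. Qed.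

Section Level.
Context {R : realType} {n r : nat} (D : lie_data R n r).
Hypotheses (cG : compact_group (grp D)) (simpleK : simple_lie (lie (grp D))).
Hypotheses (mT : maximal_torus (grp D) (tor D)) (basT : torus_basis D).
Hypotheses (simpS : simple_system D) (hth : highest_root D) (innerK : normalized_inner D).
Implicit Types (a b l : 'rV[R]_r) (x y z : 'cV[R]_r) (w v : 'M[R]_r).

Local Notation cor := (coroot D).
Local Notation s := (size (simple_roots D)).
Local Notation al := (@al R n r D).
Local Notation rho := (rho D).
Local Notation th := (theta D).
Local Notation yv := (nu_inv D).
Local Notation sw := (scaled_weight D).
Local Notation E := (nu_alcove D).

Let ra i : is_root D (al i). Proof. exact: al_root. Qed.

Let rr : regular D rho.
Proof. by move=> i; rewrite (rho_al cG simpleK mT basT simpS). Qed.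

Lemma theta_pos : pos_roots D th.
Proof.
case: (pos_or_neg cG mT basT simpS hth.1) => // pn.
have h := regular_pos cG simpleK mT basT simpS innerK rr pn.
have h2 : 0 <= ev (th - - th) (yv rho).
  apply: (nncomb_ev_ge0 (hth.2 _ pn.1)) => i.
  by apply: ltW; exact: (regular_al cG mT basT simpS innerK).
by move: h2 h; rewrite opprK evD evN; lra.
Qed.

Lemma coxeter_gt1 : 1 < dual_coxeter D.
Proof.
rewrite /dual_coxeter ltrDl (ev_theta_yv cG mT basT hth innerK).
exact: (regular_pos cG simpleK mT basT simpS innerK rr theta_pos).
Qed.

Lemma nu_alcove_dominant b : E b <-> dominant D b /\ ev b (cor th) <= 1.
Proof.
split=> [[x [x0 x1] <-]|[d0 d1]].
  split=> [i|]; last by rewrite (ev_theta_yv cG mT basT hth innerK) (yv_nu mT basT innerK).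
  rewrite (ev_cor_yv cG mT basT innerK _ (ra i)) (yv_nu mT basT innerK) mulr_ge0//.
    by apply: x0; exact: mem_nth.
  by apply: ltW; exact: (cor_ip_gt0 cG mT basT innerK).
exists (yv b); last exact: (nu_invK mT basT innerK).
split=> [a /(nthP 0)[i si <-]|]; last by rewrite -(ev_theta_yv cG mT basT hth innerK).
have := d0 (Ordinal si); rewrite (ev_cor_yv cG mT basT innerK _ (ra _)) pmulr_lge0//.
exact: (cor_ip_gt0 cG mT basT innerK).
Qed.

Lemma alcove_yv b : E b -> alcove D (yv b).
Proof. by case=> x Ax <-; rewrite (yv_nu mT basT innerK). Qed.

Lemma dominant_weightsP l : dominant_weights D l <-> weight_lattice D l /\ dominant D l.
Proof.
split=> -[wl dl]; split=> //; first by move=> i; apply: dl; exact: mem_nth.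
by move=> a /(nthP 0)[i si <-]; exact: (dl (Ordinal si)).
Qed.

Lemma kh_gt0 k : 0 < k%:R + dual_coxeter D.
Proof. by have := coxeter_gt1; have := ler0n R k; lra. Qed.

Lemma level_regular k l : level_weights D k l -> regular D (l + rho).
Proof. by case=> /dominant_weightsP[_ dl] _; exact: (regular_rho cG simpleK mT basT simpS). Qed.

(** The shift by [rho] moves the weight off the walls of the chamber. For the last wall, [l + rho]
    is at most [k + h - 1] on the coroot of [theta], with [h] the dual Coxeter number. *)
Lemma scaled_interior k l a : level_weights D k l -> pos_roots D a ->
  0 < ev a (yv (sw k l)) < 1.
Proof.
move=> kl pa; have rl := level_regular kl.
rewrite /scaled_weight (yvZ mT basT innerK) evZr mulr_gt0 ?invr_gt0 ?kh_gt0//=; last first.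
  exact: (regular_pos cG simpleK mT basT simpS innerK rl).
rewrite ltr_pdivrMl ?kh_gt0// mulr1.
have h : 0 <= ev (th - a) (yv (l + rho)).
  apply: (nncomb_ev_ge0 (hth.2 _ pa.1)) => i.
  by apply: ltW; exact: (regular_al cG mT basT simpS innerK).
have := kl.2; move: h; rewrite evD evN -(ev_theta_yv cG mT basT hth innerK) evD /dual_coxeter.
by lra.
Qed.

Lemma scaled_alcove k l : level_weights D k l -> E (sw k l).
Proof.
move=> kl; apply/nu_alcove_dominant; split=> [i|].
  rewrite (ev_cor_yv cG mT basT innerK _ (ra i)) mulr_ge0//.
    by have /andP[/ltW] := scaled_interior kl (al_pos simpS i).
  by apply: ltW; exact: (cor_ip_gt0 cG mT basT innerK).
rewrite (ev_theta_yv cG mT basT hth innerK).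
by have /andP[_ /ltW] := scaled_interior kl theta_pos.
Qed.

Lemma level0 k : level_weights D k 0.
Proof.
split; last by rewrite ev0.
by apply/dominant_weightsP; split; [exact: weight0|move=> i; rewrite ev0].
Qed.

Lemma level_bound k l i : level_weights D k l ->
  ev l (cor (al i)) <= k%:R * (ip D (cor (al i)) (cor (al i)) / 2).
Proof.
move=> [/dominant_weightsP[_ dl] lk]; rewrite (ev_cor_yv cG mT basT innerK _ (ra i)).
rewrite ler_wpM2r//; first by apply: ltW; exact: (cor_ip_gt0 cG mT basT innerK).
have h : 0 <= ev (th - al i) (yv l).
  apply: (nncomb_ev_ge0 (hth.2 _ (ra i))) => j.
  have := dl j; rewrite (ev_cor_yv cG mT basT innerK _ (ra _)) pmulr_lge0//.
  exact: (cor_ip_gt0 cG mT basT innerK).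
by move: h lk; rewrite evD evN (ev_theta_yv cG mT basT hth innerK); lra.
Qed.

(** A weight is determined by its pairings with the simple coroots, and at level [k] these are
    natural numbers below a common bound [B]. *)
Lemma finite_level k : finite_set (level_weights D k).
Proof.
pose C i := ip D (cor (al i)) (cor (al i)) / 2.
have C0 i : 0 <= k%:R * C i.
  by rewrite mulr_ge0// ltW//; exact: (cor_ip_gt0 cG mT basT innerK).
pose B := Num.bound (\sum_i k%:R * C i).
have BP i : k%:R * C i < B%:R.
  apply: le_lt_trans (archi_boundP _); last by rewrite sumr_ge0.
  by rewrite (bigD1 i)//= lerDl sumr_ge0.
pose g (f : {ffun 'I_s -> 'I_B.+1}) : 'rV[R]_r :=
  xget 0 [set l | forall i, ev l (cor (al i)) = (f i)%:R].
apply: (@sub_finite_set _ _ (g @` [set: {ffun 'I_s -> 'I_B.+1}])); last first.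
  by apply: finite_image; exact: finite_finset.
move=> l kl; have [/dominant_weightsP[wl dl] lk] := kl.
have H i : exists m : 'I_B.+1, ev l (cor (al i)) = m%:R.
  have : ev l (cor (al i)) \is a Num.nat by rewrite natrEint (wl _ (ra i)) dl.
  move=> /natrP[m mE]; have mB : (m < B.+1)%N.
    rewrite ltnS -(ler_nat R) -mE; apply: ltW; apply: le_lt_trans (BP i).
    exact: level_bound.
  by exists (Ordinal mB).
have [f fE] := choice H; exists (finfun f) => //.
apply: xget_unique => [i|l' Hl' /=]; first by rewrite ffunE.
apply: ev_inj => x; have [c ->] := coroot_expand cG simpleK mT basT simpS x.
by rewrite !ev_sumr; apply: eq_bigr => i _; rewrite !evZr Hl' ffunE fE.
Qed.

Definition level_seq k : seq 'rV[R]_r := finmap.enum_fset (fset_set (level_weights D k)).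

Lemma mem_level k b : b \in level_seq k <-> level_weights D k b.
Proof.
have H : (b \in level_seq k) = (b \in level_weights D k) := in_fset_set (finite_level k) b.
by rewrite H; split => [/set_mem|/mem_set].
Qed.

Lemma level_sum k (F : 'rV[R]_r -> R[i]) :
  \sum_(b \in level_weights D k) F b = \sum_(b <- level_seq k) F b.
Proof. exact: fsbig_finite (finite_level k). Qed.

Lemma compact_nu_alcove : compact E.
Proof.
have cl : closed E.
  have -> : E = \bigcap_(i in [set: 'I_s]) [set b | 0 <= ev b (cor (al i))] `&`
      [set b | ev b (cor th) <= 1].
    apply/seteqP; split=> b /=.
      by move=> /nu_alcove_dominant[h1 h2]; split=> // i _; exact: h1.
    by move=> [h1 h2]; apply/nu_alcove_dominant; split=> // i; exact: h1.
  apply: closedI.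
    apply: closed_bigI => i _.
    have h : closed ((fun b => ev b (cor (al i))) @^-1` [set x : R | 0 <= x]).
      by move/continuous_closedP: (@ev_continuous R r (cor (al i))); apply; exact: closed_ge.
    exact: h.
  have h : closed ((fun b => ev b (cor th)) @^-1` [set x : R | x <= 1]).
    by move/continuous_closedP: (@ev_continuous R r (cor th)); apply; exact: closed_le.
  exact: h.
have bd (j : 'I_r) : exists M : R, forall b, E b -> `|b 0 j| <= M.
  have [c cE] := coroot_expand cG simpleK mT basT simpS (delta_mx j 0).
  exists (\sum_i `|c i| * (ip D (cor (al i)) (cor (al i)) / 2)) => b Eb.
  have -> : b 0 j = ev b (delta_mx j 0).
    rewrite /ev mxE (bigD1 j)//= big1 => [|i ij]; rewrite !mxE ?eqxx ?mulr1 ?addr0//.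
    by rewrite (negbTE ij) mulr0.
  rewrite cE ev_sumr; apply: le_trans (ler_norm_sum _ _ _) _; apply: ler_sum => i _.
  rewrite evZr normrM ler_wpM2l// (ev_cor_yv cG mT basT innerK _ (ra i)) normrM.
  have h := cor_ip_gt0 cG mT basT innerK (ra i).
  rewrite (gtr0_norm h) ler_piMl//; first exact: ltW.
  exact: (root_alcove cG mT basT simpS hth (ra i) (alcove_yv Eb)).
have [M HM] := choice bd.
apply: (subclosed_compact cl (@rV_compact R r (fun j => `[- M j, M j]%classic) (fun j => @segment_compact _ _ _))).
by move=> b Eb j /=; rewrite in_itv /= -ler_norml; exact: HM.
Qed.

Variables (V : 'rV[R]_r -> rep D).
Variable N : nat -> 'rV[R]_r -> 'rV[R]_r -> 'rV[R]_r -> nat.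
Hypotheses (irrV : is_highest_weight_family V) (fusN : is_fusion V N).

Local Notation chi := (chi V).

Lemma scaled_sd_gt0 k l : level_weights D k l -> 0 < sd D (yv (sw k l)).
Proof. by move=> kl; apply: (sd_gt0 cG mT basT) => a; exact: scaled_interior. Qed.

(** The constant [k0] is shared by all levels and weights, so it cancels when two characters are
    compared; the factors [q] are positive. The value at 0 follows by exchanging [l + rho] and [rho]
    with [J_sym]. *)
Lemma chi_J : exists k0 : R[i], forall k l, level_weights D k l ->
  exists2 q : R, 0 < q &
    chi k l 0 = (q * sd D (yv (sw k l)) / sd D (yv (sw k 0)))%:C%C /\
    forall t, dconst D * (sd D (yv (sw k t)))%:C%C * chi k l t =
      q%:C%C * k0 * J D (l + rho) (- ((k%:R + dual_coxeter D)^-1 *: yv (t + rho))).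
Proof.
have [k0 k00 [k0E HV]] := normalization cG simpleK mT basT simpS innerK.
exists k0 => k l kl; have dl := kl.1.
have [irr hw] := irrV dl; have [_ dl'] := (dominant_weightsP l).1 dl.
have [q q0 qE] := HV _ _ irr hw dl'; exists q => //.
have H t : dconst D * (sd D (yv (sw k t)))%:C%C * chi k l t =
      q%:C%C * k0 * J D (l + rho) (- ((k%:R + dual_coxeter D)^-1 *: yv (t + rho))).
  by rewrite -delta_neg /Defs.chi qE /scaled_weight (yvZ mT basT innerK).
split=> //; have s0 := scaled_sd_gt0 (level0 k).
have := H 0; rewrite (J_sym cG simpleK mT basT simpS innerK) add0r -[X in _ = X]mulrA -k0E.
rewrite -(yvZ mT basT innerK) -/(sw k l) delta_neg => H0.
have n0 : (sd D (yv (sw k 0)))%:C%C != 0 :> R[i] by rewrite eq_complex /= gt_eqF.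
apply: (mulfI n0); apply: (mulfI (dconst_neq0 D)); rewrite mulrA H0.
rewrite mulrCA; congr (_ * _); move: s0 {H0 n0}; set S0 := sd D _ => s0; set S := sd D _.
have e : q * S = S0 * (q * S / S0) by field; rewrite gt_eqF.
transitivity ((S0 * (q * S / S0))%:C%C : R[i]); first by rewrite -e rmorphM.
by rewrite rmorphM.
Qed.

Lemma chi0_gt0 k l : level_weights D k l -> exists2 d : R, 0 < d & chi k l 0 = d%:C%C.
Proof.
have [k0 H] := chi_J; move=> kl; have [q q0 [-> _]] := H _ _ kl.
exists (q * sd D (yv (sw k l)) / sd D (yv (sw k 0))) => //.
by rewrite divr_gt0 ?mulr_gt0 ?scaled_sd_gt0//; exact: level0.
Qed.

Lemma chi0_neq0 k l : level_weights D k l -> chi k l 0 != 0.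
Proof. by move=> /chi0_gt0[d d0 ->]; rewrite eq_complex /= gt_eqF. Qed.

Lemma chi_sym k l t : level_weights D k l -> level_weights D k t ->
  chi k l t * chi k t 0 = chi k t l * chi k l 0.
Proof.
have [k0 H] := chi_J; move=> kl kt.
have [q q0 [qE qJ]] := H _ _ kl; have [p p0 [pE pJ]] := H _ _ kt.
rewrite qE pE; apply: (mulfI (dconst_neq0 D)); rewrite !rmorphM /=.
set e := (_^-1)%:C%C.
transitivity (dconst D * (sd D (yv (sw k t)))%:C%C * chi k l t * p%:C%C * e); first by ring.
rewrite qJ (J_sym cG simpleK mT basT simpS innerK).
transitivity (dconst D * (sd D (yv (sw k l)))%:C%C * chi k t l * q%:C%C * e); last by ring.
by rewrite pJ; ring.
Qed.

Lemma walk_mean k g l m : (0 < k)%N -> level_weights D k g -> level_weights D k l ->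
  level_weights D k m ->
  \sum_(b <- level_seq k) walk_kernel V N k g l b * chi k m b =
  chi k m l * chi k m g / chi k m 0.
Proof.
move=> k0 kg kl km; have ng := chi0_neq0 kg; have nl := chi0_neq0 kl; have nm := chi0_neq0 km.
(* Symmetry moves [b] from the argument to the index, where the fusion rule at the point [m] sums
   it. *)
transitivity (\sum_(b <- level_seq k) (N k l g b)%:R * chi k b m * (chi k m 0 / (chi k l 0 * chi k g 0))).
  apply: eq_big_seq => b /mem_level kb; rewrite /walk_kernel.
  have e := chi_sym km kb.
  transitivity ((N k l g b)%:R * (chi k m b * chi k b 0) / (chi k l 0 * chi k g 0)).
    by field; rewrite ng nl.
  by rewrite e; field; rewrite ng nl.
rewrite -mulr_suml -level_sum -fusN//.
have e1 : chi k l m = chi k m l * chi k l 0 / chi k m 0 by rewrite (chi_sym km kl) mulfK.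
have e2 : chi k g m = chi k m g * chi k g 0 / chi k m 0 by rewrite (chi_sym km kg) mulfK.
by rewrite e1 e2; field; rewrite ng nl nm.
Qed.

Lemma walk_total k g l : (0 < k)%N -> level_weights D k g -> level_weights D k l ->
  \sum_(b <- level_seq k) walk_kernel V N k g l b = 1.
Proof.
move=> k0 kg kl; have ng := chi0_neq0 kg; have nl := chi0_neq0 kl.
transitivity (\sum_(b <- level_seq k) (N k l g b)%:R * chi k b 0 * (chi k l 0 * chi k g 0)^-1).
  by apply: eq_bigr => b _; rewrite /walk_kernel mulrA.
by rewrite -mulr_suml -level_sum -fusN// ?divff ?mulf_neq0//; exact: level0.
Qed.

Lemma walk_kernel_ge0 k g l b : level_weights D k g -> level_weights D k l ->
  level_weights D k b -> exists2 q : R, 0 <= q & walk_kernel V N k g l b = q%:C%C.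
Proof.
move=> /chi0_gt0[dg g0 gE] /chi0_gt0[dl l0 lE] /chi0_gt0[db b0 bE].
exists ((N k l g b)%:R * (db / (dl * dg))); first by rewrite mulr_ge0// divr_ge0// ?mulr_ge0// ltW.
by rewrite /walk_kernel gE lE bE !rmorphM /= rmorph_nat fmorphV rmorphM.
Qed.

Lemma walk_law k g l : (0 < k)%N -> level_weights D k g -> level_weights D k l ->
  exists P : probability (tdual R r) R, [/\ P E = 1%E, is_walk_law V N k g l P &
    forall F : 'rV[R]_r -> R[i], wc E (fun b => complex.Re (F b)) ->
      wc E (fun b => complex.Im (F b)) ->
      complex_integral P E F = \sum_(b <- level_seq k) walk_kernel V N k g l b * F (sw k b)].
Proof.
move=> k0 kg kl; pose L := level_seq k.
(* Masses are indexed by all naturals; the value 0 beyond the list keeps them nonnegative. *)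
pose q i : R := if (i < size L)%N then complex.Re (walk_kernel V N k g l (nth 0 L i)) else 0.
pose pt i := sw k (nth 0 L i).
have Lk i : (i < size L)%N -> level_weights D k (nth 0 L i).
  by move=> iL; apply/mem_level; exact: mem_nth.
have q0 i : 0 <= q i.
  rewrite /q; case: ifP => // iL; have [p p0 ->] := walk_kernel_ge0 kg kl (Lk _ iL).
  exact: p0.
have key (f : 'rV[R]_r -> R) : (\sum_(i < size L) q i * f (pt i))%:C%C =
    \sum_(b <- L) walk_kernel V N k g l b * (f (sw k b))%:C%C.
  rewrite (big_nth (0 : 'rV[R]_r)) big_mkord rmorph_sum; apply: eq_bigr => i _.
  rewrite rmorphM; congr (_ * _); rewrite /q ltn_ord.
  by have [p p0 ->] := walk_kernel_ge0 kg kl (Lk _ (ltn_ord i)).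
have q1 : \sum_(i < size L) q i = 1.
  have := key (fun=> 1); under eq_bigr do rewrite mulr1.
  under [in X in _ = X -> _]eq_bigr do rewrite mulr1.
  by rewrite (walk_total k0 kg kl) => /(congr1 (@complex.Re R)).
have [P PE] := discrete_probability pt q0 q1.
have Ept i : (i < size L)%N -> E (pt i) by move=> /Lk; exact: scaled_alcove.
have P1 : P E = 1%E.
  rewrite PE -q1; congr (_%:E); apply: eq_bigr => i _.
  by rewrite indicE mem_set ?mulr1//; exact: Ept.
have fL : functional E (fun f => \sum_(i < size L) q i * f (pt i)).
  split.
  - by move=> f f' _ _; rewrite -big_split; apply: eq_bigr => i _; rewrite mulrDr.
  - by move=> f c _; rewrite mulr_sumr; apply: eq_bigr => i _; rewrite mulrCA.
  - by move=> f _ f0; apply: sumr_ge0 => i _; rewrite mulr_ge0// f0//; exact: Ept.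
  - by under eq_bigr do rewrite mulr1.
(* With this bound [integ_eq] identifies the integrals as finite sums, just as for the Riesz
   measure. *)
have muL (phi : 'rV[R]_r -> R) : wc E phi -> (forall b, E b -> 0 <= phi b) ->
    fine (P (E `&` [set b | 1 <= phi b])) <= \sum_(i < size L) q i * phi (pt i).
  move=> _ phi0; rewrite PE /=; apply: ler_sum => i _; rewrite ler_wpM2l// indicE.
  by case: (boolP (_ \in _)) => [/set_mem[_]//|_]; apply: phi0; exact: Ept.
exists P; split=> // [B _|F wR wI].
  by rewrite PE /= (key (fun b => \1_B b)) level_sum.
have iE f : wc E f -> integ E P f = \sum_(i < size L) q i * f (pt i).
  exact: (integ_eq compact_nu_alcove P1 fL muL).
rewrite /complex_integral -/(integ E P _) -/(integ E P _) (iE _ wR) (iE _ wI).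
rewrite [LHS]complex_split /= (key (fun b => complex.Re (F b))) (key (fun b => complex.Im (F b))).
rewrite mulr_sumr -big_split; apply: eq_bigr => b _ /=.
by rewrite [in RHS](complex_split (F (sw k b))) mulrDr [in LHS]mulrCA.
Qed.

End Level.

(** * Convergence of the walk laws *)

Section FunctionSpan.
Context {R : realType} {T : Type} (gen : (T -> R[i]) -> Prop).

Inductive fspan : (T -> R[i]) -> Prop :=
| fspan0 : fspan (fun=> 0)
| fspan_cons (a : R[i]) G F : gen G -> fspan F -> fspan (fun x => a * G x + F x).

Lemma fspan_gen (a : R[i]) G : gen G -> fspan (fun x => a * G x).
Proof.
move=> gG; have -> : (fun x => a * G x) = (fun x => a * G x + (fun=> 0) x).
  by apply/funext => x; rewrite addr0.
exact: fspan_cons gG fspan0.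
Qed.

Lemma fspanD F H : fspan F -> fspan H -> fspan (fun x => F x + H x).
Proof.
move=> sF sH; elim: sF => [|a G F' gG _ IH].
  have -> : (fun x => 0 + H x) = H by apply/funext => x; rewrite add0r.
  exact: sH.
have -> : (fun x => a * G x + F' x + H x) = (fun x => a * G x + (F' x + H x)).
  by apply/funext => x; rewrite addrA.
exact: fspan_cons gG IH.
Qed.

Lemma fspanZ (c : R[i]) F : fspan F -> fspan (fun x => c * F x).
Proof.
elim=> [|a G F' gG _ IH].
  have -> : (fun x : T => c * 0) = (fun=> 0) by apply/funext => x; rewrite mulr0.
  exact: fspan0.
have -> : (fun x => c * (a * G x + F' x)) = (fun x => (c * a) * G x + (c * F' x)).
  by apply/funext => x; rewrite mulrDr mulrA.
exact: fspan_cons gG IH.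
Qed.

Lemma fspan_sum (I : Type) (t : seq I) (F : I -> T -> R[i]) : (forall i, fspan (F i)) ->
  fspan (fun x => \sum_(i <- t) F i x).
Proof.
move=> sF; elim: t => [|i t IH].
  have -> : (fun x => \sum_(i <- [::]) F i x) = (fun=> 0) by apply/funext => x; rewrite big_nil.
  exact: fspan0.
have -> : (fun x => \sum_(j <- i :: t) F j x) = (fun x => F i x + \sum_(j <- t) F j x).
  by apply/funext => x; rewrite big_cons.
exact: fspanD.
Qed.

Hypothesis genM : forall G H, gen G -> gen H -> fspan (fun x => G x * H x).

Lemma fspanM F H : fspan F -> fspan H -> fspan (fun x => F x * H x).
Proof.
move=> sF sH; elim: sF => [|a G F' gG _ IH].
  have -> : (fun x => 0 * H x) = (fun=> 0) by apply/funext => x; rewrite mul0r.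
  exact: fspan0.
have -> : (fun x => (a * G x + F' x) * H x) = (fun x => a * (G x * H x) + F' x * H x).
  by apply/funext => x; rewrite mulrDl mulrA.
apply: fspanD => //; apply: fspanZ.
elim: sH => [|b G' H' gG' _ IH'].
  have -> : (fun x => G x * 0) = (fun=> 0) by apply/funext => x; rewrite mulr0.
  exact: fspan0.
have -> : (fun x => G x * (b * G' x + H' x)) = (fun x => b * (G x * G' x) + G x * H' x).
  by apply/funext => x; rewrite mulrDr mulrCA.
by apply: fspanD => //; apply: fspanZ; exact: genM.
Qed.

End FunctionSpan.

Section ComplexContinuity.
Context {R : realType}.

Lemma ccvgV (u : nat -> R[i]) a : a != 0 -> ccvg u a -> ccvg (fun k => (u k)^-1) a^-1.
Proof.
move=> a0 [u1 u2].
have n0 : complex.Re a ^+ 2 + complex.Im a ^+ 2 != 0.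
  apply: contraNneq a0 => /eqP; rewrite paddr_eq0 ?sqr_ge0// !sqrf_eq0 => /andP[/eqP e1 /eqP e2].
  by apply/eqP; rewrite [a]complex_split e1 e2 mulr0 addr0.
have H : (fun k => complex.Re (u k) ^+ 2 + complex.Im (u k) ^+ 2) @ \oo -->
    complex.Re a ^+ 2 + complex.Im a ^+ 2.
  by apply: cvgD; rewrite expr2; under eq_fun do rewrite expr2; apply: cvgM.
have RE (z : R[i]) : complex.Re z^-1 = complex.Re z * (complex.Re z ^+ 2 + complex.Im z ^+ 2)^-1.
  by case: z.
have IE (z : R[i]) : complex.Im z^-1 = - complex.Im z * (complex.Re z ^+ 2 + complex.Im z ^+ 2)^-1.
  by case: z => x y /=; rewrite mulNr.
split; rewrite ?RE ?IE; [under eq_fun do rewrite RE|under eq_fun do rewrite IE].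
  by apply: cvgM => //; exact: cvgV.
by apply: cvgM; [exact: cvgN|exact: cvgV].
Qed.

Lemma ccvg_eventually (u v : nat -> R[i]) a : (exists m, forall k, (m <= k)%N -> u k = v k) ->
  ccvg v a -> ccvg u a.
Proof.
move=> [m H] [v1 v2]; split.
  by apply: cvg_trans v1; apply: near_eq_cvg; exists m => // k /= mk; rewrite H.
by apply: cvg_trans v2; apply: near_eq_cvg; exists m => // k /= mk; rewrite H.
Qed.

Lemma continuous_scale {T : topologicalType} (b : R) (f : T -> R) :
  continuous f -> continuous (fun x => b * f x).
Proof. by move=> cf x; apply: cvgM; [exact: cvg_cst|exact: cf]. Qed.

Definition ccont {T : topologicalType} (F : T -> R[i]) : Prop :=
  continuous (fun x => complex.Re (F x)) /\ continuous (fun x => complex.Im (F x)).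

Lemma ccont_cst {T : topologicalType} (a : R[i]) : ccont (fun _ : T => a).
Proof. by split; exact: cst_continuous. Qed.

Lemma ccontD {T : topologicalType} (F G : T -> R[i]) : ccont F -> ccont G -> ccont (fun x => F x + G x).
Proof.
move=> [F1 F2] [G1 G2]; split.
  have -> : (fun x => complex.Re (F x + G x)) = (fun x => complex.Re (F x)) \+ (fun x => complex.Re (G x)).
    by apply/funext => x /=; case: (F x) (G x) => ? ? [].
  by move=> x; apply: continuousD; [exact: F1|exact: G1].
have -> : (fun x => complex.Im (F x + G x)) = (fun x => complex.Im (F x)) \+ (fun x => complex.Im (G x)).
  by apply/funext => x /=; case: (F x) (G x) => ? ? [].
by move=> x; apply: continuousD; [exact: F2|exact: G2].
Qed.

Lemma ccontZ {T : topologicalType} (a : R[i]) (F : T -> R[i]) : ccont F -> ccont (fun x => a * F x).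
Proof.
move=> [F1 F2].
have c := @continuous_scale T; split.
  have -> : (fun x => complex.Re (a * F x)) =
      (fun x => complex.Re a * complex.Re (F x)) \+ (fun x => - complex.Im a * complex.Im (F x)).
    by apply/funext => x /=; case: a (F x) => ? ? [? ?] /=; rewrite mulNr.
  by move=> x; apply: continuousD; exact: c.
have -> : (fun x => complex.Im (a * F x)) =
    (fun x => complex.Re a * complex.Im (F x)) \+ (fun x => complex.Im a * complex.Re (F x)).
  by apply/funext => x /=; case: a (F x) => ? ? [? ?] /=.
by move=> x; apply: continuousD; exact: c.
Qed.

Lemma ccont_sum {T : topologicalType} (I : Type) (t : seq I) (F : I -> T -> R[i]) :
  (forall i, ccont (F i)) -> ccont (fun x => \sum_(i <- t) F i x).
Proof.
move=> cF; elim: t => [|i t IH].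
  have -> : (fun x => \sum_(i <- [::]) F i x) = (fun=> 0) by apply/funext => x; rewrite big_nil.
  exact: ccont_cst.
have -> : (fun x => \sum_(j <- i :: t) F j x) = (fun x => F i x + \sum_(j <- t) F j x).
  by apply/funext => x; rewrite big_cons.
exact: ccontD.
Qed.

End ComplexContinuity.

(** * Test functions, limits of the means, and the limit measure *)

Section Convolution.
Context {R : realType} {n r : nat} (D : lie_data R n r).
Hypotheses (cG : compact_group (grp D)) (simpleK : simple_lie (lie (grp D))).
Hypotheses (mT : maximal_torus (grp D) (tor D)) (basT : torus_basis D).
Hypotheses (simpS : simple_system D) (hth : highest_root D) (innerK : normalized_inner D).
Variables (V : 'rV[R]_r -> rep D).
Variable N : nat -> 'rV[R]_r -> 'rV[R]_r -> 'rV[R]_r -> nat.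
Hypotheses (irrV : is_highest_weight_family V) (fusN : is_fusion V N).
Implicit Types (a b l : 'rV[R]_r) (x y z : 'cV[R]_r) (w v : 'M[R]_r).

Local Notation cor := (coroot D).
Local Notation s := (size (simple_roots D)).
Local Notation al := (@al R n r D).
Local Notation rho := (rho D).
Local Notation yv := (nu_inv D).
Local Notation sw := (scaled_weight D).
Local Notation E := (nu_alcove D).
Local Notation Ws := (Ws D).
Local Notation os := (orbit_sum D).
Local Notation chi := (chi V).

Let ra i : is_root D (al i). Proof. exact: al_root. Qed.

Definition char_gen (G : 'cV[R]_r -> R[i]) : Prop :=
  exists2 l, dominant_weights D l & G = ch (V l).
Definition orbit_gen (G : 'cV[R]_r -> R[i]) : Prop :=
  exists2 b, weight_lattice D b & G = os b.

(** Translating the inner Weyl sum by the outer variable gives [os b * os c] as the sum of the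
    [os (b + c u)], with no decomposition of tensor products. *)
Lemma orbit_genM G H : orbit_gen G -> orbit_gen H -> fspan orbit_gen (fun x => G x * H x).
Proof.
move=> [b wb ->] [c wc' ->].
(* The redundant filter keeps the membership of [u] at hand, from which [c *m u] is a weight. *)
have -> : (fun x => os b x * os c x) = (fun x => \sum_(u <- Ws | u \in Ws) os (b + c *m u) x).
  apply/funext => x; rewrite -big_seq.
  transitivity (\sum_(w <- Ws) cisev b (w *m x) * \sum_(u <- Ws) cisev c (u *m (w *m x))).
    rewrite [X in X * _]/orbit_sum mulr_suml; apply: eq_big_seq => w /(mem_Ws cG simpleK mT basT simpS) Hw.
    congr (_ * _); rewrite /orbit_sum -(sum_Wsr cG simpleK mT basT simpS (fun u => cisev c (u *m x)) Hw).
    by apply: eq_bigr => u _; rewrite mulmxA.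
  transitivity (\sum_(w <- Ws) \sum_(u <- Ws) cisev b (w *m x) * cisev c (u *m (w *m x))).
    by apply: eq_bigr => w _; rewrite mulr_sumr.
  rewrite exchange_big; apply: eq_bigr => u _; apply: eq_bigr => w _.
  by rewrite cisevD -cisev_mul.
have -> : (fun x => \sum_(u <- Ws | u \in Ws) os (b + c *m u) x) =
    (fun x => \sum_(u <- Ws) (if u \in Ws then os (b + c *m u) x else 0)).
  by apply/funext => x; rewrite big_mkcond.
apply: fspan_sum => u; case e : (u \in Ws); last exact: fspan0.
have Hu := (mem_Ws cG simpleK mT basT simpS u).1 e.
have -> : (fun x => os (b + c *m u) x) = (fun x => 1 * os (b + c *m u) x).
  by apply/funext => x; rewrite mul1r.
apply: fspan_gen; exists (b + c *m u) => //; apply: weight_lin => //.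
exact: (inW_weight cG mT basT simpS).
Qed.

(** The conjugate of an orbit sum is the orbit sum of [-b], so real and imaginary parts stay in the
    span. *)
Lemma orbit_sum_split b x :
  (complex.Re (os b x))%:C%C = 2^-1 * os b x + 2^-1 * os (- b) x /\
  (complex.Im (os b x))%:C%C = (- 'i%C / 2) * os b x + ('i%C / 2) * os (- b) x.
Proof.
have cj : os (- b) x = (complex.Re (os b x) +i* (- complex.Im (os b x)))%C.
  rewrite /orbit_sum; elim: Ws => [|w t IH].
    by rewrite !big_nil /= oppr0.
  rewrite !big_cons IH; move: (\sum_(_ <- _) _) => S; rewrite /cisev evN mulrN /cis cosN sinN.
  by apply/eqP; rewrite eq_complex /=; case: S => p q /=; apply/andP; split; apply/eqP; ring.
have h2 : (2 : R[i]) = (2 : R)%:C%C by rewrite rmorph_nat.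
have i2 : 'i%C * 'i%C = -1 :> R[i] by apply/eqP; rewrite eq_complex /=; apply/andP; split; apply/eqP; ring.
have t0 : (2 : R[i]) != 0 by rewrite pnatr_eq0.
rewrite cj; move: (os b x) => S.
have e2 : (complex.Re S +i* - complex.Im S)%C = (complex.Re S)%:C%C - 'i%C * (complex.Im S)%:C%C.
  by apply/eqP; rewrite eq_complex /=; apply/andP; split; apply/eqP; ring.
have SE := complex_split S; rewrite e2.
set p := (complex.Re S)%:C%C in SE *; set q := (complex.Im S)%:C%C in SE *.
clearbody p q; rewrite {}SE; clear e2; split; first by field.
transitivity (- ('i%C * 'i%C) * q); last by field.
by rewrite i2 opprK mul1r.
Qed.

Lemma orbit_sum_ccont b : ccont (fun c : 'rV[R]_r => os b (- yv c)).
Proof.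
rewrite /orbit_sum; apply: ccont_sum => w.
have H : continuous (fun c : 'rV[R]_r => 2%:R * pi * ev b (w *m - yv c)).
  have -> : (fun c : 'rV[R]_r => 2%:R * pi * ev b (w *m - yv c)) =
      (fun c => (- (2%:R * pi)) * ev c (invmx (Gi D) *m (b *m w)^T)).
    by apply/funext => c; rewrite mulmxN evNr (ev_yv_form mT basT innerK) mulrN mulNr.
  by apply: continuous_scale; exact: ev_continuous.
split=> c; rewrite /cisev /cis /=.
  exact: (continuous_comp (H c) (@continuous_cos R _)).
exact: (continuous_comp (H c) (@continuous_sin R _)).
Qed.

Lemma ch_ccont l : dominant_weights D l -> ccont (fun c : 'rV[R]_r => ch (V l) (- yv c)).
Proof.
move=> dl; have [irr hw] := irrV dl.
have [P uP [mu [muP nn]]] := weight_diag cG mT basT simpS irr hw.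
have -> : (fun c : 'rV[R]_r => ch (V l) (- yv c)) = (fun c => \sum_p cisev (mu p) (- yv c)).
  by apply/funext => c; rewrite (ch_mu cG mT basT uP muP).
apply: ccont_sum => p.
have H : continuous (fun c : 'rV[R]_r => 2%:R * pi * ev (mu p) (- yv c)).
  have -> : (fun c : 'rV[R]_r => 2%:R * pi * ev (mu p) (- yv c)) =
      (fun c => (- (2%:R * pi)) * ev c (invmx (Gi D) *m (mu p *m 1%:M)^T)).
    by apply/funext => c; rewrite evNr -(ev_yv_form mT basT innerK) mul1mx mulrN mulNr.
  by apply: continuous_scale; exact: ev_continuous.
split=> c; rewrite /cisev /cis /=.
  exact: (continuous_comp (H c) (@continuous_cos R _)).
exact: (continuous_comp (H c) (@continuous_sin R _)).
Qed.

Definition test_fun (f : 'rV[R]_r -> R) : Prop :=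
  exists2 F, fspan orbit_gen F & forall c, (f c)%:C%C = F (- yv c).

Lemma test_fun_cst (c : R) : test_fun (fun=> c).
Proof.
pose m : R[i] := (size Ws)%:R.
have m0 : m != 0.
  by have := Ws_size_neq0 cG simpleK mT basT simpS; rewrite !pnatr_eq0.
exists (fun x => c%:C%C / m * os 0 x) => [|b].
  by apply: fspan_gen; exists 0 => //; exact: weight0.
rewrite /orbit_sum (eq_bigr (fun=> 1)) => [|w _]; last by rewrite cisev0.
by rewrite big_const_seq count_predT iter_addr_0 divfK.
Qed.

Lemma test_funD f g : test_fun f -> test_fun g -> test_fun (fun c => f c + g c).
Proof.
move=> [F sF FE] [G sG GE]; exists (fun x => F x + G x) => [|c]; first exact: fspanD.
by rewrite rmorphD /= FE GE.
Qed.

Lemma test_funM f g : test_fun f -> test_fun g -> test_fun (fun c => f c * g c).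
Proof.
move=> [F sF FE] [G sG GE]; exists (fun x => F x * G x) => [|c].
  by apply: fspanM => // ? ?; exact: orbit_genM.
by rewrite rmorphM /= FE GE.
Qed.

Lemma wc_continuous (f : 'rV[R]_r -> R) : continuous f -> wc E f.
Proof. by move=> cf; apply: wcP; exact: continuous_subspaceT. Qed.

Lemma test_fun_wc f : test_fun f -> wc E f.
Proof.
move=> [F sF FE]; apply: wc_continuous.
have [cF _] : ccont (fun c : 'rV[R]_r => F (- yv c)).
  elim: sF => [|a G F' [b wb ->] _ IH]; first exact: ccont_cst.
  by apply: ccontD => //; apply: ccontZ; exact: orbit_sum_ccont.
have -> : f = (fun c => complex.Re (F (- yv c))) by apply/funext => c; rewrite -FE.
exact: cF.
Qed.

Lemma test_fun_sep a b : E a -> E b -> a <> b -> exists2 f, test_fun f & f a <> f b.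
Proof.
move=> Ea Eb ab; apply: contrapT => H; apply: ab.
have h f : test_fun f -> f a = f b.
  by move=> Af; apply: contrapT => fab; apply: H; exists f.
have Ay c : E c -> alcove D (yv c) := @alcove_yv _ _ _ _ mT basT innerK c.
suff e : yv a = yv b by rewrite -(nu_invK mT basT innerK a) e (nu_invK mT basT innerK).
apply: (alcove_separation cG simpleK mT basT simpS hth (Ay _ Ea) (Ay _ Eb)) => d wd.
have os_opp c : os d (yv c) = os (- d) (- yv c).
  by apply: eq_bigr => w _; rewrite /cisev mulmxN evN evNr opprK.
have wd' := weight_opp wd.
rewrite !os_opp [LHS]complex_split [RHS]complex_split.
have -> : complex.Re (os (- d) (- yv a)) = complex.Re (os (- d) (- yv b)).
  apply: (h (fun c => complex.Re (os (- d) (- yv c)))).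
  exists (fun x => 2^-1 * os (- d) x + 2^-1 * os (- - d) x) => [|c].
    by apply: fspanD; apply: fspan_gen; [exists (- d)|exists (- - d) => //; exact: weight_opp].
  by case: (orbit_sum_split (- d) (- yv c)).
congr (_ + _ * _%:C%C).
apply: (h (fun c => complex.Im (os (- d) (- yv c)))).
exists (fun x => (- 'i%C / 2) * os (- d) x + ('i%C / 2) * os (- - d) x) => [|c].
  by apply: fspanD; apply: fspan_gen; [exists (- d)|exists (- - d) => //; exact: weight_opp].
by case: (orbit_sum_split (- d) (- yv c)).
Qed.

Lemma J_span b : weight_lattice D b ->
  exists2 G, fspan char_gen G & forall x, J D b x = delta D x * G x.
Proof.
move=> wb; have [w Hw [db [k kE]]] := J_rep cG simpleK mT basT simpS b.
have wb' := inW_weight cG mT basT simpS Hw wb.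
have [[i i0]|H] := pselect (exists i, ev (b *m w) (cor (al i)) = 0).
  exists (fun=> 0) => [|x]; first exact: fspan0.
  by rewrite kE (J_singular cG simpleK mT basT simpS _ i0) !mulr0.
pose l := b *m w - rho.
have wl : weight_lattice D l.
  by apply: weight_lin => //; apply: weight_opp; exact: (rho_weight cG simpleK mT basT simpS).
have dl : dominant D l.
  move=> i; rewrite evD evN (rho_al cG simpleK mT basT simpS).
  have : ev (b *m w) (cor (al i)) \is a Num.nat by rewrite natrEint (wb' _ (ra i)) db.
  move=> /natrP[m mE]; rewrite mE subr_ge0 ler1n lt0n; apply/eqP => m0; apply: H.
  by exists i; rewrite mE m0.
have dwl : dominant_weights D l by apply/dominant_weightsP.
have [irr hw] := irrV dwl.
have [k0 k00 [_ HV]] := normalization cG simpleK mT basT simpS innerK.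
have [q q0 qE] := HV _ _ irr hw dl.
have n0 : q%:C%C * k0 != 0 :> R[i] by rewrite mulf_neq0// eq_complex /= gt_eqF.
exists (fun x => k / (q%:C%C * k0) * ch (V l) x) => [|x]; first by apply: fspan_gen; exists l.
rewrite mulrCA qE /l subrK kE [X in k / X]lock mulrA -lock divfK//.
Qed.

(** [delta] times an orbit sum is antisymmetric, so averaging writes it with alternating sums, each
    of which is [delta] times a combination of characters by [J_span]. The factor [delta] stays
    because it vanishes on the walls. *)
Lemma orbit_char b : weight_lattice D b ->
  exists2 G, fspan char_gen G & forall x, delta D x * os b x = delta D x * G x.
Proof.
move=> wb; pose I := (eps D * 'I_(size Ws))%type.
pose bb (p : I) := be p.1 + b *m nth 1%:M Ws p.2.
have wW (j : 'I_(size Ws)) : inW D (nth 1%:M Ws j).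
  by apply/(mem_Ws cG simpleK mT basT simpS); exact: mem_nth.
have fE x : delta D x * os b x = \sum_(p : I) sg p.1 * cisev (bb p) x.
  rewrite delta_sum /orbit_sum (big_nth (1%:M : 'M[R]_r)) big_mkord big_distrlr /=.
  rewrite pair_bigA /=; apply: eq_bigr => p _.
  by rewrite /bb cisevD cisev_mul mulrA.
have af : anti D (fun x => delta D x * os b x).
  move=> i x; rewrite (delta_anti cG simpleK mT basT simpS i x) mulNr; congr (- (_ * _)).
  rewrite /orbit_sum -[RHS](sum_Wsr cG simpleK mT basT simpS (fun u => cisev b (u *m x)) (inW_al i)).
  by apply: eq_bigr => w _; rewrite mulmxA.
have HG (p : I) : exists G, fspan char_gen G /\ forall x, J D (bb p) x = delta D x * G x.
  have [|G sG GE] := @J_span (bb p); last by exists G.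
  apply: weight_lin; first exact: (be_weight cG simpleK mT basT simpS).
  exact: (inW_weight cG mT basT simpS).
have [G GP] := choice HG.
pose m : R[i] := (size Ws)%:R.
have m0 : m != 0.
  by have := Ws_size_neq0 cG simpleK mT basT simpS; rewrite !pnatr_eq0.
exists (fun x => m^-1 * \sum_(p : I) sg p.1 * G p x) => [|x].
  by apply: fspanZ; apply: fspan_sum => p; apply: fspanZ; case: (GP p).
apply: (mulfI m0); rewrite (anti_avg cG simpleK mT basT simpS x fE af).
rewrite [RHS]mulrCA mulVKf// mulr_sumr; apply: eq_bigr => p _.
by rewrite (GP p).2 mulrCA.
Qed.

Lemma orbit_span_char F : fspan orbit_gen F ->
  exists2 G, fspan char_gen G & forall x, delta D x * F x = delta D x * G x.
Proof.
elim=> [|a G F' [b wb ->] _ [H sH HE]]; first by exists (fun=> 0) => //; exact: fspan0.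
have [H' sH' HE'] := orbit_char wb.
exists (fun x => a * H' x + H x) => [|x]; first by apply: fspanD => //; exact: fspanZ.
by rewrite !mulrDr HE mulrCA HE' mulrCA.
Qed.

Variables (xi gamma : 'rV[R]_r) (xi_ gamma_ : nat -> 'rV[R]_r).
Hypotheses (xiL : forall k, (0 < k)%N -> level_weights D k (xi_ k)).
Hypotheses (gaL : forall k, (0 < k)%N -> level_weights D k (gamma_ k)).
Hypotheses (xi_cvg : (k%:R^-1 *: xi_ k) @[k --> \oo] --> xi).
Hypotheses (ga_cvg : (k%:R^-1 *: gamma_ k) @[k --> \oo] --> gamma).

(** The shift by [rho] and the dual Coxeter number disappear in the limit. Indices are [k.+1] since
    levels start at 1. *)
Lemma scaled_cvg (l_ : nat -> 'rV[R]_r) l b : (k%:R^-1 *: l_ k) @[k --> \oo] --> l ->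
  ev b (- yv (sw k.+1 (l_ k.+1))) @[k --> \oo] --> ev b (- yv l).
Proof.
move=> lc; pose z := invmx (Gi D) *m (b *m 1%:M)^T.
have zE c : ev b (- yv c) = - ev c z by rewrite evNr -(ev_yv_form mT basT innerK) mul1mx.
rewrite zE; under eq_fun do rewrite zE; apply: cvgN.
have H0 : ev (k%:R^-1 *: l_ k) z @[k --> \oo] --> ev l z.
  exact: (continuous_cvg _ (@ev_continuous R r z l) lc).
have H1 : (fun k => ev (k.+1%:R^-1 *: l_ k.+1) z) @ \oo --> ev l z by move: H0; rewrite -cvg_shiftS.
pose h := dual_coxeter D.
have h1 : 1 < h := coxeter_gt1 cG simpleK mT basT simpS hth innerK.
pose t k : R := (k.+1%:R + h)^-1.
have t0 : t @ \oo --> (0 : R).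
  apply: (@squeeze_cvgr _ _ _ _ (fun=> 0) (@harmonic R)); last exact: cvg_harmonic; last exact: cvg_cst.
  apply: nearW => k; have k0 : 0 < k.+1%:R :> R by rewrite ltr0n.
  have kh : 0 < k.+1%:R + h by lra.
  by rewrite /t invr_ge0 ltW//= /harmonic lef_pV2 ?posrE//; lra.
(* Separates the quotient by [k], whose limit is given, from corrections of order [1 / (k + h)]. *)
have alg (K h' A B : R) : K != 0 -> K + h' != 0 ->
    (K + h')^-1 * (A + B) = (1 - h' * (K + h')^-1) * (K^-1 * A) + (K + h')^-1 * B.
  by move=> K0 Kh; field; rewrite K0 Kh.
have kE k : ev (sw k.+1 (l_ k.+1)) z = (1 - h * t k) * ev (k.+1%:R^-1 *: l_ k.+1) z + t k * ev rho z.
  have k0 : 0 < k.+1%:R :> R by rewrite ltr0n.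
  have e1 : ev (sw k.+1 (l_ k.+1)) z = (k.+1%:R + h)^-1 * (ev (l_ k.+1) z + ev rho z).
    by rewrite /scaled_weight evZ evD.
  have e2 : ev (k.+1%:R^-1 *: l_ k.+1) z = k.+1%:R^-1 * ev (l_ k.+1) z := evZ _ _ _.
  have n0 : k.+1%:R != 0 :> R by exact: lt0r_neq0.
  have n1 : k.+1%:R + h != 0 by apply: lt0r_neq0; lra.
  by rewrite e1 e2; exact: (alg _ _ _ _ n0 n1).
under eq_fun do rewrite kE.
have -> : ev l z = (1 - h * 0) * ev l z + 0 * ev rho z by rewrite mulr0 subr0 mul1r mul0r addr0.
apply: cvgD; apply: cvgM => //; last exact: cvg_cst.
by apply: cvgB; [exact: cvg_cst|apply: cvgM => //; exact: cvg_cst].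
Qed.

Lemma chi_cvg (l_ : nat -> 'rV[R]_r) l m : dominant_weights D m ->
  (k%:R^-1 *: l_ k) @[k --> \oo] --> l ->
  ccvg (fun k => chi k.+1 m (l_ k.+1)) (ch (V m) (- yv l)).
Proof.
move=> dm lc; have [irr hw] := irrV dm; apply: (ccvg_ch cG mT basT simpS irr hw) => b.
exact: scaled_cvg.
Qed.

Lemma chi0_cvg m : dominant_weights D m -> ccvg (fun k => chi k.+1 m 0) (rdim (V m))%:R.
Proof.
move=> dm; have [irr hw] := irrV dm; rewrite -(ch0 cG mT basT simpS irr hw).
have -> : (0 : 'cV[R]_r) = - yv 0 by rewrite (yvE mT basT innerK) mul0mx trmx0 oppr0.
apply: (@chi_cvg (fun=> 0)) => //.
by under eq_fun do rewrite scaler0; exact: cvg_cst.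
Qed.

Lemma rdim_neq0 m : dominant_weights D m -> (rdim (V m))%:R != 0 :> R[i].
Proof. by move=> /irrV[[m0 _] _]; rewrite pnatr_eq0 -lt0n. Qed.

Definition walk_sum k (F : 'cV[R]_r -> R[i]) : R[i] :=
  \sum_(b <- level_seq D k) walk_kernel V N k (gamma_ k) (xi_ k) b * F (- yv (sw k b)).

Lemma walk_sum_char m : dominant_weights D m ->
  ccvg (fun k => walk_sum k.+1 (ch (V m)))
    (ch (V m) (- yv xi) * ch (V m) (- yv gamma) / (rdim (V m))%:R).
Proof.
move=> dm; apply: (@ccvg_eventually _ _
    (fun k => chi k.+1 m (xi_ k.+1) * chi k.+1 m (gamma_ k.+1) * (chi k.+1 m 0)^-1)).
  (* From this index on, [m] has level at most [k.+1], as [walk_mean] requires. *)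
  exists (Num.bound `|ev m (cor (theta D))|) => k mk.
  apply: (walk_mean cG simpleK mT basT simpS hth innerK irrV fusN (ltn0Sn k) (gaL (ltn0Sn k)) (xiL (ltn0Sn k))).
  split=> //; apply: le_trans (ler_norm _) _; apply: le_trans (ltW (archi_boundP (normr_ge0 _))) _.
  by rewrite ler_nat; apply: leq_trans mk _.
apply: ccvgM; last by apply: ccvgV; [exact: rdim_neq0|exact: chi0_cvg].
by apply: ccvgM; exact: chi_cvg.
Qed.

Lemma walk_sum_cvg G : fspan char_gen G -> exists L, ccvg (fun k => walk_sum k.+1 G) L.
Proof.
elim=> [|a H F [m dm ->] _ [L HL]].
  exists 0; have -> : (fun k => walk_sum k.+1 (fun=> 0)) = (fun=> 0).
    by apply/funext => k; rewrite /walk_sum big1// => b _; rewrite mulr0.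
  exact: ccvg_cst.
exists (a * (ch (V m) (- yv xi) * ch (V m) (- yv gamma) / (rdim (V m))%:R) + L).
have -> : (fun k => walk_sum k.+1 (fun x => a * ch (V m) x + F x)) =
    (fun k => a * walk_sum k.+1 (ch (V m)) + walk_sum k.+1 F).
  apply/funext => k; rewrite /walk_sum mulr_sumr -big_split; apply: eq_bigr => b _ /=.
  by rewrite mulrDr mulrCA.
by apply: ccvgD => //; apply: ccvgM; [exact: ccvg_cst|exact: walk_sum_char].
Qed.

(** The walk laws charge only interior points of the alcove, where [delta] is nonzero and can be
    cancelled. *)
Lemma walk_sum_eq k F G : (forall x, delta D x * F x = delta D x * G x) -> walk_sum k F = walk_sum k G.
Proof.
move=> FG; apply: eq_big_seq => b /(mem_level cG simpleK mT basT simpS hth innerK) kb; congr (_ * _).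
have d0 : delta D (- yv (sw k b)) != 0.
  rewrite delta_neg mulf_neq0 ?dconst_neq0// eq_complex /= gt_eqF//.
  exact: (scaled_sd_gt0 cG simpleK mT basT simpS hth innerK).
exact: (mulfI d0 (FG _)).
Qed.

Lemma alcove_convolution : exists mu_ : nat -> probability (tdual R r) R,
  (forall k, (0 < k)%N -> mu_ k (E : set (tdual R r)) = 1%E /\
     is_walk_law V N k (gamma_ k) (xi_ k) (mu_ k)) /\
  exists mu : probability (tdual R r) R,
    [/\ mu (E : set (tdual R r)) = 1%E, weak_cvg E mu_ mu &
      forall l, dominant_weights D l ->
        ch (V l) (- yv xi) / (rdim (V l))%:R * (ch (V l) (- yv gamma) / (rdim (V l))%:R) =
        complex_integral mu E (fun b => ch (V l) (- yv b) / (rdim (V l))%:R)].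
Proof.
have H k := walk_law cG simpleK mT basT simpS hth innerK irrV fusN (ltn0Sn k) (gaL (ltn0Sn k)) (xiL (ltn0Sn k)).
have [P_ HP] := choice H.
have cE := compact_nu_alcove cG simpleK mT basT simpS hth innerK.
have sumE k (F : 'cV[R]_r -> R[i]) : ccont (fun c : 'rV[R]_r => F (- yv c)) ->
    complex_integral (P_ k) E (fun c => F (- yv c)) = walk_sum k.+1 F.
  by move=> [c1 c2]; have [_ _ ->] := HP k => //; exact: wc_continuous.
(* [P_ k] is the law at level [k.+1]; the predecessor shifts back, and the measure at level 0 is a
   harmless repetition. *)
exists (fun k => P_ k.-1); split=> [[|k] //= _|]; first by case: (HP k).
have [mu [mu1 muc]] : exists mu : probability (tdual R r) R,
    mu E = 1%E /\ weak_cvg E (fun k => P_ k.-1) mu.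
  apply: (weak_limit cE test_fun_cst test_funD test_funM test_fun_wc test_fun_sep) => [k|f tf].
    by case: (HP k.-1).
  have [F sF FE] := tf; have [G sG GE] := orbit_span_char sF.
  have [L [LR _]] := walk_sum_cvg sG; exists (complex.Re L).
  rewrite -cvg_shiftS.
  have -> : [sequence integ E (P_ k.+1.-1) f]_k = (fun k => complex.Re (walk_sum k.+1 G)).
    apply/funext => k; rewrite -(walk_sum_eq _ GE) /=.
    have wI : wc E (fun b => complex.Im (f b)%:C%C) by apply: wc_cst.
    have [_ _ PE] := HP k.
    have -> : integ E (P_ k.+1.-1) f =
      complex.Re (complex_integral (P_ k) E (fun c => (f c)%:C%C)) by [].
    rewrite (PE (fun c => (f c)%:C%C) (test_fun_wc tf) wI); congr complex.Re.
    by apply: eq_bigr => b _; rewrite FE.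
  exact: LR.
exists mu; split=> // l dl; have cF := ch_ccont dl.
have [c1 c2] : ccont (fun b : 'rV[R]_r => ch (V l) (- yv b) / (rdim (V l))%:R).
  have -> : (fun b : 'rV[R]_r => ch (V l) (- yv b) / (rdim (V l))%:R) =
      (fun b => (rdim (V l))%:R^-1 * ch (V l) (- yv b)) by apply/funext => b; rewrite mulrC.
  exact: ccontZ.
have lim : ccvg (fun k => complex_integral (P_ k) E (fun b => ch (V l) (- yv b) / (rdim (V l))%:R))
    (complex_integral mu E (fun b => ch (V l) (- yv b) / (rdim (V l))%:R)).
  have W f : continuous f -> (\int[P_ k]_(b in (E : set (tdual R r))) f b)%R @[k --> \oo] -->
      (\int[mu]_(b in (E : set (tdual R r))) f b)%R.
    move=> cf; have := muc f (continuous_subspaceT cf).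
    have [M _ MP] := wc_bounded cE (wc_continuous cf).
    by move=> /(_ (ex_intro _ M MP)); rewrite -cvg_shiftS.
  by split; [exact: (W _ c1)|exact: (W _ c2)].
(* The same sequence of integrals also converges to the product on the left, by [walk_sum_char]. *)
apply: ccvg_unique lim.
have -> : (fun k => complex_integral (P_ k) E (fun b => ch (V l) (- yv b) / (rdim (V l))%:R)) =
    (fun k => walk_sum k.+1 (ch (V l)) * (rdim (V l))%:R^-1).
  apply/funext => k; rewrite (sumE _ (fun x => ch (V l) x / (rdim (V l))%:R))//.
  by rewrite /walk_sum mulr_suml; apply: eq_bigr => b _; rewrite mulrA.
have -> : ch (V l) (- yv xi) / (rdim (V l))%:R * (ch (V l) (- yv gamma) / (rdim (V l))%:R) =
    ch (V l) (- yv xi) * ch (V l) (- yv gamma) / (rdim (V l))%:R * (rdim (V l))%:R^-1.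
  by rewrite -!mulrA; congr (_ * _); rewrite mulrCA.
by apply: ccvgM; [exact: walk_sum_char|exact: ccvg_cst].
Qed.

End Convolution.

Theorem proposition7p1 (R : realType) (n r : nat) (D : lie_data R n r)
    (V : 'rV[R]_r -> rep D)
    (N : nat -> 'rV[R]_r -> 'rV[R]_r -> 'rV[R]_r -> nat)
    (xi gamma : 'rV[R]_r) (xi_ gamma_ : nat -> 'rV[R]_r)
    (compact_K : compact_group (grp D))
    (connected_K : connected (grp D))
    (simple_K : simple_lie (lie (grp D)))
    (simply_connected_K : simply_connected (grp D))
    (torus_T : maximal_torus (grp D) (tor D))
    (basis_t : torus_basis D)
    (simple_Sigma : simple_system D)
    (highest_theta : highest_root D)
    (inner_k : normalized_inner D)
    (irrep_V : is_highest_weight_family V)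
    (fusion_N : is_fusion V N)
    (xi_alcove : nu_alcove D xi)
    (gamma_alcove : nu_alcove D gamma)
    (xi_level : forall k, (0 < k)%N -> level_weights D k (xi_ k))
    (gamma_level : forall k, (0 < k)%N -> level_weights D k (gamma_ k))
    (xi_cvg : (k%:R^-1 *: xi_ k) @[k --> \oo] --> xi)
    (gamma_cvg : (k%:R^-1 *: gamma_ k) @[k --> \oo] --> gamma) :
  exists mu_ : nat -> probability (tdual R r) R,
    (forall k, (0 < k)%N ->
       mu_ k (nu_alcove D : set (tdual R r)) = 1%E /\
       is_walk_law V N k (gamma_ k) (xi_ k) (mu_ k)) /\
    exists mu : probability (tdual R r) R,
      [/\ mu (nu_alcove D : set (tdual R r)) = 1%E,
          weak_cvg (nu_alcove D) mu_ mu &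
          forall l : 'rV[R]_r, (Lambda_dual D `&` chamber D) l ->
            ch (V l) (- nu_inv D xi) / (rdim (V l))%:R *
            (ch (V l) (- nu_inv D gamma) / (rdim (V l))%:R) =
            complex_integral mu (nu_alcove D)
              (fun b => ch (V l) (- nu_inv D b) / (rdim (V l))%:R)].
Proof.
have [mu_ [mu_law [mu [mu1 mu_cvg muI]]]] := alcove_convolution compact_K simple_K torus_T
  basis_t simple_Sigma highest_theta inner_k irrep_V fusion_N xi_level gamma_level xi_cvg gamma_cvg.
exists mu_; split=> //; exists mu; split=> // l [lL lC]; apply: muI; split=> // a ra.
(* Coroots lie in [Lambda], so a form that is integral on [Lambda] belongs to the weight lattice. *)
exact: lL (coroot_Lambda compact_K torus_T basis_t ra).
Qed.
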